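(* Let $G$ be a connected reductive algebraic group over $\Bbbk$, let $F,H\subseteq G$ be reductive subgroups, and let $\pi: G\to F\backslash\!\backslash G/\!\!/H$ be the quotient morphism onto the double coset variety. Suppose that the double coset $FH$ is closed in $G$. Let $Z$ be the categorical quotient for the linear action of $F\cap H$ on $\operatorname{Lie}G/(\operatorname{Lie}F+\operatorname{Lie}H)$ induced by the adjoint action of $F\cap H$ on $\operatorname{Lie}G$. Then the point $\pi(e)\in F\backslash\!\backslash G/\!\!/H$, where $e\in G$ is the identity, is regular (i.e. smooth) if and only if $Z$ is isomorphic to an affine space.
   Context: The ground field $\Bbbk$ is algebraically closed of characteristic zero. For reductive subgroups $F,H$ of $G$, the group $F\times H$ acts on $G$ by $(f,h)\circ g=fgh^{-1}$; the double coset variety $F\backslash\!\backslash G/\!\!/H$ is the categorical quotient of $G$ by this action, i.e. $\operatorname{Spec}$ of the algebra ${}^{F}\Bbbk[G]^{H}$ of $(F\times H)$-invariant regular functions on $G$, and $\pi$ is induced by the inclusion ${}^{F}\Bbbk[G]^{H}\subset\Bbbk[G]$. For a reductive group $R$ acting linearly on a vector space $N$, the categorical quotient is $\operatorname{Spec}\Bbbk[N]^R$. Affine space means $\mathbb{A}^d$, $d\ge0$. *)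

(* Defs.v *)
From HB Require Import structures.
From mathcomp Require Import all_boot all_order all_algebra.
From mathcomp Require Import ring mpoly.
From mathcomp Require Import boolp classical_sets functions.

Set Implicit Arguments.
Unset Strict Implicit.
Unset Printing Implicit Defensive.

Import GRing.Theory.
Local Open Scope ring_scope.
Local Open Scope quotient_scope.
Local Open Scope classical_set_scope.

Section Ideals.
Variable R : comPzRingType.
Implicit Types (I P : set R).

Definition is_ideal I :=
  [/\ I 0, forall a b, I a -> I b -> I (a + b) & forall a b, I b -> I (a * b)].

Definition is_prime P :=
  [/\ is_ideal P, ~ P 1 & forall a b, P (a * b) -> P a \/ P b].

Definition is_maximal I :=
  [/\ is_ideal I, ~ I 1 & forall J, is_ideal J -> ~ J 1 -> I `<=` J -> J = I].

Definition ideal_gen (s : seq R) : set R :=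
  [set a | exists c : 'I_(size s) -> R, a = \sum_(i < size s) c i * s`_i].

Definition noetherian :=
  forall I, is_ideal I -> exists s : seq R, I = ideal_gen s.

Definition has_prime_chain (d : nat) :=
  exists c : 'I_d.+1 -> set R,
    (forall i, is_prime (c i)) /\
    (forall i j : 'I_d.+1, (i < j)%N -> c i `<` c j).

(* The Krull dimension of R is d; it fails for every d if R has arbitrarily long
   chains of primes, or none. *)
Definition krull_dim (d : nat) :=
  has_prime_chain d /\ forall e, has_prime_chain e -> (e <= d)%N.

(* A noetherian local ring whose maximal ideal m is generated by dim R elements. *)
Definition regular_local_ring :=
  noetherian /\
  exists (m : set R) (d : nat) (s : seq R),
    [/\ is_maximal m, forall m', is_maximal m' -> m' = m, krull_dim d,
        size s = d & m = ideal_gen s].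

Record Spec := MkSpec {
  prime_ideal :> set R;
  prime_idealP : is_prime prime_ideal }.

End Ideals.

Section Localization.
Variables (R : comPzRingType) (x : Spec R).

Definition fraction := {u : R * R | `[< ~ prime_ideal x u.2 >]}.
Definition fnum (u : fraction) : R := (val u).1.
Definition fden (u : fraction) : R := (val u).2.

Lemma fdenP u : ~ prime_ideal x (fden u).
Proof. exact: asboolW (valP u). Qed.

Lemma compl1 : ~ prime_ideal x 1.
Proof. by case: (prime_idealP x). Qed.

Lemma complM s t : ~ prime_ideal x s -> ~ prime_ideal x t -> ~ prime_ideal x (s * t).
Proof. by move=> ns nt; case: (prime_idealP x) => _ _ h /h[]. Qed.

Definition mkfrac (a s : R) (ns : ~ prime_ideal x s) : fraction :=
  exist (fun u : R * R => `[< ~ prime_ideal x u.2 >]) (a, s) (asboolT ns).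

(* a / s = b / t iff r (a t - b s) = 0 for some r outside the prime ideal. *)
Definition frac_eq (u v : fraction) : bool :=
  `[< exists t, ~ prime_ideal x t /\ t * (fnum u * fden v) = t * (fnum v * fden u) >].

Lemma frac_eq_equiv : equiv_class_of frac_eq.
Proof.
split=> [u|u v|v u w].
- by apply/asboolP; exists 1; split; first exact: compl1.
- by apply/asboolP/asboolP => -[t [nt e]]; exists t.
move=> /asboolP[t [nt e]] /asboolP[t' [nt' e']]; apply/asboolP.
exists (t * t' * fden v); split; first exact: complM (complM nt nt') (@fdenP v).
have -> : t * t' * fden v * (fnum u * fden w) =
  t' * fden w * (t * (fnum u * fden v)) by ring.
rewrite e.
have -> : t' * fden w * (t * (fnum v * fden u)) =
  t * fden u * (t' * (fnum v * fden w)) by ring.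
rewrite e'; ring.
Qed.

Canonical frac_eq_equiv_rel := EquivRelPack frac_eq_equiv.
Canonical frac_eq_enc := defaultEncModRel frac_eq.

Definition localization := {eq_quot frac_eq}.

HB.instance Definition _ : EqQuotient fraction frac_eq localization :=
  EqQuotient.on localization.
HB.instance Definition _ := Choice.on localization.

Lemma loc_eqP (u v : fraction) :
  (exists t, ~ prime_ideal x t /\ t * (fnum u * fden v) = t * (fnum v * fden u))
  <-> \pi_localization u = \pi_localization v.
Proof.
split=> [h|/eqmodP/asboolP//].
by apply/eqmodP/asboolP.
Qed.

Lemma repr_loc (u : fraction) : let u' := repr (\pi_localization u) in
  exists t, ~ prime_ideal x t /\ t * (fnum u * fden u') = t * (fnum u' * fden u).
Proof. by apply/loc_eqP; rewrite reprK. Qed.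

Definition addf (u v : fraction) : fraction :=
  mkfrac (fnum u * fden v + fnum v * fden u) (complM (@fdenP u) (@fdenP v)).
Definition oppf (u : fraction) : fraction := mkfrac (- fnum u) (@fdenP u).
Definition mulf (u v : fraction) : fraction :=
  mkfrac (fnum u * fnum v) (complM (@fdenP u) (@fdenP v)).

Definition loc0 : localization := lift_cst localization (mkfrac 0 compl1).
Definition loc1 : localization := lift_cst localization (mkfrac 1 compl1).
Definition loc_add := lift_op2 localization addf.
Definition loc_opp := lift_op1 localization oppf.
Definition loc_mul := lift_op2 localization mulf.

Canonical pi_loc0 := PiConst loc0.
Canonical pi_loc1 := PiConst loc1.

Lemma pi_addf : {morph \pi : u v / addf u v >-> loc_add u v}.
Proof.
move=> u v; unlock loc_add; apply/loc_eqP.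
have [t [nt et]] := repr_loc u.
have [s [ns es]] := repr_loc v.
set u' := repr _ in et *; set v' := repr _ in es *.
exists (t * s); split; first exact: complM.
rewrite /addf /mkfrac /fnum /fden /= -/(fnum u) -/(fden u) -/(fnum v) -/(fden v)
  -/(fnum u') -/(fden u') -/(fnum v') -/(fden v').
transitivity (s * fden v * fden v' * (t * (fnum u * fden u')) +
  t * fden u * fden u' * (s * (fnum v * fden v'))); first by ring.
by rewrite et es; ring.
Qed.
Canonical pi_loc_add := PiMorph2 pi_addf.

Lemma pi_oppf : {morph \pi : u / oppf u >-> loc_opp u}.
Proof.
move=> u; unlock loc_opp; apply/loc_eqP.
have [t [nt et]] := repr_loc u.
set u' := repr _ in et *; exists t; split=> //.
rewrite /oppf /mkfrac /fnum /fden /= -/(fnum u) -/(fden u) -/(fnum u') -/(fden u').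
by rewrite !mulNr !mulrN et.
Qed.
Canonical pi_loc_opp := PiMorph1 pi_oppf.

Lemma pi_mulf : {morph \pi : u v / mulf u v >-> loc_mul u v}.
Proof.
move=> u v; unlock loc_mul; apply/loc_eqP.
have [t [nt et]] := repr_loc u.
have [s [ns es]] := repr_loc v.
set u' := repr _ in et *; set v' := repr _ in es *.
exists (t * s); split; first exact: complM.
rewrite /mulf /mkfrac /fnum /fden /= -/(fnum u) -/(fden u) -/(fnum v) -/(fden v)
  -/(fnum u') -/(fden u') -/(fnum v') -/(fden v').
transitivity ((t * (fnum u * fden u')) * (s * (fnum v * fden v'))); first by ring.
by rewrite et es; ring.
Qed.
Canonical pi_loc_mul := PiMorph2 pi_mulf.

Ltac loc_tac := apply/loc_eqP; exists 1; split; first exact: compl1;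
  rewrite /addf /oppf /mulf /mkfrac /fnum /fden /=; ring.

Lemma loc_addA : associative loc_add.
Proof. by move=> a b c; rewrite -[a]reprK -[b]reprK -[c]reprK !piE; loc_tac. Qed.
Lemma loc_addC : commutative loc_add.
Proof. by move=> a b; rewrite -[a]reprK -[b]reprK !piE; loc_tac. Qed.
Lemma loc_add0 : left_id loc0 loc_add.
Proof. by move=> a; rewrite -[a]reprK !piE; loc_tac. Qed.
Lemma loc_addN : left_inverse loc0 loc_opp loc_add.
Proof. by move=> a; rewrite -[a]reprK !piE; loc_tac. Qed.

HB.instance Definition _ :=
  GRing.isZmodule.Build localization loc_addA loc_addC loc_add0 loc_addN.

Lemma loc_mulA : associative loc_mul.
Proof. by move=> a b c; rewrite -[a]reprK -[b]reprK -[c]reprK !piE; loc_tac. Qed.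
Lemma loc_mulC : commutative loc_mul.
Proof. by move=> a b; rewrite -[a]reprK -[b]reprK !piE; loc_tac. Qed.
Lemma loc_mul1 : left_id loc1 loc_mul.
Proof. by move=> a; rewrite -[a]reprK !piE; loc_tac. Qed.
Lemma loc_mulDl : left_distributive loc_mul loc_add.
Proof. by move=> a b c; rewrite -[a]reprK -[b]reprK -[c]reprK !piE; loc_tac. Qed.

HB.instance Definition _ := GRing.Zmodule_isComPzRing.Build localization
  loc_mulA loc_mulC loc_mul1 loc_mulDl.

End Localization.

Definition regular_point (R : comPzRingType) (x : Spec R) :=
  regular_local_ring (localization x).

(* The base point is only there to make the ring of functions nontrivial, as
   the library's algebra structures require. *)
Section FunctionAlgebra.
Variables (k : fieldType) (T : pointedType).

Fact fct_scalerAl (a : k) (f g : T -> k^o) : a *: (f * g) = (a *: f) * g.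
Proof. by apply/funext => t; exact: mulrA. Qed.

Fact fct_scalerAr (a : k) (f g : T -> k^o) : a *: (f * g) = f * (a *: g).
Proof. by apply/funext => t; exact: mulrCA. Qed.

HB.instance Definition _ :=
  GRing.Lmodule_isLalgebra.Build k (T -> k^o) fct_scalerAl.
HB.instance Definition _ :=
  GRing.Lalgebra_isAlgebra.Build k (T -> k^o) fct_scalerAr.

End FunctionAlgebra.

(* The quotient vector space U / (U :&: W); it is U / W when W <= U. *)
Section QuotientSpace.
Variables (k : fieldType) (vT : vectType k) (U W : {vspace vT}).

Definition quotv_pred : {pred subvs_of U} := fun x => vsval x \in W.

Fact quotv_zmod_closed : zmod_closed quotv_pred.
Proof.
by split=> [|x y xW yW]; [exact: mem0v | exact: memvB].
Qed.

HB.instance Definition _ :=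
  GRing.isZmodClosed.Build (subvs_of U) quotv_pred quotv_zmod_closed.

Definition quotv := Quotient.quot quotv_pred.
HB.instance Definition _ := GRing.Zmodule.on quotv.
HB.instance Definition _ := Quotient.on quotv.

Definition quotv_proj (x : subvs_of U) : quotv := \pi x.

Definition quotv_scale (a : k) := lift_op1 quotv (fun x => a *: x).

Lemma pi_quotv_scale a :
  {morph \pi : x / a *: x >-> quotv_scale a x}.
Proof.
move=> x; unlock quotv_scale; apply/eqP.
rewrite piE /Quotient.equiv -scalerBr.
have : x - repr (\pi_quotv x) \in quotv_pred by rewrite Quotient.idealrBE reprK.
exact: memvZ.
Qed.
Canonical pi_quotv_scale_morph a := PiMorph1 (pi_quotv_scale a).

Fact quotv_scalerA a b v :
  quotv_scale a (quotv_scale b v) = quotv_scale (a * b) v.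
Proof. by rewrite -[v]reprK !piE scalerA. Qed.
Fact quotv_scale1r : left_id 1 quotv_scale.
Proof. by move=> v; rewrite -[v]reprK !piE scale1r. Qed.
Fact quotv_scalerDr : right_distributive quotv_scale +%R.
Proof. by move=> a v w; rewrite -[v]reprK -[w]reprK !piE scalerDr. Qed.
Fact quotv_scalerDl v : {morph quotv_scale^~ v : a b / a + b}.
Proof. by move=> a b; rewrite -[v]reprK !piE scalerDl. Qed.

HB.instance Definition _ := GRing.Zmodule_isLmodule.Build k quotv
  quotv_scalerA quotv_scale1r quotv_scalerDr quotv_scalerDl.

End QuotientSpace.

HB.instance Definition _ (k : fieldType) (vT : vectType k) (U W : {vspace vT}) :=
  isPointed.Build (quotv U W) 0.

Lemma vspace_of_set (k : fieldType) (vT : vectType k) (P : set vT) :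
  P 0 -> (forall a u v, P u -> P v -> P (a *: u + v)) ->
  exists U : {vspace vT}, forall v, v \in U <-> P v.
Proof.
move=> P0 PL.
suff ext d (U : {vspace vT}) : (\dim {:vT} - \dim U <= d)%N ->
    (forall v, v \in U -> P v) -> exists V : {vspace vT}, forall v, v \in V <-> P v.
  by apply: (ext _ 0%VS (leqnn _)) => v; rewrite memv0 => /eqP ->.
elim: d U => [|d IH] U dU UP.
  exists U => v; split; first exact: UP.
  suff -> : U = fullv by rewrite memvf.
  by apply/eqP; rewrite eqEdim subvf /= -subn_eq0 -leqn0.
have [[v Pv vU]|all] := pselect (exists2 v, P v & v \notin U); last first.
  by exists U => v; split=> [/UP//|Pv]; apply: contrapT => /negP vU; apply: all; exists v.
apply: (IH (U + <[v]>)%VS) => [|w].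
  have lt : (\dim U < \dim (U + <[v]>))%N.
    rewrite ltnNge; apply: contra vU => le.
    have /eqP -> : (U == U + <[v]>)%VS by rewrite eqEdim addvSl le.
    by rewrite memvE addvSr.
  have leV := dimvS (subvf (U + <[v]>)%VS).
  have ltV := leq_trans lt leV.
  by rewrite -ltnS (leq_trans _ dU) // ltn_sub2l.
case/memv_addP => u uU [_ /vlineP[a ->] ->].
by rewrite addrC; apply: PL => //; apply: UP.
Qed.

Section Differential.
Variable k : fieldType.

(* The differential of p at the point u, applied to the tangent vector w. *)
Definition mdiff m (p : {mpoly k[m]}) (u w : 'I_m -> k) : k :=
  \sum_(i < m) (p^`M(i)).@[u] * w i.

Lemma mdiffM m (p q : {mpoly k[m]}) u w :
  mdiff (p * q) u w = p.@[u] * mdiff q u w + q.@[u] * mdiff p u w.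
Proof.
rewrite /mdiff !mulr_sumr -big_split /=; apply: eq_bigr => i _.
by rewrite mderivM mevalD !mevalM; ring.
Qed.

Lemma mdiffD m (p q : {mpoly k[m]}) u w :
  mdiff (p + q) u w = mdiff p u w + mdiff q u w.
Proof.
rewrite /mdiff -big_split /=; apply: eq_bigr => i _.
by rewrite mderivD mevalD mulrDl.
Qed.

Lemma mdiffZ m c (p : {mpoly k[m]}) u w : mdiff (c *: p) u w = c * mdiff p u w.
Proof.
rewrite /mdiff mulr_sumr; apply: eq_bigr => i _.
by rewrite mderivZ mevalZ mulrA.
Qed.

Lemma mdiff0 m u w : mdiff (0 : {mpoly k[m]}) u w = 0.
Proof. by rewrite /mdiff big1 // => i _; rewrite mderiv0 meval0 mul0r. Qed.

Lemma mdiff1 m u w : mdiff (1 : {mpoly k[m]}) u w = 0.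
Proof.
by rewrite /mdiff big1 // => i _; rewrite -mpolyC1 mderivC meval0 mul0r.
Qed.

Lemma mdiffX m i u w : mdiff ('X_i : {mpoly k[m]}) u w = w i.
Proof.
rewrite /mdiff (bigD1 i) //= big1 ?addr0 => [|j ji].
  have -> : ('X_i : {mpoly k[m]})^`M(i) = 1.
    rewrite mderivX mnm1E eqxx scale1r -mpolyX0; congr 'X_[_].
    by apply/mnmP => j; rewrite mnmBE subnn mnm0E.
  by rewrite meval1 mul1r.
by rewrite mderivX mnm1E eq_sym (negPf ji) scale0r meval0 mul0r.
Qed.

Lemma mdiff_comp m l (p : {mpoly k[m]}) (c : m.-tuple {mpoly k[l]}) u w :
  mdiff (p \mPo c) u w =
  mdiff p (fun i => (tnth c i).@[u]) (fun i => mdiff (tnth c i) u w).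
Proof.
set u' := fun i => _; set w' := fun i => _.
pose P (q : {mpoly k[m]}) := mdiff (q \mPo c) u w = mdiff q u' w'.
have PM q r : P q -> P r -> P (q * r).
  move=> Pq Pr; rewrite /P rmorphM /= !mdiffM Pq Pr.
  by rewrite !comp_mpoly_meval.
have P1 : P 1 by rewrite /P comp_mpoly1 !mdiff1.
have PX i : P 'X_i by rewrite /P comp_mpolyXU mdiffX -tnth_nth.
rewrite -/(P p); elim/mpolyind: p => [|a e p _ _ IH].
  by rewrite /P comp_mpoly0 !mdiff0.
rewrite /P comp_mpolyD comp_mpolyZ !mdiffD !mdiffZ IH; congr (_ * _ + _).
rewrite -/(P _) mpolyXE_id; apply: (big_ind P) => // i _.
by elim: (e i) => [|d IHd]; rewrite ?expr0 // exprS; apply: PM.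
Qed.

End Differential.

Section AlgebraicGroups.
Variables (k : closedFieldType) (n : nat).
Implicit Types (p : {mpoly k[n * n]}) (g : 'M[k]_n) (X Y : set 'M[k]_n).

Definition mx_eval p g : k := p.@[mxvec g 0].

(* Y is a closed subset of X, for the topology that X inherits from the Zariski
   topology of the affine space of matrices. *)
Definition zclosed_in X Y :=
  exists S : set {mpoly k[n * n]},
    Y = X `&` [set g | forall p, S p -> mx_eval p g = 0].

Definition zconnected X :=
  forall Y, zclosed_in X Y -> zclosed_in X (X `\` Y) -> Y = set0 \/ Y = X.

(* A linear algebraic group, as a Zariski closed subgroup of GL_n(k). *)
Record alg_group := AlgGroup {
  carrier :> set 'M[k]_n;
  carrier_unit : forall g, carrier g -> g \in unitmx;
  carrier1 : carrier 1%:M;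
  carrierM : forall g h, carrier g -> carrier h -> carrier (g *m h);
  carrierV : forall g, carrier g -> carrier (invmx g);
  carrier_closed : zclosed_in [set g | g \in unitmx] carrier }.

Implicit Types G F H U : alg_group.

Definition normal_in G U :=
  U `<=` G /\
  forall g u, carrier G g -> carrier U u -> carrier U (g *m u *m invmx g).

Definition unipotent U :=
  forall u, carrier U u -> exists m : nat, (u - 1%:M) ^+ m = 0.

(* The unipotent radical is trivial; G need not be connected. *)
Definition reductive G :=
  forall U, normal_in G U -> zconnected U -> unipotent U ->
    carrier U = [set 1%:M].

Definition group_id G : G := SigSub (mem_set (carrier1 G)).

Definition double_coset F H : set 'M[k]_n := [set a *m b | a in F & b in H].

(* The tangent space at the identity, inside the space of matrices. *)
Definition tangent_id G : set 'M[k]_n :=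
  [set x | forall p, (forall g, carrier G g -> mx_eval p g = 0) ->
           mdiff p (mxvec 1%:M 0) (mxvec x 0) = 0].

Lemma tangent_id_vspace G :
  exists L : {vspace 'M[k]_n}, forall x, x \in L <-> tangent_id G x.
Proof.
apply: vspace_of_set => [p _|a x y hx hy p hp].
  by rewrite /mdiff big1 // => i _; rewrite linear0 mxE mulr0.
rewrite /mdiff; under eq_bigr do rewrite linearP !mxE mulrDr mulrCA.
rewrite big_split -mulr_sumr /=; have := hx p hp; have := hy p hp.
by rewrite /mdiff => -> ->; rewrite mulr0 addr0.
Qed.

Definition lie G : {vspace 'M[k]_n} := projT1 (cid (tangent_id_vspace G)).

Lemma lieP G x : x \in lie G <-> tangent_id G x.
Proof. exact: (projT2 (cid (tangent_id_vspace G)) x). Qed.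

Definition Ad g (x : 'M[k]_n) : 'M[k]_n := g *m x *m invmx g.

(* Regular functions on G: polynomials in the matrix entries and 1/det. *)
Definition regular_fun G (f : G -> k) :=
  exists p : {mpoly k[n * n + 1]}, forall g : G,
    f g = p.@[row_mx (mxvec (val g)) (const_mx (\det (val g))^-1) 0].

(* f (a g b^-1) = f g; here g' is a g b^-1 as an element of G. *)
Definition biinvariant F H G (f : G -> k) :=
  forall (a b : 'M[k]_n) (g g' : G), carrier F a -> carrier H b ->
    val g' = a *m val g *m invmx b -> f g' = f g.

End AlgebraicGroups.

Section AdjointAction.
Variables (k : closedFieldType) (n : nat) (G : alg_group k n).

Lemma lieS (F : alg_group k n) : F `<=` G -> (lie F <= lie G)%VS.
Proof.
move=> FG; apply/subvP => x /lieP tx; apply/lieP => p hp.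
by apply: tx => g /FG; apply: hp.
Qed.

Lemma Ad_lie g x : carrier G g -> x \in lie G -> Ad g x \in lie G.
Proof.
move=> Gg /lieP tx; apply/lieP => p hp.
pose L := lin_mx (mulmx g) *m lin_mx (mulmxr (invmx g)) : 'M[k]_(n * n).
have LE y : mxvec (Ad g y) = mxvec y *m L by rewrite mulmxA !mul_vec_lin.
pose c : (n * n).-tuple {mpoly k[n * n]} :=
  [tuple \sum_(i < n * n) L i j *: 'X_i | j < n * n].
have cE y j : (tnth c j).@[mxvec y 0] = mxvec (Ad g y) 0 j.
  rewrite tnth_mktuple rmorph_sum LE mxE; apply: eq_bigr => i _.
  by rewrite /= mevalZ mevalXU mulrC.
have dE u y j : mdiff (tnth c j) u (mxvec y 0) = mxvec (Ad g y) 0 j.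
  rewrite tnth_mktuple LE mxE.
  rewrite (big_morph (fun q : {mpoly k[n * n]} => mdiff q u (mxvec y 0))
    (id1 := 0) (op1 := +%R)); first last.
  - exact: mdiff0.
  - by move=> q r; rewrite mdiffD.
  by apply: eq_bigr => i _; rewrite mdiffZ mdiffX mulrC.
have := tx (p \mPo c).
have -> : mdiff (p \mPo c) (mxvec 1%:M 0) (mxvec x 0) =
          mdiff p (mxvec 1%:M 0) (mxvec (Ad g x) 0).
  rewrite mdiff_comp [LHS]/mdiff [RHS]/mdiff.
  apply: eq_bigr => j _; rewrite dE; congr (_ * _).
  apply: meval_eq => i; rewrite cE /Ad mulmx1 mulmxV //.
  exact: carrier_unit Gg.
apply=> h Gh; rewrite /mx_eval comp_mpoly_meval.
rewrite (meval_eq (v2 := mxvec (Ad g h) 0)) => [|i]; last exact: cE.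
by apply: hp; do 2?apply: carrierM => //; apply: carrierV.
Qed.

End AdjointAction.

Section DoubleCosetVariety.
Variables (k : closedFieldType) (n : nat) (F G H : alg_group k n).

(* The algebra of (F x H)-invariant regular functions on G; its spectrum is the
   double coset variety. *)
Definition dc_pred : {pred G -> k} :=
  fun f => `[< regular_fun f /\ biinvariant F H f >].

Fact dc_subring_closed : subring_closed dc_pred.
Proof.
split=> [|f f'|f f'].
- apply/asboolP; split=> [|//]; exists 1 => g; exact/esym/meval1.
- move=> /asboolP[[p fp] If] /asboolP[[p' fp'] If']; apply/asboolP; split.
    by exists (p - p') => g; rewrite mevalB -fp -fp'.
  move=> a b g g' Fa Hb e.
  by rewrite -[LHS]/(f g' - f' g') (If _ _ _ _ Fa Hb e) (If' _ _ _ _ Fa Hb e).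
move=> /asboolP[[p fp] If] /asboolP[[p' fp'] If']; apply/asboolP; split.
  by exists (p * p') => g; rewrite mevalM -fp -fp'.
move=> a b g g' Fa Hb e.
by rewrite -[LHS]/(f g' * f' g') (If _ _ _ _ Fa Hb e) (If' _ _ _ _ Fa Hb e).
Qed.

HB.instance Definition _ :=
  GRing.isSubringClosed.Build (G -> k) dc_pred dc_subring_closed.

Record dc_alg := DcAlg { dc_fun :> G -> k; dc_funP : dc_fun \in dc_pred }.

HB.instance Definition _ := [isSub for dc_fun].
HB.instance Definition _ := [Choice of dc_alg by <:].
HB.instance Definition _ :=
  GRing.SubChoice_isSubComPzRing.Build (G -> k) dc_pred dc_alg dc_subring_closed.

Fact dc_proj_prime (g : G) : is_prime [set f : dc_alg | f g = 0].
Proof.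
split=> [|/eqP|f f' /eqP]; last 2 first.
- by rewrite oner_eq0.
- by rewrite mulf_eq0 => /orP[] /eqP; [left|right].
split=> //= f f'; first by move=> f0 f'0; rewrite -[LHS]/(f g + f' g) f0 f'0 addr0.
by move=> f'0; rewrite -[LHS]/(f g * f' g) f'0 mulr0.
Qed.

(* The image of g under the quotient morphism: the contraction to the invariant
   algebra of the maximal ideal of g. *)
Definition dc_proj (g : G) : Spec dc_alg := MkSpec (dc_proj_prime g).

End DoubleCosetVariety.

(* The regular functions on a finite-dimensional vector space N: the algebra of
   functions generated by the linear forms. *)
Inductive polynomial_fun (k : fieldType) (N : lmodType k) : (N -> k^o) -> Prop :=
| PolyLin (l : {linear N -> k^o}) : polynomial_fun l
| PolyCst (c : k) : polynomial_fun (cst c)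
| PolyAdd f g : polynomial_fun f -> polynomial_fun g -> polynomial_fun (f + g)
| PolyMul f g : polynomial_fun f -> polynomial_fun g -> polynomial_fun (f * g).

Section SliceQuotient.
Variables (k : closedFieldType) (n : nat) (F G H : alg_group k n).

Definition slice_rep := quotv (lie G) (lie F + lie H)%VS.
HB.instance Definition _ := GRing.Lmodule.on slice_rep.
HB.instance Definition _ := Pointed.on slice_rep.

(* Ad a maps lie G to itself for a in G, so vsproj only retypes its value; by
   slice_act_proj the choice of the representative does not matter. *)
Definition slice_act (a : 'M[k]_n) (v : slice_rep) : slice_rep :=
  quotv_proj _ (vsproj (lie G) (Ad a (vsval (repr v)))).

Lemma slice_act_proj a (x y : subvs_of (lie G)) :
  F `<=` G -> carrier F a -> carrier H a -> vsval y = Ad a (vsval x) ->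
  slice_act a (quotv_proj _ x) = quotv_proj _ y.
Proof.
move=> FG Fa Ha yE; apply/eqmodP => /=.
set z := repr _.
have : z - x \in quotv_pred (U := lie G) (lie F + lie H)%VS.
  by rewrite Quotient.idealrBE reprK.
case/memv_addP => u uF [v vH zx].
have zx' : vsval z - vsval x = u + v by rewrite -zx.
rewrite /Quotient.equiv unfold_in /quotv_pred linearB /= vsprojK; last first.
  by apply: Ad_lie (subvsP z); apply: FG.
have -> : Ad a (vsval z) - vsval y = Ad a u + Ad a v.
  by rewrite yE /Ad -mulmxBl -mulmxBr zx' mulmxDr mulmxDl.
by apply: memv_add; apply: Ad_lie.
Qed.

(* The algebra k[N]^(F :&: H) for N = Lie G / (Lie F + Lie H); its spectrum is
   the categorical quotient of N. *)
Definition slice_pred : {pred slice_rep -> k^o} :=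
  fun f => `[< polynomial_fun f /\
    forall a v, (carrier F `&` carrier H) a -> f (slice_act a v) = f v >].

Fact slice_subalg_closed : subalg_closed slice_pred.
Proof.
split=> [|c f f'|f f'].
- by apply/asboolP; split=> //; exact: (PolyCst _ 1).
- move=> /asboolP[pf If] /asboolP[pf' If']; apply/asboolP; split.
    have -> : c *: f + f' = (cst c : slice_rep -> k^o) * f + f' by [].
    by apply: PolyAdd => //; apply: PolyMul => //; exact: PolyCst.
  move=> a v FHa.
  by rewrite -[LHS]/(c * f (slice_act a v) + f' (slice_act a v)) If // If'.
move=> /asboolP[pf If] /asboolP[pf' If']; apply/asboolP; split.
  exact: PolyMul.
move=> a v FHa.
by rewrite -[LHS]/(f (slice_act a v) * f' (slice_act a v)) If // If'.
Qed.

HB.instance Definition _ :=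
  GRing.isSubalgClosed.Build k (slice_rep -> k^o) slice_pred
    (GRing.subalg_closed_semi slice_subalg_closed).

Record slice_alg :=
  SliceAlg { slice_fun :> slice_rep -> k^o; slice_funP : slice_fun \in slice_pred }.

HB.instance Definition _ := [isSub for slice_fun].
HB.instance Definition _ := [Choice of slice_alg by <:].
HB.instance Definition _ := [SubChoice_isSubAlgebra of slice_alg by <:].

End SliceQuotient.

(* The affine variety with coordinate algebra A is isomorphic to some A^d. *)
Definition is_affine_space (k : closedFieldType) (A : algType k) :=
  exists (d : nat) (phi : {lrmorphism {mpoly k[d]} -> A}), bijective phi.

(* Main.v *)
(* An elementary form of the slice theorem. Let N = Lie G / (Lie F + Lie H), S = F :&: H, and filter
   the biinvariant functions on G by their order of vanishing at e. Symbols of such functions are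
   S-invariant polynomials on N. Conversely every homogeneous S-invariant polynomial is a symbol: it
   extends along the closed orbit F H, by descent from F x H, and linear reductivity makes the
   extension biinvariant. An invariant Euler field splits the filtration, so pi(e) is regular if and
   only if the graded algebra k[N]^S is polynomial. *)
Require Import Defs.
From HB Require Import structures.
From mathcomp Require Import all_boot all_order all_algebra.
From mathcomp Require Import ring zify mpoly.
From mathcomp Require Import boolp classical_sets functions.

Set Implicit Arguments.
Unset Strict Implicit.
Unset Printing Implicit Defensive.

Import GRing.Theory.
Local Open Scope ring_scope.
Local Open Scope quotient_scope.
Local Open Scope classical_set_scope.

(** Reductive means here that the unipotent radical is trivial, so complete reducibility has to be
    derived: a space of nilpotents in Lie F stable under brackets and Ad would exponentiate into the
    radical, which makes trace forms nondegenerate; then a Casimir element, or a finite average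
    where Lie F acts trivially, splits off fixed vectors. Descent uses characteristic 0: a function
    constant on the fibres of the multiplication F x H -> F H is algebraic over the functions of the
    product, and separability excludes a degree above one. This extends a symbol over a dense part
    of the orbit only. The functions on the orbit after multiplication by which the extension exists
    form an ideal stable under F x H; since F H is closed and homogeneous, one member nonzero at a
    point forces the ideal to be the unit ideal. The same device yields the Euler field and shows
    that the order of vanishing at e and the powers of the maximal ideal of pi(e) define the same
    topology, without which the filtration would say nothing about the local ring. Dimensions are
    bounded by counting monomials, and truncated eigenvectors replace completions. *)

Local Notation tnthE := tnth_mktuple.
Local Ltac eqbig := apply: eq_bigr.

(** * Ideals, noetherian rings and Hilbert's basis theorem *)

Section IdealTheory.
Variable R : comPzRingType.
Implicit Types (I J : set R) (s : seq R).

Lemma ideal0 I : is_ideal I -> I 0.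
by case. Qed.

Lemma idealD I a b : is_ideal I -> I a -> I b -> I (a + b).
by case=> _ D _;apply:D. Qed.

Lemma idealM I a b : is_ideal I -> I b -> I (a * b).
by case=> _ _;apply. Qed.

Lemma idealMr I a b : is_ideal I -> I a -> I (a * b).
by rewrite mulrC;apply:idealM. Qed.

Lemma idealN I a : is_ideal I -> I a -> I (- a).
by move=>iI Ia;rewrite -mulN1r;apply:idealM. Qed.

Lemma idealB I a b : is_ideal I -> I a -> I b -> I (a - b).
by move=>iI Ia Ib;apply:idealD =>//;apply:idealN. Qed.

Lemma ideal_sum I (T : Type) (r : seq T) (P : pred T) (F : T -> R) : is_ideal I ->
 (forall i, P i -> I (F i)) -> I (\sum_(i <- r | P i) F i).
by move=>iI h;apply:(big_ind I) =>//;[apply:ideal0 | move=>? ?;apply:idealD].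
Qed.

Lemma ideal_subl I a b : is_ideal I -> I (a - b) -> I b -> I a.
by move=>iI h /(idealD iI h);rewrite subrK. Qed.

Lemma ideal_gen_ideal s : is_ideal (ideal_gen s).
split.
- by exists (fun=> 0);rewrite big1 // => i _;rewrite mul0r.
- move=>_ _ [c ->] [d ->];exists (fun i => c i + d i).
 by rewrite -big_split;eqbig => i _;rewrite mulrDl.
move=>a _ [c ->];exists (fun i => a * c i).
by rewrite mulr_sumr;eqbig => i _;rewrite mulrA.
Qed.

Lemma mem_ideal_gen s a : a \in s -> ideal_gen s a.
move=>sa;have lt : (index a s < size s)%N by rewrite index_mem.
exists (fun i => (i == Ordinal lt)%:R);rewrite (bigD1 (Ordinal lt)) //= eqxx mul1r.
by rewrite nth_index // big1 ?addr0 // => i /negPf ->;rewrite mul0r.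
Qed.

Lemma ideal_gen_sub I s : is_ideal I -> (forall a, a \in s -> I a) -> ideal_gen s `<=` I.
by move=>iI h _ [c ->];apply:ideal_sum =>// i _;apply:idealM =>//;apply/h/mem_nth.
Qed.

Lemma ideal_genS s t : {subset s <= t} -> ideal_gen s `<=` ideal_gen t.
move=>st;apply:ideal_gen_sub;first exact:ideal_gen_ideal.
by move=>a /st;apply:mem_ideal_gen.
Qed.

Lemma ideal_genP I s : is_ideal I -> (forall a, a \in s -> I a) ->
 (forall a, I a -> ideal_gen s a) -> I = ideal_gen s.
by move=>iI sI Is;apply/seteqP;split=>// a;apply:ideal_gen_sub.
Qed.

Lemma noetherian_gens : noetherian R -> forall I, is_ideal I ->
 exists2 s, (forall a, a \in s -> I a) & forall a, I a -> ideal_gen s a.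
by move=>nR I /nR[s ->];exists s =>// a;apply:mem_ideal_gen.
Qed.

Lemma gens_noetherian : (forall I, is_ideal I ->
 exists2 s, (forall a, a \in s -> I a) & forall a, I a -> ideal_gen s a) ->
 noetherian R.
by move=>h I iI;have [s sI Is] := h I iI;exists s;apply:ideal_genP. Qed.

Lemma ideal_bigcup (f : nat -> set R) : (forall i, is_ideal (f i)) ->
 (forall i j, (i <= j)%N -> f i `<=` f j) -> is_ideal [set a | exists i, f i a].
move=>fI fS;split.
- by exists 0%N;apply:ideal0.
- move=>a b [i fa] [j fb];exists (maxn i j).
 by apply:idealD =>//;[apply:(fS i);rewrite ?leq_maxl | apply:(fS j);rewrite ?leq_maxr].
by move=>a b [i fb];exists i;apply:idealM.
Qed.

Lemma seq_bound (f : nat -> set R) s :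
 (forall i j, (i <= j)%N -> f i `<=` f j) ->
 (forall a, a \in s -> exists i, f i a) -> exists i, forall a, a \in s -> f i a.
move=>fS;elim: s =>[|a s IH] h;first by exists 0%N.
have [i si] := IH (fun b sb => h b (@mem_behead _ (a :: s) b sb)).
have [j aj] := h a (mem_head _ _).
exists (maxn i j) => b;rewrite inE => /orP[/eqP ->|/si].
 by apply:(fS j);rewrite ?leq_maxr.
by apply:fS;rewrite leq_maxl.
Qed.

Lemma noetherian_chain : noetherian R -> forall f : nat -> set R,
 (forall i, is_ideal (f i)) -> (forall i j, (i <= j)%N -> f i `<=` f j) ->
 exists n, forall i, f i `<=` f n.
move=>nR f fI fS;have [s sI Is] := noetherian_gens nR (ideal_bigcup fI fS).
have [n sn] := seq_bound fS sI;exists n => i a fa.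
by apply:(ideal_gen_sub (fI n) sn);apply:Is;exists i.
Qed.

Definition ideal_add I J : set R := [set a | exists b c, [/\ I b, J c & a = b + c]].

Lemma ideal_add_ideal I J : is_ideal I -> is_ideal J -> is_ideal (ideal_add I J).
move=>iI iJ;split.
- by exists 0, 0;split;rewrite ?addr0 //;apply:ideal0.
- move=>_ _ [b [c [Ib Jc ->]]] [b' [c' [Ib' Jc' ->]]];exists (b + b'), (c + c').
 by split;rewrite 1?addrACA //;apply:idealD.
move=>a _ [b [c [Ib Jc ->]]];exists (a * b), (a * c).
by split;rewrite ?mulrDr //;apply:idealM.
Qed.

Lemma ideal_addl I J a : is_ideal J -> I a -> ideal_add I J a.
by move=>iJ Ia;exists a, 0;split;rewrite ?addr0 //;apply:ideal0. Qed.

Lemma ideal_addr I J a : is_ideal I -> J a -> ideal_add I J a.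
by move=>iI Ja;exists 0, a;split;rewrite ?add0r //;apply:ideal0. Qed.

Lemma is_primeX (P : set R) a n : is_prime P -> P (a ^+ n) -> P a.
move=>[iP P1 PM];elim: n =>[|n IH];first by rewrite expr0 => /P1.
by rewrite exprS => /PM[].
Qed.

End IdealTheory.

Lemma noetherian_surj (R S : comPzRingType) (f : {rmorphism R -> S}) :
 (forall y, exists x, f x = y) -> noetherian R -> noetherian S.
move=>fS nR;apply:gens_noetherian => I iI.
have iJ : is_ideal [set x | I (f x)].
 split=> /=;first by rewrite rmorph0;apply:ideal0.
  by move=>a b;rewrite rmorphD;apply:idealD.
 by move=>a b;rewrite rmorphM;apply:idealM.
have [s sI Is] := noetherian_gens nR iJ;exists (map f s).
 by move=>_ /mapP[a /sI ? ->].
move=>y;have [x <-] := fS y => /Is[c ->];rewrite rmorph_sum.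
apply:ideal_sum =>[|i _];first exact:ideal_gen_ideal.
rewrite rmorphM;apply:idealM;first exact:ideal_gen_ideal.
by apply:mem_ideal_gen;apply/map_f/mem_nth.
Qed.

Lemma field_noetherian (k : fieldType) : noetherian k.
apply:gens_noetherian => I iI.
have [[a Ia a0]|h] := pselect (exists2 a, I a & a != 0).
 exists [:: a] =>[b|b _];first by rewrite inE => /eqP ->.
 rewrite -[b](divfK a0);apply:idealM;first exact:ideal_gen_ideal. by apply:mem_ideal_gen;rewrite inE.
exists [::] =>// a Ia;have -> : a = 0.
 by apply:contrapT => /eqP a0;apply:h;exists a.
exact:(ideal0 (ideal_gen_ideal _)).
Qed.

(* Hilbert: I is generated by finitely many polynomials of each degree d at most D
  whose coefficients of degree d generate the ideal of all such coefficients,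
  where D is a degree from which these ideals of coefficients are stationary. *)
Lemma poly_noetherian (R : comNzRingType) : noetherian R -> noetherian {poly R}.
move=>nR;apply:gens_noetherian => I iI.
pose J d := [set a | exists p : {poly R}, [/\ I p, (size p <= d.+1)%N & p`_d = a]].
have iJ d : is_ideal (J d).
 split.
 - by exists 0;rewrite size_poly0 coef0;split=>//;apply:ideal0.
 - move=>_ _ [p [Ip sp <-]] [q [Iq sq <-]];exists (p + q);rewrite coefD.
  split=>//;first exact:idealD. by rewrite (leq_trans (size_polyD _ _)) // geq_max sp sq.
 move=>a _ [p [Ip sp <-]];exists (a%:P * p);rewrite coefCM;split=>//.
  exact:idealM.
 by rewrite mul_polyC (leq_trans (size_scale_leq _ _)).
have JS i j : (i <= j)%N -> J i `<=` J j.
 move=>ij _ [p [Ip sp <-]];exists ('X^(j - i) * p);split.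
 - exact:idealM.
 - apply:leq_trans (size_polyMleq _ _) _;rewrite size_polyXn /=.
  by rewrite (leq_trans (leq_add (leqnn _) sp)) // addnS subnK.
 by rewrite coefXnM ltnNge leq_subr /= subKn.
have [D JD] := noetherian_chain nR iJ JS.
have gens d : exists s : seq {poly R}, (forall p, p \in s -> I p /\ (size p <= d.+1)%N) /\
  forall a, J d a -> exists q, [/\ ideal_gen s q, (size q <= d.+1)%N & q`_d = a].
 have [s sJ Js] := noetherian_gens nR (iJ d).
 (* [g] realises each leading coefficient in [J d] by a polynomial of I; the value 0 elsewhere is a
    dummy. *)
 pose g a := if pselect (J d a) is left h then projT1 (cid h) else 0.
 have gP a : J d a -> [/\ I (g a), (size (g a) <= d.+1)%N & (g a)`_d = a].
  by rewrite /g;case:pselect =>// h _;case:(cid h).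
 exists (map g s);split=>[p /mapP[a /sJ /gP[Ig sg _] ->] //|a /Js[c ->]].
 exists (\sum_(i < size s) (c i)%:P * g s`_i);split.
 - apply:ideal_sum =>[|i _];first exact:ideal_gen_ideal.
  apply:idealM;first exact:ideal_gen_ideal. by apply/mem_ideal_gen/map_f/mem_nth.
 - apply:(big_ind (fun p : {poly R} => (size p <= d.+1)%N)) =>[|p q sp sq|i _].
  + by rewrite size_poly0.
  + by rewrite (leq_trans (size_polyD _ _)) // geq_max sp sq.
  rewrite mul_polyC (leq_trans (size_scale_leq _ _)) //. by have [] := gP s`_i (sJ _ (mem_nth _ (ltn_ord i))).
 rewrite coef_sum;eqbig => i _;rewrite coefCM. by have [_ _ ->] := gP s`_i (sJ _ (mem_nth _ (ltn_ord i))).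
pose s d := projT1 (cid (gens d)).
have sP d : (forall p, p \in s d -> I p /\ (size p <= d.+1)%N) /\
  forall a, J d a -> exists q, [/\ ideal_gen (s d) q, (size q <= d.+1)%N & q`_d = a].
 exact:(projT2 (cid (gens d))).
pose t := flatten [seq s d | d <- iota 0 D.+1].
have tI : is_ideal (ideal_gen t) by exact:ideal_gen_ideal.
have st d : (d <= D)%N -> ideal_gen (s d) `<=` ideal_gen t.
 move=>dD;apply:ideal_genS => p ps;apply/flatten_mapP;exists d =>//. by rewrite mem_iota.
have It p : p \in t -> I p.
 by move=>/flatten_mapP[d _ /(proj1 (sP d))[]].
exists t =>// p;have [m] := ubnP (size p).
elim: m p =>// m IH p;rewrite ltnS => sm Ip.
have [/eqP|p0] := eqVneq (size p) 0%N.
 by rewrite size_poly_eq0 => /eqP ->;apply:ideal0.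
set d := (size p).-1;have sp : size p = d.+1 by rewrite prednK // lt0n.
have Jp : J d p`_d by exists p;rewrite sp.
suff [q [tq sq qd]] : exists q, [/\ ideal_gen t q, (size q <= d.+1)%N & q`_d = p`_d].
 apply:(ideal_subl tI _ tq);apply:IH.
  rewrite (leq_trans _ sm) // sp ltnS;apply/leq_sizeP => j.
  rewrite leq_eqVlt => /orP[/eqP <-|dj];first by rewrite coefB qd subrr.
  by rewrite coefB !nth_default ?subrr ?sp // (leq_trans sq).
 by apply:idealB =>//;apply:(ideal_gen_sub iI It).
have [dD|Dd] := leqP d D.
 have [q [sq qs qd]] := (proj2 (sP d)) _ Jp. by exists q;split=>//;apply:(st d).
have [q [sq qs qd]] := (proj2 (sP D)) _ (JD d _ Jp).
exists ('X^(d - D) * q);split.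
- by apply:idealM =>//;apply:(st D).
- apply:leq_trans (size_polyMleq _ _) _;rewrite size_polyXn /=.
 by rewrite (leq_trans (leq_add (leqnn _) qs)) // addnS subnK // ltnW.
by rewrite coefXnM ltnNge leq_subr /= subKn // ltnW.
Qed.

Lemma mpoly_gen_ind (R : comNzRingType) n (P : {mpoly R[n]} -> Prop) :
 (forall c, P c%:MP) -> (forall i, P 'X_i) ->
 (forall p q, P p -> P q -> P (p + q)) -> (forall p q, P p -> P q -> P (p * q)) ->
 forall p, P p.
move=>PC PX PD PM;elim/mpolyind =>[|c m p _ _ Pp];first by rewrite -mpolyC0.
apply:PD =>//;rewrite -mul_mpolyC;apply:(PM) =>//.
rewrite mpolyXE_id;apply:(big_ind P) =>[|p' q' Pp' Pq'|i _];first by rewrite -mpolyC1.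
 exact:(PM).
by elim: (m i) =>[|d IHd];rewrite ?expr0 -?mpolyC1 // exprS;apply:(PM).
Qed.

Lemma mpoly_rmorph_eq (R S : comNzRingType) n (f g : {rmorphism {mpoly R[n]} -> S}) :
 (forall c, f c%:MP = g c%:MP) -> (forall i, f 'X_i = g 'X_i) -> f =1 g.
move=>fgC fgX;apply:mpoly_gen_ind =>[//|//|p q ep eq|p q ep eq];first by rewrite !rmorphD /= ep eq.
by rewrite !rmorphM /= ep eq.
Qed.

(* {mpoly R[n.+1]} is a polynomial ring in n variables over {poly R}. *)
Lemma mpoly_split (R : comNzRingType) n :
 exists (f : {rmorphism {mpoly R[n.+1]} -> {mpoly {poly R}[n]}})
     (g : {rmorphism {mpoly {poly R}[n]} -> {mpoly R[n.+1]}}),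
  cancel f g /\ forall c, f c%:MP = (c%:P)%:MP.
have [g0 [g0C g0X]] : exists g0 : {rmorphism {poly R} -> {mpoly R[n.+1]}},
  (forall c, g0 c%:P = c%:MP) /\ g0 'X = 'X_ord0.
 pose cX : commr_rmorph (@mpolyC n.+1 R) 'X_ord0 := fun a => mulrC _ _.
 exists (horner_morph cX);split=>[c|];last exact:horner_morphX. exact:horner_morphC.
pose g := mmap g0 (fun i : 'I_n => 'X_(lift ord0 i)).
pose f := mmap (@mpolyC n {poly R} \o polyC)
 (fun i : 'I_n.+1 => if unlift ord0 i is Some j then 'X_j else 'X%:MP).
have fC c : f c%:MP = (c%:P)%:MP by rewrite /f mmapC.
exists f, g;split=>//;apply:(mpoly_rmorph_eq (f := g \o f) (g := idfun)) =>[c|i] /=.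
 by rewrite -[LHS]/(g (f _)) fC /g mmapC;exact:g0C.
rewrite /f mmapX mmap1U /g;case:unliftP =>[j ->|->].
 by rewrite mmapX mmap1U.
by rewrite mmapC;exact:g0X.
Qed.

Lemma mpoly_noetherian (R : comNzRingType) n : noetherian R -> noetherian {mpoly R[n]}.
elim: n R =>[|n IH] R nR.
 apply:(@noetherian_surj R {mpoly R[0]} (@mpolyC 0 R)) =>// p.
 by exists (p@_0%MM);rewrite [RHS]nvar0_mpolyC.
have [f [g [fK _]]] := mpoly_split R n.
apply:(@noetherian_surj {mpoly {poly R}[n]} {mpoly R[n.+1]} g);last exact/IH/poly_noetherian.
by move=>p;exists (f p).
Qed.

(** * The residue field of a prime ideal *)

Section PrimeQuotient.
Variables (R : comNzRingType) (P : set R) (pP : is_prime P).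

Definition prime_pred : {pred R} := fun a => `[< P a >].

Fact prime_pred_ideal : idealr_closed prime_pred.
have [iP P1 _] := pP;split=>[||a b c /asboolP Pb /asboolP Pc];apply/asboolP =>//.
 exact:ideal0.
by apply:idealD =>//;apply:idealM.
Qed.

Fact prime_pred_prime : prime_idealr_closed prime_pred.
have [_ _ PM] := pP;move=>a b /asboolP /PM[] h;apply/orP;[left|right];
 exact/asboolP.
Qed.

HB.instance Definition _ := isIdealr.Build R prime_pred prime_pred_ideal.
HB.instance Definition _ := isPrimeIdealrClosed.Build R prime_pred prime_pred_prime.

Definition prime_quot := {ideal_quot prime_pred}.
HB.instance Definition _ := GRing.ComNzRing.on prime_quot.

(** Units and inverses are chosen classically: [{fraction _}] takes an integral domain that carries
    them. *)
Definition prime_quot_unit : pred prime_quot := fun x => `[< exists y, y * x = 1 >].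
Definition prime_quot_inv (x : prime_quot) : prime_quot :=
 if pselect (exists y, y * x = 1) is left h then projT1 (cid h) else x.

Fact prime_quot_mulVr : {in prime_quot_unit, left_inverse 1 prime_quot_inv *%R}.
move=>x /asboolP h;rewrite /prime_quot_inv;case:pselect =>// h'.
exact:(projT2 (cid h')).
Qed.

Fact prime_quot_unitPl (x y : prime_quot) : y * x = 1 -> prime_quot_unit x.
by move=>h;apply/asboolP;exists y. Qed.

Fact prime_quot_inv_out : {in [predC prime_quot_unit], prime_quot_inv =1 id}.
by move=>x /asboolP h;rewrite /prime_quot_inv;case:pselect.
Qed.

HB.instance Definition _ := GRing.ComNzRing_hasMulInverse.Build prime_quot
 prime_quot_mulVr prime_quot_unitPl prime_quot_inv_out.

HB.instance Definition _ := GRing.ComUnitRing_isIntegral.Build prime_quot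
 (@Quotient.rquot_IdomainAxiom R prime_pred).

Definition prime_frac (a : R) : {fraction prime_quot} := tofrac (\pi_prime_quot a : prime_quot).

Fact prime_frac_zmod : zmod_morphism prime_frac.
move=>a b;rewrite /prime_frac -tofracB;congr tofrac;exact:(rmorphB (\pi_prime_quot)).
Qed.

Fact prime_frac_monoid : monoid_morphism prime_frac.
split=>[|a b];rewrite /prime_frac.
 by rewrite -tofrac1;congr tofrac;exact:(rmorph1 (\pi_prime_quot)).
by rewrite -tofracM;congr tofrac;exact:(rmorphM (\pi_prime_quot)).
Qed.

HB.instance Definition _ :=
 GRing.isZmodMorphism.Build R {fraction prime_quot} prime_frac prime_frac_zmod.
HB.instance Definition _ :=
 GRing.isMonoidMorphism.Build R {fraction prime_quot} prime_frac prime_frac_monoid.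

Lemma prime_frac_eq0 a : prime_frac a = 0 <-> P a.
rewrite /prime_frac;split=>[/eqP|Pa].
 rewrite tofrac_eq0 -(rmorph0 (\pi_prime_quot)) => /eqP /eqmodP /asboolP. by rewrite subr0.
apply/eqP;rewrite tofrac_eq0 -(rmorph0 (\pi_prime_quot));apply/eqP/eqmodP.
by apply/asboolP;rewrite subr0.
Qed.

End PrimeQuotient.

(** The field is used only through these two properties. Congruences modulo P become equations
    between values of [e], and the last clause serves to clear denominators. *)
Lemma prime_field (R : comNzRingType) (P : set R) : is_prime P ->
 exists (L : fieldType) (e : {rmorphism R -> L}),
  (forall a, e a = 0 <-> P a) /\ forall x, exists a b, ~ P b /\ x = e a / e b.
move=>pP;exists {fraction (prime_quot pP)}, (@prime_frac R P pP).
split=>[a|x];first exact:prime_frac_eq0.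
have [n [d [d0 ->]]] : exists n d : prime_quot pP, d != 0 /\ x = tofrac n / tofrac d.
 exists (repr x).1, (repr x).2;split;first exact:denom_ratioP.
 apply:(mulIf (x := tofrac (repr x).2));rewrite ?tofrac_eq0 ?denom_ratioP //.
 rewrite divfK ?tofrac_eq0 ?denom_ratioP // -{1}[x]reprK;unlock tofrac.
 rewrite -[LHS]FracField.pi_mul;apply/eqP;rewrite FracField.equivf_def.
 rewrite /FracField.mulf !numden_Ratio ?oner_eq0 ?mulf_neq0 ?denom_ratioP //. by rewrite !mulr1 mulrC.
  exact:oner_neq0.
 exact:oner_neq0.
exists (repr n), (repr d);split.
 by move=>/(prime_frac_eq0 pP) /eqP;rewrite /prime_frac reprK tofrac_eq0 (negPf d0).
by rewrite /= /prime_frac !reprK.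
Qed.

(** * Specialisation of homomorphisms into an algebraically closed field *)

Section OneVariable.
Variables (R : idomainType) (L : fieldType) (e : {rmorphism {poly R} -> L}).

(* R[X] -> L with X |-> z: mu is a minimal polynomial of z over the image of R,
  with coefficients in R; it is only determined up to the kernel of R -> L. *)
Definition ker_coef (p : {poly R}) := forall i, e (p`_i)%:P = 0.

Definition min_relation (mu : {poly R}) :=
 [/\ e (lead_coef mu)%:P != 0, e mu = 0, (1 < size mu)%N &
   forall q, e q = 0 -> (size q < size mu)%N -> ker_coef q].

Lemma ker_coef_eval (T : comNzRingType) (h : {rmorphism {poly R} -> T}) p :
 (forall a, e a%:P = 0 -> h a%:P = 0) -> ker_coef p -> h p = 0.
move=>eh kp;rewrite -[p]coefK poly_def rmorph_sum big1 // => i _.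
by rewrite -mul_polyC rmorphM eh ?mul0r.
Qed.

Lemma ker_coef0 p : ker_coef p -> e p = 0.
exact:ker_coef_eval. Qed.

Lemma ker_coefB p q : ker_coef p -> ker_coef q -> ker_coef (p - q).
by move=>kp kq i;rewrite coefB polyCB rmorphB kp kq subrr. Qed.

Lemma ker_coefN p : ker_coef p -> ker_coef (- p).
by move=>kp i;rewrite coefN polyCN rmorphN kp oppr0. Qed.

Lemma ker_coefM p q : ker_coef q -> ker_coef (p * q).
move=>kq i;rewrite coefM !rmorph_sum big1 // => j _.
by rewrite /= polyCM rmorphM kq mulr0.
Qed.

(* The truncation of p at its highest coefficient outside the kernel. *)
Lemma ker_coef_trunc p : ~ ker_coef p -> exists p1,
 [/\ e (lead_coef p1)%:P != 0, (size p1 <= size p)%N & ker_coef (p - p1)].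
have [m] := ubnP (size p);elim: m p =>// m IH p;rewrite ltnS => sm np.
have [l0|l0] := eqVneq (e (lead_coef p)%:P) 0;last first.
 by exists p;split=>// i;rewrite subrr coef0 rmorph0.
have p0 : p != 0 by apply:contra_notN np => /eqP -> i;rewrite coef0 rmorph0.
have klt : ker_coef (lead_coef p *: 'X^((size p).-1)).
 by move=>i;rewrite coefZ polyCM rmorphM l0 mul0r.
have slt : (size (p - lead_coef p *: 'X^((size p).-1))%R < size p)%N.
 rewrite [X in (_ < X)%N](polySpred p0) ltnS;apply/leq_sizeP => j.
 rewrite leq_eqVlt => /orP[/eqP <-|ltj];rewrite coefB coefZ coefXn.
  by rewrite eqxx mulr1 subrr.
 by rewrite (gtn_eqF ltj) mulr0 subr0 nth_default // (polySpred p0).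
have [|h|p1 [n1 s1 k1]] := IH (p - lead_coef p *: 'X^((size p).-1)).
- exact:leq_trans slt sm.
- apply:np => i;have := h i;rewrite coefB polyCB rmorphB.
 by have := klt i => ->;rewrite subr0.
exists p1;split=>//;first exact:leq_trans s1 (ltnW slt).
have -> : p - p1 = (p - lead_coef p *: 'X^((size p).-1) - p1) - - (lead_coef p *: 'X^((size p).-1)).
 by rewrite opprK addrAC subrK.
by apply:ker_coefB =>//;apply:ker_coefN.
Qed.

(** The dichotomy between z transcendental and z algebraic over the image of R. A relation of least
    size among those with a coefficient outside the kernel is minimal once it is truncated at its
    top surviving coefficient. *)
Lemma trans_or_min :
 (forall p, e p = 0 -> ker_coef p) \/ exists mu, min_relation mu.
have [tr|ntr] := pselect (forall p, e p = 0 -> ker_coef p);[by left | right].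
have [p [ep np]] : exists p, e p = 0 /\ ~ ker_coef p.
 apply:contrapT => h;apply:ntr => p ep;apply:contrapT => np;apply:h. by exists p.
have [m] := ubnP (size p);elim: m p ep np =>// m IH p ep np;rewrite ltnS => sm.
have [p1 [l1 s1 k1]] := ker_coef_trunc np.
have ep1 : e p1 = 0.
 by have := ker_coef0 k1;rewrite rmorphB ep sub0r => /eqP;rewrite oppr_eq0 => /eqP.
have [[q [eq sq nq]]|h] := pselect (exists q, [/\ e q = 0, (size q < size p1)%N & ~ ker_coef q]).
 by apply:(IH q) =>//;apply:leq_trans sq (leq_trans s1 sm).
exists p1;split=>// [|q eq sq];last first.
 by apply:contrapT => nq;apply:h;exists q.
rewrite ltnNge;apply/negP => /size1_polyC p1C.
by move: l1;rewrite p1C lead_coefC -p1C ep1 eqxx.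
Qed.

(** Pseudo-division by mu: the remainder kills z and is shorter than mu, so minimality puts its
    coefficients into the kernel. *)
Lemma min_relation_reduce mu p : min_relation mu -> e p = 0 ->
 exists (N : nat) q r, lead_coef mu ^+ N *: p = q * mu + r /\ ker_coef r.
move=>[l0 emu smu minmu] ep.
have mu0 : mu != 0 by rewrite -size_poly_gt0 (leq_trans _ smu).
exists (scalp p mu), (p %/ mu)%R, (p %% mu)%R.
have eqd := Pdiv.Idomain.divp_eq p mu;split=>//.
apply:minmu;last by rewrite ltn_modp.
have -> : p %% mu = lead_coef mu ^+ scalp p mu *: p - (p %/ mu) * mu.
 by rewrite eqd addrC addKr.
by rewrite rmorphB -mul_polyC !rmorphM /= ep emu !mulr0 subrr.
Qed.

(** Coprimality of p with the irreducible polynomial mu, without denominators. Among the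
    combinations of p and mu modulo [ker_coef], one of least size does not vanish at z; hence its
    cofactor in mu does and is at least as long as mu, which leaves only size 1 for the combination
    itself. *)
Lemma min_relation_bezout mu p : min_relation mu -> e p != 0 ->
 exists u v (r : R) g, [/\ u * p + v * mu = r%:P + g, ker_coef g & e r%:P != 0].
move=>mmu ep;have [l0 emu smu minmu] := mmu.
have mu0 : mu != 0 by rewrite -size_poly_gt0 (leq_trans _ smu).
pose G (f : {poly R}) := exists u v g : {poly R}, u * p + v * mu = f + g /\ ker_coef g.
have Gsub a b f : G a -> G f -> G (b * a - f).
 move=>[u [v [g [eg kg]]]] [u' [v' [g' [eg' kg']]]].
 exists (b * u - u'), (b * v - v'), (b * g - g');split;last first.
  by apply:ker_coefB =>//;apply:ker_coefM.
 transitivity (b * (u * p + v * mu) - (u' * p + v' * mu));first by ring. by rewrite eg eg';ring.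
have kc0 : ker_coef 0 by move=>i;rewrite coef0 rmorph0.
have Gp : G p by exists 1, 0, 0;rewrite mul1r mul0r;split.
have Gmu : G mu by exists 0, 1, 0;rewrite mul1r mul0r addrC;split.
have Gtr f f1 : G f -> ker_coef (f - f1) -> G f1.
 move=>[u [v [g [eg kg]]]] kf;exists u, v, (f - f1 - (- g)).
 split;last by apply:ker_coefB =>//;apply:ker_coefN. by rewrite eg;ring.
have npk : ~ ker_coef p by move=>/ker_coef0 /eqP;rewrite (negPf ep).
suff main m (f : {poly R}) : (size f < m)%N -> G f -> ~ ker_coef f ->
  exists2 f, G f & size f = 1%N /\ e (lead_coef f)%:P != 0.
 have [f [u [v [g [eg kg]]]] [/eqP/size_poly1P[c c0 fC] lf]] := main _ p (ltnSn _) Gp npk.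
 exists u, v, c, g;rewrite eg fC;split=>//. by move: lf;rewrite fC lead_coefC.
elim: m f =>// m IH f;rewrite ltnS => sm Gf nf.
have [f1 [l1 s1 k1]] := ker_coef_trunc nf.
have Gf1 := Gtr _ _ Gf k1;have s1m := leq_trans s1 sm.
have f10 : f1 != 0 by apply:contraNneq l1 => ->;rewrite lead_coef0 rmorph0.
have [[q [Gq sq nq]]|h] := pselect (exists q, [/\ G q, (size q < size f1)%N & ~ ker_coef q]).
 by apply:(IH q) =>//;apply:leq_trans sq s1m.
have red q : G q -> exists (N : nat) b c,
  lead_coef f1 ^+ N *: q = b * f1 + c /\ ker_coef c.
 move=>Gq;exists (scalp q f1), (q %/ f1)%R, (q %% f1)%R. have eqd := Pdiv.Idomain.divp_eq q f1;split=>//.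
 apply:contrapT => nk;apply:h;exists (q %% f1);rewrite ltn_modp;split=>//.
 have -> : q %% f1 = (lead_coef f1 ^+ scalp q f1)%:P * q - (q %/ f1) * f1.
  by rewrite mul_polyC eqd;ring.
 apply:(Gsub) =>//. have -> : (q %/ f1) * f1 = (q %/ f1) * f1 - 0 by rewrite subr0.
 by apply:(Gsub) =>//;exists 0, 0, 0;rewrite !mul0r addr0.
exists f1 =>//;split=>//.
have [N [b [c [eb kc]]]] := red _ Gmu.
have lN M : e (lead_coef f1 ^+ M)%:P != 0 by rewrite polyC_exp rmorphXn expf_neq0.
have ef1 : e f1 != 0.
 apply/negP => /eqP ef1;have [M [b' [c' [eb' kc']]]] := red _ Gp.
 have /eqP := congr1 e eb';rewrite -mul_polyC rmorphM rmorphD rmorphM /= ef1 mulr0 add0r.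
 by rewrite (ker_coef0 kc') mulf_eq0 (negPf (lN _)) (negPf ep).
have eb0 : e b = 0.
 have /eqP := congr1 e eb;rewrite -mul_polyC rmorphM rmorphD rmorphM /= emu mulr0.
 rewrite (ker_coef0 kc) addr0 eq_sym mulf_eq0 (negPf ef1) orbF => /eqP //.
have nkb : ~ ker_coef b.
 move=>kb;have : ker_coef (lead_coef f1 ^+ N *: mu).
  by rewrite eb -[c]opprK;apply:ker_coefB;[rewrite mulrC;apply:ker_coefM | apply:ker_coefN].
 move=>/(_ (size mu).-1);rewrite coefZ polyCM rmorphM -lead_coefE => /eqP.
 by rewrite mulf_eq0 (negPf (lN _)) (negPf l0).
have [b1 [lb1 sb1 kb1]] := ker_coef_trunc nkb.
have eb1 : e b1 = 0.
 by have := ker_coef0 kb1;rewrite rmorphB eb0 sub0r => /eqP;rewrite oppr_eq0 => /eqP.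
have nkb1 : ~ ker_coef b1 by move=>/(_ (size b1).-1) /eqP;rewrite -lead_coefE (negPf lb1).
have sb1mu : (size mu <= size b1)%N.
 by rewrite leqNgt;apply/negP => lt;apply:nkb1;apply:minmu.
apply/eqP;rewrite eqn_leq andbC;apply/andP;split;first by rewrite size_poly_gt0.
rewrite leqNgt;apply/negP => s1gt.
have cc : ker_coef ((lead_coef f1 ^+ N *: mu) - b1 * f1).
 have -> : lead_coef f1 ^+ N *: mu - b1 * f1 = f1 * (b - b1) - - c by rewrite eb;ring.
 by apply:ker_coefB;[apply:ker_coefM | apply:ker_coefN].
have b10 : b1 != 0 by apply:contraNneq lb1 => ->;rewrite lead_coef0 rmorph0.
have := cc (size (b1 * f1)).-1;rewrite coefB coefZ polyCB rmorphB -lead_coefE lead_coefM.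
rewrite nth_default;last first.
 rewrite size_mul //;case:(size f1) s1gt =>[|[|z]] // _.
 by rewrite !addnS /= (leq_trans sb1mu) // leq_addr.
rewrite mulr0 polyC0 rmorph0 sub0r polyCM rmorphM => /eqP.
by rewrite oppr_eq0 mulf_eq0 (negPf lb1) (negPf l1).
Qed.

End OneVariable.

Lemma horner_rmorph (R S : comNzRingType) (f : {rmorphism {poly R} -> S})
  (g : {rmorphism R -> S}) (p : {poly R}) :
 (forall a, f a%:P = g a) -> f p = (map_poly g p).[f 'X].
move=>fg;elim/poly_ind: p =>[|p c IH];first by rewrite !rmorph0 horner0.
by rewrite !rmorphD !rmorphM /= map_polyC map_polyX hornerMXaddC /= -IH fg.
Qed.

Lemma poly_rmorph_at (R S : comNzRingType) (g : {rmorphism R -> S}) (t : S) :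
 exists h : {rmorphism {poly R} -> S},
  (forall p, h p = (map_poly g p).[t]) /\ forall a, h a%:P = g a.
pose ct : commr_rmorph g t := fun a => mulrC _ _.
by exists (horner_morph ct);split=>// a;exact:horner_morphC.
Qed.

Lemma poly_nonroot (k : closedFieldType) (p : {poly k}) : p != 0 ->
 exists t, p.[t] != 0.
by move=>/closed_nonrootP[t pt];exists t. Qed.

(** Chevalley's theorem on images in algebraic form: points are homomorphisms to k that kill the
    kernel of [e], and the image of the open set s != 0 contains the open set a != 0. *)
Definition extends (k : nzRingType) (R T : comNzRingType) (L : fieldType)
  (i : {rmorphism R -> T}) (e : {rmorphism T -> L}) :=
 forall s, e s != 0 -> exists2 a, e (i a) != 0 &
 forall h : {rmorphism R -> k}, (forall r, e (i r) = 0 -> h r = 0) -> h a != 0 ->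
 exists h' : {rmorphism T -> k},
  [/\ forall r, h' (i r) = h r, forall q, e q = 0 -> h' q = 0 & h' s != 0].

(** Evaluation at t is compatible with the kernel of [e]: pseudo-division by mu, whose leading
    coefficient stays invertible, reduces any relation to mu itself. *)
Lemma min_relation_ext (k : closedFieldType) (R : idomainType) (L : fieldType)
  (e : {rmorphism {poly R} -> L}) mu (h : {rmorphism R -> k}) t :
 min_relation e mu -> (forall r, e r%:P = 0 -> h r = 0) ->
 h (lead_coef mu) != 0 -> (map_poly h mu).[t] = 0 ->
 exists h' : {rmorphism {poly R} -> k},
  [/\ forall r, h' r%:P = h r, h' 'X = t & forall q, e q = 0 -> h' q = 0].
move=>mmu kh hl hmu;have [h' [h'E h'C]] := poly_rmorph_at h t.
exists h';split=>// [|q eq];first by rewrite h'E map_polyX hornerX.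
have [N [b [c [eb kc]]]] := min_relation_reduce mmu eq.
have /eqP := congr1 h' eb;rewrite -mul_polyC rmorphD !rmorphM /=.
rewrite h'C rmorphXn (h'E mu) hmu mulr0 add0r.
rewrite (@ker_coef_eval _ _ e _ h' c) // =>[|a ea];last by rewrite h'C kh.
by rewrite mulf_eq0 (negPf (expf_neq0 _ hl)) => /eqP.
Qed.

(** For z transcendental, a is a surviving coefficient of s and X goes to a value that is not a root
    of the specialised s. For z algebraic, a is the leading coefficient of mu, which leaves the
    specialised mu a root, times the constant of the Bezout relation, which keeps s from vanishing
    at that root. *)
Lemma extends_poly (k : closedFieldType) (R : idomainType) (L : fieldType)
  (e : {rmorphism {poly R} -> L}) : extends k (@polyC R) e.
move=>s es;have [tr|[mu mmu]] := trans_or_min e.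
 have ns : ~ ker_coef e s by move=>/ker_coef0 /eqP;rewrite (negPf es).
 have [i ei] : exists i, e (s`_i)%:P != 0.
  apply:contrapT => h;apply:ns => i. by apply/eqP/negPn/negP => ei;apply:h;exists i.
 exists s`_i =>// h kh ha. have hs : map_poly h s != 0.
  by apply:contraNneq ha => hs;rewrite -[h _]coef_map /= hs coef0.
 have [t ht] := poly_nonroot hs;have [h' [h'E h'C]] := poly_rmorph_at h t.
 exists h';split=>// [q /tr kq|];last by rewrite h'E. by apply:(ker_coef_eval _ kq) => a /kh;rewrite h'C.
have [u [v [r [g [eg kg er]]]]] := min_relation_bezout mmu es.
have [l0 emu smu _] := mmu.
exists (lead_coef mu * r);first by rewrite /= polyCM rmorphM mulf_neq0.
move=>h kh;rewrite rmorphM mulf_eq0 => /norP[hl hr].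
have : size (map_poly h mu) != 1%N.
 by rewrite size_poly_eq // gtn_eqF.
move=>/closed_rootP[t /eqP ht];have [h' [h'C h'X h'K]] := min_relation_ext mmu kh hl ht.
exists h';split=>//;apply:contraNneq hr => hs.
have := congr1 h' eg;rewrite !rmorphD !rmorphM /= hs (h'K mu) // !mulr0 add0r h'C.
by rewrite (@ker_coef_eval _ _ e _ h' g) ?addr0 =>[->|a ea|] //;rewrite h'C kh.
Qed.

Lemma extends_mpoly (k : closedFieldType) n (R : idomainType) (L : fieldType)
  (e : {rmorphism {mpoly R[n]} -> L}) : extends k (@mpolyC n R) e.
elim: n R e =>[|n IH] R e s es.
 have sE := nvar0_mpolyC s;exists s@_0%MM;first by rewrite /= -sE. move=>h kh ha.
 exists (h \o mcoeff 0%MM : {rmorphism _ -> _});split=>[r|q|] /=.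
 - by rewrite mpolyCK.
 - by rewrite {1}[q]nvar0_mpolyC => /kh.
 - by [].
have [f [g [fK fC]]] := mpoly_split R n.
have gfC c : g (c%:P)%:MP = c%:MP by rewrite -fC fK.
have egfs : e (g (f s)) != 0 by rewrite fK.
have [a1 ea1 H1] := IH _ (e \o g : {rmorphism _ -> _}) (f s) egfs.
have [a ea H0] := @extends_poly k R L (e \o g \o @mpolyC n {poly R} : {rmorphism _ -> _}) a1 ea1.
exists a =>[|h kh ha];first by rewrite /= -gfC.
have [r er|h1 [h1C h1K h1a]] := H0 h _ ha;first by apply:kh;rewrite /= -gfC.
have [//|h2 [h2C h2K h2s]] := H1 h1 _ h1a.
exists (h2 \o f : {rmorphism _ -> _});split=>[r|q eq|//] /=.
 by rewrite fC h2C h1C.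
by apply:h2K;rewrite /= fK.
Qed.

(** * Extension of derivations in characteristic zero *)

Definition is_deriv (T : comNzRingType) (L : fieldType) (e D : T -> L) :=
 (forall a b, D (a + b) = D a + D b) /\
 (forall a b, D (a * b) = e a * D b + e b * D a).

Section DerivTheory.
Variables (T : comNzRingType) (L : fieldType) (e : {rmorphism T -> L}) (D : T -> L).
Hypothesis dD : is_deriv e D.

Lemma deriv_0 : D 0 = 0.
by have := dD.1 0 0;rewrite addr0 => /eqP;rewrite -subr_eq0 opprD addrA subrr sub0r oppr_eq0 => /eqP. Qed.

Lemma deriv_N a : D (- a) = - D a.
by apply/eqP;rewrite -addr_eq0 -dD.1 addNr deriv_0. Qed.

Lemma deriv_B a b : D (a - b) = D a - D b.
by rewrite dD.1 deriv_N. Qed.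

End DerivTheory.

Section ExtendDerivation.
Variables (R : idomainType) (L : fieldType) (char0 : has_pchar0 L).
Variable (e : {rmorphism {poly R} -> L}).

(** Separability: mu' is shorter than mu, and its top coefficient is a nonzero integer times that of
    mu, so mu' cannot be a relation. *)
Lemma min_relation_deriv mu : min_relation e mu -> e mu^`() != 0.
move=>[l0 _ smu minmu];have mu0 : mu != 0 by rewrite -size_poly_gt0 (leq_trans _ smu).
apply/negP => /eqP /minmu /(_ (lt_size_deriv mu0)) /(_ (size mu).-2) /eqP.
rewrite coef_deriv;case E : (size mu) smu l0 =>[|[|s]] //= _.
rewrite lead_coefE E /= raddfMn rmorphMn /= -mulr_natr mulf_eq0 => /negPf -> /=.
by have /pcharf0P -> := char0.
Qed.

Variables (d : R -> L).
Hypothesis dd : is_deriv (fun a => e a%:P) d.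
Hypothesis d_ker : forall a, e a%:P = 0 -> d a = 0.

Let d0 : d 0 = 0.
exact:(deriv_0 (e := e \o polyC)). Qed.

(** The derivation that extends [d] and sends X to w: [d] on the coefficients plus w times the
    formal derivative. *)
Let ext (w : L) (p : {poly R}) :=
 \sum_(i < size p) d p`_i * e 'X ^+ i + e p^`() * w.

Let extE w (p : {poly R}) n : (size p <= n)%N ->
 ext w p = \sum_(i < n) d p`_i * e 'X ^+ i + e p^`() * w.
move=>sp;congr (_ + _);rewrite (big_ord_widen n (fun i => d p`_i * e 'X ^+ i)) //.
rewrite big_mkcond /=;eqbig => i _;case:ltnP =>// le.
by rewrite nth_default // d0 mul0r.
Qed.

Let extD w (p q : {poly R}) : ext w (p + q) = ext w p + ext w q.
pose n := maxn (size p) (size q).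
rewrite (@extE w p n) ?leq_maxl // (@extE w q n) ?leq_maxr // (@extE w _ n) ?size_polyD //.
rewrite derivD rmorphD mulrDl addrACA -big_split;congr (_ + _).
by eqbig => i _;rewrite coefD dd.1 mulrDl.
Qed.

Let extC w a : ext w a%:P = d a.
by rewrite (@extE w _ 1) ?size_polyC ?leq_b1 // derivC rmorph0 mul0r addr0
 big_ord1 coefC expr0 mulr1.
Qed.

Let extCM w a (p : {poly R}) : ext w (a%:P * p) = e a%:P * ext w p + e p * d a.
rewrite (@extE w _ (size p));last by rewrite mul_polyC size_scale_leq.
rewrite derivM derivC mul0r add0r rmorphM /ext mulrDr -mulrA.
rewrite addrAC;congr (_ + _).
under eq_bigr => i _ do rewrite coefCM dd.2 mulrDl -mulrA.
rewrite big_split mulr_sumr;congr (_ + _).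
have -> : e p = \sum_(i < size p) e (p`_i *: 'X^i) by rewrite -rmorph_sum -poly_def coefK.
rewrite mulr_suml;eqbig => i _.
by rewrite -mul_polyC rmorphM rmorphXn /= mulrAC.
Qed.

Let extXM w (p : {poly R}) : ext w ('X * p) = e 'X * ext w p + e p * w.
rewrite (@extE w _ (size p).+1);last first.
 by rewrite (leq_trans (size_polyMleq _ _)) // size_polyX.
rewrite derivM derivX mul1r rmorphD rmorphM /= /ext.
rewrite big_ord_recl coefXM /= d0 mul0r add0r.
under eq_bigr => i _ do rewrite coefXM /= exprS mulrCA.
by rewrite -mulr_sumr;ring.
Qed.

Let ext_deriv w : is_deriv e (ext w).
split=>[|p q];first exact:extD.
elim/poly_ind: p =>[|p c IH].
 have e0 : ext w 0 = 0 by rewrite -polyC0 extC. by rewrite mul0r e0 rmorph0 !mul0r mulr0 addr0.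
have -> : (p * 'X + c%:P) * q = 'X * (p * q) + c%:P * q by ring.
rewrite extD extXM IH extCM extD [p * 'X]mulrC extXM extC.
by rewrite rmorphD !rmorphM /=;ring.
Qed.

Let ext_ker w (p : {poly R}) : ker_coef e p -> ext w p = 0.
move=>kp;rewrite /ext big1 =>[|i _];last by rewrite d_ker ?mul0r.
rewrite (@ker_coef_eval _ _ e _ e) ?mul0r ?add0r // => i.
by rewrite coef_deriv raddfMn rmorphMn /= kp mul0rn.
Qed.

(** When z is transcendental the value on X is free and 0 is taken. When z is algebraic the
    requirement D mu = 0 determines it, with the nonzero value of mu' at z as denominator. *)
Lemma extend_deriv_poly : exists D : {poly R} -> L,
 [/\ is_deriv e D, forall a, D a%:P = d a & forall p, e p = 0 -> D p = 0].
have [tr|[mu mmu]] := trans_or_min e.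
 by exists (ext 0);split=>[|a|p /tr];[exact:ext_deriv | exact:extC | exact:ext_ker].
pose w := - ext 0 mu / e mu^`();exists (ext w);split=>[|a|p ep];[exact:ext_deriv | exact:extC |].
have dw := ext_deriv w;have [l0 emu _ _] := mmu.
have wmu : ext w mu = 0.
 have wE : ext w mu = ext 0 mu + e mu^`() * w by rewrite /ext mulr0 addr0.
 by rewrite wE mulrC divfK ?addrN // min_relation_deriv.
have [N [b [c [eb kc]]]] := min_relation_reduce mmu ep.
have := congr1 (ext w) eb;rewrite -mul_polyC !dw.2 dw.1 dw.2.
rewrite emu wmu (ext_ker w kc) ep !mul0r !mulr0 !addr0 polyC_exp rmorphXn => /eqP.
by rewrite mulf_eq0 expf_eq0 (negPf l0) andbF => /eqP.
Qed.

End ExtendDerivation.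

Lemma deriv_comp (S T : comNzRingType) (L : fieldType) (e D : T -> L)
  (f : {rmorphism S -> T}) : is_deriv e D -> is_deriv (e \o f) (D \o f).
by move=>[DD DM];split=> a b /=;rewrite ?rmorphD ?rmorphM /= ?DD ?DM.
Qed.

Lemma extend_deriv_mpoly n (R : idomainType) (L : fieldType) (e : {rmorphism {mpoly R[n]} -> L})
  (d : R -> L) : has_pchar0 L ->
 is_deriv (fun a => e a%:MP) d -> (forall a, e a%:MP = 0 -> d a = 0) ->
 exists D : {mpoly R[n]} -> L,
  [/\ is_deriv e D, forall a, D a%:MP = d a & forall p, e p = 0 -> D p = 0].
move=>char0;elim: n R e d =>[|n IH] R e d dd dk.
 exists (d \o mcoeff 0%MM);split=>[|a|p] /=.
 - have := deriv_comp (mcoeff 0%MM : {rmorphism {mpoly R[0]} -> R}) dd.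
  by case=> DD DM;split=>// a b;rewrite DM /= -!nvar0_mpolyC.
 - by rewrite mpolyCK.
 - by rewrite {1}[p]nvar0_mpolyC => /dk.
have [f [g [fK fC]]] := mpoly_split R n.
have gfC c : g (c%:P)%:MP = c%:MP by rewrite -fC fK.
have [||D1 [dD1 D1C D1K]] :=
 @extend_deriv_poly R L char0 (e \o g \o @mpolyC n {poly R} : {rmorphism _ -> _}) d.
- by case:dd => DD DM;split=>// a b;rewrite /= DM !gfC.
- by move=>a /=;rewrite gfC;apply:dk.
have [//|//|D [dD DC DK]] := IH _ (e \o g : {rmorphism _ -> _}) D1.
exists (D \o f);split=>[|a|p ep] /=;last by apply:DK;rewrite /= fK.
 by have := deriv_comp f dD;case=> h1 h2;split=>// a b;rewrite h2 /= !fK.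
by rewrite fC DC D1C.
Qed.

Lemma deriv_mpolyE n (k : comNzRingType) (L : fieldType) (e : {rmorphism {mpoly k[n]} -> L})
  (D : {mpoly k[n]} -> L) : is_deriv e D -> (forall c, D c%:MP = 0) ->
 forall p, D p = \sum_(i < n) e p^`M(i) * D 'X_i.
move=>dD DC;apply:mpoly_gen_ind =>[c|i|p q Dp Dq|p q Dp Dq].
- by rewrite DC big1 // => i _;rewrite mderivC rmorph0 mul0r.
- rewrite (bigD1 i) //= big1 ?addr0 =>[|j ji].
  have -> : ('X_i : {mpoly k[n]})^`M(i) = 1.
   rewrite mderivX mnm1E eqxx scale1r -mpolyX0;congr 'X_[_]. by apply/mnmP => j;rewrite mnmBE subnn mnm0E.
  by rewrite rmorph1 mul1r.
 by rewrite mderivX mnm1E eq_sym (negPf ji) scale0r rmorph0 mul0r.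
- rewrite dD.1 Dp Dq -big_split;eqbig => i _.
 by rewrite mderivD rmorphD mulrDl.
rewrite dD.2 Dp Dq !mulr_sumr -big_split;eqbig => i _ /=.
by rewrite mderivM rmorphD !rmorphM /=;ring.
Qed.

(** * Minimal primes, the Nullstellensatz and generic points *)

Section PrimeExistence.
Variable R : comNzRingType.
Implicit Types (I P M : set R).

Definition radical I := forall a n, I (a ^+ n) -> I a.

Lemma maximal_prime I : is_ideal I -> ~ I 1 -> exists2 P, is_prime P & I `<=` P.
move=>iI I1;pose Q := [set J : set R | J = set0 \/ [/\ is_ideal J, ~ J 1 & I `<=` J]].
have [F FQ Ftot|M [QM maxM]] := @Zorn_bigcup R Q.
 have [h|h] := pselect (exists2 J, F J & J !=set0);last first.
  left;apply/seteqP;split=>// a [J FJ Ja];case:h;exists J =>//. by exists a.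
 have QF J a : F J -> J a -> [/\ is_ideal J, ~ J 1 & I `<=` J].
  by move=>FJ Ja;case:(FQ J FJ) =>// J0;rewrite J0 in Ja.
 case:h => J0 FJ0 [a0 Ja0];right;split;last first.
 - by move=>a Ia;exists J0 =>//;case:(QF J0 a0 FJ0 Ja0) => _ _;apply.
 - by case=> J FJ J1;case:(QF J 1 FJ J1).
 split.
 - by exists J0 =>//;apply:ideal0;case:(QF J0 a0 FJ0 Ja0).
 - move=>a b [J FJ Ja] [K FK Kb];have [iJ _ _] := QF J a FJ Ja.
  have [iK _ _] := QF K b FK Kb;case:(Ftot J K FJ FK) =>[JK|KJ].
   by exists K =>//;apply:idealD =>//;apply:JK.
  by exists J =>//;apply:idealD =>//;apply:KJ.
 by move=>a b [J FJ Jb];have [iJ _ _] := QF J b FJ Jb;exists J =>//;apply:idealM.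
have [iM M1 IM] : [/\ is_ideal M, ~ M 1 & I `<=` M].
 case:QM =>// M0;case:(maxM I);last by right;split.
 by rewrite M0;split=>// h;case:(h 0);apply:ideal0.
exists M =>//;split=>// a b Mab.
apply:contrapT => /not_orP[na nb].
have big c : ~ M c -> exists2 x, M x & exists y, 1 = x + y * c.
 move=>nc;pose N := ideal_add M (ideal_gen [:: c]).
 have iN : is_ideal N by apply:ideal_add_ideal =>//;apply:ideal_gen_ideal.
 have MN : M `<=` N by move=>x;apply:ideal_addl;apply:ideal_gen_ideal. have : N 1.
  apply:contrapT => N1;apply:(maxM N);last by right;split=>// x /IM /MN.
  split=>// NM;apply:nc;apply:NM;apply:ideal_addr =>//. by apply:mem_ideal_gen;rewrite inE.
 case=> x [z [Mx [f ->] ->]];exists x =>//;exists (f ord0). by rewrite big_ord1.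
have [x Mx [y xy]] := big a na;have [x' Mx' [y' xy']] := big b nb.
apply:M1;rewrite -[1]mulr1 {1}xy xy'.
have -> : (x + y * a) * (x' + y' * b) = (x' + y' * b) * x + (y * a) * x' + (y * y') * (a * b).
 by ring.
by apply:idealD =>//;first apply:idealD =>//;apply:idealM.
Qed.

(** P is the complement of a maximal multiplicative set avoiding I. Maximality gives s * f^i in I
    for each f in P, and the radical property replaces f^i by f. The last clause says that I and P
    agree after localization at P. *)
Lemma minimal_prime I M0 : is_ideal I -> radical I -> M0 1 ->
 (forall a b, M0 a -> M0 b -> M0 (a * b)) -> (forall a, M0 a -> ~ I a) ->
 exists P, [/\ is_prime P, I `<=` P, forall a, M0 a -> ~ P a &
  forall f, P f -> exists2 s, ~ P s & I (s * f)].
move=>iI rI M01 M0M M0I.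
pose mult M := [/\ M0 `<=` M, forall a b, M a -> M b -> M (a * b) & forall a, M a -> ~ I a].
pose Q := [set M : set R | M = set0 \/ mult M].
have [F FQ Ftot|M [QM maxM]] := @Zorn_bigcup R Q.
 have [h|h] := pselect (exists2 J, F J & J !=set0);last first.
  left;apply/seteqP;split=>// a [J FJ Ja];case:h;exists J =>//. by exists a.
 have QF J a : F J -> J a -> mult J.
  by move=>FJ Ja;case:(FQ J FJ) =>// J0;rewrite J0 in Ja.
 case:h => J0 FJ0 [a0 Ja0];right;split.
 - by move=>a Ia;exists J0 =>//;case:(QF J0 a0 FJ0 Ja0) => + _ _;apply.
 - move=>a b [J FJ Ja] [K FK Kb];have [_ MJ _] := QF J a FJ Ja.
  have [_ MK _] := QF K b FK Kb;case:(Ftot J K FJ FK) =>[JK|KJ].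
   by exists K =>//;apply:MK =>//;apply:JK.
  by exists J =>//;apply:MJ =>//;apply:KJ.
 by move=>a [J FJ Ja];case:(QF J a FJ Ja) => _ _;apply.
have [M0S MM MI] : mult M.
 case:QM =>// M_0;case:(maxM M0);last by right;split. by rewrite M_0;split=>// h;case:(h 1).
have inv f : ~ M f -> exists2 s, M s & I (s * f).
 move=>nf;pose N := [set a | exists s i, M s /\ a = s * f ^+ i].
 have MN : M `<=` N by move=>s Ms;exists s, 0%N;rewrite mulr1.
 have [a [[s [i [Ms aE]]] Ia]] : exists a, N a /\ I a.
  apply:contrapT => h;apply:(maxM N).
   split=>// NM;apply:nf;apply:NM;exists 1, 1%N. by rewrite mul1r;split=>//;apply:M0S.
  right;split=>[x /M0S /MN //||a Na Ia];last by apply:h;exists a.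
  move=>_ _ [s [i [Ms ->]]] [s' [i' [Ms' ->]]];exists (s * s'), (i + i')%N.
  by rewrite exprD mulrACA;split=>//;apply:MM.
 exists s =>//;case:i aE =>[|i] aE.
  by case:(MI s Ms);move: Ia;rewrite aE mulr1.
 apply:(rI _ i.+1);rewrite exprMn exprSr -mulrA -aE. exact:idealM.
have iP : is_ideal (~` M).
 split=>[/MI|a b na nb Mab|a b nb Mab];first by case;apply:ideal0.
  have [s Ms Isa] := inv a na;have [t Mt Itb] := inv b nb.
  apply:(MI (s * t * (a + b)));first by apply:(MM) =>//;apply:(MM).
  have -> : s * t * (a + b) = t * (s * a) + s * (t * b) by ring. by apply:idealD =>//;apply:idealM.
 have [s Ms Isb] := inv b nb;apply:(MI (s * (a * b)));first exact:MM. by rewrite mulrCA;apply:idealM.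
exists (~` M);split=>[|a Ia Ma|a /M0S Ma nMa|f /inv[s Ms Isf]].
- split=>// [M1|a b nab];first by apply:M1;apply:M0S.
 by apply:contrapT => /not_orP[/contrapT Ma /contrapT Mb];apply:nab;apply:MM.
- exact:(MI a).
- exact:nMa.
by exists s =>// /(_ Ms).
Qed.

End PrimeExistence.

(** Two applications: P0 is minimal over the contraction of I and avoids the powers of b; then P is
    minimal over I and avoids the image of the complement of P0. Hence P contracts into P0, and the
    last clause is the minimality of P0. *)
Lemma minimal_prime_over (R0 R : comNzRingType) (f : {rmorphism R0 -> R}) (I : set R) b :
 is_ideal I -> radical I -> ~ I (f b) ->
 exists P, [/\ is_prime P, I `<=` P, ~ P (f b),
  forall a, P a -> exists2 s, ~ P s & I (s * a) &
  forall q, P (f q) -> exists2 t, ~ P (f t) & I (f (t * q))].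
move=>iI rI nb;pose I0 := [set q | I (f q)].
have iI0 : is_ideal I0.
 split=>[|q r|q r];rewrite /I0 /= ?rmorph0 ?rmorphD ?rmorphM.
 - exact:ideal0.
 - exact:idealD.
 - exact:idealM.
have [||||P0 [pP0 IP0 bP0 minP0]] := @minimal_prime R0 I0 [set a | exists n, a = b ^+ n] iI0.
- by move=>a n;rewrite /I0 /= rmorphXn => /rI.
- by exists 0%N.
- by move=>_ _ [n ->] [n' ->];exists (n + n')%N;rewrite exprD.
- by move=>_ [n ->];rewrite /I0 /= rmorphXn => /rI.
have [iP0 P01 P0M] := pP0.
have [|||P [pP IP M0P minP]] := @minimal_prime R I [set a | exists2 q, ~ P0 q & a = f q] iI rI.
- by exists 1;rewrite ?rmorph1.
- move=>_ _ [q nq ->] [r nr ->];exists (q * r);last by rewrite rmorphM.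
 by case/P0M.
- by move=>_ [q nq ->] Iq;apply:nq;apply:IP0.
exists P;split=>// [|q Pq].
 by apply:M0P;exists b =>//;apply:bP0;exists 1%N.
have Pq0 : P0 q by apply:contrapT => nq;apply:(M0P (f q)) =>//;exists q.
have [t nt It] := minP0 q Pq0;exists t =>//.
by apply:M0P;exists t.
Qed.

Section VanishingIdeals.
Variables (k : closedFieldType) (m : nat).
Implicit Types (V : set ('I_m -> k)) (f g : {mpoly k[m]}).

Definition vanish V : set {mpoly k[m]} := [set f | forall x, V x -> f.@[x] = 0].

Lemma vanish_ideal V : is_ideal (vanish V).
split=>[x _|f g vf vg x Vx|f g vg x Vx];first by rewrite meval0.
 by rewrite mevalD vf ?vg ?addr0.
by rewrite mevalM vg ?mulr0.
Qed.

Lemma vanish_radical V : radical (vanish V).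
by move=>f n h x Vx;have /eqP := h x Vx;rewrite rmorphXn expf_eq0 => /andP[_ /eqP].
Qed.

Lemma rmorph_meval (h : {rmorphism {mpoly k[m]} -> k}) : (forall c, h c%:MP = c) ->
 forall f, h f = f.@[fun i => h 'X_i].
by move=>hC;apply:mpoly_rmorph_eq =>[c|i] /=;rewrite ?hC ?mevalC ?mevalXU.
Qed.

(** The identity of k is specialised along k -> k[x]/P. Its kernel condition is trivial, since a
    homomorphism of fields is injective. *)
Lemma prime_point (P : set {mpoly k[m]}) s : is_prime P -> ~ P s ->
 exists x, (forall f, P f -> f.@[x] = 0) /\ s.@[x] != 0.
move=>pP nPs;have [L [e [eP _]]] := prime_field pP.
have es : e s != 0 by apply/eqP => /eP.
have [a ea] := @extends_mpoly k m k L e s es.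
have a0 : a != 0 by apply:contraNneq ea => ->;rewrite rmorph0.
move=>/(_ idfun)[r /eqP| |h [hC hK hs]] //=.
 by rewrite -[e _]/((e \o @mpolyC m k) r) fmorph_eq0 => /eqP.
have hE := rmorph_meval hC;exists (fun i => h 'X_i);split=>[f /eP /hK|].
 by rewrite hE.
by rewrite -hE.
Qed.

Lemma nullstellensatz (J : set {mpoly k[m]}) : is_ideal J ->
 (forall x, exists2 f, J f & f.@[x] != 0) -> J 1.
move=>iJ h;apply:contrapT => J1;have [P pP JP] := maximal_prime iJ J1.
have nP1 : ~ P 1 by case:pP.
have [x [Px _]] := prime_point pP nP1;have [f /JP /Px -> ] := h x.
by rewrite eqxx.
Qed.

End VanishingIdeals.

(* A prime that is minimal over vanish V and whose contraction along c is minimal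
  over the ideal of the image of V: a generic point of a component of V that
  dominates a component of the image. *)
Section GenericPoint.
Variables (k : closedFieldType) (m l : nat) (V : set ('I_m -> k)).
Variable (c : l.-tuple {mpoly k[m]}).

Definition cpt (x : 'I_m -> k) : 'I_l -> k := fun i => (tnth c i).@[x].

Definition generic (P : set {mpoly k[m]}) := [/\ is_prime P, vanish V `<=` P,
 forall a, P a -> exists2 s, ~ P s & vanish V (s * a) &
 forall q, P (q \mPo c) -> exists2 t, ~ P (t \mPo c) & vanish V ((t * q) \mPo c)].

Lemma exists_generic b x : V x -> b.@[cpt x] != 0 ->
 exists2 P, generic P & ~ P (b \mPo c).
move=>Vx bx.
have [|P [pP VP Pb h1 h2]] := minimal_prime_over (f := comp_mpoly c)
 (b := b) (vanish_ideal V) (@vanish_radical _ _ V). by move/(_ x Vx)/eqP;rewrite comp_mpoly_meval (negPf bx).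
by exists P.
Qed.

Lemma generic_nonvanish P s : generic P -> (forall x, V x -> s.@[x] != 0) -> ~ P s.
move=>[pP VP h _] sV /h[t nPt vt];apply:nPt;apply:VP => x Vx.
by have /eqP := vt x Vx;rewrite mevalM mulf_eq0 (negPf (sV x Vx)) orbF => /eqP.
Qed.

(** The contraction of P is finitely generated, so the product of the multipliers of its generators
    serves every q at once. *)
Lemma generic_comp_ker P : generic P -> exists2 t, ~ P (t \mPo c) &
 forall q, P (q \mPo c) -> vanish V ((t * q) \mPo c).
move=>[pP VP _ h2];have [iP P1 PM] := pP.
have iJ : is_ideal [set q | P (q \mPo c)].
 split=>[|q r|q r] /=;rewrite ?comp_mpoly0 ?comp_mpolyD ?rmorphM;first exact:ideal0.
  exact:idealD.
 exact:idealM.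
have [s sP Js] := noetherian_gens (@mpoly_noetherian k l (@field_noetherian k)) iJ.
suff [t nt th] : exists2 t, ~ P (t \mPo c) &
  forall q, q \in s -> vanish V ((t * q) \mPo c).
 exists t =>// q /Js[f ->];rewrite mulr_sumr raddf_sum.
 apply:ideal_sum =>[|i _];first exact:vanish_ideal.
 rewrite /= mulrCA rmorphM;apply:(idealM _ (vanish_ideal V)). exact:(th _ (mem_nth _ (ltn_ord i))).
elim: s sP {Js} =>[|q s IH] sP;first by exists 1;rewrite ?comp_mpoly1.
have [|t nt th] := IH;first by move=>r rs;apply:sP;rewrite inE rs orbT.
have [t' nt' th'] := h2 q (sP q (mem_head _ _)).
exists (t' * t);first by rewrite rmorphM => /PM[].
move=>r;rewrite inE => /orP[/eqP ->|rs].
 by rewrite mulrAC rmorphM mulrC;apply:(idealM _ (vanish_ideal V)).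
by rewrite -mulrA rmorphM;apply:(idealM _ (vanish_ideal V));apply:th.
Qed.

End GenericPoint.

Lemma comp_mpoly_deriv (k : comNzRingType) m l (c : l.-tuple {mpoly k[m]}) (i j : 'I_l) :
 (('X_j : {mpoly k[l]})^`M(i)) \mPo c = (i == j)%:R.
rewrite mderivX mnm1E eq_sym;case:eqP =>[->|_];last by rewrite scale0r comp_mpoly0.
rewrite scale1r (_ : 'X_[_] = 1) ?comp_mpoly1 // -mpolyX0;congr 'X_[_].
by apply/mnmP => i';rewrite mnmBE subnn mnm0E.
Qed.

Lemma prime_field_pchar (k : fieldType) (L : fieldType) (f : {rmorphism k -> L}) :
 has_pchar0 k -> has_pchar0 L.
by move=>h p;rewrite (fmorph_pchar f) h. Qed.

(** * Lifting tangent vectors at a generic point *)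

Section TangentLift.
Variables (k : closedFieldType) (m l : nat) (V : set ('I_m -> k)) (sV : {mpoly k[m]}).
Variable (c : l.-tuple {mpoly k[m]}).
(** V is a closed subset of the principal open set sV != 0; for matrix groups [sV] is a
    determinant. *)
Hypothesis sV_ne0 : forall x, V x -> sV.@[x] != 0.
Hypothesis V_closed : forall x, sV.@[x] != 0 -> (forall f, vanish V f -> f.@[x] = 0) -> V x.

Section Frac.
Variables (P : set {mpoly k[m]}) (gP : generic V c P).
Variables (L : fieldType) (e : {rmorphism {mpoly k[m]} -> L}).
Hypothesis eP : forall a, e a = 0 <-> P a.

Let ek : {rmorphism k -> L} := e \o @mpolyC m k.
Let e0 : {rmorphism {mpoly k[l]} -> L} := e \o comp_mpoly c.

(** D is a derivation of k[y] into L along c. It kills the kernel of [e0], because some multiple t q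
    of each kernel element q vanishes on V and t survives in L. It is then extended to k[y][x],
    which maps to L by y |-> c and by the residue map on x. *)
Lemma derivation_lift (D : 'I_l -> {mpoly k[m]}) : has_pchar0 k ->
 (forall q, vanish V (q \mPo c) -> vanish V (\sum_i (q^`M(i) \mPo c) * D i)) ->
 exists w : 'I_m -> L, (forall f, P f -> \sum_j e f^`M(j) * w j = 0) /\
  forall i, \sum_j e (tnth c i)^`M(j) * w j = e (D i).
move=>char0 hD;have [pP VP _ h2] := gP.
pose d (q : {mpoly k[l]}) := \sum_i e (q^`M(i) \mPo c) * e (D i).
have cM (p q : {mpoly k[l]}) : (p * q) \mPo c = (p \mPo c) * (q \mPo c) by exact:rmorphM.
have dd : is_deriv e0 d.
 split=>[p q|p q];rewrite /d.
  by rewrite -big_split;eqbig => i _;rewrite mderivD comp_mpolyD rmorphD mulrDl.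
 rewrite !mulr_sumr -big_split;eqbig => i _ /=.
 rewrite mderivM comp_mpolyD !cM rmorphD !rmorphM mulrDl addrC -!mulrA. by congr (_ + _);rewrite mulrCA.
have dK q : e0 q = 0 -> d q = 0.
 move=>eq0;have /eP /h2[t nt] := eq0;move=>/hD /VP /eP.
 rewrite rmorph_sum;under eq_bigr => i _ do rewrite rmorphM.
 rewrite -/(d (t * q)) dd.2 eq0 mul0r addr0 => /eqP;rewrite mulf_eq0 => /orP[/eqP /eP //|/eqP //].
have [e1 [e1C e1X]] : exists e1 : {rmorphism {mpoly {mpoly k[l]}[m]} -> L},
  (forall q, e1 q%:MP = e0 q) /\ forall j, e1 'X_j = e 'X_j.
 by exists (mmap e0 (fun j => e 'X_j));split=> ? /=;rewrite ?mmapC ?mmapX ?mmap1U.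
have [j1 [j1C j1X]] : exists j1 : {rmorphism {mpoly k[m]} -> {mpoly {mpoly k[l]}[m]}},
  (forall a, j1 a%:MP = a%:MP%:MP) /\ forall j, j1 'X_j = 'X_j.
 by exists (map_mpoly (@mpolyC l k));split=> ? /=;rewrite ?map_mpolyC ?map_mpolyX.
have e1j f : e1 (j1 f) = e f.
 move: f;apply:(mpoly_rmorph_eq (f := e1 \o j1)) =>[a|j] /=.
  by rewrite j1C e1C /e0 /= comp_mpolyC.
 by rewrite j1X e1X.
have [||D1 [dD1 D1C D1K]] := extend_deriv_mpoly (e := e1) (d := d)
 (prime_field_pchar ek char0).
- by case:dd => DD DM;split=>// p q;rewrite DM !e1C.
- by move=>q;rewrite e1C;apply:dK.
pose D2 f := D1 (j1 f).
have dD2 : is_deriv e D2.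
 by split=>[a b|a b];rewrite /D2 ?rmorphD ?rmorphM /= ?dD1.1 ?dD1.2 ?e1j.
have D2C a : D2 a%:MP = 0.
 rewrite /D2 j1C D1C /d big1 // => i _. by rewrite mderivC comp_mpoly0 rmorph0 mul0r.
have D2E := deriv_mpolyE dD2 D2C.
exists (fun j => D2 'X_j);split=>[f Pf|i];rewrite -D2E.
 by apply:D1K;rewrite e1j;apply/eP.
(* The polynomial y_i - c_i(x) lies in the kernel of [e1], so the extension has the same value on
   y_i and on c_i(x). *)
have : D1 (('X_i)%:MP - j1 (tnth c i)) = 0.
 apply:D1K;rewrite rmorphB e1C e1j /e0 /= comp_mpolyXU. by rewrite -tnth_nth subrr.
rewrite (deriv_B dD1) D1C => /eqP;rewrite subr_eq0 => /eqP D1i;rewrite /D2 -D1i.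
rewrite /d (bigD1 i) //= big1 ?addr0 =>[|j ji];rewrite comp_mpoly_deriv.
 by rewrite eqxx rmorph1 mul1r.
by rewrite (negPf ji) rmorph0 mul0r.
Qed.

End Frac.

(* Characteristic 0: a tangent field along the image of V lifts at a generic point. *)
Lemma tangent_lift (D : 'I_l -> {mpoly k[m]}) : has_pchar0 k -> (exists x, V x) ->
 (forall q, vanish V (q \mPo c) -> vanish V (\sum_i (q^`M(i) \mPo c) * D i)) ->
 exists x w, [/\ V x, forall f, vanish V f -> mdiff f x w = 0 &
  forall i, mdiff (tnth c i) x w = (D i).@[x]].
move=>char0 [x0 Vx0] hD.
have [|P gP _] := @exists_generic k m l V c 1 x0 Vx0;first by rewrite meval1 oner_eq0.
have [pP VP _ _] := gP;have [L [e [eP fracL]]] := prime_field pP.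
have [w [wP wc]] := derivation_lift gP eP char0 hD.
pose nd j := cid (fracL (w j));pose a j := projT1 (nd j).
pose b j := projT1 (cid (projT2 (nd j))).
have nb j : ~ P (b j) by case:(projT2 (cid (projT2 (nd j)))).
have wE j : w j = e (a j) / e (b j) by case:(projT2 (cid (projT2 (nd j)))).
(* The vector w over L is W / d with polynomial numerators W; it can be evaluated at any zero of P
   where d * sV is nonzero. *)
pose d := \prod_j b j;pose W j := a j * \prod_(i | i != j) b i.
have eb j : e (b j) != 0 by apply/negP => /eqP /eP;apply:nb.
have ed : e d != 0 by rewrite rmorph_prod;apply/prodf_neq0.
have eW j : e (W j) = e d * w j.
 have -> : d = b j * \prod_(i | i != j) b i by rewrite /d (bigD1 j).
 rewrite wE /W (rmorphM e) (rmorphM e) [RHS]mulrC -mulrA;congr (_ * _). by rewrite mulKf.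
have [x [Px]] : exists x, (forall f, P f -> f.@[x] = 0) /\ (d * sV).@[x] != 0.
 apply:prime_point =>// Pd;have [_ _ /(_ _ _ Pd)[/eP/eqP|]] := pP.
  by rewrite (negPf ed).
 exact:generic_nonvanish gP sV_ne0.
rewrite mevalM mulf_eq0 => /norP[dx sx].
exists x, (fun j => (W j).@[x] / d.@[x]);split.
- by apply:V_closed =>// f /VP /Px.
- move=>f /VP Pf;have : P (\sum_j f^`M(j) * W j).
  apply/eP;rewrite rmorph_sum;under eq_bigr => j _ do rewrite rmorphM /= eW mulrCA.
  by rewrite -mulr_sumr (wP _ Pf) mulr0.
 move/Px;rewrite rmorph_sum /mdiff => h. under eq_bigr => j _ do rewrite mulrA.
 rewrite -mulr_suml;have -> : \sum_j (f^`M(j)).@[x] * (W j).@[x] = 0;last by rewrite mul0r.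
 by rewrite -[RHS]h;eqbig => j _;rewrite -mevalM.
move=>i;have : P (\sum_j (tnth c i)^`M(j) * W j - d * D i).
 apply/eP;rewrite rmorphB rmorph_sum rmorphM /= -wc. under eq_bigr => j _ do rewrite rmorphM /= eW mulrCA.
 by rewrite -mulr_sumr subrr.
move/Px/eqP;rewrite mevalB mevalM subr_eq0 => /eqP h;rewrite /mdiff.
under eq_bigr => j _ do rewrite mulrA.
rewrite -mulr_suml;apply:(mulIf dx);rewrite divfK // [RHS]mulrC -h rmorph_sum.
by eqbig => j _;rewrite -mevalM.
Qed.

End TangentLift.

(** * Descent of functions that are constant on fibres *)

Lemma two_roots (k : closedFieldType) (p : {poly k}) : (2 < size p)%N ->
 (forall t, p.[t] = 0 -> p^`().[t] != 0) ->
 exists t t', [/\ t != t', p.[t] = 0 & p.[t'] = 0].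
move=>sp sep;have /closed_rootP[t rt] : size p != 1%N by rewrite gtn_eqF // ltnW.
have [q pE] := factor_theorem _ _ rt;have p0 : p != 0.
 by rewrite -size_poly_gt0 (leq_trans _ sp).
have q0 : q != 0 by apply:contraNneq p0 => q0;rewrite pE q0 mul0r.
have sq : size q != 1%N.
 by apply:contraL sp => /eqP sq;rewrite pE size_Mmonic ?monicXsubC // sq size_XsubC.
have /closed_rootP[t' rt'] := sq;exists t, t';split;last 2 first.
- exact/eqP.
- by rewrite pE hornerM (eqP rt') mul0r.
apply/eqP => tt';have := sep t (eqP rt).
rewrite {1}pE derivM hornerD !hornerM derivXsubC hornerXsubC subrr mulr0 add0r.
by rewrite hornerC mulr1 tt' (eqP rt') eqxx.
Qed.

Section DescentFrac.
Variables (k : closedFieldType) (m : nat) (V : set ('I_m -> k)) (sV : {mpoly k[m]}).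
Hypothesis V_closed : forall x, sV.@[x] != 0 -> (forall f, vanish V f -> f.@[x] = 0) -> V x.
Variables (P : set {mpoly k[m]}) (pP : is_prime P) (VP : vanish V `<=` P) (nPsV : ~ P sV).
Variables (L : fieldType) (e : {rmorphism {mpoly k[m]} -> L}).
Hypothesis eP : forall a, e a = 0 <-> P a.

(** Specialisation along R -> R[x] -> L: a homomorphism of R that is nonzero at a1 is completed to a
    point x at which every identity e f = e1 r * e g holds with its values. *)
Lemma spread (R : idomainType) (e1 : {rmorphism R -> L}) (i : {rmorphism k -> R}) s :
 (forall a, e1 (i a) = e a%:MP) -> ~ P s ->
 exists2 a1, e1 a1 != 0 & forall h : {rmorphism R -> k}, (forall a, h (i a) = a) ->
  (forall r, e1 r = 0 -> h r = 0) -> h a1 != 0 ->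
  exists x, s.@[x] != 0 /\ forall f g r, e f = e1 r * e g -> f.@[x] = h r * g.@[x].
move=>ei nPs.
have [e2 [e2C e2X]] : exists e2 : {rmorphism {mpoly R[m]} -> L},
  (forall q, e2 q%:MP = e1 q) /\ forall j, e2 'X_j = e 'X_j.
 by exists (mmap e1 (fun j => e 'X_j));split=> ? /=;rewrite ?mmapC ?mmapX ?mmap1U.
have [j2 [j2C j2X]] : exists j2 : {rmorphism {mpoly k[m]} -> {mpoly R[m]}},
  (forall a, j2 a%:MP = (i a)%:MP) /\ forall j, j2 'X_j = 'X_j.
 by exists (map_mpoly i);split=> ? /=;rewrite ?map_mpolyC ?map_mpolyX.
have e2j f : e2 (j2 f) = e f.
 move: f;apply:(mpoly_rmorph_eq (f := e2 \o j2)) =>[a|j] /=.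
  by rewrite j2C e2C ei.
 by rewrite j2X e2X.
have e2s : e2 (j2 s) != 0 by rewrite e2j;apply/negP => /eqP /eP.
have [a1 ea1 H] := @extends_mpoly k m R L e2 (j2 s) e2s.
exists a1;first by rewrite -e2C.
move=>h hi hK ha1;have [r|//|h' [h'C h'K h's]] := H h.
 by rewrite /= e2C;apply:hK.
have h'j f : h' (j2 f) = f.@[fun j => h' 'X_j].
 rewrite -[LHS]/((h' \o j2) f) rmorph_meval =>[|a] /=;last by rewrite j2C h'C hi.
 by apply:meval_eq => j;rewrite j2X.
exists (fun j => h' 'X_j);split=>[|f g r efg];first by rewrite -h'j.
rewrite -!h'j -h'C -rmorphM;apply/eqP;rewrite -subr_eq0 -rmorphB.
apply/eqP/h'K;rewrite rmorphB rmorphM /= !e2j e2C efg subrr //.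
Qed.

Variables (R : idomainType) (f0 : {rmorphism R -> {mpoly k[m]}}) (i0 : {rmorphism k -> R}).
Hypothesis f0i : forall a, f0 (i0 a) = a%:MP.

(** Let X go to u / v. If u / v were transcendental, or algebraic of degree above one, over the
    functions of the base, two points of one fibre would give it different values. So mu is linear,
    and its coefficients are the required fraction. *)
Lemma descent_frac u v : has_pchar0 k -> ~ P v ->
 (forall x x', V x -> V x' -> (forall r, (f0 r).@[x] = (f0 r).@[x']) -> v.@[x] != 0 -> v.@[x'] != 0 ->
   u.@[x] * v.@[x'] = u.@[x'] * v.@[x]) ->
 exists a b, ~ P (f0 b) /\ P (f0 b * u - f0 a * v).
move=>char0 nPv cst;have [iP P1 PM] := pP.
have ev : e v != 0 by apply/negP => /eqP /eP.
pose e0 : {rmorphism R -> L} := e \o f0.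
have [e1 [e1E e1C]] := poly_rmorph_at e0 (e u / e v).
have e1X : e1 'X = e u / e v by rewrite e1E map_polyX hornerX.
have charL : has_pchar0 L := prime_field_pchar (e \o @mpolyC m k : {rmorphism k -> L}) char0.
pose i : {rmorphism k -> {poly R}} := polyC \o i0.
have nPs : ~ P (v * sV) by case/PM.
have [a|a1 ea1 Ha1] := @spread _ e1 i (v * sV) _ nPs.
 by rewrite e1C /e0 /= f0i.
(* Homomorphisms that agree on R come from two points of V in one fibre, where u / v takes the same
   value. *)
have two (h h' : {rmorphism {poly R} -> k}) :
  (forall a, h (i a) = a) -> (forall r, h r%:P = h' r%:P) ->
  (forall r, e1 r = 0 -> h r = 0) -> (forall r, e1 r = 0 -> h' r = 0) ->
  h a1 != 0 -> h' a1 != 0 -> h 'X = h' 'X.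
 move=>hi hh' hK h'K ha h'a. have [x [sx Hx]] := Ha1 h hi hK ha.
 have [y [sy Hy]] := Ha1 h' (fun a => esym (etrans (esym (hi a)) (hh' _))) h'K h'a.
 have inV (h0 : {rmorphism {poly R} -> k}) z : (v * sV).@[z] != 0 ->
   (forall f g r, e f = e1 r * e g -> f.@[z] = h0 r * g.@[z]) -> V z /\ v.@[z] != 0.
  rewrite mevalM mulf_eq0 => /norP[vz sz] Hz;split=>//;apply:V_closed =>// f /VP /eP ef.
  by rewrite (Hz f 1 0) ?rmorph0 ?mul0r // ef.
 have [Vx vx] := inV h x sx Hx;have [Vy vy] := inV h' y sy Hy.
 have ux : u.@[x] = h 'X * v.@[x] by apply:Hx;rewrite e1X divfK.
 have uy : u.@[y] = h' 'X * v.@[y] by apply:Hy;rewrite e1X divfK. have cxy r : (f0 r).@[x] = (f0 r).@[y].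
  have ec : e (f0 r) = e1 r%:P * e 1 by rewrite rmorph1 mulr1 e1C.
  by rewrite (Hx _ _ _ ec) (Hy _ _ _ ec) !meval1 hh'.
 have := cst x y Vx Vy cxy vx vy;rewrite ux uy -!mulrA [v.@[y] * _]mulrC.
 by move/(mulIf _);apply;rewrite mulf_neq0.
have pt t : ~ P (f0 t) -> exists h0 : {rmorphism R -> k},
  [/\ forall a, h0 (i0 a) = a, forall r, e1 r%:P = 0 -> h0 r = 0 & h0 t != 0].
 move=>nPt;have [x0 [Px0 tx0]] := prime_point pP nPt.
 exists (meval x0 \o f0 : {rmorphism _ -> _});split=>[a|r|//] /=.
 - by rewrite f0i mevalC.
 - by rewrite e1C => /eP /Px0.
(* In the transcendental case X may be sent to two distinct values over one point of the base, both
   avoiding the zeros of a1. *)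
have [tr|[mu mmu]] := trans_or_min e1.
 have ns : ~ ker_coef e1 a1 by move=>/ker_coef0 /eqP;rewrite (negPf ea1).
 have [j ej] : exists j, e1 (a1`_j)%:P != 0.
  apply:contrapT => h;apply:ns => j. by apply/eqP/negPn/negP => ei;apply:h;exists j.
 have [|h0 [h0C h0K h0j]] := pt a1`_j.
  by move=>/eP h;move: ej;rewrite e1C /e0 /= h eqxx.
 have p0 : map_poly h0 a1 != 0.
  by apply:contraNneq h0j => hs;rewrite -[h0 _]coef_map /= hs coef0.
 have [t ht] := poly_nonroot p0. have [|t' ht'] := @poly_nonroot _ (map_poly h0 a1 * ('X - t%:P)).
  by rewrite mulf_neq0 ?polyXsubC_eq0.
 move: ht';rewrite hornerM mulf_eq0 => /norP[ht' tt'].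
 have [h [hE hC]] := poly_rmorph_at h0 t;have [h' [h'E h'C]] := poly_rmorph_at h0 t'.
 case/eqP: tt';rewrite hornerXsubC;apply/eqP;rewrite subr_eq0;apply/eqP.
 have hX : h 'X = t by rewrite hE map_polyX hornerX. have h'X : h' 'X = t' by rewrite h'E map_polyX hornerX.
 rewrite -hX -h'X;apply/esym/two =>[a|r|r /tr|r /tr||].
 - by rewrite /i /= hC h0C.
 - by rewrite hC h'C.
 - by apply:ker_coef_eval => a;rewrite hC;apply:h0K.
 - by apply:ker_coef_eval => a;rewrite h'C;apply:h0K.
 - by rewrite hE.
 - by rewrite h'E.
have [l0 emu smu _] := mmu.
have Pe r : e1 r%:P != 0 -> ~ P (f0 r).
 by move=>h /eP h';move: h;rewrite e1C /e0 /= h' eqxx.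
have [s2|s2] := leqP (size mu) 2.
 exists (- mu`_0), (lead_coef mu);split;first exact:Pe.
 have {s2} s2 : size mu = 2 by apply/eqP;rewrite eqn_leq s2.
 have muE : mu = (mu`_0)%:P + (lead_coef mu)%:P * 'X.
  apply/polyP => j;rewrite lead_coefE s2 coefD coefC coefCM coefX.
  case:j =>[|[|j]] /=;rewrite ?mulr0 ?addr0 ?add0r ?mulr1 //. by rewrite nth_default // s2.
 apply/eP;rewrite rmorphN mulNr opprK rmorphD !rmorphM /=.
 have : e1 ((mu`_0)%:P + (lead_coef mu)%:P * 'X) = 0 by rewrite -muE.
 rewrite rmorphD rmorphM /= !e1C e1X /e0 /=.
 move/(congr1 (fun z => z * e v));rewrite mul0r mulrDl -mulrA divfK // addrC => <-. reflexivity.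
(* Degree at least two: the first Bezout relation keeps a1 nonzero at the roots of the specialised
   mu, the second keeps that polynomial separable, and two distinct roots contradict [two]. *)
have [u1 [v1 [r1 [g1 [E1 kg1 er1]]]]] := min_relation_bezout mmu ea1.
have [u2 [v2 [r2 [g2 [E2 kg2 er2]]]]] := min_relation_bezout mmu (min_relation_deriv charL mmu).
have [|h0 [h0C h0K]] := pt (lead_coef mu * (r1 * r2)).
 by rewrite !rmorphM => /PM[/Pe|/PM[/Pe|/Pe]];apply.
rewrite !rmorphM !mulf_eq0 => /norP[hl /norP[hr1 hr2]].
have hmu t : (map_poly h0 mu).[t] = 0 -> exists h : {rmorphism {poly R} -> k},
  [/\ forall r, h r%:P = h0 r, h 'X = t, forall q, e1 q = 0 -> h q = 0 & h a1 != 0].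
 move=>ht;have [h [hC hX hK]] := min_relation_ext mmu h0K hl ht.
 exists h;split=>//;apply:contraNneq hr1 => ha.
 have := congr1 h E1;rewrite !rmorphD !rmorphM /= ha (hK mu) // !mulr0 add0r hC.
 by rewrite (@ker_coef_eval _ _ e1 _ h g1) ?addr0 =>[->|a ea|] //;rewrite hC h0K.
have smap : (2 < size (map_poly h0 mu))%N by rewrite size_poly_eq.
have [t ht|t [t' [tt' ht ht']]] := two_roots smap.
 have [h [hC hX hK _]] := hmu t ht;rewrite deriv_map. apply:contraNneq hr2 => hd.
 have hE q : h q = (map_poly h0 q).[t] by rewrite (horner_rmorph (f := h) (g := h0)) // hX.
 have := congr1 h E2;rewrite !rmorphD !rmorphM /= (hE mu^`()) hd (hK mu) // !mulr0 add0r hC.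
 by rewrite (@ker_coef_eval _ _ e1 _ h g2) ?addr0 =>[->|a ea|] //;rewrite hC h0K.
have [h [hC hX hK ha]] := hmu t ht;have [h' [h'C h'X h'K h'a]] := hmu t' ht'.
case/eqP: tt';rewrite -hX -h'X;apply:two =>// [a|r];last by rewrite hC h'C.
by rewrite /i /= hC h0C.
Qed.

End DescentFrac.

Section Descent.
Variables (k : closedFieldType) (m l : nat) (V : set ('I_m -> k)) (sV : {mpoly k[m]}).
Variable (c : l.-tuple {mpoly k[m]}).
Hypothesis sV_ne0 : forall x, V x -> sV.@[x] != 0.
Hypothesis V_closed : forall x, sV.@[x] != 0 -> (forall f, vanish V f -> f.@[x] = 0) -> V x.

(* Characteristic 0: a quotient of functions that is constant on the fibres of c is,
  generically, a quotient of functions on the image of c. *)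
Lemma descent P u v : has_pchar0 k -> generic V c P -> ~ P v ->
 (forall x x', V x -> V x' -> cpt c x = cpt c x' -> v.@[x] != 0 -> v.@[x'] != 0 ->
   u.@[x] * v.@[x'] = u.@[x'] * v.@[x]) ->
 exists a b : {mpoly k[l]}, ~ P (b \mPo c) /\
  forall x, V x -> v.@[x] != 0 -> b.@[cpt c x] * u.@[x] = a.@[cpt c x] * v.@[x].
move=>char0 gP nPv cst;have [pP VP h1 h2] := gP;have [iP P1 PM] := pP.
have [L [e [eP _]]] := prime_field pP.
have nPsV := generic_nonvanish gP sV_ne0.
have [||a [b [nPb Pab]]] := descent_frac (f0 := comp_mpoly c) (i0 := @mpolyC l k)
 V_closed pP VP nPsV eP (u := u) _ char0 nPv.
- by move=>a;rewrite /= comp_mpolyC.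
- move=>x x' Vx Vx' cxx';apply:cst =>//;apply/funext => j.
 by have := cxx' 'X_j;rewrite /= comp_mpolyXU -tnth_nth.
have [s nPs vs] := h1 _ Pab.
have nPs' : ~ P (s * (v * sV)).
 by case/PM =>// /PM[].
(* The relation is known only where s is nonzero. If a1 does not vanish at the image of x, the fibre
   of x contains a point y of V with s and v nonzero, and constancy carries the relation from y to
   x. Elsewhere the factors a1 and t make it trivial. *)
have [z|a1 ea1 Ha1] := @spread k m P L e eP _ (e \o comp_mpoly c : {rmorphism _ -> _})
 (@mpolyC l k) _ _ nPs'. by rewrite /= comp_mpolyC.
have [t nPt tP] := generic_comp_ker gP.
exists (a1 * t * a), (a1 * t * b);split.
 by rewrite !rmorphM => /PM[/PM[/eP/eqP|//]|//];rewrite (negPf ea1).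
move=>x Vx vx;rewrite !mevalM.
have [->|a1x] := eqVneq a1.@[cpt c x] 0;first by rewrite !mul0r.
have [->|tx] := eqVneq t.@[cpt c x] 0;first by rewrite mulr0 !mul0r.
rewrite -!mulrA;congr (_ * (_ * _)).
have [z|r /eP /tP /(_ x Vx)|//|y [sy Hy]] := Ha1 (meval (cpt c x) : {rmorphism _ -> _}).
- by rewrite /= mevalC.
- by rewrite comp_mpoly_meval mevalM => /eqP;rewrite mulf_eq0 (negPf tx) => /eqP.
move: sy;rewrite !mevalM !mulf_eq0 => /norP[sy /norP[vy sVy]].
have Vy : V y.
 apply:V_closed =>// f /VP /eP ef. by rewrite (Hy f 1 0) ?rmorph0 ?mul0r // ef.
have cxy : cpt c x = cpt c y.
 apply/funext => j;have ec : e (tnth c j) = e ('X_j \mPo c) * e 1.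
  by rewrite rmorph1 mulr1 comp_mpolyXU -tnth_nth.
 by rewrite [in RHS]/cpt (Hy _ _ _ ec) meval1 mulr1 /= mevalXU.
have /eqP := vs y Vy;rewrite mevalM mulf_eq0 (negPf sy) /= mevalB !mevalM.
rewrite subr_eq0 !comp_mpoly_meval -/(cpt c y) => /eqP bu.
have cuv := cst x y Vx Vy cxy vx vy.
apply:(mulIf vy);rewrite cxy -mulrA cuv mulrA bu;ring.
Qed.

End Descent.

(** * Powers of ideals, the Artin-Rees lemma and Krull's intersection theorem *)

Section IdealPowers.
Variable R : comPzRingType.
Implicit Types (I J : set R).

Definition ideal_mul I J : set R :=
 [set a | exists2 s : seq (R * R), (forall p, p \in s -> I p.1 /\ J p.2) &
   a = \sum_(p <- s) p.1 * p.2].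

Fixpoint ipow I n : set R := if n is n'.+1 then ideal_mul I (ipow I n') else setT.

Lemma ideal_mul_ideal I J : is_ideal I -> is_ideal (ideal_mul I J).
move=>iI;split;first by exists [::];rewrite ?big_nil.
 move=>_ _ [s sh ->] [t th ->];exists (s ++ t);last by rewrite big_cat.
 by move=>p;rewrite mem_cat => /orP[/sh|/th].
move=>a _ [s sh ->];exists [seq (a * p.1, p.2) | p <- s].
 by move=>_ /mapP[p /sh[Ip Jp] ->];split=>//;apply:idealM.
by rewrite big_map mulr_sumr;eqbig => p _;rewrite mulrA.
Qed.

Lemma mem_ideal_mul I J a b : I a -> J b -> ideal_mul I J (a * b).
move=>Ia Jb;exists [:: (a, b)];last by rewrite big_seq1.
by move=>p;rewrite inE => /eqP ->.
Qed.

Lemma ideal_mul_min I J K : is_ideal K ->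
 (forall a b, I a -> J b -> K (a * b)) -> ideal_mul I J `<=` K.
move=>iK h _ [s sh ->];rewrite big_seq;apply:ideal_sum =>// p /sh[].
exact:h.
Qed.

Lemma ipow_ideal I n : is_ideal I -> is_ideal (ipow I n).
by case:n =>[|n] iI;[split | apply:ideal_mul_ideal]. Qed.

Lemma ipowM I i j a b : is_ideal I -> ipow I i a -> ipow I j b ->
 ipow I (i + j) (a * b).
move=>iI;elim: i a =>[|i IH] a;first by move=>_;apply:idealM;apply:ipow_ideal.
move=>Ia Ib;apply:(ideal_mul_min (K := [set x | ipow I (i + j).+1 (x * b)]) _ _ Ia).
 have iP := ipow_ideal (i + j).+1 iI;split=>[|x y|x y] /=.
 - by rewrite mul0r;apply:ideal0.
 - by rewrite mulrDl;apply:idealD.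
 - by rewrite -mulrA;apply:idealM.
by move=>x y Ix Iy /=;rewrite -mulrA;apply:mem_ideal_mul =>//;apply:IH.
Qed.

Lemma ipowS I n : is_ideal I -> ipow I n.+1 `<=` ipow I n.
move=>iI;apply:ideal_mul_min;first exact:ipow_ideal.
by move=>a b _;apply:idealM;apply:ipow_ideal.
Qed.

Lemma ipow_le I i j : is_ideal I -> (i <= j)%N -> ipow I j `<=` ipow I i.
move=>iI;elim: j =>[|j IH];first by rewrite leqn0 => /eqP ->.
rewrite leq_eqVlt => /orP[/eqP -> //|];rewrite ltnS => /IH h a /ipowS.
by move/(_ iI)/h.
Qed.

Lemma ipow1 I : is_ideal I -> ipow I 1 = I.
move=>iI;apply/seteqP;split=>[|a Ia];last by rewrite -[a]mulr1;apply:mem_ideal_mul.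
by apply:ideal_mul_min =>// a b Ia _;apply:idealMr.
Qed.

End IdealPowers.

Section ArtinRees.
Variables (R : comNzRingType) (nR : noetherian R) (n : nat) (x : 'I_n -> R).
Implicit Types (P Q H : {mpoly R[n]}) (b : set R).

Let I := ideal_gen [seq x i | i <- enum 'I_n].
Let iI : is_ideal I.
exact:ideal_gen_ideal. Qed.

Let Ix i : I (x i).
by apply/mem_ideal_gen/map_f;rewrite mem_enum. Qed.

Let IE a : I a -> exists c : 'I_n -> R, a = \sum_i c i * x i.
suff sub : I `<=` [set a | exists c : 'I_n -> R, a = \sum_i c i * x i] by apply:sub.
apply:ideal_gen_sub =>[|_ /mapP[i _ ->]].
 split;first by exists (fun=> 0);rewrite big1 // => i _;rewrite mul0r.
  move=>_ _ [c ->] [d ->];exists (fun i => c i + d i). by rewrite -big_split;eqbig => i _;rewrite mulrDl.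
 move=>b _ [c ->];exists (fun i => b * c i). by rewrite mulr_sumr;eqbig => i _;rewrite mulrA.
exists (fun j => (j == i)%:R);rewrite (bigD1 i) //= eqxx mul1r big1 ?addr0 //.
by move=>j /negPf ->;rewrite mul0r.
Qed.

(** Polynomials in n variables over R, evaluated at the generators x, stand in for the Rees algebra
    of I. *)
Lemma ipow_form T z : ipow I T z <->
 exists2 P, P \is T.-homog & P.@[x] = z.
split=>[|[P hP <-]].
 elim: T z =>[|T IH] z.
  by move=>_;exists z%:MP;rewrite ?mevalC // -[z%:MP]mulr1 mul_mpolyC dhomogZ ?dhomog1.
 apply:(@ideal_mul_min _ _ _ [set z | exists2 P, P \is T.+1.-homog & P.@[x] = z]).
  split.
  - by exists 0;rewrite ?dhomog0 ?meval0.
  - by move=>a b [P hP <-] [Q hQ <-];exists (P + Q);rewrite ?dhomogD ?mevalD.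
  - by move=>a b [P hP <-];exists (a *: P);rewrite ?dhomogZ ?mevalZ.
 move=>a b /IE[c ->] /IH[P hP <-];exists (\sum_i c i *: 'X_i * P).
  rewrite -[T.+1]add1n;apply:rpred_sum => i _.
  by apply:dhomogM =>//;apply:dhomogZ;rewrite dhomogX /= mdeg1.
 rewrite rmorph_sum mulr_suml;eqbig => i _ /=. by rewrite mevalM mevalZ mevalXU.
rewrite mevalE;have iP := ipow_ideal T iI.
rewrite big_seq;apply:ideal_sum =>// m mP;rewrite -(dhomog_mf hP mP).
apply:(idealM _ (ipow_ideal _ iI));rewrite /= mdegE.
rewrite -[X in ipow I X]/(\sum_(i < n) m i)%N.
elim/big_ind2: _ =>//.
 by move=>d a d' a' h h';apply:ipowM.
move=>i _;elim: (m i) =>[//|d IHd];rewrite exprS.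
exact:mem_ideal_mul.
Qed.

Lemma pihomogM_homog d T Q H : H \is d.-homog ->
 exists2 Q', pihomog mdeg T (Q * H) = Q' * H & (d <= T)%N -> Q' \is (T - d).-homog.
move=>hH;rewrite {1}[Q]mpolyE mulr_suml raddf_sum /=.
exists (\sum_(m <- msupp Q | (mdeg m + d)%N == T) Q@_m *: 'X_[m]).
 rewrite mulr_suml [RHS]big_mkcond;eqbig => m _. have hm : Q@_m *: 'X_[m] * H \is (mdeg m + d).-homog.
  by apply:dhomogM =>//;apply:dhomogZ;rewrite dhomogX.
 case:eqP =>[<-|/eqP ne];first by rewrite pihomog_dE. by rewrite (pihomog_ne0 ne).
move=>dT;apply:rpred_sum => m /eqP <-.
by rewrite addnK;apply:dhomogZ;rewrite dhomogX.
Qed.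

(** The forms whose value at x lies in b generate an ideal J of R[X]; t is the largest degree in a
    finite set of such forms generating J. The degree T part of an expression of a form through them
    has coefficients of degree at least T - t. *)
Lemma artin_rees b : is_ideal b ->
 exists t, forall T z, ipow I T z -> b z -> ideal_mul (ipow I (T - t)) b z.
move=>ib;pose good H := exists2 d, H \is d.-homog & b H.@[x].
pose J := [set P | exists2 hs, (forall H, H \in hs -> good H) & ideal_gen hs P].
have iJ : is_ideal J.
 split;first by exists [::] =>//;apply:ideal0;apply:ideal_gen_ideal.
  move=>P Q [hs gh hP] [gs gg hQ];exists (hs ++ gs).
   by move=>H;rewrite mem_cat => /orP[/gh|/gg].
  apply:idealD;first exact:ideal_gen_ideal.
   by apply:ideal_genS hP => H h;rewrite mem_cat h.
  by apply:ideal_genS hQ => H h;rewrite mem_cat h orbT.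
 by move=>P Q [hs gh hQ];exists hs =>//;apply:idealM =>//;apply:ideal_gen_ideal.
have [s sJ Js] := noetherian_gens (mpoly_noetherian (n := n) nR) iJ.
have [hs gh Jh] : exists2 hs, (forall H, H \in hs -> good H) & J `<=` ideal_gen hs.
 suff [hs gh sh] : exists2 hs, (forall H, H \in hs -> good H) &
   forall g, g \in s -> ideal_gen hs g.
  exists hs =>// P /Js;apply:ideal_gen_sub =>//;exact:ideal_gen_ideal.
 elim: s sJ {Js} =>[|g s IH] sJ;first by exists [::].
 have [|hs gh sh] := IH;first by move=>a h;apply:sJ;rewrite inE h orbT.
 have [hs' gh' gh2] := sJ g (mem_head _ _);exists (hs' ++ hs).
  by move=>H;rewrite mem_cat => /orP[/gh'|/gh].
 move=>a;rewrite inE => /orP[/eqP ->|/sh h].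
  by apply:ideal_genS gh2 => H h;rewrite mem_cat h.
 by apply:ideal_genS h => H h;rewrite mem_cat h orbT.
have [dg dgP] : exists dg : {mpoly R[n]} -> nat,
  forall H, H \in hs -> H \is (dg H).-homog /\ b H.@[x].
 exists (fun H => if pselect (good H) is left h then projT1 (cid2 h) else 0%N).
 by move=>H /gh g;case:pselect =>// h;case:(cid2 h).
exists (\max_(H <- hs) dg H)%N => T z /ipow_form[P hP <-] bP.
have JP : J P by exists [:: P];[move=>H;rewrite inE => /eqP ->;exists T |
 apply:mem_ideal_gen;rewrite inE].
have [c PE] := Jh P JP;have iM := ideal_mul_ideal b (ipow_ideal (T - \max_(H <- hs) dg H) iI).
rewrite -(pihomog_dE hP) PE (raddf_sum (pihomog mdeg T)) (raddf_sum (meval x)).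
apply:ideal_sum =>// i _ /=.
have hi := mem_nth 0 (ltn_ord i);have [hH bH] := dgP _ hi.
have [Q -> hQ] := pihomogM_homog T (c i) hH.
have le : (dg (hs`_i)%R <= \max_(H <- hs) dg H)%N by rewrite (big_rem _ hi) leq_maxl.
(* When T is below the degree of the generator, the truncated difference is 0 and the 0-th power is
   the whole ring. *)
have [dT|Td] := leqP (dg (hs`_i)%R) T;last first.
 have -> : (T - \max_(H <- hs) dg H)%N = 0%N by apply/eqP;rewrite subn_eq0 ltnW // (leq_trans Td).
 by rewrite mevalM;apply:mem_ideal_mul.
rewrite mevalM;apply:mem_ideal_mul =>//.
apply:(ipow_le (j := (T - dg (hs`_i)%R)%N)) =>//;first exact:leq_sub2l.
by apply/ipow_form;exists Q =>//;apply:hQ.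
Qed.

End ArtinRees.

Section KrullIntersection.
Variables (R : comNzRingType) (nR : noetherian R) (I : set R) (iI : is_ideal I).
Implicit Types (a b q : set R).

Lemma artin_rees_ideal b : is_ideal b ->
 exists t, forall T z, ipow I T z -> b z -> ideal_mul (ipow I (T - t)) b z.
move=>ib;have [s sI Is] := noetherian_gens nR iI.
have := artin_rees nR (fun i : 'I_(size s) => s`_i) ib.
suff -> : ideal_gen [seq s`_i | i : 'I_(size s) <- enum 'I_(size s)] = I by [].
apply/esym/ideal_genP =>// [y /mapP[i _ ->]|y /Is].
 exact/sI/mem_nth.
apply:ideal_genS => z /(nthP 0)[i si <-];apply/mapP.
by exists (Ordinal si);rewrite ?mem_enum.
Qed.

(** Artin-Rees for b = a + (f) in degree t + 1: f agrees modulo a with an element of I^(t+1) and b,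
    hence of I b, so f lies in a + I f. *)
Lemma krull_intersection a f : is_ideal a ->
 (forall T, exists2 g, ipow I T g & a (f - g)) -> exists2 u, I u & a ((1 - u) * f).
move=>ia h;pose b := ideal_add a (ideal_gen [:: f]).
have igf := ideal_gen_ideal [:: f];have ib : is_ideal b by apply:ideal_add_ideal.
have [t ht] := artin_rees_ideal ib.
have [g Ig ag] := h t.+1.
have bg : b g.
 rewrite -[g](subKr f) addrC;apply:idealD =>//.
  by apply:ideal_addl =>//;apply:idealN.
 by apply:ideal_addr =>//;apply:mem_ideal_gen;rewrite inE.
have := ht t.+1 g Ig bg;rewrite subSnn ipow1 //.
suff sub : ideal_mul I b `<=` [set z | exists2 u, I u & a (z - u * f)].
 case/sub => u Iu au;exists u =>//. by have := idealD ia ag au;rewrite addrA subrK mulrBl mul1r.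
apply:ideal_mul_min.
 split.
 - by exists 0;rewrite ?mul0r ?subr0;apply:ideal0.
 - move=>y z [u Iu au] [v Iv av];exists (u + v);first exact:idealD.
  by rewrite mulrDl opprD addrACA;apply:idealD.
 - move=>y z [u Iu au];exists (y * u);first exact:idealM.
  by rewrite -mulrA -mulrBr;apply:idealM.
move=>y _ Iy [a1 [_ [aa1 [c ->] ->]]];exists (y * c ord0);first exact:idealMr.
by rewrite big_ord1 /= mulrDr mulrA addrK;apply:idealM.
Qed.

(** Artin-Rees for b = q + (x); primality of q then cancels x at the cost of t powers of I. *)
Lemma colon_pow q x : is_prime q -> ~ q x ->
 exists t, forall T g, ideal_add q (ipow I T) (x * g) ->
  ideal_add q (ipow I (T - t)) g.
move=>[iq q1 qM] nqx;pose b := ideal_add q (ideal_gen [:: x]).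
have igx := ideal_gen_ideal [:: x];have ib : is_ideal b by apply:ideal_add_ideal.
have [t ht] := artin_rees_ideal ib;exists t => T g [q0 [z [qq0 Iz xg]]].
have bz : b z.
 have -> : z = - q0 + x * g by rewrite xg addKr.
 apply:idealD =>//;first by apply:ideal_addl =>//;apply:idealN.
 by apply:ideal_addr =>//;apply:idealMr =>//;apply:mem_ideal_gen;rewrite inE.
have := ht T z Iz bz;have ip := ipow_ideal (T - t) iI.
suff sub : ideal_mul (ipow I (T - t)) b `<=`
  [set y | exists2 h, ipow I (T - t) h & q (y - x * h)].
 case/sub => h Ih qh;exists (g - h), h;split=>//;last by rewrite subrK.
 have : q (x * (g - h)) by rewrite mulrBr xg -addrA;apply:idealD. by case/qM.
apply:ideal_mul_min.
 split.
 - by exists 0;rewrite ?mulr0 ?subr0;apply:ideal0.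
 - move=>y w [u Iu au] [v Iv av];exists (u + v);first exact:idealD.
  by rewrite mulrDr opprD addrACA;apply:idealD.
 - move=>y w [u Iu au];exists (y * u);first exact:idealM.
  by rewrite mulrCA -mulrBr;apply:idealM.
move=>y _ Iy [a1 [_ [aa1 [c ->] ->]]];exists (y * c ord0);first exact:idealMr.
by rewrite big_ord1 /= mulrDr mulrA [x * _]mulrC addrK;apply:idealM.
Qed.

End KrullIntersection.

(** * Chains of primes and the growth of codimensions *)

Section Growth.
Variables (k : fieldType) (B : comNzRingType) (i : {rmorphism k -> B}).
Implicit Types (J q : set B) (s t u : seq B) (c : nat -> k).

Definition comb c s : B := \sum_(0 <= j < size s) i (c j) * s`_j.

Definition indep J s := forall c, J (comb c s) -> forall j, (j < size s)%N -> c j = 0.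

Definition spans J s := forall f, exists c, J (f - comb c s).

Lemma comb_cat c s t : comb c (s ++ t) = comb c s + comb (fun j => c (j + size s)%N) t.
rewrite /comb size_cat (big_cat_nat (n := size s)) ?leq_addr //=;congr (_ + _).
 by apply:eq_big_nat => j /andP[_ js];rewrite nth_cat js.
rewrite -{1}[size s]add0n big_addn addKn;eqbig => j _.
by rewrite nth_cat ltnNge leq_addl /= addnK.
Qed.

Lemma comb_map c s x : comb c [seq x * y | y <- s] = x * comb c s.
rewrite /comb size_map mulr_sumr;apply:eq_big_nat => j /andP[_ js].
by rewrite (nth_map 0) // mulrCA.
Qed.

Lemma comb_eq0 c s : (forall j, (j < size s)%N -> c j = 0) -> comb c s = 0.
by move=>h;rewrite /comb big_nat big1 // => j /andP[_ /h ->];rewrite rmorph0 mul0r.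
Qed.

Lemma combD c c' s : comb (fun j => c j + c' j) s = comb c s + comb c' s.
by rewrite -big_split;eqbig => j _;rewrite rmorphD mulrDl. Qed.

Lemma combZ a c s : comb (fun j => a * c j) s = i a * comb c s.
by rewrite mulr_sumr;eqbig => j _;rewrite rmorphM mulrA. Qed.

Lemma indepS J J' s : J `<=` J' -> indep J' s -> indep J s.
by move=>JJ h c /JJ /h. Qed.

Lemma spansS J J' s : J `<=` J' -> spans J s -> spans J' s.
by move=>JJ h f;have [c /JJ] := h f;exists c. Qed.

Lemma indep_le_spans J s t : is_ideal J -> indep J s -> spans J t -> (size s <= size t)%N.
move=>iJ si st;rewrite leqNgt;apply/negP => lt.
pose d j := projT1 (cid (st s`_j)).
have dP j : J (s`_j - comb (d j) t) by exact:(projT2 (cid (st s`_j))).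
pose A := \matrix_(a < size s, b < size t) d a b.
have : ~~ row_free A.
 by rewrite /row_free neq_ltn (leq_ltn_trans (rank_leq_col A) lt).
rewrite -kermx_eq0 => /rowV0Pn[v /sub_kermxP vA v0].
pose c j := if insub j is Some a then v 0 a else 0.
have cE (a : 'I_(size s)) : c a = v 0 a by rewrite /c valK.
have Jc : J (comb c s).
 have -> : comb c s = \sum_(a < size s) i (c a) * (s`_a - comb (d a) t).
  rewrite -[LHS]subr0 /comb big_mkord. under [RHS]eq_bigr => a _ do rewrite mulrBr.
  rewrite big_split /= sumrN;congr (_ - _). under eq_bigr => a _ do rewrite big_mkord mulr_sumr.
  rewrite exchange_big big1 //= => b _. under eq_bigr => a _ do rewrite mulrA -rmorphM.
  rewrite -mulr_suml -rmorph_sum;have /matrixP/(_ 0 b) := vA;rewrite !mxE => vAb.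
  suff -> : \sum_(a < size s) c a * d a b = 0 by rewrite rmorph0 mul0r.
  by rewrite -[RHS]vAb;eqbig => a _;rewrite mxE cE.
 by apply:ideal_sum =>// a _;apply:idealM.
case/eqP: v0;apply/rowP => a;rewrite mxE -cE.
by apply:(si c Jc).
Qed.

Variables (nB : noetherian B) (I : set B) (iI : is_ideal I) (I1 : ~ I 1).

(** A mean value estimate for the power l + 1; it sums growth of degree l into growth of degree l +
    1. *)
Lemma leq_exp_sub a b l : (b <= a)%N -> (a ^ l.+1 <= b ^ l.+1 + l.+1 * (a - b) * a ^ l)%N.
move=>ba;elim: l =>[|l IH];first by rewrite !expn1 expn0 mul1n muln1 subnKC.
have e1 : (a * b ^ l.+1 <= b ^ l.+2 + (a - b) * a ^ l.+1)%N.
 by rewrite -{1}(subnKC ba) mulnDl -expnS leq_add2l leq_mul2l leq_exp2r // ba orbT.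
have -> : (a ^ l.+2 = a * a ^ l.+1)%N by rewrite expnS.
rewrite (leq_trans (leq_mul (leqnn a) IH)) // mulnDr mulnCA -expnS -mulnA.
by rewrite -mulnA [X in (_ <= _ + X)%N]mulSn addnA leq_add2r.
Qed.

(** A lower bound for the Hilbert-Samuel function. For x in q 1 outside q 0, a family independent
    modulo q 1 and x times a family independent modulo q 0 in precision T - t are jointly
    independent modulo q 0 in precision T; [colon_pow] supplies the shift t. *)
Lemma chain_growth l (q : nat -> set B) : (forall j, (j <= l)%N -> is_prime (q j)) ->
 (forall j, (j < l)%N -> q j `<` q j.+1) -> q l `<=` I ->
 exists C, forall T, exists2 u, indep (ideal_add (q 0%N) (ipow I T.+1)) u &
  (T.+1 ^ l <= C * size u)%N.
elim: l q =>[|l IH] q qp qs qI.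
 exists 1%N => T;exists [:: 1] =>// c [a [b [qa Ib ab]]] [|//] _. apply/eqP;apply:contra_notT I1 => c0.
 have Ic : I (i (c 0%N)).
  move: ab;rewrite /comb big_nat1 mulr1 => ->;apply:idealD =>//;first exact:qI.
  by move: Ib;move/(ipow_le iI (isT : (1 <= T.+1)%N));rewrite ipow1.
 have -> : 1 = i (c 0%N)^-1 * i (c 0%N) by rewrite -rmorphM mulVf // rmorph1. exact:idealM.
have [||//|C hC] := IH (fun j => q j.+1).
- by move=>j jl;apply:qp.
- by move=>j jl;apply:qs.
have [q01 nq01] := qs 0%N isT.
have [x q1x nq0x] : exists2 x, q 1%N x & ~ q 0%N x.
 by apply:contrapT => h;apply:nq01 => x q1x;apply:contrapT => nqx;apply:h;exists x.
have pq0 := qp 0%N isT;have [iq0 _ _] := pq0;have [iq1 _ _] := qp 1%N isT.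
(* The successor makes t positive, so that T - t is smaller than T in the induction. *)
have [t0 ht0] := colon_pow nB iI pq0 nq0x;pose t := t0.+1.
have sub01 T : ideal_add (q 0%N) (ipow I T) `<=` ideal_add (q 1%N) (ipow I T).
 by move=>_ [a [b [qa Ib ->]]];exists a, b;split=>//;apply:q01.
exists (l.+1 * t * C)%N => T;elim/ltn_ind: T => T IHT.
have [u ui su] := hC T.
(* Below t the family for q 1 is enough: the missing factor T + 1 is at most t, and t is part of the
   constant. *)
have [Tt|tT] := ltnP T t.
 exists u;first exact:indepS (sub01 _) ui. rewrite expnS -!mulnA (leq_trans (leq_mul (leqnn _) su)) //.
 by rewrite (leq_trans _ (leq_pmull _ _)) // leq_mul.
have [|v vi sv] := IHT (T - t)%N;first by rewrite ltn_subrL /= (leq_trans _ tT).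
exists (u ++ [seq x * y | y <- v]).
 move=>c;rewrite comb_cat comb_map => h. have iqI j : is_ideal (ideal_add (q 1%N) (ipow I j)).
  by apply:ideal_add_ideal =>//;apply:ipow_ideal.
 have cu0 : forall j, (j < size u)%N -> c j = 0.
  apply:ui;apply:(ideal_subl (b := - (x * comb (fun j => c (j + size u)%N) v)) (iqI _)).
   by rewrite opprK;apply:sub01.
  apply:idealN =>//;apply:ideal_addl;first exact:ipow_ideal. exact:idealMr.
 move=>j;rewrite size_cat size_map => js. have [ju|uj] := ltnP j (size u);first exact:cu0.
 rewrite -(subnK uj);apply:(vi (fun j => c (j + size u)%N));last by rewrite ltn_subLR.
 have := h;rewrite comb_eq0 // add0r => /ht0. have -> : ((T - t).+1 = T.+1 - t)%N by rewrite subSn.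
 case=> a [b [qa Ib ->]];exists a, b;split=>//. by apply:ipow_le Ib =>//;apply:leq_sub2l.
rewrite size_cat size_map mulnDr.
have := leq_exp_sub l (leq_subr t T.+1);rewrite subKn;last by rewrite ltnW // ltnS.
rewrite [(T.+1 - t)%N]subSn // => /leq_trans;apply;rewrite addnC.
by rewrite leq_add // -!mulnA !leq_mul.
Qed.

(** Taking T equal to C' * C makes T + 1 larger than the product of the constants of the lower and
    the upper bound, which excludes l > d. *)
Lemma chain_le_growth l d C (q : nat -> set B) : (forall j, (j <= l)%N -> is_prime (q j)) ->
 (forall j, (j < l)%N -> q j `<` q j.+1) -> q l `<=` I ->
 (forall T, exists2 s, spans (ipow I T.+1) s & (size s <= C * T.+1 ^ d)%N) ->
 (l <= d)%N.
move=>qp qs qI sp;have [C' hC] := chain_growth qp qs qI.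
rewrite leqNgt;apply/negP => dl.
have [u ui su] := hC (C' * C)%N;have [s ss zs] := sp (C' * C)%N.
have iq : is_ideal (ideal_add (q 0%N) (ipow I (C' * C).+1)).
 apply:ideal_add_ideal;last exact:ipow_ideal. by case:(qp 0%N isT).
have us : (size u <= size s)%N.
 apply:(indep_le_spans iq ui);apply:spansS ss => a. by apply:ideal_addr;case:(qp 0%N isT).
have := leq_trans su (leq_mul (leqnn C') (leq_trans us zs)).
rewrite -(subnKC (ltnW dl)) expnD mulnA [leqRHS]mulnC leq_pmul2l ?expn_gt0 //.
rewrite leqNgt => /negP;apply;rewrite -ltnS in dl.
have : (0 < l - d)%N by rewrite subn_gt0.
case:(l - d)%N =>// e _;rewrite expnS (leq_trans _ (leq_pmulr _ _)) ?expn_gt0 //.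
Qed.

End Growth.

(** * Localization at a prime and regular points *)

Section LocalizationMap.
Variables (R : comPzRingType) (x : Spec R).
Local Notation S := (localization x).

Definition toloc (a : R) : S := \pi_S (mkfrac a (@compl1 R x)).

Fact toloc_zmod : zmod_morphism toloc.
move=>a b;rewrite /toloc -[RHS]/(loc_add _ (loc_opp _)) -pi_oppf -pi_addf;apply/loc_eqP;exists 1.
by split;[exact:compl1 | unfold Defs.addf, Defs.oppf, Defs.mulf, mkfrac, fnum, fden;cbn;ring].
Qed.

Fact toloc_monoid : monoid_morphism toloc.
split=>[|a b];first by rewrite /toloc [RHS]/GRing.one /= /loc1;unlock.
rewrite /toloc -[RHS]/(loc_mul _ _) -pi_mulf;apply/loc_eqP;exists 1.
by split;[exact:compl1 | unfold Defs.addf, Defs.oppf, Defs.mulf, mkfrac, fnum, fden;cbn;ring].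
Qed.

HB.instance Definition _ := GRing.isZmodMorphism.Build R S toloc toloc_zmod.
HB.instance Definition _ := GRing.isMonoidMorphism.Build R S toloc toloc_monoid.

Lemma toloc_unit s : ~ prime_ideal x s -> exists y, y * toloc s = 1.
move=>ns;exists (\pi_S (mkfrac 1 ns));rewrite /toloc -[LHS]/(loc_mul _ _) -pi_mulf.
transitivity (toloc 1);last exact:rmorph1.
rewrite /toloc;apply/loc_eqP;exists 1.
by split;[exact:compl1 | unfold Defs.addf, Defs.oppf, Defs.mulf, mkfrac, fnum, fden;cbn;ring].
Qed.

Lemma toloc_num z : exists a s, ~ prime_ideal x s /\ z * toloc s = toloc a.
have [u ->] : exists u, z = \pi_S u by exists (repr z);rewrite reprK.
exists (fnum u), (fden u);split;first exact:fdenP.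
rewrite /toloc -[LHS]/(loc_mul _ _) -pi_mulf;apply/loc_eqP;exists 1.
by split;[exact:compl1 | unfold Defs.addf, Defs.oppf, Defs.mulf, mkfrac, fnum, fden;cbn;ring].
Qed.

Lemma toloc_eq0 a : toloc a = 0 -> exists2 t, ~ prime_ideal x t & t * a = 0.
rewrite -(rmorph0 toloc) => /loc_eqP[t [nt]].
unfold mkfrac, fnum, fden;rewrite /= => e;exists t =>//.
by rewrite -[a]mulr1 e mul0r mulr0.
Qed.

End LocalizationMap.

Section RegularLocal.
Variables (R : comPzRingType) (x : Spec R).
Local Notation S := (localization x).
Local Notation f := (@toloc R x).
Local Notation M := (prime_ideal x).

Let pM : is_prime M.
exact:prime_idealP. Qed.
Let iM : is_ideal M.
by case:pM. Qed.
Let M1 : ~ M 1.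
by case:pM. Qed.
Let MM a b : ~ M a -> ~ M b -> ~ M (a * b).
exact:complM. Qed.

Definition preloc (Q : set S) : set R := [set a | Q (f a)].

Definition extloc (q : set R) : set S :=
 [set z | exists a s, [/\ q a, ~ M s & z * f s = f a]].

Lemma preloc_num Q a s z : is_ideal Q -> ~ M s -> z * f s = f a -> Q z <-> Q (f a).
move=>iQ ns e;split=>[Qz|Qa];first by rewrite -e;apply:idealMr.
have [y ys] := toloc_unit ns;rewrite -[z]mul1r -ys.
by rewrite -mulrA [_ * z]mulrC e;apply:idealM.
Qed.

Lemma preloc_ideal Q : is_ideal Q -> is_ideal (preloc Q).
move=>iQ;split=>[|a b|a b];rewrite /preloc /= ?rmorph0 ?rmorphD ?rmorphM.
- exact:ideal0.
- exact:idealD.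
- exact:idealM.
Qed.

Lemma preloc_sub Q : is_ideal Q -> ~ Q 1 -> preloc Q `<=` M.
move=>iQ Q1 a Qa;apply:contrapT => /toloc_unit[y ya];apply:Q1.
by rewrite -ya;apply:idealM.
Qed.

Lemma preloc_prime Q : is_prime Q -> is_prime (preloc Q).
move=>[iQ Q1 QM];split;first exact:preloc_ideal.
 by rewrite /preloc /= rmorph1.
by move=>a b;rewrite /preloc /= rmorphM => /QM.
Qed.

Lemma preloc_proper Q Q' : is_ideal Q -> is_ideal Q' -> Q `<` Q' -> preloc Q `<` preloc Q'.
move=>iQ iQ' [QQ nQ];split=>[a /QQ //|h];apply:nQ => z Qz.
have [a [s [ns e]]] := toloc_num z.
by apply/(preloc_num iQ ns e)/h;apply/(preloc_num iQ' ns e).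
Qed.

Lemma extloc_num q a : is_ideal q -> extloc q (f a) -> exists2 t, ~ M t & q (t * a).
move=>iq [b [s [qb ns e]]].
have : f (a * s - b) = 0 by rewrite rmorphB rmorphM /= e subrr.
case/toloc_eq0 => t nt e0;exists (t * s);first exact:MM.
have -> : t * s * a = t * b + t * (a * s - b) by ring.
by rewrite e0 addr0;apply:idealM.
Qed.

Lemma extloc_mem q a : q a -> extloc q (f a).
by exists a, 1;rewrite rmorph1 mulr1;split. Qed.

Lemma extloc_ideal q : is_ideal q -> is_ideal (extloc q).
move=>iq;split.
- by rewrite -(rmorph0 f);apply:extloc_mem;apply:ideal0.
- move=>z w [a [s [qa ns e]]] [b [t [qb nt e']]].
 exists (a * t + b * s), (s * t);split;last 2 first.
 + exact:MM.
 + by rewrite rmorphD !rmorphM /= -e -e';ring.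
 by apply:idealD =>//;apply:idealMr.
move=>z w [b [t [qb nt e']]];have [a [s [ns e]]] := toloc_num z.
exists (a * b), (s * t);split;last by rewrite !rmorphM /= -e -e';ring.
 exact:idealM.
exact:MM.
Qed.

Lemma extloc_prime q : is_prime q -> q `<=` M -> is_prime (extloc q).
move=>[iq q1 qM] qsM;split;first exact:extloc_ideal.
 by rewrite -(rmorph1 f) => /(extloc_num iq)[t nt];rewrite mulr1 => /qsM.
move=>z w;have [a [s [ns e]]] := toloc_num z;have [b [t [nt e']]] := toloc_num w.
move=>[d [r [qd nr ed]]].
have : extloc q (f (a * b)).
 exists (d * (s * t)), r;split=>//;first exact:idealMr. by rewrite !rmorphM /= -e -e' -ed;ring.
case/(extloc_num iq) => u nu /qM[/qsM //|/qM[]] h;[left|right].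
 by exists a, s.
by exists b, t.
Qed.

Lemma extloc_proper q q' : is_ideal q -> is_prime q -> q `<=` M -> q `<` q' ->
 extloc q `<` extloc q'.
move=>iq [_ _ qM] qsM [qq nq];split.
 by move=>z [a [s [qa ns e]]];exists a, s;split=>//;apply:qq.
move=>h;apply:nq => a qa;have /(extloc_num iq)[t nt] := h _ (extloc_mem qa).
by case/qM =>// /qsM.
Qed.

Lemma loc_noetherian : noetherian R -> noetherian S.
move=>nR;apply:gens_noetherian => Q iQ.
have [s sQ Qs] := noetherian_gens nR (preloc_ideal iQ).
exists (map f s) =>[_ /mapP[a /sQ Qa ->] //|z Qz].
have [a [t [nt e]]] := toloc_num z.
have ig := ideal_gen_ideal (map f s);apply/(preloc_num ig nt e).
have /Qs[c ->] : preloc Q a by apply/(preloc_num iQ nt e).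
rewrite rmorph_sum;apply:ideal_sum =>// j _;rewrite rmorphM;apply:idealM =>//.
by apply/mem_ideal_gen/map_f/mem_nth.
Qed.

Lemma extloc1 : ~ extloc M 1.
by rewrite -(rmorph1 f) => /(extloc_num iM)[t nt];rewrite mulr1 => /nt.
Qed.

Lemma proper_extloc Q : is_ideal Q -> ~ Q 1 -> Q `<=` extloc M.
move=>iQ Q1 z Qz;have [a [s [ns e]]] := toloc_num z;exists a, s;split=>//.
by apply:(preloc_sub iQ Q1);apply/(preloc_num iQ ns e).
Qed.

Lemma extloc_maximal : is_maximal (extloc M).
split;[exact:extloc_ideal | exact:extloc1 |].
by move=>J iJ J1 MJ;apply/seteqP;split=>//;apply:proper_extloc.
Qed.

Lemma maximal_extloc N : is_maximal N -> N = extloc M.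
move=>[iN N1 maxN];apply/esym;apply:maxN;first exact:extloc_ideal.
 exact:extloc1.
exact:proper_extloc.
Qed.

(** Chains of primes of the localization, read in R; the values of [q] beyond l are irrelevant. *)
Definition chain_below l (q : nat -> set R) :=
 [/\ forall j, (j <= l)%N -> is_prime (q j), forall j, (j < l)%N -> q j `<` q j.+1 &
   q l `<=` M].

Lemma chain_le l (q : nat -> set R) : (forall j, (j < l)%N -> q j `<` q j.+1) ->
 forall a b, (a < b)%N -> (b <= l)%N -> q a `<` q b.
move=>qs a;elim=>// b IH;rewrite ltnS leq_eqVlt => /orP[/eqP -> |ab] bl.
 exact:qs.
have [h1 h2] := qs b bl;have [h3 h4] := IH ab (ltnW bl).
by split=>[z /h3 /h1 //|h];apply:h4 => z /h1 /h.
Qed.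

Lemma chain_prime_loc l : has_prime_chain S l <-> exists q, chain_below l q.
split=>[[c [pc sc]]|[q [qp qs qM]]].
 exists (fun j => preloc (c (inord j)));split=>[j jl|j jl|].
 - exact:preloc_prime.
 - apply:preloc_proper;[by case:(pc (inord j)) | by case:(pc (inord j.+1)) |].
  by apply:sc;rewrite !inordK // ltnW.
 - by apply:preloc_sub;case:(pc (inord l)).
have qjM j : (j <= l)%N -> q j `<=` M.
 rewrite leq_eqVlt => /orP[/eqP -> //|jl] z qz;apply:qM.
 by case:(chain_le qs jl (leqnn l)) => h _;apply:h.
exists (fun j => extloc (q j));split=>[j|j j' jj'].
 have jl : (j <= l)%N by rewrite -ltnS. by apply:extloc_prime;[apply:qp | apply:qjM].
have jl : (j <= l)%N by rewrite -ltnS.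
have j'l : (j' <= l)%N by rewrite -ltnS.
apply:extloc_proper;[by case:(qp j jl) | exact:qp | exact:qjM |].
exact:(chain_le qs).
Qed.

(** Length of chains and generation of the maximal ideal are expressed in R, with multipliers t
    outside the prime in place of denominators. *)
Lemma regular_pointP : regular_point x <-> noetherian S /\ exists d s,
 [/\ exists q, chain_below d q, forall l q, chain_below l q -> (l <= d)%N,
   size s = d, forall a, a \in s -> M a &
   forall a, M a -> exists2 t, ~ M t & ideal_gen s (t * a)].
split=>[[nS [m [d [s [mm um [chd dmax] ss mg]]]]]|[nS [d [s [chd dmax ss sM Mg]]]]].
 split=>//;exists d;have mE := maximal_extloc mm.
 have sm z : z \in s -> extloc M z by move=>zs;rewrite -mE mg;apply:mem_ideal_gen.
 have sE z : exists a, z \in s -> M a /\ exists2 r, ~ M r & z * f r = f a.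
  have [/sm[a [r [Ma nr e]]]|zs] := boolP (z \in s);last by exists 0. by exists a => _;split=>//;exists r.
 pose g z := projT1 (cid (sE z)). have gP z : z \in s -> M (g z) /\ exists2 r, ~ M r & z * f r = f (g z).
  exact:(projT2 (cid (sE z))).
 exists (map g s);split=>[||||a Ma].
 - by apply/chain_prime_loc.
 - by move=>l q h;apply:dmax;apply/chain_prime_loc;exists q.
 - by rewrite size_map.
 - by move=>_ /mapP[z /gP[h _] ->].
 have ig := ideal_gen_ideal (map g s). suff : extloc (ideal_gen (map g s)) (f a) by apply:extloc_num.
 have : ideal_gen s (f a) by rewrite -mg mE;apply:extloc_mem.
 apply:ideal_gen_sub;first exact:extloc_ideal.
 move=>z zs;have [_ [r nr e]] := gP z zs;exists (g z), r;split=>//. exact/mem_ideal_gen/map_f.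
split=>//;exists (extloc M), d, (map f s);split.
- exact:extloc_maximal.
- exact:maximal_extloc.
- split;first by apply/chain_prime_loc.
 by move=>l /chain_prime_loc[q];apply:dmax.
- by rewrite size_map.
apply:ideal_genP;first exact:extloc_ideal.
 by move=>_ /mapP[a /sM Ma ->];apply:extloc_mem.
have ig := ideal_gen_ideal (map f s).
move=>z [a [r [Ma nr e]]];apply/(preloc_num ig nr e).
have [t nt [c tE]] := Mg a Ma;apply/(@preloc_num _ (t * a) t (f a) ig nt).
 by rewrite rmorphM mulrC.
rewrite tE rmorph_sum;apply:ideal_sum =>// j _;rewrite rmorphM;apply:idealM =>//.
by apply/mem_ideal_gen/map_f/mem_nth.
Qed.

End RegularLocal.

(** * Weighted gradings of polynomial rings *)

Section Weights.
Variables (d : nat) (e : 'I_d -> nat).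

Definition wt (m : 'X_{1..d}) : nat := (\sum_(j < d) m j * e j)%N.

Fact wt0 : wt 0%MM = 0%N.
by rewrite /wt big1 // => j _;rewrite mnm0E. Qed.

Fact wtD : {morph wt : m1 m2 / (m1 + m2)%MM >-> (m1 + m2)%N}.
by move=>m1 m2;rewrite /wt -big_split;eqbig => j _;rewrite mnmDE mulnDl.
Qed.

HB.instance Definition _ := isMeasure.Build d wt wt0 wtD.

Lemma wtU j : wt U_(j)%MM = e j.
rewrite /wt (bigD1 j) //= mnm1E eqxx mul1n big1 ?addn0 // => j' /negPf jj'.
by rewrite mnm1E eq_sym jj' mul0n.
Qed.

End Weights.

Section Homogeneous.
Variables (R : comNzRingType) (n : nat) (mf : measure n).
Implicit Types (p q : {mpoly R[n]}).

Lemma mcoeff_pihomog j p m : (pihomog mf j p)@_m = if mf m == j then p@_m else 0.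
rewrite pihomogE raddf_sum /= big_mkcond /=.
have [mp|mp] := boolP (m \in msupp p).
 rewrite (bigD1_seq m) ?msupp_uniq //= big1 ?addr0 =>[|m' m'm].
  by case:eqP =>// _;rewrite mcoeffZ mcoeffX eqxx mulr1.
 by case:eqP =>// _;rewrite mcoeffZ mcoeffX (negPf m'm) mulr0.
rewrite (memN_msupp_eq0 mp) if_same big_seq big1 // => m' m'p.
case:eqP =>// _;rewrite mcoeffZ mcoeffX;case:eqP =>[e|];last by rewrite mulr0.
by move: mp;rewrite -e m'p.
Qed.

Lemma homog_sum p : exists N, forall N', (N <= N')%N -> p = \sum_(j < N') pihomog mf j p.
by exists (mmeasure mf p) => N' h;apply:pihomog_partitionE. Qed.

Lemma pihomogM j p q :
 pihomog mf j (p * q) = \sum_(a < j.+1) pihomog mf a p * pihomog mf (j - a) q.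
have [N1 h1] := homog_sum p;have [N2 h2] := homog_sum q.
pose N := (maxn (maxn N1 N2) j.+1)%N.
have N1N : (N1 <= N)%N by rewrite !leq_max leqnn.
have N2N : (N2 <= N)%N by rewrite !leq_max leqnn orbT.
have jN : (j.+1 <= N)%N by rewrite leq_max leqnn orbT.
rewrite {1}(h1 N N1N) mulr_suml raddf_sum /=.
rewrite [RHS](big_ord_widen N (fun a => pihomog mf a p * pihomog mf (j - a) q)) //.
rewrite [RHS]big_mkcond /=;eqbig => a _.
rewrite {1}(h2 N N2N) mulr_sumr raddf_sum /=.
have hab (b : 'I_N) : pihomog mf a p * pihomog mf b q \is (a + b).-homog for mf.
 by apply:dhomogM;apply:pihomogP.
rewrite ltnS;case:leqP => aj.
 have bN : (j - a < N)%N by rewrite (leq_trans _ jN) // ltnS leq_subr.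
 rewrite (bigD1 (Ordinal bN)) //= big1 ?addr0 =>[|b bj].
  by rewrite pihomog_dE //;have := hab (Ordinal bN);rewrite /= subnKC.
 apply:pihomog_ne0 (hab b);apply:contraNneq bj => abj;apply/eqP/val_inj. by rewrite /= -abj addKn.
rewrite big1 // => b _;apply:pihomog_ne0 (hab b).
by rewrite gtn_eqF // ltn_addr.
Qed.

Lemma pihomog_const j (c : R) : pihomog mf j (c%:MP : {mpoly R[n]}) = if j == 0%N then c%:MP else 0.
have h : (c%:MP : {mpoly R[n]}) \is 0.-homog for mf.
 apply/dhomogP => m;rewrite msuppC;case:eqP =>// _;rewrite inE => /eqP ->. exact:(@mf0 n mf).
case:(posnP j) =>[-> |j0];first by rewrite pihomog_dE.
by rewrite (pihomog_ne0 _ h) // ltn_eqF.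
Qed.

End Homogeneous.

Section WeightedComposition.
Variables (R : comNzRingType) (d r : nat) (mf : measure r) (e : 'I_d -> nat).
Variables (t : d.-tuple {mpoly R[r]}).
Hypothesis th : forall j, tnth t j \is (e j).-homog for mf.

Lemma dhomog_monomial (m : 'X_{1..d}) : 'X_[m] \mPo t \is (wt e m).-homog for mf.
rewrite comp_mpolyX /wt.
elim/big_ind2: _ =>[|a p b q ha hb|j _];first exact:dhomog1.
 exact:dhomogM.
by rewrite mulnC;apply:dhomogMn.
Qed.

Lemma pihomog_comp j (p : {mpoly R[d]}) :
 pihomog mf j (p \mPo t) = pihomog (wt e) j p \mPo t.
rewrite [in LHS](mpolyE p) (pihomogE (wt e)) [X in pihomog _ _ X]raddf_sum /= [RHS]raddf_sum /=.
rewrite raddf_sum [RHS]big_mkcond /=;eqbig => m _;rewrite !linearZ /=.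
have hm := dhomog_monomial m.
case:eqP =>[<-|/eqP ne];first by rewrite pihomog_dE.
by rewrite (pihomog_ne0 ne) // scaler0.
Qed.

End WeightedComposition.

(** The kernels of the iterates become stationary at some n. Writing an element x of the kernel as
    the n-th iterate of y, the element y is killed by n + 1 iterations, hence by n, and x = 0. *)
Lemma surj_endo_inj (R : comNzRingType) (f : {rmorphism R -> R}) : noetherian R ->
 (forall y, exists x, f x = y) -> injective f.
move=>nR fS;apply:raddf_inj => x fx.
pose K n := [set y : R | iter n f y = 0].
have itD n y z : iter n f (y + z) = iter n f y + iter n f z.
 by elim: n =>//= n ->;rewrite rmorphD.
have itM n y z : iter n f (y * z) = iter n f y * iter n f z.
 by elim: n =>//= n ->;rewrite rmorphM.
have iter0 n : iter n f 0 = 0 by elim: n =>//= n ->;rewrite rmorph0.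
have iK n : is_ideal (K n).
 split=>[|y z|y z];rewrite /K /= ?iter0 ?itD ?itM //.
  by move=>-> ->;rewrite addr0.
 by move=>->;rewrite mulr0.
have KS a b : (a <= b)%N -> K a `<=` K b.
 by move=>ab y;rewrite /K /= -(subnK ab) iterD => ->;rewrite iter0.
have [n hn] := noetherian_chain nR iK KS.
have [y yx] : exists y, iter n f y = x.
 elim: n {hn} x {fx} =>[|n IH] x;first by exists x. by have [z <-] := fS x;have [y <-] := IH z;exists y.
have /hn : K n.+1 y by rewrite /K /= yx.
by rewrite /K /= yx.
Qed.

(** * Filtered rings: dimension and regularity from the graded ring *)

Section Minimal.
Variables (k : fieldType) (B : comNzRingType) (i : {rmorphism k -> B}).
Variables (J : set B) (iJ : is_ideal J).

Definition span_mod (s : seq B) (f : B) := exists c, J (f - comb i c s).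

Lemma span_mod_mem s f : f \in s -> span_mod s f.
move=>fs;exists (fun j => (j == index f s)%:R).
have lt : (index f s < size s)%N by rewrite index_mem.
suff -> : comb i (fun j => (j == index f s)%:R) s = f by rewrite subrr;apply:ideal0.
rewrite /comb (bigD1_seq (index f s)) ?mem_index_iota ?iota_uniq //=.
rewrite eqxx rmorph1 mul1r nth_index // big1 ?addr0 //.
by move=>j /negPf ->;rewrite rmorph0 mul0r.
Qed.

Lemma span_modD s f g : span_mod s f -> span_mod s g -> span_mod s (f + g).
move=>[c cf] [c' cg];exists (fun j => c j + c' j).
by rewrite combD opprD addrACA;apply:idealD.
Qed.

Lemma span_modZ s a f : span_mod s f -> span_mod s (i a * f).
by move=>[c cf];exists (fun j => a * c j);rewrite combZ -mulrBr;apply:idealM.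
Qed.

Lemma span_mod_ideal s f : J f -> span_mod s f.
by exists (fun=> 0);rewrite comb_eq0 // subr0. Qed.

Lemma span_mod_sum s (T : Type) (r : seq T) (P : pred T) (F : T -> B) :
 (forall j, P j -> span_mod s (F j)) -> span_mod s (\sum_(j <- r | P j) F j).
move=>h;apply:(big_ind (span_mod s)) =>[|f g|//];last exact:span_modD.
by apply:span_mod_ideal;apply:ideal0.
Qed.

Lemma span_mod_trans s t f : (forall g, g \in s -> span_mod t g) ->
 span_mod s f -> span_mod t f.
move=>st [c cf];rewrite -[f](subrK (comb i c s)).
apply:span_modD;first exact:span_mod_ideal.
rewrite /comb big_nat;apply:span_mod_sum => j /andP[_ js].
by apply:span_modZ;apply:st;apply:mem_nth.
Qed.

Lemma extract_indep (s : seq B) : exists t : seq B, [/\ {subset t <= s}, indep i J t &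
 forall f, f \in s -> span_mod t f].
elim: s =>[|f s [t [ts ti sp]]];first by exists [::].
have [h|h] := pselect (span_mod t f).
 exists t;split=>// [g /ts gs|g];first by rewrite inE gs orbT. by rewrite inE => /orP[/eqP -> //|/sp].
exists (f :: t);split=>[g||g].
- by rewrite !inE => /orP[-> //|/ts ->];rewrite orbT.
- move=>c;rewrite -cat1s comb_cat => Jc.
 have E1 : comb i c [:: f] = i (c 0%N) * f by rewrite /comb big_nat1. have c0 : c 0%N = 0.
  apply/eqP/negPn/negP => c0;apply:h;exists (fun j => - (c 0%N)^-1 * c (j + 1)%N).
  rewrite combZ rmorphN mulNr opprK -[f]mul1r -(rmorph1 i) -(mulVf c0) rmorphM.
  by rewrite -mulrA -E1 -mulrDr;apply:idealM.
 move: Jc;rewrite E1 c0 rmorph0 mul0r add0r => /ti h' [|j] //= jt. by rewrite -addn1 h'.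
rewrite inE => /orP[/eqP ->|/sp];first by apply:span_mod_mem;rewrite mem_head.
by apply:span_mod_trans => g' g't;apply:span_mod_mem;rewrite inE g't orbT.
Qed.

End Minimal.

(* A filtration ord j of B by ideals cofinal with the powers of the maximal
  ideal of x, whose graded ring is the graded subring C of polynomials: the
  relation lead j f c says that f lies in the j-th step with symbol c. *)
Record filtered (k : closedFieldType) (B : comNzRingType) (i : {rmorphism k -> B})
  (x : Spec B) r (C : set {mpoly k[r]}) (lead : nat -> B -> {mpoly k[r]} -> Prop) := Filtered {
 C_const : forall a, C a%:MP;
 C_add : forall c c', C c -> C c' -> C (c + c');
 C_mul : forall c c', C c -> C c' -> C (c * c');
 C_hom : forall j c, C c -> C (pihomog mdeg j c);
 lead_hom : forall j f c, lead j f c -> c \is j.-homog /\ C c;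
 lead_ex : forall j c, c \is j.-homog -> C c -> exists f, lead j f c;
 lead_uniq : forall j f c c', lead j f c -> lead j f c' -> c = c';
 leadD : forall j f g c c', lead j f c -> lead j g c' -> lead j (f + g) (c + c');
 leadZ : forall j a f c, lead j f c -> lead j (i a * f) (a%:MP * c);
 leadM : forall j j' f g c c', lead j f c -> lead j' g c' -> lead (j + j') (f * g) (c * c');
 lead_0 : forall j f, lead j f 0 <-> exists c, lead j.+1 f c;
 lead_const : forall f, exists a, lead 0 f a%:MP;
 lead_max : forall f, prime_ideal x f <-> lead 0 f 0;
 lead_pow : forall n, exists J, forall f c, lead J f c -> ipow x n f }.

Lemma comp_mpoly0_eq0 (R : comNzRingType) d r (t : d.-tuple {mpoly R[r]}) (q : {mpoly R[d]}) :
 d = 0%N -> q \mPo t = 0 -> q = 0.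
move=>d0;move: t q;rewrite d0 => t q.
rewrite [q]nvar0_mpolyC comp_mpolyC -mpolyC0 => /(congr1 (mcoeff 0%MM)).
by rewrite !mcoeffC eqxx !mulr1 => ->;rewrite mpolyC0.
Qed.

Section Filtered.
Variables (k : closedFieldType) (B : comNzRingType) (i : {rmorphism k -> B}) (x : Spec B).
Variables (r : nat) (C : set {mpoly k[r]}) (lead : nat -> B -> {mpoly k[r]} -> Prop).
Hypotheses (fB : filtered i x C lead) (nB : noetherian B).

Let M : set B := prime_ideal x.
Definition ord j f := exists c, lead j f c.

Lemma ord_zero f : ord 0 f.
by have [a h] := lead_const fB f;exists a%:MP. Qed.

Lemma ordS j f : ord j.+1 f -> lead j f 0.
by move=>h;apply/(lead_0 fB). Qed.

Lemma ord_le j j' f : (j <= j')%N -> ord j' f -> ord j f.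
move=>jj';rewrite -(subnK jj');elim: (j' - j)%N =>// l IH.
by rewrite addSn => /ordS h;apply:IH;exists 0.
Qed.

Lemma ord_lead0 j j' f : (j < j')%N -> ord j' f -> lead j f 0.
by move=>jj' /(ord_le jj') /ordS. Qed.

Lemma ord_ideal j : is_ideal (ord j).
have h0 : ord j 0.
 elim: j =>[|j [c h]];first exact:ord_zero.
 by apply/(lead_0 fB);have := leadZ fB 0 h;rewrite rmorph0 mul0r mpolyC0 mul0r.
split=>// [a b [c h] [c' h']|a b [c h]];first by exists (c + c');apply:(leadD fB).
by have [a' ha] := ord_zero a;exists (a' * c);apply:(leadM fB ha h).
Qed.

Lemma ordM j j' f g : ord j f -> ord j' g -> ord (j + j') (f * g).
by move=>[c h] [c' h'];exists (c * c');apply:(leadM fB). Qed.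

Lemma ord_one f : M f <-> ord 1 f.
by rewrite /M (lead_max fB) (lead_0 fB). Qed.

Lemma lead_congr j f g c : lead j f c -> ord j.+1 (g - f) -> lead j g c.
by move=>h /ordS h';have := leadD fB h h';rewrite addrC subrK addr0. Qed.

Lemma lead_sub j f g c c' : lead j f c -> lead j g c' -> lead j (f - g) (c - c').
move=>h h';have := leadD fB h (leadZ fB (-1) h').
by rewrite rmorphN rmorph1 mulN1r mpolyCN mpolyC1 mulN1r.
Qed.

Lemma lead1 a : lead 0 (i a) a%:MP.
have h1 : lead 0 1 1.
 have [b h] := lead_const fB 1. have [f hf] := lead_ex fB (dhomog1 _ _) (C_const fB 1).
 have /(lead_uniq fB) := leadM fB hf h;rewrite mulr1 mul1r => /(_ _ hf) bE. by move: h;rewrite bE.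
by have := leadZ fB a h1;rewrite !mulr1.
Qed.

Lemma M_ideal : is_ideal M.
by case:(prime_idealP x). Qed.
Lemma M_proper : ~ M 1.
by case:(prime_idealP x). Qed.
#[local] Hint Resolve M_ideal ord_ideal : core.

Lemma M_res f : exists a, M (f - i a).
have [a h] := lead_const fB f;exists a;apply/(lead_max fB).
by have := lead_sub h (lead1 a);rewrite subrr.
Qed.

Lemma pow_ord T f : ipow M T f -> ord T f.
elim: T f =>[|T IH] f;first by move=>_;apply:ord_zero.
by apply:ideal_mul_min =>// a b /ord_one ha /IH hb;rewrite -add1n;apply:ordM.
Qed.

Lemma lead_prod d (b : 'I_d -> B) (t : d.-tuple {mpoly k[r]}) (e : 'I_d -> nat)
  (q : {mpoly k[d]}) j : (forall l, lead (e l) (b l) (tnth t l)) ->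
 lead j (mmap i b (pihomog (wt e) j q)) (pihomog (wt e) j q \mPo t).
move=>hb;rewrite pihomogE !raddf_sum /=.
have lead00 : lead j 0 0 by apply/ordS;apply:ideal0.
elim/big_ind2: _ =>[//|f c f' c'|m /eqP <-];first exact:(leadD fB).
rewrite mmapZ comp_mpolyZ -mul_mpolyC;apply:(leadZ fB).
rewrite mmapX comp_mpolyX /mmap1 /wt.
elim/big_ind3: _ =>[|w1 f c w2 f' c'|l _];first by have := lead1 1;rewrite rmorph1 mpolyC1.
 exact:(leadM fB).
elim: (m l) =>[|n IH];first by rewrite !expr0 -mpolyC1 -(rmorph1 i);apply:lead1.
by rewrite !exprS mulSn;apply:(leadM fB).
Qed.

Section Generators.
Variables (d : nat) (e : 'I_d -> nat) (t : d.-tuple {mpoly k[r]}) (b : 'I_d -> B).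
Hypotheses (e_gt0 : forall l, (0 < e l)%N) (tb : forall l, lead (e l) (b l) (tnth t l)).
Let ev : {mpoly k[d]} -> B := mmap i b.

Let th l : tnth t l \is (e l).-homog.
by case:(lead_hom fB (tb l)). Qed.

Lemma b_max l : M (b l).
by apply/ord_one/(ord_le (e_gt0 l));exists (tnth t l). Qed.

Lemma ev_monomial m : ipow M (mdeg m) (ev 'X_[m]).
rewrite /ev mmapX /mmap1 mdegE;elim/big_ind2: _ =>[//|n1 f n2 g|l _].
 exact:ipowM.
elim: (m l) =>// n IH;rewrite exprS -add1n;apply:ipowM =>//.
by rewrite ipow1 //;apply:b_max.
Qed.

Section Spanning.
Variable P : pred 'X_{1..d}.
Hypothesis gen : forall c, C c -> exists2 q : {mpoly k[d]}, all P (msupp q) & c = q \mPo t.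

(** Successive approximation: the error of order T is reduced by the value at b of a polynomial with
    the same symbol. P restricts the monomials in use, for the counts that follow. *)
Lemma approx T f : exists2 q : {mpoly k[d]}, all P (msupp q) & ord T (f - ev q).
elim: T =>[|T [q qP [c h]]].
 by exists 0;[rewrite msupp0 | apply:ord_zero].
have [hc Cc] := lead_hom fB h;have [q' q'P cE] := gen Cc.
exists (q + pihomog (wt e) T q').
 apply/allP => m /msuppD_le;rewrite mem_cat => /orP[/(allP qP) //|].
 rewrite mcoeff_msupp mcoeff_pihomog;case:(_ =P T) => _;last by rewrite eqxx.
 by rewrite -mcoeff_msupp;apply/allP.
rewrite {1}/ev rmorphD /= opprD addrA;apply/(lead_0 fB).
have := lead_sub h (lead_prod q' T tb).
by rewrite -(pihomog_comp th) -cE (pihomog_dE hc) subrr.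
Qed.

(** Each b l lies in M, so a monomial with an exponent above T lies in M^(T+1); only the exponents
    up to T remain to be counted. *)
Lemma spans_monomials T : exists2 s, spans i (ipow M T.+1) s &
 size s = #|[pred m : {ffun 'I_d -> 'I_T.+1} | P [multinom (m j : nat) | j < d]]|.
pose mn (m : {ffun 'I_d -> 'I_T.+1}) : 'X_{1..d} := [multinom (m j : nat) | j < d].
pose A := [pred m | P (mn m)];have iP := ipow_ideal T.+1 M_ideal.
exists [seq ev 'X_[mn m] | m <- enum A];last by rewrite size_map -cardE.
have [J hJ] := lead_pow fB T.+1 => f;have [q qP [c /hJ h]] := approx J f.
suff : span_mod i (ipow M T.+1) [seq ev 'X_[mn m] | m <- enum A] f by [].
rewrite -[f](subrK (ev q));apply:span_modD =>//;first exact:span_mod_ideal.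
rewrite (mpolyE q) /ev rmorph_sum /= big_seq;apply:span_mod_sum =>// m mq.
rewrite -mul_mpolyC rmorphM /= mmapC;apply:span_modZ =>//.
have [/forallP mT|/forallPn[j]] := boolP [forall j, (m j < T.+1)%N].
 apply:span_mod_mem =>//;apply/mapP;pose m' := [ffun j => Ordinal (mT j)].
 have mE : mn m' = m by apply/mnmP => j;rewrite mnmE ffunE.
 by exists m';rewrite ?mE // mem_enum inE mE (allP qP).
rewrite -leqNgt => Tm;apply:span_mod_ideal =>//.
have le : (T.+1 <= mdeg m)%N by rewrite (leq_trans Tm) // mdegE (bigD1 j) //= leq_addr.
exact:(ipow_le M_ideal le (ev_monomial m)).
Qed.

End Spanning.

Hypothesis gen : forall c, C c -> exists q : {mpoly k[d]}, c = q \mPo t.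

Lemma chains_le l q : chain_below x l q -> (l <= d)%N.
move=>[qp qs qM];apply:(@chain_le_growth _ _ i nB M M_ideal M_proper l d 1 q) =>// T.
have [|s ss zs] := @spans_monomials predT _ T.
 by move=>c /gen[p ->];exists p =>//;apply/allP.
exists s =>//;rewrite zs mul1n (leq_trans (max_card _)) //.
by rewrite card_ffun !card_ord.
Qed.

(** Division by the relation q0: monomials divisible by its leading monomial are rewritten through
    smaller ones, by induction on the monomial order. *)
Lemma relation_reduce (q0 : {mpoly k[d]}) : q0 != 0 -> q0 \mPo t = 0 -> forall c, C c ->
 exists2 q : {mpoly k[d]}, all (fun m => ~~ (mlead q0 <= m)%MM) (msupp q) & c = q \mPo t.
move=>q0n q0t;pose P m := ~~ (mlead q0 <= m)%MM.
pose red (c : {mpoly k[r]}) := exists2 q : {mpoly k[d]}, all P (msupp q) & c = q \mPo t.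
have redD c c' : red c -> red c' -> red (c + c').
 move=>[q qP ->] [q' q'P ->];exists (q + q');last by rewrite rmorphD.
 by apply/allP => m /msuppD_le;rewrite mem_cat => /orP[/(allP qP)|/(allP q'P)].
have redZ a c : red c -> red (a *: c).
 move=>[q qP ->];exists (a *: q);last by rewrite linearZ. by apply/allP => m /msuppZ_le /(allP qP).
have red0 : red 0 by exists 0;rewrite ?rmorph0 // msupp0.
have redX m : red ('X_[m] \mPo t).
 move: m;apply:(@ltmwf d) => m IH. have [le|nle] := boolP (mlead q0 <= m)%MM;last first.
  by exists 'X_[m] =>//;rewrite msuppX /= andbT.
 have lc0 : mleadc q0 != 0 by rewrite mleadc_eq0.
 have : 'X_[m - mlead q0] * q0 \mPo t = 0 by rewrite rmorphM /= q0t mulr0.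
 rewrite {2}(mpolyE q0) (bigD1_seq (mlead q0)) ?msupp_uniq ?mlead_supp //= mulrDr rmorphD /=.
 rewrite -scalerAr -mpolyXD submK // linearZ /= => /eqP;rewrite addr_eq0 => /eqP e1.
 rewrite -['X_[m] \mPo t]scale1r -(mulVf lc0) -scalerA e1 scalerN -scaleNr;apply:(redZ).
 rewrite mulr_sumr raddf_sum big_seq_cond /=;apply:(big_ind red) =>// m' /andP[m'q m'l].
 rewrite -scalerAr -mpolyXD linearZ /=;apply:(redZ);apply:IH.
 have : (m' < mlead q0)%O by rewrite Order.POrderTheory.lt_neqAle m'l msupp_le_mlead.
 by rewrite -(ltmc_add2l _ _ (m - mlead q0)) addmC (addmC (mlead q0)) submK.
move=>c /gen[q ->];rewrite (mpolyE q) raddf_sum;apply:(big_ind red) =>// m _.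
by rewrite /= linearZ /=;apply:redZ.
Qed.

(** A monomial not divisible by a0 has some exponent j below a0 j. With exponents up to T there are
    at most mdeg a0 * (T+1)^(d-1) of them, so the dimension falls below d. *)
Lemma relation_chain (q0 : {mpoly k[d]}) l q : q0 != 0 -> q0 \mPo t = 0 -> chain_below x l q -> (l < d)%N.
move=>q0n q0t [qp qs qM];pose a0 := mlead q0.
have d0 : (0 < d)%N.
 by rewrite lt0n;apply:contraNneq q0n => d0;apply/eqP/(comp_mpoly0_eq0 d0 q0t).
rewrite -(prednK d0) ltnS.
apply:(@chain_le_growth _ _ i nB M M_ideal M_proper l d.-1 (mdeg a0) q) =>// T.
have [s ss zs] := spans_monomials (relation_reduce q0n q0t) T.
exists s =>//;rewrite {}zs.
pose A j := finset (fun m : {ffun 'I_d -> 'I_T.+1} => (m j < a0 j)%N).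
apply:(@leq_trans #|\big[@finset.setU _/@finset.set0 _]_j A j|).
 apply/subset_leq_card/fintype.subsetP => m;rewrite inE => /mnm_lepP /= h;apply/finset.bigcupP.
 have : ~~ [forall j, (a0 j <= m j)%N].
  by apply/negP => /forallP h';apply:h => j;rewrite mnmE.
 by case/forallPn => j;rewrite -ltnNge => mj;exists j =>//;rewrite inE.
apply:(@leq_trans (\sum_j #|A j|)).
 elim/big_ind2: _ =>[|X n1 Y n2 h1 h2|//];first by rewrite cards0.
 by rewrite (leq_trans (leq_card_setU _ _)) // leq_add.
rewrite mdegE big_distrl /=;apply:leq_sum => j _.
pose F l : pred 'I_T.+1 := if l == j then [pred v : 'I_T.+1 | (v < a0 j)%N] else predT.
have -> : #|A j| = #|family F|.
 apply:eq_card => m;rewrite inE;apply/idP/familyP =>[mj z|/(_ j)].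
  by rewrite /F;case:eqP =>// ->.
 by rewrite /F eqxx.
rewrite card_family foldrE big_map big_enum /= (bigD1 j) //=.
apply:leq_mul.
 rewrite /F eqxx;apply:leq_trans (_ : #|[seq inord v : 'I_T.+1 | v <- iota 0 (a0 j)]| <= _)%N.
  apply/subset_leq_card/fintype.subsetP => v;rewrite inE => va;apply/mapP.
  by exists (v : nat);rewrite ?mem_iota // inord_val.
 by rewrite (leq_trans (card_size _)) // size_map size_iota.
rewrite (eq_bigr (fun=> T.+1)) =>[|z /negPf lj].
 rewrite prod_nat_const;suff -> : #|(fun z : 'I_d => z != j)| = d.-1 by []. by rewrite cardC1 card_ord.
by rewrite /F lj card_ord.
Qed.

Hypothesis indep_t : forall q : {mpoly k[d]}, q \mPo t = 0 -> q = 0.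

(** The lowest weighted component of q evaluates to a nonzero symbol, by independence of t; so the
    order of q(b) is the lowest weight in q. *)
Lemma ev_ord T (q : {mpoly k[d]}) :
 ord T (ev q) <-> forall j, (j < T)%N -> pihomog (wt e) j q = 0.
have [N qN] := homog_sum (wt e) q;split=>[|h];last first.
 rewrite (qN _ (leqnn N)) /ev rmorph_sum;apply:ideal_sum =>// j _ /=.
 have [jT|Tj] := ltnP j T;first by rewrite h // rmorph0;apply:ideal0.
 by apply:(ord_le Tj);exists (pihomog (wt e) j q \mPo t);apply:lead_prod.
move=>h j;elim/ltn_ind: j => j IH jT;apply:indep_t.
apply:(lead_uniq fB) (ord_lead0 jT h);have := lead_prod q j tb.
move/lead_congr;apply.
have {1}-> : q = \sum_(l < maxn N j.+1) pihomog (wt e) l q by apply:qN;rewrite leq_maxl.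
have jN : (j < maxn N j.+1)%N by rewrite leq_max leqnn orbT.
rewrite (bigD1 (Ordinal jN)) //= /ev rmorphD /= addrAC subrr add0r rmorph_sum.
apply:ideal_sum =>// l lj;rewrite /=.
have [lj'|jl] := ltnP l j.
 have -> : pihomog (wt e) l q = 0 by apply:IH =>//;apply:ltn_trans jT. by rewrite rmorph0;apply:ideal0.
have jl' : (j < l)%N by rewrite ltn_neqAle jl andbT eq_sym.
by apply:(ord_le jl');exists (pihomog (wt e) l q \mPo t);apply:lead_prod.
Qed.

(** Its kernel represents the ideal generated by the first j variables. *)
Definition kill j : d.-tuple {mpoly k[d]} := [tuple if (l < j)%N then 0 else 'X_l | l < d].

Lemma kill_wt j l : tnth (kill j) l \is (e l).-homog for (wt e).
by rewrite tnthE;case:ifP;rewrite ?dhomog0 // dhomogX /= wtU. Qed.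

Lemma killX j l : 'X_l \mPo kill j = if (l < j)%N then 0 else 'X_l.
by rewrite comp_mpolyXU -tnth_nth tnthE. Qed.

Lemma kill_le j j' q : (j <= j')%N -> (q \mPo kill j) \mPo kill j' = q \mPo kill j'.
move=>jj';move: q;apply:(mpoly_rmorph_eq (f := comp_mpoly (kill j') \o comp_mpoly (kill j))
 (g := comp_mpoly (kill j'))) =>[c|l] /=;first by rewrite !comp_mpolyC.
rewrite !killX;case:ifP => lj;last by rewrite killX.
by rewrite comp_mpoly0 (leq_trans lj jj').
Qed.

Lemma kill_pihomog j w (q : {mpoly k[d]}) :
 pihomog (wt e) w (q \mPo kill j) = pihomog (wt e) w q \mPo kill j.
exact:(pihomog_comp (kill_wt j)). Qed.

(** The closure, in the topology of the filtration, of the ideal generated by the first j elements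
    b; it corresponds to a coordinate subspace of the formal completion. *)
Definition chain_ideal j : set B :=
 [set f | forall T, exists2 q : {mpoly k[d]}, q \mPo kill j = 0 & ord T (f - ev q)].

Let gen' c : C c -> exists2 q : {mpoly k[d]}, all predT (msupp q) & c = q \mPo t.
by move=>/gen[q ->];exists q =>//;apply/allP. Qed.

Lemma chain_ideal_ideal j : is_ideal (chain_ideal j).
split=>[T|f g hf hg T|a f hf T].
- by exists 0;rewrite ?comp_mpoly0 // /ev rmorph0 subrr;apply:ideal0.
- have [q q0 h] := hf T;have [q' q'0 h'] := hg T;exists (q + q').
  by rewrite comp_mpolyD q0 q'0 addr0.
 by rewrite /ev rmorphD /= opprD addrACA;apply:idealD.
have [q q0 h] := hf T;have [p _ hp] := approx gen' T a;exists (p * q).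
 by rewrite rmorphM /= q0 mulr0.
have -> : a * f - ev (p * q) = a * (f - ev q) + ev q * (a - ev p) by rewrite /ev rmorphM /=;ring.
by apply:idealD =>//;apply:idealM.
Qed.

(** For f and g outside the closure, any sufficiently precise approximations have, after [kill],
    lowest components of weights a < Tf and c < Tg. Their product is a nonzero component of weight a
    + c, visible in precision Tf + Tg, so f g is outside as well. *)
Lemma chain_ideal_prime j : is_prime (chain_ideal j).
have evB (p q : {mpoly k[d]}) : ev p - ev q = ev (p - q) by rewrite /ev rmorphB.
split=>[||f g fg];first exact:chain_ideal_ideal.
 move=>h;have [q q0] := h 1%N. have -> : 1 - ev q = ev (1 - q) by rewrite -evB /ev rmorph1.
 move/ev_ord => /(_ 0%N isT) /(congr1 (comp_mpoly (kill j))) /eqP.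
 rewrite -kill_pihomog rmorphB /= q0 subr0 rmorph0 rmorph1 -mpolyC1 pihomog_const /=.
 by rewrite mpolyC1 oner_eq0.
have key f' : ~ chain_ideal j f' -> exists T0, forall q T, (T0 <= T)%N -> ord T (f' - ev q) ->
  exists w, [/\ (w < T0)%N, pihomog (wt e) w (q \mPo kill j) != 0 &
   forall w', (w' < w)%N -> pihomog (wt e) w' (q \mPo kill j) = 0].
 move=>nf';have [T0 nT0] : exists T0, ~ exists2 q : {mpoly k[d]}, q \mPo kill j = 0 & ord T0 (f' - ev q).
  by apply:contrapT => nT;apply:nf' => T;apply:contrapT => h;apply:nT;exists T.
 exists T0 => q T TT /(ord_le TT) hq.
 have ex : exists w, (w < T0)%N && (pihomog (wt e) w (q \mPo kill j) != 0).
  apply:contrapT => nex;apply:nT0;exists (q - (q \mPo kill j)).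
   by rewrite rmorphB /= kill_le // subrr.
  rewrite -evB opprB addrCA;apply:idealD =>//.
  apply/ev_ord => w wT;apply/eqP/negPn/negP => w0;apply:nex;exists w. by rewrite wT.
 case:(ex_minnP ex) => w /andP[wT w0] wm;exists w;split=>// w' w'w.
 apply/eqP/negPn/negP => w'0;have := wm w';rewrite (ltn_trans w'w wT) w'0 leqNgt w'w. by move/(_ isT).
apply:contrapT => /not_orP[/key[Tf hf] /key[Tg hg]].
have [q _ aq] := approx gen' (Tf + Tg) f;have [p _ ap] := approx gen' (Tf + Tg) g.
have [a [aT a0 am]] := hf q _ (leq_addr _ _) aq;have [c [cT c0 cm]] := hg p _ (leq_addl _ _) ap.
have [r0 r00 ar] := fg (Tf + Tg)%N.
have : ord (Tf + Tg) (ev (q * p - r0)).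
 have -> : ev (q * p - r0) = (f * g - ev r0) - (f * (g - ev p) + ev p * (f - ev q)).
  by rewrite /ev rmorphB rmorphM /=;ring.
 by apply:idealB =>//;apply:idealD =>//;apply:idealM.
have acT : (a + c < Tf + Tg)%N by rewrite -addnS leq_add // ltnW.
move/ev_ord => /(_ _ acT) /(congr1 (comp_mpoly (kill j))) /eqP.
rewrite -kill_pihomog rmorphB rmorphM /= r00 subr0 rmorph0 pihomogM.
have aac : (a < (a + c).+1)%N by rewrite ltnS leq_addr.
rewrite (bigD1 (Ordinal aac)) //= addKn big1 ?addr0 =>[|l la];first by rewrite mulf_eq0 (negPf a0) (negPf c0).
have [la'|al] := ltnP l a;first by rewrite am ?mul0r.
have al' : (a < l)%N by rewrite ltn_neqAle al andbT eq_sym.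
by rewrite cm ?mulr0 //;have := ltn_ord l;lia.
Qed.

Lemma pihomog_wt0 (q : {mpoly k[d]}) : pihomog (wt e) 0 q = (q@_0%MM)%:MP.
apply/mpolyP => m;rewrite mcoeff_pihomog mcoeffC /=.
have [->|/eqP m0] := eqVneq m 0%MM;first by rewrite mf0 eqxx mulr1.
case:eqP =>[m0'|];last by rewrite mulr0.
case:m0;apply/mnmP => l;rewrite mnm0E;move/eqP: m0';rewrite /wt sum_nat_eq0.
by move/forallP/(_ l);rewrite /= muln_eq0 => /orP[/eqP //|];rewrite eqn0Ngt e_gt0.
Qed.

Lemma chain_of_gens : chain_below x d chain_ideal.
have evB (p q : {mpoly k[d]}) : ev p - ev q = ev (p - q) by rewrite /ev rmorphB.
split=>[j _|j jd|f hf];first exact:chain_ideal_prime.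
 split=>[f hf T|/(_ (b (Ordinal jd)))].
  by have [q q0 h] := hf T;exists q =>//;rewrite -(kill_le _ (leqnSn j)) q0 comp_mpoly0.
 have evX l : ev 'X_l = b l by rewrite /ev mmapX mmap1U. have hb : chain_ideal j.+1 (b (Ordinal jd)).
  move=>T;exists 'X_(Ordinal jd);first by rewrite killX /= ltnSn. by rewrite evX subrr;apply:ideal0.
 move/(_ hb (e (Ordinal jd)).+1) =>[q q0];rewrite -evX evB.
 move/ev_ord => /(_ _ (ltnSn _)) /(congr1 (comp_mpoly (kill j))) /eqP.
 rewrite -kill_pihomog rmorphB /= q0 subr0 rmorph0 killX /= ltnn.
 rewrite pihomog_dE ?dhomogX /= ?wtU // => /eqP /(congr1 (mcoeff U_(Ordinal jd))) /eqP.
 by rewrite mcoeffX eqxx mcoeff0 oner_eq0.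
have [q q0 /ord_one h] := hf 1%N;rewrite -[f](subrK (ev q));apply:idealD =>//.
apply/ord_one/ev_ord => w;rewrite ltnS leqn0 => /eqP ->.
have := congr1 (pihomog (wt e) 0) q0;rewrite kill_pihomog raddf0 pihomog_wt0 comp_mpolyC.
by rewrite -(pihomog_wt0 q).
Qed.

(** The chain of closures gives dimension at least d and the monomial count at most d. The b l
    generate M up to closure, and Krull's intersection theorem turns this into generation after
    localization. *)
Lemma regular_of_gens : regular_point x.
apply/regular_pointP;split;first exact:loc_noetherian.
exists d, [seq b l | l <- enum 'I_d].
split=>[||||a Ma];first by exists chain_ideal;exact:chain_of_gens.
- exact:chains_le.
- by rewrite size_map size_enum_ord.
- by move=>_ /mapP[l _ ->];apply:b_max.
set s := map _ _;have ig := ideal_gen_ideal s.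
have bs l : ideal_gen s (b l) by apply/mem_ideal_gen/map_f;rewrite mem_enum.
have [u Mu hu] : exists2 u, M u & ideal_gen s ((1 - u) * a).
 apply:(krull_intersection nB M_ideal ig) => T.
 have [J hJ] := lead_pow fB T;have [q _ aq] := approx gen' (maxn J 1) a.
 exists (a - ev q);first by have [c /hJ] := ord_le (leq_maxl _ _) aq. have q0 : q@_0%MM = 0.
  apply/eqP;rewrite -(mpolyC_eq0 d) -pihomog_wt0;apply/eqP. suff /ev_ord/(_ 0%N isT) : ord 1 (ev q) by [].
  rewrite -[ev q](subKr a);apply:idealB =>//;first exact/ord_one. exact:ord_le (leq_maxr _ _) aq.
 rewrite opprB addrC subrK (mpolyE q) /ev rmorph_sum;apply:ideal_sum =>// m _ /=.
 have [->|m0] := eqVneq m 0%MM;first by rewrite q0 scale0r rmorph0;apply:ideal0.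
 have [l ml] : exists l, m l != 0%N.
  apply/existsP;apply:contraNT m0 => /existsPn h;apply/eqP/mnmP => l. by rewrite mnm0E;apply/eqP/negPn/h.
 have lm : (U_(l) <= m)%MM.
  by apply/mnm_lepP => l';rewrite mnm1E;case:eqP =>// <-;rewrite lt0n.
 rewrite -mul_mpolyC -(submK lm) mpolyXD !rmorphM /=;apply:idealM =>//;apply:idealM =>//.
 by rewrite mmapX mmap1U.
exists (1 - u) =>// M1u;apply:M_proper;rewrite -[1](subrK u);exact:idealD.
Qed.

End Generators.
End Filtered.

Lemma ipowMM (R : comPzRingType) (I : set R) a b : is_ideal I -> I a -> I b ->
 ipow I 2 (a * b).
by move=>iI Ia Ib;rewrite -[2%N]/(1 + 1)%N;apply:ipowM =>//;rewrite ipow1. Qed.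

(** With 1 adjoined to both families, this compares independent and spanning families of B / M^2,
    the sum of k and M / M^2. *)
Lemma indep_size_le (k : fieldType) (B : comNzRingType) (i : {rmorphism k -> B}) (M : set B)
  (s Y : seq B) : is_ideal M -> ~ M 1 -> (forall f, exists a, M (f - i a)) ->
 (forall y, y \in Y -> M y) -> (forall f, M f -> span_mod i (ipow M 2) s f) ->
 indep i (ipow M 2) Y -> (size Y <= size s)%N.
move=>iM M1 Mres YM sM iY;have iM2 := ipow_ideal 2 iM.
have M2M f : ipow M 2 f -> M f.
 by move/(ipow_le iM (isT : (1 <= 2)%N));rewrite ipow1.
rewrite -ltnS -[X in (X < _)%N]/(size Y).
apply:(@indep_le_spans _ _ i (ipow M 2) (1 :: Y) (1 :: s) iM2) =>[c|f].
 rewrite -cat1s comb_cat => h. have E1 : comb i c [:: 1] = i (c 0%N) by rewrite /comb big_nat1 mulr1.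
 have c0 : c 0%N = 0.
  apply/eqP/negPn/negP => c0;apply:M1;rewrite -(rmorph1 i) -(mulVf c0) rmorphM.
  apply:idealM =>//;rewrite -E1 -[comb i c _](addrK (comb i (fun j => c (j + 1)%N) Y)).
  apply:idealB =>//;first exact:M2M.
  by rewrite /comb big_nat;apply:ideal_sum =>// j /andP[_ jY];apply:idealM =>//;apply/YM/mem_nth.
 move: h;rewrite E1 c0 rmorph0 add0r => /iY h [|j] //= jY. by rewrite -addn1 h.
have [a Ma] := Mres f.
suff : span_mod i (ipow M 2) (1 :: s) f by [].
rewrite -[f](subrK (i a));apply:span_modD =>//.
 apply:(span_mod_trans iM2) (sM _ Ma) => g gs. by apply:span_mod_mem =>//;rewrite inE gs orbT.
by rewrite -[i a]mulr1;apply:span_modZ =>//;apply:span_mod_mem =>//;rewrite mem_head.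
Qed.

(** Generators of M modulo M^2 generate M^T modulo M^(T+1) by products, so the polynomials in b
    approximate every element. *)
Lemma span_pow (k : fieldType) (B : comNzRingType) (i : {rmorphism k -> B}) (M : set B)
  d (b : 'I_d -> B) : is_ideal M -> (forall f, exists a, M (f - i a)) ->
 (forall l, M (b l)) ->
 (forall f, M f -> exists c : 'I_d -> k, ipow M 2 (f - \sum_l i (c l) * b l)) ->
 forall T f, exists q : {mpoly k[d]}, ipow M T (f - mmap i b q).
move=>iM Mres bM span;have ip T := ipow_ideal T iM.
suff h T f : ipow M T f -> exists q : {mpoly k[d]}, ipow M T.+1 (f - mmap i b q).
 elim=>[|T IH] f;first by exists 0. have [q /h[q' hq']] := IH f.
 by exists (q + q');rewrite rmorphD /= opprD addrA.
elim: T f =>[|T IH] f.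
 by move=>_;have [a Ma] := Mres f;exists a%:MP;rewrite mmapC ipow1.
pose K := [set f | ipow M T.+1 f /\ exists q : {mpoly k[d]}, ipow M T.+2 (f - mmap i b q)].
suff sub : ipow M T.+1 `<=` K by move/sub =>[].
apply:ideal_mul_min =>[|a g Ma hg].
 split.
 - by split;[apply:ideal0 | exists 0;rewrite rmorph0 subr0;apply:ideal0].
 - move=>g h [hg [p hp]] [hh [q hq]];split;first exact:idealD.
  by exists (p + q);rewrite rmorphD opprD addrACA;apply:(idealD (ip T.+2)).
 move=>g h [hh [p hp]];split;first exact:idealM.
 have [a Ma] := Mres g;exists (a%:MP * p);rewrite rmorphM /= mmapC.
 have -> : g * h - i a * mmap i b p = (g - i a) * h + i a * (h - mmap i b p) by ring.
 by apply:(idealD (ip T.+2));[apply:mem_ideal_mul | apply:(idealM _ (ip T.+2))].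
split;first exact:mem_ideal_mul.
have [q hq] := IH g hg;have [c hc] := span a Ma.
exists ((\sum_l (c l)%:MP * 'X_l) * q);rewrite rmorphM rmorph_sum /=.
have -> : \sum_l mmap i b ((c l)%:MP * 'X_l) = \sum_l i (c l) * b l.
 by eqbig => l _;rewrite rmorphM /= mmapC mmapX mmap1U.
have -> : a * g - (\sum_l i (c l) * b l) * mmap i b q =
 (a - \sum_l i (c l) * b l) * g + (\sum_l i (c l) * b l) * (g - mmap i b q) by ring.
apply:(idealD (ip T.+2));first by rewrite -[T.+2]/(2 + T)%N;apply:ipowM.
by apply:mem_ideal_mul =>//;apply:ideal_sum =>// l _;apply:idealM.
Qed.

(** * The Euler derivation and homogeneous parameters *)

Section Euler.
Variables (k : closedFieldType) (B : comNzRingType) (i : {rmorphism k -> B}) (x : Spec B).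
Variables (r : nat) (C : set {mpoly k[r]}) (lead : nat -> B -> {mpoly k[r]} -> Prop).
Hypotheses (char0 : has_pchar0 k) (fB : filtered i x C lead).
Variable D : B -> B.
Hypotheses (DD : forall f g, D (f + g) = D f + D g)
 (DZ : forall a f, D (i a * f) = i a * D f)
 (DM : forall f g, D (f * g) = f * D g + g * D f)
 (Dlead : forall j f c, lead j f c -> lead j (D f) ((j%:R)%:MP * c)).

Let M : set B := prime_ideal x.
Let M_ideal : is_ideal M := M_ideal x.
Let ord_ideal := ord_ideal fB.
#[local] Hint Resolve M_ideal ord_ideal : core.

Let nat_inj (j n : nat) : (j%:R == n%:R :> k) = (j == n).
have /pcharf0P c0 := char0;wlog le : j n / (j <= n)%N =>[h|].
 by case/orP: (leq_total j n) => /h // e;rewrite eq_sym e eq_sym.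
by rewrite eq_sym -subr_eq0 -natrB // c0 subn_eq0 eqn_leq le.
Qed.

(** Eigenvectors up to order n take the place of homogeneous elements of a completion. *)
Definition eigen n j f := ord lead n (D f - i j%:R * f).

Lemma eigenD n j f g : eigen n j f -> eigen n j g -> eigen n j (f + g).
by move=>h h';rewrite /eigen DD mulrDr opprD addrACA;apply:idealD. Qed.

Lemma eigenZ n j a f : eigen n j f -> eigen n j (i a * f).
by move=>h;rewrite /eigen DZ mulrCA -mulrBr;apply:idealM. Qed.

Lemma eigen0 n j : eigen n j 0.
have D0 : D 0 = 0 by have := DZ 0 0;rewrite rmorph0 !mul0r.
by rewrite /eigen D0 mulr0 subrr;apply:ideal0.
Qed.

Lemma eigenM n j j' f g : eigen n j f -> eigen n j' g -> eigen n (j + j') (f * g).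
move=>h h';rewrite /eigen DM natrD rmorphD /=.
have -> : f * D g + g * D f - (i j%:R + i j'%:R) * (f * g) =
 f * (D g - i j'%:R * g) + g * (D f - i j%:R * f) by ring.
by apply:idealD =>//;apply:idealM.
Qed.

Lemma ord_D n f : ord lead n f -> ord lead n (D f).
by move=>[c /Dlead h];exists ((n%:R)%:MP * c). Qed.

Lemma eigen1 n : eigen n 0 1.
have D1 : D 1 = 0.
 by apply:(addrI (D 1));rewrite addr0;have := DM 1 1;rewrite !mul1r => <-.
by rewrite /eigen D1 rmorph0 mul0r subrr;apply:ideal0.
Qed.

Lemma eigen_lead j f c : lead j f c -> eigen j.+1 j f.
move=>h;apply/(lead_0 fB);have := lead_sub fB (Dlead h) (leadZ fB j%:R h).
by rewrite subrr.
Qed.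

(** To gain the order n', apply (D - n') / (j - n'). It annihilates the error in degree n' and, as j
    differs from n', changes the element only in order n', so the symbol is kept. *)
Lemma eigen_improve n0 n j f c : lead j f c -> (j < n0)%N -> (n0 <= n)%N -> eigen n0 j f ->
 exists f', [/\ lead j f' c, eigen n j f' & ord lead n0 (f' - f)].
move=>hf jn0 le ef;rewrite -(subnK le).
elim: (n - n0)%N =>[|m [f' [hf' ef' of']]].
 by exists f;split=>//;rewrite subrr;apply:ideal0.
set n' := (m + n0)%N in ef' *;have n0n' : (n0 <= n')%N by rewrite leq_addl.
have jn' : (j%:R - n'%:R : k) != 0 by rewrite subr_eq0 nat_inj ltn_eqF // (leq_trans jn0).
pose a := (j%:R - n'%:R : k)^-1;pose g := i a * (D f' - i n'%:R * f').
have ia : i a * (i j%:R - i n'%:R) = 1 by rewrite -rmorphB -rmorphM mulVf // rmorph1.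
have gf : g - f' = i a * (D f' - i j%:R * f').
 by rewrite -[X in _ - X]mul1r -ia /g;ring.
have ogf : ord lead n' (g - f') by rewrite gf;apply:idealM.
exists g;split.
- by apply:(lead_congr fB hf');apply:(ord_le fB) ogf;apply:leq_trans n0n'.
- have D_n' h : ord lead n' h -> ord lead n'.+1 (D h - i n'%:R * h).
  by move=>[c' /eigen_lead].
 rewrite /eigen /g DZ mulrCA -mulrBr;apply:idealM =>//. have DB u v : D (u - v) = D u - D v.
  by rewrite -[v]mul1r -mulNr -(rmorphN1 i) DD DZ rmorphN1 mulN1r mul1r.
 have -> : D (D f' - i n'%:R * f') - i j%:R * (D f' - i n'%:R * f') =
   D (D f' - i j%:R * f') - i n'%:R * (D f' - i j%:R * f') by rewrite !DB !DZ;ring.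
 exact:D_n'.
- rewrite -[g](subrK f') -addrA;apply:idealD =>//.
 exact:(ord_le fB) ogf.
Qed.

(** Independence of eigenvectors for distinct eigenvalues: applying D - W to the sum removes its
    last term and multiplies the others by nonzero constants. *)
Lemma eigen_sum n W (h : nat -> B) : (forall w, eigen n w (h w)) ->
 ord lead n (\sum_(w < W) h w) -> forall w, (w < W)%N -> ord lead n (h w).
elim: W h =>// W IH h eh;rewrite big_ord_recr /= => os.
have os' : ord lead n (\sum_(w < W) i (w%:R - W%:R) * h w).
 have -> : \sum_(w < W) i (w%:R - W%:R) * h w =
   (D (\sum_(w < W) h w + h W) - i W%:R * (\sum_(w < W) h w + h W)) -
   (D (h W) - i W%:R * h W) - \sum_(w < W) (D (h w) - i w%:R * h w).
  rewrite DD;have -> : D (\sum_(w < W) h w) = \sum_(w < W) D (h w).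
   apply:(big_morph D DD);by have := eigen0 0 0;have := DZ 0 0;rewrite rmorph0 !mul0r.
  rewrite sumrB mulrDr mulr_sumr. rewrite (eq_bigr (fun w : 'I_W => i w%:R * h w - i W%:R * h w));last first.
   by move=>w _;rewrite rmorphB mulrBl.
  rewrite sumrB;ring.
 apply:idealB =>//;last by apply:ideal_sum =>// w _;apply:eh. apply:idealB =>//;last exact:eh.
 by apply:idealB =>//;[apply:ord_D | apply:idealM].
have hW w : (w < W)%N -> ord lead n (h w).
 move=>wW;have := IH (fun w => i (w%:R - W%:R) * h w) (fun w => eigenZ _ (eh w)) os' w wW.
 have nz : (w%:R - W%:R : k) != 0 by rewrite subr_eq0 nat_inj ltn_eqF.
 by move/(idealM (i (w%:R - W%:R)^-1) (ord_ideal n));rewrite mulrA -rmorphM mulVf // rmorph1 mul1r.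
move=>w;rewrite ltnS leq_eqVlt => /orP[/eqP ->|/hW //].
rewrite -[h W](addKr (\sum_(w < W) h w)) addrC.
by apply:idealB =>//;apply:ideal_sum =>// w' _;apply:hW.
Qed.

Lemma eigen_comp n d (e : 'I_d -> nat) (b : 'I_d -> B) (q : {mpoly k[d]}) w :
 (forall l, eigen n (e l) (b l)) -> eigen n w (mmap i b (pihomog (wt e) w q)).
move=>eb;rewrite pihomogE rmorph_sum /=;apply:(big_ind (eigen n w)) =>[|f g|m /eqP <-].
- exact:eigen0.
- exact:eigenD.
rewrite mmapZ mmapX /mmap1 /wt;apply:eigenZ.
elim/big_ind2: _ =>[|w1 f w2 g|l _];[exact:eigen1 | exact:eigenM |].
elim: (m l) =>[|n' IH];first by rewrite expr0;apply:eigen1.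
by rewrite exprS mulSn;apply:eigenM.
Qed.

Lemma eigen_split n f : M f -> (0 < n)%N -> exists2 L : seq B,
 (forall y, y \in L -> exists j c, [/\ (0 < j)%N, (j < n)%N, lead j y c & eigen n j y]) &
 ord lead n (f - \sum_(y <- L) y).
move=>Mf n0;suff h j : (0 < j)%N -> (j <= n)%N -> exists2 L : seq B,
 (forall y, y \in L -> exists j c, [/\ (0 < j)%N, (j < n)%N, lead j y c & eigen n j y]) &
 ord lead j (f - \sum_(y <- L) y) by exact:h.
elim: j =>// -[|j] IH _ jn.
 by exists [::];rewrite ?big_nil ?subr0 //;apply/(ord_one fB).
have [//||L Lh [c hc]] := IH;first exact:ltnW.
have [y [hy ey _]] := eigen_improve hc (ltnSn _) jn (eigen_lead hc).
exists (y :: L) =>[z|].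
 by rewrite inE => /orP[/eqP ->|/Lh //];exists j.+1, c.
rewrite big_cons opprD [- y - _]addrC addrA;apply/(lead_0 fB).
by have := lead_sub fB hc hy;rewrite subrr.
Qed.

(** The given parameters are split into truncated eigenvectors, among which a basis Y of M / M^2 is
    extracted; it has at most [size s] elements. A symbol of degree j is realised by an eigenvector
    f', which is expanded as a polynomial in eigenvectors lifting Y; comparing the parts of
    eigenvalue j expresses the symbol. *)
Lemma gens_of_regular (s : seq B) : (forall a, a \in s -> M a) ->
 (forall a, M a -> exists2 t, ~ M t & ideal_gen s (t * a)) ->
 exists d (e : 'I_d -> nat) (t : d.-tuple {mpoly k[r]}) (b : 'I_d -> B),
  [/\ (d <= size s)%N, forall l, (0 < e l)%N, forall l, lead (e l) (b l) (tnth t l) &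
   forall c, C c -> exists q : {mpoly k[d]}, c = q \mPo t].
move=>sM Ms;have [J hJ] := lead_pow fB 2;pose n0 := maxn J 1.
have n0_gt0 : (0 < n0)%N by rewrite leq_max orbT.
have iM2 := ipow_ideal 2 M_ideal.
have ordM2 n f : (n0 <= n)%N -> ord lead n f -> ipow M 2 f.
 move=>nn h;have [c /hJ //] : ord lead J f. by apply:(ord_le fB) h;rewrite (leq_trans _ nn) // leq_maxl.
have Mres := M_res fB.
pose Q y := exists j c, [/\ (0 < j)%N, (j < n0)%N, lead j y c & eigen n0 j y].
have QM y : Q y -> M y.
 by move=>[j [c [j0 _ h _]]];apply/(ord_one fB)/(ord_le fB j0);exists c.
have [Y0 Y0Q sY0] : exists2 Y0 : seq B, (forall y, y \in Y0 -> Q y) &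
  forall a, a \in s -> span_mod i (ipow M 2) Y0 a.
 elim: s sM {Ms} =>[|a s IH] sM;first by exists [::].
 have [|Y YQ Ys] := IH;first by move=>a' a's;apply:sM;rewrite inE a's orbT.
 have [L LQ aL] := eigen_split (sM a (mem_head _ _)) n0_gt0.
 exists (L ++ Y) =>[y|a'];first by rewrite mem_cat => /orP[/LQ|/YQ]. rewrite inE => /orP[/eqP ->|/Ys].
  rewrite -[a](subrK (\sum_(y <- L) y));apply:span_modD =>//.
   by apply:span_mod_ideal =>//;apply:ordM2 aL.
  rewrite big_seq;apply:span_mod_sum =>// y yL;apply:span_mod_mem =>//. by rewrite mem_cat yL.
 by apply:(span_mod_trans iM2) => g gY;apply:span_mod_mem =>//;rewrite mem_cat gY orbT.
have [Y [YY0 iY spY]] := extract_indep i iM2 Y0.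
have Ms2 f : M f -> span_mod i (ipow M 2) s f.
 move=>Mf;have [t nt [c tf]] := Ms f Mf;have [tau ht] := Mres t.
 have tau0 : tau != 0 by apply:contra_notN nt => /eqP t0;move: ht;rewrite t0 rmorph0 subr0.
 have -> : f = i tau^-1 * (t * f) - i tau^-1 * ((t - i tau) * f).
  have : i tau^-1 * i tau = 1 by rewrite -rmorphM mulVf // rmorph1.
  by move=>h;rewrite -{1}[f]mul1r -h;ring.
 rewrite addrC;apply:span_modD =>//.
  apply:span_mod_ideal =>//;apply:idealN =>//;apply:idealM =>//. exact:ipowMM.
 apply:span_modZ =>//;rewrite tf;apply:span_mod_sum =>// l _.
 have [g hg] := Mres (c l);have ls := mem_nth 0 (ltn_ord l).
 rewrite -[c l](subrK (i g)) mulrDl;apply:span_modD =>//.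
  apply:span_mod_ideal =>//;apply:ipowMM =>//;exact:sM.
 by apply:span_modZ =>//;apply:span_mod_mem.
have MY f : M f -> span_mod i (ipow M 2) Y f.
 move/Ms2;apply:(span_mod_trans iM2) => a /sY0. by apply:(span_mod_trans iM2) => y /spY.
have YQ y : y \in Y -> Q y by move/YY0/Y0Q.
have le : (size Y <= size s)%N.
 by apply:(indep_size_le M_ideal (@M_proper _ _) Mres _ Ms2 iY) => y /YQ/QM.
have : forall l : 'I_(size Y), exists p : nat * {mpoly k[r]},
  [/\ (0 < p.1)%N, (p.1 < n0)%N, lead p.1 Y`_l p.2 & eigen n0 p.1 Y`_l].
 by move=>l;have [j [c h]] := YQ _ (mem_nth 0 (ltn_ord l));exists (j, c).
move/fin_all_exists =>[p hp].
exists (size Y), (fun l => (p l).1), [tuple (p l).2 | l < size Y], (fun l => Y`_l).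
split=>// [l|l|c Cc];first by case:(hp l).
 by rewrite tnthE;case:(hp l).
set t := [tuple _ | _ < _].
suff hom j c' : c' \is j.-homog -> C c' -> exists q : {mpoly k[size Y]}, c' = q \mPo t.
 have [N cN] := homog_sum mdeg c;rewrite (cN N (leqnn N)).
 elim/big_ind: _ =>[|c1 c2 [q1 ->] [q2 ->]|j _];first by exists 0;rewrite comp_mpoly0.
  by exists (q1 + q2);rewrite comp_mpolyD.
 by apply:hom (pihomogP _ _ _) (C_hom fB _ Cc).
move=>{c Cc} hc Cc;have [f hf] := lead_ex fB hc Cc.
(* Precision beyond j is needed so that the comparison of eigencomponents modulo order n still
   determines the symbol in degree j. *)
pose n := (maxn n0 j.+1).
have n0n : (n0 <= n)%N by rewrite leq_maxl.
have jn : (j < n)%N by rewrite leq_max leqnn orbT.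
have [f' [hf' ef' _]] := eigen_improve hf (ltnSn _) jn (eigen_lead hf).
have : forall l, exists b, [/\ lead (p l).1 b (p l).2, eigen n (p l).1 b & ord lead n0 (b - Y`_l)].
 by move=>l;have [_ h1 h2 h3] := hp l;apply:eigen_improve h3.
move/fin_all_exists =>[b hb].
have tb l : lead (p l).1 (b l) (tnth t l) by rewrite tnthE;case:(hb l).
have bM l : M (b l).
 by apply/(ord_one fB)/(ord_le fB);last (by exists (tnth t l);apply:tb);case:(hp l).
have span g : M g -> exists c : 'I_(size Y) -> k, ipow M 2 (g - \sum_l i (c l) * b l).
 move=>/MY[a ha];exists (fun l => a l). rewrite -[g](subrK (comb i a Y)) -addrA;apply:idealD =>//.
 rewrite /comb big_mkord -sumrB;apply:ideal_sum =>// l _;rewrite -mulrBr;apply:idealM =>//.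
 rewrite -opprB;apply:idealN =>//;apply:(@ordM2 n0) =>//;by case:(hb l).
have [q hq] := span_pow M_ideal Mres bM span n f'.
have {}hq := pow_ord fB hq.
have [N qN] := homog_sum (wt (fun l => (p l).1)) q.
pose W := maxn N j.+1;have jW : (j < W)%N by rewrite leq_max leqnn orbT.
(* The eigencomponents of the difference between the polynomial in b and f'; f' is subtracted in
   weight j only. *)
pose h w := mmap i b (pihomog (wt (fun l => (p l).1)) w q) - (if w == j then f' else 0).
have eh w : eigen n w (h w).
 rewrite /h -mulN1r -(rmorphN1 i);apply:eigenD;first by apply:eigen_comp => l;case:(hb l).
 by apply:eigenZ;case:eqP =>[-> //|_];apply:eigen0.
have oh : ord lead n (\sum_(w < W) h w).
 rewrite sumrB -rmorph_sum /= -(qN W) ?leq_maxl // (bigD1 (Ordinal jW)) //= eqxx.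
 rewrite big1 ?addr0 =>[|w wj];first by rewrite -opprB;apply:idealN.
 by case:eqP =>// wj';case/eqP: wj;apply:val_inj.
have := eigen_sum eh oh jW;rewrite /h eqxx => hj.
exists (pihomog (wt (fun l => (p l).1)) j q);apply:(lead_uniq fB hf').
apply:(lead_congr fB (lead_prod fB q j tb));apply:(ord_le fB jn).
by rewrite -opprB;apply:idealN.
Qed.

End Euler.

(** * Homogeneous generators and the regularity criterion *)

Lemma comp_mpolyA (R : comNzRingType) a b c (p : {mpoly R[a]}) (u : a.-tuple {mpoly R[b]})
  (v : b.-tuple {mpoly R[c]}) :
 (p \mPo u) \mPo v = p \mPo [tuple tnth u l \mPo v | l < a].
move: p;apply:(mpoly_rmorph_eq (f := comp_mpoly v \o comp_mpoly u)
 (g := comp_mpoly [tuple tnth u l \mPo v | l < a])) =>[c'|l] /=;first by rewrite !comp_mpolyC.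
by rewrite !comp_mpolyXU -!tnth_nth tnthE.
Qed.

(* Graded Nakayama: homogeneous generators lifting a basis of m / m^2 are no more
  numerous than the given ones, and a surjective endomorphism of a noetherian
  ring is injective. *)
Lemma homogeneous_generators (k : fieldType) r (C : set {mpoly k[r]}) d (t0 : d.-tuple {mpoly k[r]}) :
 (forall a, C a%:MP) -> (forall c c', C c -> C c' -> C (c + c')) ->
 (forall c c', C c -> C c' -> C (c * c')) -> (forall j c, C c -> C (pihomog mdeg j c)) ->
 (forall l, C (tnth t0 l)) -> (forall c, C c -> exists q : {mpoly k[d]}, c = q \mPo t0) ->
 (forall q : {mpoly k[d]}, q \mPo t0 = 0 -> q = 0) ->
 exists d' (e : 'I_d' -> nat) (t : d'.-tuple {mpoly k[r]}),
  [/\ forall l, (0 < e l)%N, forall l, tnth t l \is (e l).-homog, forall l, C (tnth t l),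
   forall c, C c -> exists q : {mpoly k[d']}, c = q \mPo t &
   forall q : {mpoly k[d']}, q \mPo t = 0 -> q = 0].
move=>CC CD CM Ch Ct gen ind;pose psi (p : {mpoly k[d]}) := p \mPo t0.
have psi_inj p q : psi p = psi q -> p = q.
 by move=>e;apply:subr0_eq;apply/ind;rewrite rmorphB /= -/(psi p) e subrr.
have psiC p : C (psi p).
 move: p;apply:mpoly_gen_ind =>[c|l|p q|p q].
 - by rewrite /psi comp_mpolyC;apply:CC.
 - by rewrite /psi comp_mpolyXU -tnth_nth;apply:Ct.
 - by rewrite /psi rmorphD;apply:CD.
 - by rewrite /psi rmorphM;apply:CM.
pose ct (p : {mpoly k[d]}) : k := (psi p)@_0%MM.
have ctD p q : ct (p + q) = ct p + ct q by rewrite /ct /psi rmorphD /= mcoeffD.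
have ctM p q : ct (p * q) = ct p * ct q by rewrite /ct /psi rmorphM /= rmorphM.
have ctC c : ct c%:MP = c by rewrite /ct /psi comp_mpolyC mcoeffC eqxx mulr1.
pose M : set {mpoly k[d]} := [set p | ct p = 0].
have iM : is_ideal M.
 split=>[|p q|p q];rewrite /M /=;first by rewrite -mpolyC0 ctC.
  by rewrite ctD => -> ->;rewrite addr0.
 by rewrite ctM => ->;rewrite mulr0.
have M1 : ~ M 1 by rewrite /M /= -mpolyC1 ctC => /eqP;rewrite oner_eq0.
pose i := @mpolyC d k.
have Mres p : exists a, M (p - i a).
 by exists (ct p);rewrite /M /= -mulN1r -mpolyC1 -mpolyCN ctD ctM !ctC mulN1r subrr.
have iM2 := ipow_ideal 2 iM.
have M2M p : ipow M 2 p -> M p.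
 by move/(ipow_le iM (isT : (1 <= 2)%N));rewrite ipow1.
pose a0 l := ct 'X_l.
pose s : seq {mpoly k[d]} := [seq 'X_l - i (a0 l) | l <- enum 'I_d].
have sM p : p \in s -> M p.
 move=>/mapP[l _ ->];rewrite /M /= -mulN1r -mpolyC1 -mpolyCN ctD ctM !ctC. by rewrite mulN1r subrr.
have spM (u : {mpoly k[d]}) : span_mod i (ipow M 2) s u -> M u.
 move=>[c h];rewrite -[u](subrK (comb i c s));apply:idealD =>//;first exact:M2M.
 rewrite /comb big_nat;apply:ideal_sum =>// j /andP[_ js];apply:idealM =>//.
 by apply:sM;apply:mem_nth.
have Ms p : M p -> span_mod i (ipow M 2) s p.
 suff h : exists2 u, span_mod i (ipow M 2) s u & exists a, p = i a + u.
  move=>Mp;have [u hu [a pE]] := h.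
  have a_0 : a = 0 by have := Mp;rewrite pE /M /= ctD ctC (spM _ hu) addr0.
  by rewrite pE a_0 /i mpolyC0 add0r.
 move: p;apply:mpoly_gen_ind =>[c|l|p q [u hu [a ->]] [v hv [b ->]]|p q [u hu [a ->]] [v hv [b ->]]].
 - by exists 0;[apply:span_mod_ideal =>//;apply:ideal0 | exists c;rewrite addr0].
 - exists ('X_l - i (a0 l));last by exists (a0 l);rewrite addrC subrK.
  by apply:span_mod_mem =>//;apply:map_f;rewrite mem_enum.
 - by exists (u + v);[apply:span_modD | exists (a + b);rewrite /i mpolyCD addrACA].
 exists (i a * v + i b * u + u * v);last by exists (a * b);rewrite /i mpolyCM;ring.
 apply:span_modD =>//;first by apply:span_modD =>//;apply:span_modZ.
 by apply:span_mod_ideal =>//;apply:ipowMM =>//;apply:spM.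
have [g hg] : exists g, forall c, C c -> psi (g c) = c.
 have h c : exists p, C c -> psi p = c.
  by have [/gen[p ->]|] := pselect (C c);[exists p | exists 0].
 by exists (fun c => projT1 (cid (h c))) => c;apply:(projT2 (cid (h c))).
have const0 (c : {mpoly k[r]}) : pihomog mdeg 0 c = (c@_0%MM)%:MP.
 apply/mpolyP => m;rewrite mcoeff_pihomog mcoeffC /= mdeg_eq0.
 by case:eqP =>[->|_];rewrite ?mulr1 ?mulr0 //= eqxx ?mulr1.
have [N hN] : exists N, forall l, tnth t0 l = \sum_(j < N.+1) pihomog mdeg j (tnth t0 l).
 have : forall l, exists N, forall N', (N <= N')%N -> tnth t0 l = \sum_(j < N') pihomog mdeg j (tnth t0 l).
  by move=>l;apply:homog_sum.
 move/fin_all_exists =>[f hf];exists (\max_l f l)%N => l. by apply:hf;rewrite leqW // leq_bigmax.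
pose h (p : 'I_d * 'I_N) := pihomog mdeg p.2.+1 (tnth t0 p.1).
have hC p : C (h p) by apply:Ch;apply:Ct.
pose Y0 := [seq g (h p) | p <- enum {: 'I_d * 'I_N}].
pose Q y := exists2 j, (0 < j)%N & psi y \is j.-homog.
have Y0Q y : y \in Y0 -> Q y.
 move=>/mapP[p _ ->];exists p.2.+1 =>//;rewrite hg //;exact:pihomogP.
have QM y : Q y -> M y.
 move=>[j j0 hj];have := pihomog_ne0 (_ : j != 0%N) hj;rewrite const0 -lt0n.
 by move/(_ j0)/eqP;rewrite mpolyC_eq0 => /eqP.
have [Y [YY0 iY spY]] := extract_indep i iM2 Y0.
have YQ y : y \in Y -> Q y by move/YY0/Y0Q.
have le : (size Y <= d)%N.
 have le : (size Y <= size s)%N by apply:(indep_size_le iM M1 Mres _ Ms iY) => y /YQ/QM.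
 by rewrite (leq_trans le) // size_map size_enum_ord.
have MY p : M p -> span_mod i (ipow M 2) Y p.
 move/Ms;apply:(span_mod_trans iM2) => _ /mapP[l _ ->].
 suff -> : 'X_l - i (a0 l) = \sum_(j < N) g (h (l, j)).
  apply:span_mod_sum =>// j _;apply:spY;apply:map_f;rewrite mem_enum. by [].
 apply:psi_inj;rewrite /psi rmorphB rmorph_sum /= comp_mpolyC comp_mpolyXU -tnth_nth.
 rewrite {1}(hN l) big_ord_recl /= const0.
 have -> : (tnth t0 l)@_0%MM = a0 l by rewrite /a0 /ct /psi comp_mpolyXU -tnth_nth.
 rewrite addrAC subrr add0r;eqbig => j _. by rewrite -/(psi _) hg.
have : forall l : 'I_(size Y), exists j, (0 < j)%N /\ psi Y`_l \is j.-homog.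
 by move=>l;have [j j0 hj] := YQ _ (mem_nth 0 (ltn_ord l));exists j.
move/fin_all_exists =>[e he].
pose Yt : (size Y).-tuple {mpoly k[d]} := [tuple Y`_l | l < size Y].
pose t : (size Y).-tuple {mpoly k[r]} := [tuple psi Y`_l | l < size Y].
have psiY (q : {mpoly k[size Y]}) : psi (q \mPo Yt) = q \mPo t.
 by rewrite /psi comp_mpolyA;congr (_ \mPo _);apply:eq_mktuple => l;rewrite tnthE.
pose Gen (c : {mpoly k[r]}) := exists q : {mpoly k[size Y]}, c = q \mPo t.
have GenD c c' : Gen c -> Gen c' -> Gen (c + c') by move=>[q ->] [q' ->];exists (q + q');rewrite rmorphD.
have GenM c c' : Gen c -> Gen c' -> Gen (c * c') by move=>[q ->] [q' ->];exists (q * q');rewrite rmorphM.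
have GenC a : Gen a%:MP by exists a%:MP;rewrite comp_mpolyC.
have Gen0 : Gen 0 by rewrite -mpolyC0.
have GenS (T : Type) (z : seq T) (P : pred T) (F : T -> {mpoly k[r]}) :
  (forall j, P j -> Gen (F j)) -> Gen (\sum_(j <- z | P j) F j).
 by move=>hF;apply:(big_ind Gen).
have hom n c : C c -> Gen (pihomog mdeg n c).
 elim/ltn_ind: n c => n IH c Cc. have [->|n0] := posnP n;first by rewrite const0;apply:(GenC).
 have [a Ma] := Mres (g c);have [b hb] := MY _ Ma.
 (* A constant, a linear combination of the new generators, and an element of the square of the
    ideal. The degree n part of the last is a sum of products of components of lower degree, to
    which induction applies. *)
 have -> : c = a%:MP + psi (comb i b Y) + psi (g c - i a - comb i b Y).
  rewrite -{1}(hg c Cc) -(comp_mpolyC a t0) -!(rmorphD (comp_mpoly t0));congr (psi _). by rewrite /i;ring.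
 rewrite !raddfD /=;apply:(GenD);first apply:(GenD).
 - by rewrite pihomog_const;case:eqP.
 - rewrite /comb big_mkord /psi rmorph_sum raddf_sum;apply:(GenS) => l _ /=.
  rewrite rmorphM /= comp_mpolyC mul_mpolyC linearZ /= -mul_mpolyC;apply:(GenM) =>//.
  have [_ hl] := he l;have [<-|ne] := eqVneq (e l) n;last by rewrite (pihomog_ne0 ne).
  rewrite pihomog_dE //;exists 'X_l;by rewrite comp_mpolyXU -tnth_nth tnthE.
 move: (g c - _ - _) hb => z;pose K := [set z | Gen (pihomog mdeg n (psi z))].
 move=>[zs hzs ->];rewrite /psi rmorph_sum raddf_sum big_seq;apply:(GenS) => p /hzs[p1].
 rewrite -[X in X p.2]/(ipow M 1) ipow1 // => p2 /=. rewrite rmorphM /= pihomogM;apply:(GenS) => j _.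
 have [j0|j0] := posnP j.
  by rewrite j0 const0 -/(psi _) -/(ct _) p1 mpolyC0 mul0r.
 have [jn|jn] := ltnP j n;last first.
  have -> : (n - j = 0)%N by apply/eqP;rewrite subn_eq0.
  by rewrite const0 -/(psi _) -/(ct _) p2 mpolyC0 mulr0.
 by apply:(GenM);apply:IH;rewrite ?ltn_subrL ?j0 ?n0 //;apply:psiC.
have genY c : C c -> Gen c.
 by move=>Cc;have [N' cN] := homog_sum mdeg c;rewrite (cN N' (leqnn N'));apply:(GenS) => j _;apply:hom.
exists (size Y), e, t;split=>// [l|l|l|q q0].
- by case:(he l).
- by rewrite tnthE;case:(he l).
- by rewrite tnthE;apply:psiC.
have : forall l, exists u : {mpoly k[size Y]}, tnth t0 l = u \mPo t by move=>l;apply:genY.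
move/fin_all_exists =>[u hu].
have uY p : (p \mPo [tuple u l | l < d]) \mPo Yt = p.
 apply:psi_inj;rewrite psiY comp_mpolyA /psi;congr (_ \mPo _).
 by apply:eq_from_tnth => l;rewrite !tnthE -hu.
(* There are at most d new generators; sending the surplus variables to 0 turns the surjection onto
   k[X_1..X_d] into an endomorphism of that ring. *)
pose pad (l : 'I_d) : {mpoly k[size Y]} := if insub (l : nat) is Some l' then 'X_l' else 0.
pose F : {rmorphism {mpoly k[d]} -> {mpoly k[d]}} :=
 comp_mpoly Yt \o comp_mpoly [tuple pad l | l < d].
have padS (z : {mpoly k[size Y]}) : exists y, z = y \mPo [tuple pad l | l < d].
 exists (z \mPo [tuple 'X_(widen_ord le l) | l < size Y]).
 rewrite comp_mpolyA -[LHS]comp_mpoly_id;congr (_ \mPo _).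
 apply:eq_from_tnth => l;rewrite !tnthE comp_mpolyXU -tnth_nth tnthE /pad.
 by rewrite insubT //= => lt;congr 'X__;apply:val_inj.
have Finj : injective F.
 apply:surj_endo_inj;first exact/mpoly_noetherian/field_noetherian.
 by move=>p;have [y hy] := padS (p \mPo [tuple u l | l < d]);exists y;rewrite /F /= -hy uY.
have [y qy] := padS q.
suff y0 : y = 0 by rewrite qy y0 comp_mpoly0.
by apply:Finj;rewrite rmorph0 /F /= -qy;apply:psi_inj;rewrite psiY q0 /psi comp_mpoly0.
Qed.

(** From a regular point there result no more generators than the dimension, and a relation among
    them would make every chain too short. In the other direction homogeneous generators of C are
    lifted to B and become regular parameters. *)
Theorem regular_filtered (k : closedFieldType) (B : comNzRingType) (i : {rmorphism k -> B}) (x : Spec B)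
  r (C : set {mpoly k[r]}) (lead : nat -> B -> {mpoly k[r]} -> Prop) (D : B -> B) :
 has_pchar0 k -> noetherian B -> filtered i x C lead ->
 (forall f g, D (f + g) = D f + D g) -> (forall a f, D (i a * f) = i a * D f) ->
 (forall f g, D (f * g) = f * D g + g * D f) ->
 (forall j f c, lead j f c -> lead j (D f) ((j%:R)%:MP * c)) ->
 regular_point x <-> exists d (t : d.-tuple {mpoly k[r]}),
  [/\ forall l, C (tnth t l), forall c, C c -> exists q : {mpoly k[d]}, c = q \mPo t &
   forall q : {mpoly k[d]}, q \mPo t = 0 -> q = 0].
move=>char0 nB fB DD DZ DM Dlead;split=>[/regular_pointP[_ [d [s [[c hc] cd ss sM Ms]]]]|].
 have [d' [e [t [b [le e0 tb gen]]]]] := gens_of_regular char0 fB DD DZ DM Dlead sM Ms. rewrite ss in le.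
 have d'd := chains_le fB nB e0 tb gen hc.
 exists d', t;split=>// [l|q q0];first by case:(lead_hom fB (tb l)). apply/eqP/negPn/negP => qn.
 by have := relation_chain fB nB e0 tb gen qn q0 hc;rewrite ltnNge le.
move=>[d [t0 [Ct gen ind]]].
have [d' [e [t [e0 th tC gen' ind']]]] := homogeneous_generators (C_const fB) (C_add fB) (C_mul fB)
 (C_hom fB) Ct gen ind.
have : forall l, exists b, lead (e l) b (tnth t l) by move=>l;apply:(lead_ex fB).
move/fin_all_exists =>[b tb].
exact:(regular_of_gens fB nB e0 tb gen' ind').
Qed.

(** * Derivations, invariant vector fields and Lie algebras *)

Definition derivation (A : comNzRingType) (D : A -> A) :=
 (forall p q, D (p + q) = D p + D q) /\ (forall p q, D (p * q) = p * D q + q * D p).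

Lemma bracket_der (A : comNzRingType) (D D' : A -> A) : derivation D -> derivation D' ->
 derivation (fun p => D (D' p) - D' (D p)).
move=>[DD DM] [DD' DM'];split=> p q;first by rewrite DD DD' DD' DD;ring.
by rewrite !(DM, DM', DD, DD');ring.
Qed.

Section VectorField.
Variables (k : comNzRingType) (m : nat).
Implicit Types (p q : {mpoly k[m]}).

Definition vfield (v : 'I_m -> {mpoly k[m]}) p := \sum_i p^`M(i) * v i.

Lemma vfieldD v p q : vfield v (p + q) = vfield v p + vfield v q.
by rewrite /vfield -big_split;eqbig => i _;rewrite mderivD mulrDl. Qed.

Lemma vfieldM v p q : vfield v (p * q) = p * vfield v q + q * vfield v p.
rewrite /vfield !mulr_sumr -big_split /=;eqbig => i _.
by rewrite mderivM;ring.
Qed.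

Lemma vfield_der v : derivation (vfield v).
by split;[apply:vfieldD | apply:vfieldM]. Qed.

Lemma vfieldC v c : vfield v c%:MP = 0.
by rewrite /vfield big1 // => i _;rewrite mderivC mul0r. Qed.

Lemma vfield_linear v a p q : vfield v (a *: p + q) = a *: vfield v p + vfield v q.
by rewrite vfieldD -mul_mpolyC vfieldM vfieldC mulr0 addr0 mul_mpolyC. Qed.

Lemma vfieldX v i : vfield v 'X_i = v i.
rewrite /vfield (bigD1 i) //= big1 ?addr0 =>[|j ji].
 rewrite mderivX mnm1E eqxx scale1r (_ : 'X_[_] = 1) ?mul1r // -mpolyX0.
 by congr 'X_[_];apply/mnmP => j;rewrite mnmBE subnn mnm0E.
by rewrite mderivX mnm1E eq_sym (negPf ji) scale0r mul0r.
Qed.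

Lemma derivation_ext (D D' : {mpoly k[m]} -> {mpoly k[m]}) : derivation D -> derivation D' ->
 (forall c, D c%:MP = D' c%:MP) -> (forall i, D 'X_i = D' 'X_i) -> D =1 D'.
move=>[DD DM] [DD' DM'] eC eX;apply:mpoly_gen_ind =>// p q ep eq.
 by rewrite DD DD' ep eq.
by rewrite DM DM' ep eq.
Qed.

End VectorField.

Lemma vfield_eval (k : fieldType) m (v : 'I_m -> {mpoly k[m]}) p u :
 (vfield v p).@[u] = mdiff p u (fun i => (v i).@[u]).
by rewrite /vfield rmorph_sum;eqbig => i _;rewrite /= mevalM. Qed.

Lemma eq_mdiff (k : fieldType) m (p : {mpoly k[m]}) u u' w w' :
 u =1 u' -> w =1 w' -> mdiff p u w = mdiff p u' w'.
by move=>eu ew;eqbig => i _;rewrite ew (meval_eq (v2 := u')).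
Qed.

(** A linear map as a substitution that pulls back values and differentials together; with it ideals
    and tangent spaces are moved by translations. *)
Lemma lin_sub (k : fieldType) n n' (T : {linear 'M[k]_n -> 'M[k]_n'}) :
 exists c : (n' * n').-tuple {mpoly k[n * n]},
  (forall p y, (p \mPo c).@[mxvec y 0] = p.@[mxvec (T y) 0]) /\
  (forall p u y, mdiff (p \mPo c) (mxvec u 0) (mxvec y 0) = mdiff p (mxvec (T u) 0) (mxvec (T y) 0)).
pose L : 'M_(n * n, n' * n') := lin_mx T.
have LE y : mxvec (T y) = mxvec y *m L by rewrite mul_vec_lin.
pose c : (n' * n').-tuple {mpoly k[n * n]} :=
 [tuple \sum_(i < n * n) L i j *: 'X_i | j < n' * n'].
have cE y j : (tnth c j).@[mxvec y 0] = mxvec (T y) 0 j.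
 rewrite tnthE rmorph_sum LE mxE;eqbig => i _. by rewrite /= mevalZ mevalXU mulrC.
have dE u y j : mdiff (tnth c j) u (mxvec y 0) = mxvec (T y) 0 j.
 rewrite tnthE LE mxE. rewrite (big_morph (fun q : {mpoly k[n * n]} => mdiff q u (mxvec y 0))
  (id1 := 0) (op1 := +%R));first last.
 - exact:mdiff0.
 - by move=>q r;rewrite mdiffD.
 by eqbig => i _;rewrite mdiffZ mdiffX mulrC.
exists c;split=>[p y|p u y].
 by rewrite comp_mpoly_meval;apply:meval_eq => j;apply:cE.
by rewrite mdiff_comp;apply:eq_mdiff => j;[apply:cE | apply:dE].
Qed.

Lemma mx_evalB (k : closedFieldType) n (p q : {mpoly k[n * n]}) g :
 mx_eval (p - q) g = mx_eval p g - mx_eval q g.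
exact:mevalB. Qed.

Section LieAlgebra.
Variables (k : closedFieldType) (n : nat).
Implicit Types (F : alg_group k n) (x y : 'M[k]_n) (p : {mpoly k[n * n]}).

Definition gen_mx : 'M[{mpoly k[n * n]}]_n := vec_mx (\row_l 'X_l).

Lemma gen_mx_eval g : map_mx (meval (mxvec g 0)) gen_mx = g.
apply:(can_inj mxvecK);rewrite /gen_mx map_vec_mx vec_mxK.
by apply/rowP => j;rewrite !mxE mevalXU.
Qed.

(** The left-invariant vector field with value g x at g. *)
Definition lx x := vfield (fun l => mxvec (gen_mx *m map_mx (@mpolyC _ _) x) 0 l).

Lemma lx_eval x p g : mx_eval (lx x p) g = mdiff p (mxvec g 0) (mxvec (g *m x) 0).
rewrite /mx_eval vfield_eval;apply:eq_mdiff =>// j.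
have -> : (mxvec (gen_mx *m map_mx (@mpolyC _ _) x) 0 j).@[mxvec g 0] =
  map_mx (meval (mxvec g 0)) (mxvec (gen_mx *m map_mx (@mpolyC _ _) x)) 0 j by rewrite [RHS]mxE.
rewrite map_mxvec map_mxM gen_mx_eval;congr (mxvec (_ *m _) _ _).
by apply/matrixP => a b;rewrite 2!mxE;apply:mevalC.
Qed.

Lemma lx_mxvec x l : lx x 'X_l = mxvec (gen_mx *m map_mx (@mpolyC _ _) x) 0 l.
by rewrite /lx vfieldX. Qed.

Lemma gen_mxE a b : gen_mx a b = 'X_(mxvec_index a b).
by rewrite !mxE. Qed.

Lemma lx_gen x a b : lx x (gen_mx a b) = (gen_mx *m map_mx (@mpolyC _ _) x) a b.
by rewrite gen_mxE lx_mxvec mxvecE. Qed.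

Lemma lxD x p q : lx x (p + q) = lx x p + lx x q.
exact:vfieldD. Qed.
Lemma lxM x p q : lx x (p * q) = p * lx x q + q * lx x p.
exact:vfieldM. Qed.
Lemma lxC x c : lx x c%:MP = 0.
exact:vfieldC. Qed.
Lemma lx0 x : lx x 0 = 0.
by rewrite -mpolyC0 lxC. Qed.
Lemma lx_linear x a p q : lx x (a *: p + q) = a *: lx x p + lx x q.
exact:vfield_linear. Qed.
Lemma lx_der x : derivation (lx x).
exact:vfield_der. Qed.

HB.instance Definition _ x :=
 GRing.isLinear.Build k {mpoly k[n * n]} {mpoly k[n * n]} *:%R (lx x) (lx_linear x).

Lemma lx_sum x (I : Type) (r : seq I) (P : pred I) G :
 lx x (\sum_(i <- r | P i) G i) = \sum_(i <- r | P i) lx x (G i).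
exact:(big_morph (lx x) (lxD x) (lx0 x)). Qed.

Lemma lx_gen_mul x (z : 'M[k]_n) a b : lx x ((gen_mx *m map_mx (@mpolyC (n * n) k) z) a b) =
 (gen_mx *m map_mx (@mpolyC (n * n) k) (x *m z)) a b.
rewrite map_mxM mulmxA [in LHS]mxE lx_sum [RHS]mxE;eqbig => j _.
rewrite lxM lx_gen;have -> : map_mx (@mpolyC (n * n) k) z j b = (z j b)%:MP by rewrite mxE.
by rewrite lxC mulr0 add0r mulrC.
Qed.

Lemma lx_bracket x y p : lx x (lx y p) - lx y (lx x p) = lx (x *m y - y *m x) p.
have d1 := bracket_der (lx_der x) (lx_der y).
move: p;apply:(derivation_ext d1 (lx_der _)) =>[c|l];first by rewrite !lxC ?lx0 subrr.
case/mxvec_indexP: l => a b;rewrite -gen_mxE !lx_gen !lx_gen_mul map_mxB mulmxBr.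
by rewrite [in RHS]mxE [X in _ = _ + X]mxE.
Qed.

Definition ideal_of F : set {mpoly k[n * n]} := [set p | forall g, carrier F g -> mx_eval p g = 0].

(** Left translation by g moves the tangency condition at g to the identity. *)
Lemma lie_lx F x p : x \in lie F -> ideal_of F p -> ideal_of F (lx x p).
move=>/lieP xF pF g Fg;rewrite lx_eval.
have [c [c1 c2]] := lin_sub (mulmx g).
rewrite -[g in mxvec g 0]mulmx1 -c2;apply:xF => h Fh.
by rewrite /mx_eval c1;apply:pF;apply:carrierM.
Qed.

Lemma lie_of_lx F x : (forall p, ideal_of F p -> ideal_of F (lx x p)) -> x \in lie F.
move=>h;apply/lieP => p /h/(_ _ (carrier1 F)).
by rewrite lx_eval mul1mx.
Qed.

Lemma lie_bracket F x y : x \in lie F -> y \in lie F -> x *m y - y *m x \in lie F.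
move=>xF yF;apply:lie_of_lx => p pF g Fg;rewrite -lx_bracket.
have h1 := lie_lx xF (lie_lx yF pF) Fg;have h2 := lie_lx yF (lie_lx xF pF) Fg.
by rewrite mx_evalB h1 h2 subrr.
Qed.

(* A linear condition constant on F holds on its Lie algebra. *)
Lemma lie_linear F (T : {linear 'M[k]_n -> k^o}) c x :
 (forall g, carrier F g -> T g = c) -> x \in lie F -> T x = 0.
move=>hT /lieP xF;pose u l := (T (vec_mx (delta_mx 0 l)) : k).
pose p : {mpoly k[n * n]} := \sum_l u l *: 'X_l + (- c)%:MP.
have TE y : T y = (\sum_l (u l * mxvec y 0 l : k) : k).
 rewrite -{1}[y]mxvecK [mxvec y in LHS]row_sum_delta raddf_sum raddf_sum /=.
 by eqbig => l _;rewrite !linearZ /= mulrC.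
have pF g : carrier F g -> mx_eval p g = 0.
 move=>Fg;rewrite /mx_eval mevalD mevalC rmorph_sum /=.
 rewrite (_ : \sum_l _ = c) ?subrr // -[RHS](hT g Fg) TE. by eqbig => l _;rewrite mevalZ mevalXU.
have := xF p pF;rewrite /p mdiffD.
have -> : mdiff (- c)%:MP (mxvec 1%:M 0) (mxvec x 0) = 0.
 by rewrite /mdiff big1 // => i _;rewrite mderivC meval0 mul0r.
rewrite addr0 (big_morph (fun q : {mpoly k[n * n]} => mdiff q (mxvec 1%:M 0) (mxvec x 0))
 (fun q r => mdiffD q r _ _) (mdiff0 _ _)).
under eq_bigr => l _ do rewrite mdiffZ mdiffX.
by rewrite TE.
Qed.

End LieAlgebra.

(** * Polynomials in an operator and replicas *)

Section FunctionalCalculus.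
Variables (k : fieldType) (V : lmodType k) (L : {linear V -> V}).
Implicit Types (h g : {poly k}) (v : V).

(** The operator h(L) applied to v; the space need not be finite-dimensional, as in the case of
    vector fields acting on polynomials. *)
Definition opoly h v := \sum_(i < size h) h`_i *: iter i L v.

Lemma opoly_widen N h v : (size h <= N)%N -> opoly h v = \sum_(i < N) h`_i *: iter i L v.
move=>le;rewrite /opoly (big_ord_widen N (fun i => h`_i *: iter i L v) le).
by rewrite big_mkcond;eqbig => i _;case:ltnP =>// h';rewrite nth_default // scale0r.
Qed.

Lemma opolyD h g v : opoly (h + g) v = opoly h v + opoly g v.
rewrite (opoly_widen v (size_polyD h g)) (opoly_widen v (leq_maxl (size h) (size g))).
rewrite (opoly_widen v (leq_maxr (size h) (size g))) -big_split;eqbig => i _.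
by rewrite coefD scalerDl.
Qed.

Lemma opolyC c v : opoly c%:P v = c *: v.
rewrite (@opoly_widen 1) ?size_polyC_leq1 // big_ord1 coefC eqxx //.
Qed.

Lemma opolyMX h v : opoly (h * 'X) v = opoly h (L v).
rewrite (@opoly_widen (size h).+1);last first.
 by rewrite (leq_trans (size_polyMleq _ _)) // size_polyX addn2.
rewrite big_ord_recl coefMX eqxx scale0r add0r;eqbig => i _.
by rewrite coefMX /= -iterS iterSr.
Qed.

Lemma opoly_linear h a u v : opoly h (a *: u + v) = a *: opoly h u + opoly h v.
have itP i : iter i L (a *: u + v) = a *: iter i L u + iter i L v.
 by elim: i =>//= i ->;rewrite linearP.
rewrite /opoly scaler_sumr -big_split;eqbig => i _ /=.
by rewrite itP scalerDr !scalerA mulrC.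
Qed.

HB.instance Definition _ h := GRing.isLinear.Build k V V *:%R (opoly h) (opoly_linear h).

Lemma opoly0 v : opoly 0 v = 0.
by rewrite /opoly size_poly0 big_ord0. Qed.

Lemma opolyZ c h v : opoly (c *: h) v = c *: opoly h v.
rewrite (opoly_widen v (size_scale_leq c h)) /opoly scaler_sumr.
by eqbig => i _;rewrite coefZ scalerA.
Qed.

Lemma opolyM h g v : opoly (h * g) v = opoly h (opoly g v).
elim/poly_ind: g v =>[|g c IH] v;first by rewrite mulr0 !opoly0 linear0.
rewrite mulrDr opolyD mulrA opolyMX IH opolyD opolyMX linearD /=;congr (_ + _).
by rewrite opolyC linearZ /= mulrC mul_polyC opolyZ.
Qed.

Lemma opoly_subX a v : opoly ('X - a%:P) v = L v - a *: v.
by rewrite -polyCN opolyD opolyC scaleNr -{1}['X]mul1r opolyMX -polyC1 opolyC scale1r.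
Qed.

Lemma opoly_dvd h g v : (g %| h)%R -> opoly g v = 0 -> opoly h v = 0.
by move=>/dvdpP[q ->] e;rewrite opolyM e linear0. Qed.

Lemma opoly_stable (S : set V) h v : S 0 -> (forall a u w, S u -> S w -> S (a *: u + w)) ->
 (forall u, S u -> S (L u)) -> S v -> S (opoly h v).
move=>S0 SP SL Sv;rewrite /opoly;elim/big_ind: _ =>// [u w Su Sw|i _].
 by rewrite -[u]scale1r;apply:SP.
rewrite -[_ *: _]addr0;apply:SP =>//;elim: (nat_of_ord i) =>//= j;exact:SL.
Qed.

End FunctionalCalculus.

Lemma iter_opoly (k : fieldType) (V : lmodType k) (L : {linear V -> V}) a M v :
 iter M (fun u => L u - a *: u) v = opoly L (('X - a%:P) ^+ M) v.
elim: M v =>[|M IH] v;first by rewrite expr0 -polyC1 opolyC scale1r.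
by rewrite iterSr IH exprSr opolyM opoly_subX.
Qed.

Lemma coprimep_prod_XsubC (k : fieldType) (s : seq k) a n : a \notin s ->
 coprimep (('X - a%:P) ^+ n) (\prod_(b <- s) ('X - b%:P) ^+ n).
move=>as_;rewrite big_seq.
apply:(big_ind (coprimep (('X - a%:P) ^+ n))) =>[|u v hu hv|b bs].
- exact:coprimep1.
- by rewrite coprimepMr hu.
apply/coprimep_expl/coprimep_expr/coprimep_XsubC2.
by rewrite subr_eq0;apply:contraNneq as_ => <-.
Qed.

(** By the Leibniz rule L - (a + b) acts on p q as (L - a) p times q plus p times (L - b) q:
    products of generalised eigenvectors are generalised eigenvectors, and the eigenvalues add
    up. *)
Lemma iter_nil_mul (k : fieldType) m (L : {linear {mpoly k[m]} -> {mpoly k[m]}}) a b s p q a' b' :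
 (forall p q, L (p * q) = p * L q + q * L p) -> (a' + b' <= s)%N ->
 iter a' (fun u => L u - a *: u) p = 0 -> iter b' (fun u => L u - b *: u) q = 0 ->
 iter s (fun u => L u - (a + b) *: u) (p * q) = 0.
move=>LM;have it0 c t : iter t (fun u => L u - c *: u) 0 = 0 by rewrite iter_opoly linear0.
elim: s p q a' b' =>[|s IH] p q a' b'.
 by rewrite leqn0 addn_eq0 => /andP[/eqP -> /eqP ->] /= ->;rewrite mul0r.
case:a' =>[|a'] h;first by move=>/= -> _;rewrite mul0r it0 linear0 scaler0 subrr.
case:b' h =>[|b'] h;first by move=>_ /= ->;rewrite mulr0 it0 linear0 scaler0 subrr.
rewrite [iter s.+1 _ _]iterSr => pa qb.
have -> : L (p * q) - (a + b) *: (p * q) = (L p - a *: p) * q + p * (L q - b *: q).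
 by rewrite LM scalerDl mulrBl mulrBr -scalerAl -scalerAr;ring.
rewrite iter_opoly linearD /= -!iter_opoly.
have h1 : (a' + b'.+1 <= s)%N by lia.
have h2 : (a'.+1 + b' <= s)%N by lia.
by rewrite (IH _ _ _ _ h1) -?iterSr // (IH _ _ _ _ h2) -?iterSr // addr0.
Qed.

Lemma crt_poly (k : fieldType) (s : seq k) (f : k -> k) n : uniq s ->
 exists h : {poly k}, forall a, a \in s -> ('X - a%:P) ^+ n %| h - (f a)%:P.
elim: s =>[|a s IH] /=;first by exists 0.
move=>/andP[as_ us];have [h hs] := IH us.
have /Bezout_eq1_coprimepP[[u v] /= uv] := coprimep_prod_XsubC n as_.
set P := ('X - a%:P) ^+ n in uv *;set Q := \prod_(b <- s) _ in uv.
exists (h * (u * P) + (f a)%:P * (v * Q)) => b;rewrite inE => /orP[/eqP ->|bs].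
 have -> : h * (u * P) + (f a)%:P * (v * Q) - (f a)%:P = (h - (f a)%:P) * u * P.
  have -> : v * Q = 1 - u * P by rewrite -uv addrC addKr. ring.
 by rewrite dvdp_mulIr.
have -> : h * (u * P) + (f a)%:P * (v * Q) - (f b)%:P =
  (h - (f b)%:P) * (u * P) + ((f a)%:P - (f b)%:P) * v * Q.
 have -> : u * P = 1 - v * Q by rewrite -uv addrK. ring.
apply:dvdp_add;first by apply:dvdp_mulr;apply:hs.
by apply:dvdp_mull;rewrite /Q (big_rem _ bs) /= dvdp_mulIl.
Qed.

Lemma prod_dvdp (k : fieldType) (s : seq k) (g : {poly k}) n : uniq s ->
 (forall a, a \in s -> ('X - a%:P) ^+ n %| g) -> \prod_(a <- s) ('X - a%:P) ^+ n %| g.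
elim: s =>[|a s IH] /=;first by rewrite big_nil dvd1p.
move=>/andP[as_ us] h;rewrite big_cons Gauss_dvdp;last exact:coprimep_prod_XsubC.
rewrite h ?mem_head //= IH // => b bs;by rewrite h // inE bs orbT.
Qed.

Section MatrixPolynomial.
Variables (k : fieldType) (n : nat) (x : 'M[k]_n).

Definition mxp (h : {poly k}) : 'M[k]_n := opoly (mulmxr x) h 1%:M.

Lemma opoly_mulmxr m (v : 'M_(m, n)) h : opoly (mulmxr x) h v = v *m mxp h.
rewrite /mxp /opoly mulmx_sumr;eqbig => i _;rewrite -scalemxAr;congr (_ *: _).
by elim: (nat_of_ord i) =>[|j IH] /=;rewrite ?mulmx1 // IH mulmxA.
Qed.

Lemma mxpM h g : mxp (h * g) = mxp h *m mxp g.
by rewrite mulrC /mxp opolyM opoly_mulmxr. Qed.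

Lemma mxpD h g : mxp (h + g) = mxp h + mxp g.
exact:opolyD. Qed.

Lemma mxpC c : mxp c%:P = c%:M.
by rewrite /mxp opolyC scalemx1. Qed.

Lemma mxp_subX a : mxp ('X - a%:P) = x - a%:M.
by rewrite /mxp opoly_subX /= mul1mx scalemx1. Qed.

Lemma mxpX : mxp 'X = x.
by have := mxp_subX 0;rewrite polyC0 subr0 raddf0 subr0. Qed.

Lemma mxp_dvd h g : g %| h -> mxp g = 0 -> mxp h = 0.
exact:opoly_dvd. Qed.

End MatrixPolynomial.

Lemma mxp_annih (k : fieldType) n (x : 'M[k]_n) : exists2 P : {poly k}, P != 0 & mxp x P = 0.
case:n x =>[|n] x;first by exists 1;rewrite ?oner_neq0 //;apply/matrixP => -[].
exists (char_poly x);first by rewrite monic_neq0 // char_poly_monic.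
rewrite -[RHS](Cayley_Hamilton x).
elim/poly_ind: (char_poly x) =>[|p c IH];first by rewrite /mxp opoly0 rmorph0.
by rewrite mxpD mxpM mxpC mxpX IH rmorphD rmorphM /= horner_mx_X horner_mx_C.
Qed.

Lemma mxp_restrict (k : fieldType) n w (x : 'M[k]_n) (B : 'M_(w, n)) T h :
 B *m x = T *m B -> B *m mxp x h = mxp T h *m B.
move=>e;elim/poly_ind: h =>[|h c IH];first by rewrite /mxp !opoly0 mulmx0 mul0mx.
by rewrite !mxpD !mxpM !mxpC !mxpX mulmxDr mulmxA IH -mulmxA e mulmxA mulmxDl scalar_mxC mul_scalar_mx.
Qed.

Lemma idempotent_trace (k : fieldType) n (E : 'M[k]_n) : E *m E = E -> \tr E = (\rank E)%:R.
move=>EE;rewrite -{1}(mulmx_base E) mxtrace_mulC.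
suff -> : row_base E *m col_base E = 1%:M by rewrite mxtrace1.
apply:(row_full_inj (col_base_full E));apply:(row_free_inj (row_base_free E)).
by rewrite mulmx1 mulmxA mulmx_base -mulmxA mulmx_base EE.
Qed.

Lemma nilpotent_trace (k : closedFieldType) n (A : 'M[k]_n) N : A ^+ N = 0 -> \tr A = 0.
case:n A =>[|n] A AN;first by rewrite /mxtrace big_ord0.
have [rs rsE] := closed_field_poly_normal (char_poly A).
have lc : lead_coef (char_poly A) = 1 by apply/eqP;apply:char_poly_monic.
rewrite lc scale1r in rsE.
have rs0 a : a \in rs -> a = 0.
 move=>ars;have : root (char_poly A) a by rewrite rsE root_prod_XsubC.
 rewrite -eigenvalue_root_char => /eigenvalueP[v vA v0]. have : v *m A ^+ N = a ^+ N *: v.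
  elim: N {AN} =>[|N IH];first by rewrite !expr0 mulmx1 scale1r.
  by rewrite exprSr mulmxA IH -scalemxAl vA scalerA exprSr.
 rewrite AN mulmx0 => /esym/eqP;rewrite scaler_eq0 (negPf v0) orbF expf_eq0. by case/andP => _ /eqP.
have cX : char_poly A = 'X^(n.+1).
 have -> : char_poly A = \prod_(r <- rs) 'X.
  by rewrite rsE !big_seq;eqbig => r /rs0 ->;rewrite subr0.
 have sz : size rs = n.+1.
  by have := size_char_poly A;rewrite {1}rsE size_prod_XsubC => -[].
 by rewrite big_const_seq count_predT iter_mulr_1 sz.
have := char_poly_trace A isT;rewrite cX coefXn /= -[n.+1 in LHS]addn1.
by rewrite ltn_eqF ?addn1 // => /esym/eqP;rewrite oppr_eq0 => /eqP.
Qed.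

Lemma intr_char0 (k : fieldType) (N : int) : has_pchar0 k -> (N%:~R == 0 :> k) = (N == 0).
move=>/pcharf0P c0;case:N => N;first by rewrite -pmulrn c0.
by rewrite NegzE mulrNz oppr_eq0 -pmulrn c0.
Qed.

(** f is, up to a common denominator, a Q-linear function on the Q-span of the lam i: it respects
    every integral relation. As lam i0 is nonzero, the i0-th unit vector lies outside the rational
    space U of relations, and a coordinate of v - proj v detects it. *)
Lemma int_dual (k : fieldType) m (lam : 'I_m -> k) i0 : has_pchar0 k -> lam i0 != 0 ->
 exists2 f : 'I_m -> int, f i0 != 0 &
  forall w : 'I_m -> int, \sum_i lam i *~ w i = 0 -> \sum_i w i * f i = 0.
move=>char0 l0.
pose P : set 'rV[rat]_m := [set c | exists N : int, exists z : 'I_m -> int,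
 [/\ N != 0, forall i, N%:~R * c 0 i = (z i)%:~R & \sum_i lam i *~ z i = 0]].
have P0 : P 0.
 exists 1, (fun=> 0);split=>// [i|];first by rewrite mxE mulr0. by rewrite big1 // => i _;rewrite mulr0z.
have PL a u v : P u -> P v -> P (a *: u + v).
 move=>[N [z [N0 zN z0]]] [N' [z' [N'0 z'N z'0]]].
 exists (denq a * N * N'), (fun i => numq a * N' * z i + denq a * N * z' i);split.
 - by rewrite !mulf_neq0.
 - move=>i;rewrite !mxE !(intrM, intrD) -zN -z'N.
  have : (denq a)%:~R * a = (numq a)%:~R :> rat by rewrite mulrC numqE. by move=><-;ring.
 under eq_bigr => i _ do rewrite mulrzDr ![_ * N' * _]mulrC ![_ * N * _]mulrC !mulrzA.
 by rewrite big_split /= -!mulrz_suml z0 z'0 !mul0rz addr0.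
have [U UP] := vspace_of_set P0 PL.
have e0U : delta_mx 0 i0 \notin U.
 apply/negP => /UP[N [z [N0 zN z0]]];case/eqP: l0. have zi i : z i = if i == i0 then N else 0.
  have := zN i;rewrite mxE eqxx /= mulr_natr;case:eqP => _;rewrite ?mulr1n ?mulr0n.
   by move/intr_inj.
  by move/eqP;rewrite eq_sym intr_eq0 => /eqP.
 move: z0;rewrite (bigD1 i0) //= zi eqxx big1 ?addr0 =>[|i /negPf ii];last by rewrite zi ii mulr0z.
 by move/eqP;rewrite -mulrzr mulf_eq0 intr_char0 // (negPf N0) orbF => /eqP.
pose q : 'rV[rat]_m -> 'rV[rat]_m := fun v => v - projv U v.
have qU v : v \in U -> q v = 0 by move=>vU;rewrite /q projv_id // subrr.
have q0 : q (delta_mx 0 i0) != 0.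
 by apply:contraNneq e0U => /eqP;rewrite subr_eq0 => /eqP ->;apply:memv_proj.
have [j qj] : exists j, q (delta_mx 0 i0) 0 j != 0.
 by apply/existsP;apply:contraNT q0 => /existsPn h;apply/eqP/rowP => j;rewrite [RHS]mxE;apply/eqP/negPn/h.
pose g i := q (delta_mx 0 i) 0 j.
have qE v : q v 0 j = \sum_i v 0 i * g i.
 rewrite /g /q {1 2}[v]row_sum_delta linear_sum /= -sumrB summxE.
 by eqbig => i _;rewrite linearZ /= -scalerBr mxE.
pose M := \prod_i denq (g i).
have Mg i : M%:~R * g i = (numq (g i) * \prod_(i' | i' != i) denq (g i'))%:~R.
 by rewrite /M (bigD1 i) //= !intrM mulrAC [_ * g i]mulrC -numqE.
exists (fun i => numq (g i) * \prod_(i' | i' != i) denq (g i')).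
 by rewrite -(intr_eq0 rat) -Mg mulf_neq0 // intr_eq0;apply/prodf_neq0.
move=>w w0;apply:(@intr_inj rat);rewrite rmorph_sum /=.
under eq_bigr => i _ do rewrite intrM -Mg mulrCA.
rewrite -mulr_sumr;have -> : \sum_i (w i)%:~R * g i = q (\row_i (w i)%:~R) 0 j.
 by rewrite qE;eqbig => i _;rewrite mxE.
rewrite qU ?mxE ?mulr0 //;apply/UP;exists 1, w;split=>// i.
by rewrite mxE mul1r.
Qed.

(* A replica of x: a polynomial in x that acts on every representation through
  the same additive function of the eigenvalues. *)
Lemma replica (k : closedFieldType) n w (x : 'M[k]_n) (B : 'M_(w, n)) (C : 'M_(n, w)) M :
 has_pchar0 k -> B *m C = 1%:M -> B *m x = (B *m x *m C) *m B ->
 (exists N, B *m mxp x ('X^N) = 0) \/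
 exists h, [/\ 'X^M %| h, \tr (B *m (x *m mxp x h) *m C) != 0 &
  forall F : alg_group k n, x \in lie F -> mxp x h \in lie F].
move=>char0 BC Bx;have [P P0 xP] := mxp_annih x.
have [rs rsE] := closed_field_poly_normal P.
(* 0 is made an eigenvalue on purpose, so that h can be required to vanish there to high order. *)
pose s := undup (0 :: rs);have us : uniq s by apply:undup_uniq.
pose N := maxn (size rs).+1 M.
have annih g : (forall a, a \in s -> ('X - a%:P) ^+ N %| g) -> mxp x g = 0.
 move=>/(prod_dvdp us) h;apply:mxp_dvd h _;apply:mxp_dvd xP. rewrite rsE dvdpZl ?lead_coef_eq0 //.
 have : \prod_(r <- rs) ('X - r%:P) %| \prod_(r <- 0 :: rs) ('X - r%:P).
  by rewrite [X in _ %| X]big_cons dvdp_mulIr.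
 move/dvdp_trans;apply.
 rewrite -big_undup_iterop_count -/s;apply:(big_ind2 (fun p q : {poly k} => p %| q)) =>// [p p' q q'|a _].
  exact:dvdp_mul.
 rewrite Monoid.iteropE iter_mulr_1. have le : (count_mem a (0%R :: rs) <= N)%N.
  by rewrite (leq_trans (count_size _ _)) // leq_maxl.
 by rewrite -(subnK le) exprD dvdp_mulIr.
have nN : (M <= N)%N by rewrite leq_maxr.
pose m := size s;pose lam (i : 'I_m) := s`_i.
have ls i : lam i \in s by apply:mem_nth.
have lam_inj i j : (lam i == lam j) = (i == j) by rewrite nth_uniq.
have sE a : a \in s -> exists i, a = lam i.
 move=>as_;have lti : (index a s < m)%N by rewrite index_mem.
 by exists (Ordinal lti);rewrite /lam nth_index.
(* By the Chinese remainder theorem [e i] evaluates at x to the projection [E i] onto the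
   generalised eigenspace of lam i. *)
have : forall i, exists e : {poly k}, forall a, a \in s -> ('X - a%:P) ^+ N %| e - ((a == lam i)%:R)%:P.
 by move=>i;apply:(crt_poly (fun a => (a == lam i)%:R)).
move/fin_all_exists =>[e he].
have he' i j : ('X - (lam j)%:P) ^+ N %| e i - ((j == i)%:R)%:P.
 by have := he i _ (ls j);rewrite lam_inj.
have e_dvd i j : j != i -> ('X - (lam j)%:P) ^+ N %| e i.
 by move=>/negPf ji;have := he' i j;rewrite ji subr0.
have e_1 i : ('X - (lam i)%:P) ^+ N %| e i - 1 by have := he' i i;rewrite eqxx.
have annih2 g h : (forall i, ('X - (lam i)%:P) ^+ N %| g - h) -> mxp x g = mxp x h.
 move=>d;apply/eqP;rewrite -subr_eq0 -scaleN1r -opolyZ scaleN1r -mxpD. by apply/eqP/annih => _ /sE[i ->].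
pose E i := mxp x (e i).
have mxp_sum (I : finType) (G : I -> {poly k}) : mxp x (\sum_i G i) = \sum_i mxp x (G i).
 by apply:(big_morph (mxp x));[apply:mxpD | apply:opoly0].
have E1 : \sum_i E i = 1%:M.
 rewrite -mxp_sum -(mxpC x 1);apply:annih2 => j.
 rewrite (bigD1 j) //= addrAC;apply:dvdp_add;first exact:e_1.
 apply:(big_ind (fun p => ('X - (lam j)%:P) ^+ N %| p)) =>[|p q|i ij].
 - exact:dvdp0.
 - exact:dvdp_add.
 - by apply:e_dvd;rewrite eq_sym.
pose T := B *m x *m C.
have BT g : B *m mxp x g *m C = mxp T g by rewrite (mxp_restrict g Bx) -(mulmxA _ B C) BC mulmx1.
have BE g : B *m mxp x g = (B *m mxp x g *m C) *m B by rewrite BT (mxp_restrict g Bx).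
have idem i : mxp T (e i) *m mxp T (e i) = mxp T (e i).
 rewrite -mxpM -!BT;congr (_ *m _ *m _);apply:annih2 => j.
 have -> : e i * e i - e i = e i * (e i - 1) by ring.
 by have [->|ji] := eqVneq j i;[apply:dvdp_mull;apply:e_1 | apply:dvdp_mulr;apply:e_dvd].
have [/existsP[i0 /andP[l0 Ei0]]|/existsPn h0] := boolP [exists i, (lam i != 0) && (mxp T (e i) != 0)];last first.
 left;exists N;rewrite -[mxp x _]mul1mx -E1 mulmx_suml mulmx_sumr big1 // => i _.
 have := h0 i;have [li|li] := eqVneq (lam i) 0;last first.
  by rewrite /= negbK => /eqP h;rewrite mulmxA /E BE BT h !mul0mx.
 move=>_;rewrite /E -mxpM [mxp x _](annih2 _ 0) ?{1}/mxp ?opoly0 ?mulmx0 // => j.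
 rewrite subr0;have [->|ji] := eqVneq j i;last by apply:dvdp_mulr;apply:e_dvd.
 by rewrite li subr0 dvdp_mulIr.
(* The replica is multiplication by the integer f i on the generalised eigenspace of lam i. *)
right;have [f fi0 hf] := int_dual char0 l0.
pose phi a := if insub (index a s) is Some i then (f i)%:~R else 0 : k.
have phiE i : phi (lam i) = (f i)%:~R.
 by rewrite /phi /lam index_uniq // valK.
have [h hh] := crt_poly phi N us.
have hh' i : ('X - (lam i)%:P) ^+ N %| h - ((f i)%:~R)%:P by rewrite -phiE;apply:hh.
have yE i : mxp x h *m E i = (f i)%:~R *: E i.
 rewrite -mxpM -mul_scalar_mx -(mxpC x) -mxpM;apply:annih2 => j.
 rewrite -mulrBl;have [->|ji] := eqVneq j i;first by apply:dvdp_mulr. by apply:dvdp_mull;apply:e_dvd.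
exists h;split=>[||F xF].
(* The eigenvalue 0 is itself an integral relation, so f vanishes there and X^N divides h. *)
- have [z z0] : exists z, 0 = lam z by apply:sE;rewrite mem_undup mem_head.
 have fz : f z = 0.
  have := hf (fun i => (i == z)%:R);rewrite (bigD1 z) //= eqxx -z0 mul0rz big1 =>[|i /negPf ->];last by rewrite mulr0z.
  rewrite addr0 => /(_ erefl);rewrite (bigD1 z) //= eqxx mul1r big1 ?addr0 // => i /negPf ->.
  by rewrite mul0r.
 have := hh' z;rewrite fz subr0 -z0 subr0;apply:dvdp_trans. by rewrite -(subnK nN) exprD dvdp_mulIr.
- pose r i := \rank (mxp T (e i)).
 have trE i : \tr (B *m (x *m E i) *m C) = lam i * (r i)%:R.
  have -> : x *m E i = (x - (lam i)%:M) *m E i + lam i *: E i.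
   by rewrite mulmxBl mul_scalar_mx subrK.
  rewrite mulmxDr mulmxDl mxtraceD -[RHS]add0r;congr (_ + _).
   rewrite -mxp_subX -mxpM BT;apply:(@nilpotent_trace _ _ _ N.+1).
   have <- : mxp T ((('X - (lam i)%:P) * e i) ^+ N.+1) = mxp T (('X - (lam i)%:P) * e i) ^+ N.+1.
    elim: N.+1 =>[|N' IH];first by rewrite !expr0 -polyC1 mxpC. by rewrite [in LHS]exprS mxpM IH [RHS]exprS.
   rewrite -BT [mxp x _](annih2 _ 0) ?{1}/mxp ?opoly0 ?mulmx0 ?mul0mx // => j.
   rewrite subr0 exprMn;have [->|ji] := eqVneq j i.
    by apply:dvdp_mulr;rewrite exprS dvdp_mulIr.
   by apply:dvdp_mull;rewrite exprS;apply:dvdp_mulr;apply:e_dvd.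
  by rewrite -scalemxAr -scalemxAl mxtraceZ BT (idempotent_trace (idem i)).
 (* A vanishing trace is an integral relation with coefficients f i * r i; f turns it into a
    vanishing sum of the nonnegative integers r i * f i ^ 2, although the i0-th is positive. *)
 apply/negP => /eqP tr0. have : \sum_i lam i *~ (f i * (r i)%:Z) = 0.
  rewrite -[RHS]tr0 -[mxp x h]mulmx1 -E1 mulmx_sumr mulmx_sumr mulmx_sumr mulmx_suml raddf_sum.
  eqbig => i _ /=;rewrite yE -!scalemxAr -scalemxAl mxtraceZ trE. by rewrite -mulrzr intrM mulrCA -pmulrn.
 move/hf => s0;have := s0;rewrite (bigD1 i0) //=.
 have ge0 i : (0 <= f i * (r i)%:Z * f i :> int)%R by rewrite mulrAC;apply:Num.Theory.mulr_ge0 =>//;rewrite -expr2 Num.Theory.sqr_ge0.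
 move/eqP;rewrite Num.Theory.paddr_eq0 //;last by apply:Num.Theory.sumr_ge0.
 case/andP;rewrite !mulf_eq0 (negPf fi0) orbF /= => /eqP[] /eqP. by rewrite /r mxrank_eq0 (negPf Ei0).
(* It remains to see that [lx y] preserves the ideal of F. A polynomial is a sum of products of
   generalised eigenvectors of [lx x]; for such a product v records the multiplicities of the lam i,
   the eigenvalue is [mu v], and [lx y] multiplies by [fw v]. *)
set y := mxp x h;apply:lie_of_lx => p pI.
pose mu (v : {ffun 'I_m -> int}) := \sum_i lam i *~ v i.
pose fw (v : {ffun 'I_m -> int}) : k := (\sum_i v i * f i)%:~R.
pose D (z : {ffun 'I_m -> int} * {mpoly k[n * n]}) :=
 (exists M, iter M (fun u => lx x u - mu z.1 *: u) z.2 = 0) /\ lx y z.2 = fw z.1 *: z.2.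
have muD v v' : mu (v + v') = mu v + mu v'.
 by rewrite /mu -big_split;eqbig => i _;rewrite ffunE mulrzDr.
have fwD v v' : fw (v + v') = fw v + fw v'.
 by rewrite /fw -rmorphD -big_split;congr (_%:~R);eqbig => i _;rewrite ffunE mulrDl.
have D_mul z z' : D z -> D z' -> D (z.1 + z'.1, z.2 * z'.2).
 move=>[[M1 hM] e1] [[M2 hM'] e1'];split=> /=.
  by exists (M1 + M2)%N;rewrite muD;apply:iter_nil_mul hM hM' =>//;apply:lxM.
 by rewrite lxM e1 e1' fwD scalerDl [RHS]addrC -!scalerAr [z'.2 * _]mulrC.
have [ws pE wsD] : exists2 ws, p = \sum_(z <- ws) z.2 & forall z, z \in ws -> D z.
 move: p {pI};apply:mpoly_gen_ind =>[c|l|p q [s1 -> h1] [s2 -> h2]|p q [s1 -> h1] [s2 -> h2]].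
 - exists [:: (0, c%:MP)] =>[|z];first by rewrite big_seq1.
  rewrite inE => /eqP ->;split=> /=;first exists 1%N.
   rewrite /= lxC /mu big1 ?scale0r ?subrr // => i _;by rewrite ffunE mulr0z.
  by rewrite lxC /fw big1 ?scale0r // => i _;rewrite ffunE mul0r.
 - case/mxvec_indexP: l => a b;rewrite -gen_mxE.
  pose G z := (gen_mx k n *m map_mx (@mpolyC (n * n) k) z) a b.
  pose dl i : {ffun 'I_m -> int} := [ffun i' => (i' == i)%:R]. have mudl i : mu (dl i) = lam i.
   by rewrite /mu (bigD1 i) //= ffunE eqxx big1 ?addr0 // => j /negPf ji;rewrite ffunE ji mulr0z.
  have fwdl i : fw (dl i) = (f i)%:~R.
   congr (_%:~R);rewrite (bigD1 i) //= ffunE eqxx mul1r big1 ?addr0 // => j /negPf ji.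
   by rewrite ffunE ji mul0r.
  have GZ c z : c *: G z = G (c *: z).
   rewrite /G map_mxZ /= -scalemxAr [RHS]mxE;exact/esym/mul_mpolyC.
  have GB z z' : G z - G z' = G (z - z') by rewrite /G map_mxB mulmxBr [RHS]mxE [X in _ = _ + X]mxE.
  exists [seq (dl i, G (E i)) | i <- enum 'I_m].
   rewrite big_map big_enum /= -[gen_mx k n]mulmx1 -(map_mx1 (@mpolyC (n * n) k)) -E1.
   by rewrite map_mx_sum mulmx_sumr summxE.
  move=>_ /mapP[i _ ->];split=> /=;last by rewrite lx_gen_mul yE -[LHS]/(G _) -GZ fwdl.
  exists N;rewrite mudl.
  have itE M1 z : iter M1 (fun u => lx x u - lam i *: u) (G z) = G (mxp x (('X - (lam i)%:P) ^+ M1) *m z).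
   elim: M1 =>[|M1 IH];first by rewrite expr0 -polyC1 mxpC mul1mx.
   rewrite iterS IH lx_gen_mul GZ GB exprS mxpM mxp_subX -mulmxA mulmxBl mul_scalar_mx. by [].
  rewrite itE -mxpM (annih2 _ 0) =>[|j].
   by rewrite /mxp opoly0 /G raddf0 mulmx0 mxE.
  by rewrite subr0;have [->|ji] := eqVneq j i;[apply:dvdp_mulIl | apply:dvdp_mull;apply:e_dvd].
 - exists (s1 ++ s2);first by rewrite big_cat.
  by move=>z;rewrite mem_cat => /orP[/h1|/h2].
 exists [seq (z.1 + z'.1, z.2 * z'.2) | z <- s1, z' <- s2].
  by rewrite big_allpairs_dep /= big_distrlr.
 by move=>_ /allpairsP[[z z'] /= [/h1 hz /h2 hz' ->]];apply:D_mul.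
have [M' hM] : exists M', forall z, z \in ws -> iter M' (fun u => lx x u - mu z.1 *: u) z.2 = 0.
 elim: ws wsD {pE} =>[|z ws IH] wsD;first by exists 0%N.
 have [|M1 hM] := IH;first by move=>z' z's;apply:wsD;rewrite inE z's orbT.
 have [[M2 hM'] _] := wsD z (mem_head _ _);exists (M1 + M2)%N => z';rewrite inE => /orP[/eqP ->|/hM h'].
  by rewrite iterD hM' iter_opoly linear0.
 by rewrite addnC iterD h' iter_opoly linear0.
(* Since f kills the integral relations, [fw v] depends on [mu v] alone. Interpolating this
   dependence makes [lx y] act on p as a polynomial in [lx x], which preserves the ideal. *)
have [psi psiE] : exists psi : k -> k, forall z, z \in ws -> psi (mu z.1) = fw z.1.
 have h1 a : exists b, forall z, z \in ws -> mu z.1 = a -> b = fw z.1.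
  have [[z zs za]|no] := pselect (exists2 z, z \in ws & mu z.1 = a);last first.
   by exists 0 => z zs za;case:no;exists z.
  exists (fw z.1) => z' _ z'a;apply/eqP;rewrite -subr_eq0 -rmorphB.
  have : \sum_i lam i *~ (z.1 i - z'.1 i) = 0.
   by under eq_bigr => i _ do rewrite mulrzBr;rewrite sumrB -/(mu _) -/(mu _) za z'a subrr.
  move/hf => e2;rewrite -sumrB (eq_bigr (fun i => (z.1 i - z'.1 i) * f i)) ?e2 ?rmorph0 // => i _.
  by rewrite mulrBl.
 by exists (fun a => projT1 (cid (h1 a))) => z zs;apply:(projT2 (cid (h1 _))) zs erefl.
have [g hg] := crt_poly psi M' (undup_uniq [seq mu z.1 | z <- ws]).
suff -> : lx y p = opoly (lx x) g p.
 apply:(opoly_stable (S := ideal_of F)) =>// [g' _|a u v hu hv g' Fg'|u hu].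
 - exact:meval0.
 - by rewrite /mx_eval mevalD mevalZ -!/(mx_eval _ _) hu // hv // mulr0 addr0.
 - exact:lie_lx.
rewrite pE lx_sum linear_sum /= big_seq [RHS]big_seq;eqbig => z zs.
have [_ ->] := wsD z zs;apply/eqP;rewrite eq_sym -subr_eq0 -(psiE z zs) -scaleNr -(opolyC (lx x)) polyCN -opolyD.
apply/eqP;apply:opoly_dvd (hg (mu z.1) _) _;first by rewrite mem_undup;apply/mapP;exists z.
by rewrite -iter_opoly hM.
Qed.

(** * Engel's theorem on spaces of nilpotent matrices *)

Section Engel.
Variables (k : fieldType) (n : nat).
Implicit Types (S : {vspace 'M[k]_n}) (U : {vspace 'rV[k]_n}) (x y z s : 'M[k]_n).

Definition stable S U := forall s v, s \in S -> v \in U -> v *m s \in U.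

(** Engel's conclusion relative to every proper stable subspace U; this form can be iterated into a
    full flag. *)
Definition descends S := forall U, stable S U -> U != fullv ->
 exists v, v \notin U /\ forall s, s \in S -> v *m s \in U.

Lemma annihilator S U : exists U' : {vspace 'rV[k]_n},
 forall v, v \in U' <-> (forall s, s \in S -> v *m s \in U).
apply:vspace_of_set =>[s _|a u v hu hv s sS];first by rewrite mul0mx mem0v.
by rewrite mulmxDl -scalemxAl memvD // ?memvZ ?hu ?hv.
Qed.

Definition annih S U := projT1 (cid (annihilator S U)).

Lemma annihP S U v : v \in annih S U <-> (forall s, s \in S -> v *m s \in U).
exact:(projT2 (cid (annihilator S U)) v). Qed.

Definition flag S i := iter i (annih S) 0%VS.

Lemma flagS S i s v : s \in S -> v \in flag S i.+1 -> v *m s \in flag S i.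
by move=>sS /annihP;apply. Qed.

Lemma flag_sub S i j : (i <= j)%N -> (flag S i <= flag S j)%VS.
move=>ij;rewrite -(subnK ij);elim: (j - i)%N =>[|l IH];first by rewrite add0n.
rewrite addSn (subv_trans IH) //;elim: (l + i)%N =>[|l' IH'];first exact:sub0v.
apply/subvP => v vl;apply/annihP => s sS;exact:(subvP IH') (flagS sS vl).
Qed.

Lemma flag_full S : descends S -> flag S n = fullv.
move=>dS;have st i : stable S (flag S i).
 move=>s v sS vi;case:i vi =>[|i] vi;first by move: vi;rewrite /flag /= !memv0 => /eqP ->;rewrite mul0mx.
 exact:(subvP (flag_sub S (leqnSn i))) (flagS sS vi).
suff h i : (i <= n)%N -> (i <= \dim (flag S i))%N.
 apply/eqP;rewrite eqEdim subvf /= dimvf /dim /= mul1n;exact:h.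
elim: i =>// i IH lin;have le := IH (ltnW lin).
have [fi|fi] := eqVneq (flag S i) fullv.
 have := dimvS (flag_sub S (leqnSn i));rewrite fi dimvf /dim /= mul1n. by move/(leq_trans lin).
have [v [vi vS]] := dS _ (st i) fi;apply:leq_ltn_trans le _.
rewrite ltnNge;apply:contra vi => le.
have /eqP -> : flag S i == flag S i.+1 by rewrite eqEdim flag_sub.
by apply/annihP.
Qed.

Lemma iter_in (U : {vspace 'rV[k]_n}) (A : {vspace 'rV[k]_n}) y N : y ^+ N = 0 ->
 (forall v, v \in A -> v *m y \in A) -> (forall v, v \in U -> v *m y \in U) ->
 forall v, v \in A -> v \notin U -> exists w, [/\ w \in A, w \notin U & w *m y \in U].
move=>yN Ay Uy;have h M v : v \in A -> v \notin U -> v *m y ^+ M \in U ->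
  exists w, [/\ w \in A, w \notin U & w *m y \in U].
 elim: M v =>[|M IH] v vA vU;first by rewrite expr0 mulmx1 (negPf vU).
 rewrite exprS mulmxA;have [vy _|vy] := boolP (v *m y \in U);first by exists v.
 by apply:IH =>//;apply:Ay.
move=>v vA vU;have vN : v *m y ^+ N \in U by rewrite yN mulmx0 mem0v.
exact:h vA vU vN.
Qed.

(* Jacobson's form of Engel's argument: enlarge a maximal subspace with a common
  flag by an element that brackets it into itself. *)
Lemma engel (r : {vspace 'M[k]_n}) :
 (forall x y, x \in r -> y \in r -> x *m y - y *m x \in r) ->
 (forall x, x \in r -> exists N, x ^+ N = 0) -> descends r.
move=>rB rN;suff ext m S : (\dim r - \dim S <= m)%N -> (S <= r)%VS -> descends S -> descends r.
 apply:(ext _ 0%VS (leqnn _));first exact:sub0v. move=>U _ Un;have [v vU] : exists v, v \notin U.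
  have : ~~ (fullv <= U)%VS by apply:contra Un => h;rewrite eqEsubv subvf.
  by case/subvPn => v _ vU;exists v.
 by exists v;split=>// s;rewrite memv0 => /eqP ->;rewrite mulmx0 mem0v.
elim: m S =>[|m IH] S dm Sr dS.
 suff <- : S = r by []. by apply/eqP;rewrite eqEdim Sr -subn_eq0 -leqn0.
have [rS|/subvPn[x xr xS]] := boolP (r <= S)%VS.
 by suff <- : S = r by [];apply/eqP;rewrite eqEsubv Sr rS.
have [y [yr yS yB]] : exists y, [/\ y \in r, y \notin S & forall s, s \in S -> s *m y - y *m s \in S].
 (* [Fil l z]: z moves the flag of S down by l - n steps. Without a normalising y, brackets with S
    could be repeated outside S; each gains one step, and after 2n of them the element would be
    0. *)
 apply:contrapT => no. pose Fil l z := forall i v, v \in flag S i -> v *m z \in flag S (i + n - l).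
 have step l z : z \in r -> z \notin S -> Fil l z -> exists z', [/\ z' \in r, z' \notin S & Fil l.+1 z'].
  move=>zr zS zl;apply:contrapT => no';apply:no;exists z;split=>// s sS.
  apply:contrapT => /negP nz;apply:no';exists (s *m z - z *m s);split=>//.
   by apply:rB =>//;apply:(subvP Sr).
  move=>i v vi;rewrite mulmxBr !mulmxA;apply:memvB.
   case:i vi =>[|i] vi;first by move: vi;rewrite /flag /= memv0 => /eqP ->;rewrite !mul0mx mem0v.
   have := zl _ _ (flagS sS vi);apply:(subvP (flag_sub S _));lia.
  have := zl _ _ vi;case e: (i + n - l)%N =>[|j] vz.
   by move: vz;rewrite /flag /= memv0 => /eqP ->;rewrite mul0mx mem0v.
  have -> : (i + n - l.+1)%N = j by lia. exact:flagS vz.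
 have full := flag_full dS. have all l : exists z, [/\ z \in r, z \notin S & Fil l z].
  elim: l =>[|l [z [zr zS zl]]];last exact:step zl. exists x;split=>// i v _;rewrite subn0.
  have : (fullv <= flag S (i + n))%VS by rewrite -full flag_sub // leq_addl.
  by move/subvP;apply;apply:memvf.
 have [z [zr zS zl]] := all (n + n)%N;case/negP: zS. suff -> : z = 0 by apply:mem0v.
 apply/row_matrixP => i;rewrite row0 rowE. have := zl n (delta_mx 0 i);rewrite full => /(_ (memvf _)).
 by rewrite subnn /flag /= memv0 => /eqP.
apply:(IH (S + <[y]>)%VS).
- have lt : (\dim S < \dim (S + <[y]>))%N.
  rewrite ltnNge;apply:contra yS => le. have /eqP -> : (S == S + <[y]>)%VS by rewrite eqEdim addvSl le.
  by rewrite memvE addvSr.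
 have leV : (\dim (S + <[y]>) <= \dim r)%N by apply:dimvS;rewrite subv_add Sr -memvE. lia.
- by rewrite subv_add Sr -memvE.
move=>U stU Un;have SS s : s \in S -> s \in (S + <[y]>)%VS by apply/subvP/addvSl.
have yT : y \in (S + <[y]>)%VS by rewrite memvE addvSr.
have [v [vU vS]] := dS U (fun s v sS => stU s v (SS s sS)) Un.
have [N yN] := rN y yr.
(* As y brackets S into itself, it preserves the vectors that S sends into U; the last nonzero power
   of y on such a vector modulo U serves S and y together. *)
have [||w [wA wU wy]] := @iter_in U (annih S U) y N yN _ (fun v => stU y v yT) v _ vU.
- move=>v' /annihP v'S;apply/annihP => s sS.
 have -> : v' *m y *m s = v' *m s *m y - v' *m (s *m y - y *m s).
  by rewrite mulmxBr !mulmxA opprB addrC subrK.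
 by apply:memvB;[apply:stU (v'S _ sS) | apply/v'S/yB].
- exact/annihP.
exists w;split=>// _ /memv_addP[s sS [_ /vlineP[a ->] ->]].
by rewrite mulmxDr -scalemxAr;apply:memvD;[apply:(annihP _ _ _).1 wA _ sS | apply:memvZ].
Qed.

End Engel.

(** * Exponentials, connectedness and the unipotent radical *)

Section ExpPoly.
Variables (k : closedFieldType) (n : nat).

Definition peval (E : 'M[{poly k}]_n) (p : {mpoly k[n * n]}) : {poly k} :=
 mmap (@polyC k) (fun l => mxvec E 0 l) p.

Lemma peval_horner E p t : (peval E p).[t] = mx_eval p (map_mx (horner_eval t) E).
rewrite /peval /mx_eval;move: p.
apply:(mpoly_rmorph_eq (f := horner_eval t \o mmap (@polyC k) (fun l => mxvec E 0 l))
 (g := meval (mxvec (map_mx (horner_eval t) E) 0))) =>[c|l] /=. by rewrite mmapC mevalC /horner_eval hornerC.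
rewrite mmapX mmap1U mevalXU -map_mxvec mxE.
by [].
Qed.

Lemma peval_deriv E p : (peval E p)^`() = \sum_l peval E p^`M(l) * (mxvec E 0 l)^`().
move: p;apply:mpoly_gen_ind =>[c|l|p q hp hq|p q hp hq].
- rewrite /peval mmapC derivC big1 // => l _;by rewrite mderivC mmap0 mul0r.
- rewrite {1}/peval mmapX mmap1U (bigD1 l) //= big1 ?addr0 =>[|j jl].
  rewrite mderivX mnm1E eqxx scale1r (_ : 'X_[_] = 1) ?/peval ?rmorph1 ?mul1r // -mpolyX0.
  by congr 'X_[_];apply/mnmP => j;rewrite mnmBE subnn mnm0E.
 by rewrite mderivX mnm1E eq_sym (negPf jl) scale0r /peval rmorph0 mul0r.
- rewrite /peval rmorphD derivD /= -!/(peval _ _) hp hq -big_split /=.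
 by eqbig => l _;rewrite mderivD /peval rmorphD mulrDl.
rewrite /peval rmorphM derivM /= -!/(peval _ _) hp hq mulr_suml mulr_sumr -big_split /=.
by eqbig => l _;rewrite mderivM /peval rmorphD !rmorphM /=;ring.
Qed.

(** The chain rule along an integral curve E' = E x of the left-invariant field of x. *)
Lemma peval_lx (E : 'M[{poly k}]_n) p (x : 'M[k]_n) : (forall a b, (E a b)^`() = (E *m map_mx (@polyC k) x) a b) ->
 (peval E p)^`() = peval E (lx x p).
move=>hE;rewrite peval_deriv /lx /vfield /peval rmorph_sum /=;eqbig => l _.
rewrite rmorphM /=;congr (_ * _);case/mxvec_indexP: l => a b;rewrite !mxvecE hE !mxE.
rewrite rmorph_sum;eqbig => j _ /=;rewrite rmorphM /= gen_mxE.
by rewrite mmapX mmap1U mxvecE;congr (_ * _);rewrite !mxE mmapC.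
Qed.

Lemma poly_nat_zero (q : {poly k}) : has_pchar0 k -> (forall m, q.[m%:R] = 0) -> q = 0.
move=>/pcharf0P c0 q0;apply/eqP/negPn/negP => qn.
have ar : all (root q) [seq m%:R | m <- iota 0 (size q)].
 by apply/allP => _ /mapP[m _ ->];apply/rootP.
have ur : uniq [seq m%:R : k | m <- iota 0 (size q)].
 rewrite map_inj_in_uniq ?iota_uniq // => a b _ _ /eqP. wlog ab : a b / (a <= b)%N =>[h'|].
  by case/orP: (leq_total a b) => /h' // e;rewrite eq_sym => /e ->.
 by rewrite eq_sym -subr_eq0 -natrB // c0 subn_eq0 => ba;apply/eqP;rewrite eqn_leq ab.
by have := max_poly_roots qn ar ur;rewrite size_map size_iota ltnn.
Qed.

End ExpPoly.

Section Unipotent.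
Variables (k : closedFieldType) (n : nat) (char0 : has_pchar0 k).
Implicit Types (F : alg_group k n) (x z : 'M[k]_n).

Lemma unit_nilpotent z N : z ^+ N = 0 -> 1%:M + z \in unitmx.
move=>zN;rewrite -row_free_unit -kermx_eq0;apply/eqP/row_matrixP => i;rewrite row0.
set v := row i _;have /sub_kermxP : (v <= kermx (1%:M + z))%MS by apply:row_sub.
rewrite mulmxDr mulmx1 => /eqP;rewrite addrC addr_eq0 => /eqP vz.
have h M : v *m z ^+ M = (-1) ^+ M *: v.
 elim: M =>[|M IH];first by rewrite !expr0 mulmx1 scale1r.
 by rewrite exprSr mulmxA IH -scalemxAl vz exprSr -scalerA scaleN1r.
have := h N;rewrite zN mulmx0 => /esym/eqP;rewrite scaler_eq0 signr_eq0 => /eqP.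
by [].
Qed.

Lemma carrier_of_ideal F g : g \in unitmx -> (forall p, ideal_of F p -> mx_eval p g = 0) -> carrier F g.
move=>gu h;have [S FS] := carrier_closed F;rewrite FS;split=>// p Sp;apply:h => g'.
by rewrite FS => -[_];apply.
Qed.

Lemma char0_natf i : (i.+1)%:R != 0 :> k.
by have /pcharf0P -> := char0. Qed.

Lemma char0_fact i : i`!%:R != 0 :> k.
by have /pcharf0P -> := char0;rewrite -lt0n fact_gt0. Qed.

(** exp(t x) with t the polynomial variable; the truncation is exact when x^N = 0. *)
Definition expm N x : 'M[{poly k}]_n :=
 \sum_(i < N) ((i`!%:R)^-1 *: 'X^i) *: map_mx (@polyC k) (x ^+ i).

Lemma expm_deriv N x : x ^+ N = 0 -> forall a b,
 (expm N x a b)^`() = (expm N x *m map_mx (@polyC k) x) a b.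
case:N =>[|N] xN a b;first by rewrite /expm !big_ord0 mul0mx !mxE deriv0.
rewrite /expm mulmx_suml !summxE raddf_sum big_ord_recl big_ord_recr /=.
have -> : (((0`!%:R)^-1 *: 'X^0) *: map_mx (@polyC k) (x ^+ 0)) a b = ((0`!%:R)^-1 * (x ^+ 0) a b)%:P.
 by rewrite !mxE expr0 alg_polyC polyCM.
rewrite derivC add0r.
have -> : ((((N`!)%:R)^-1 *: 'X^N) *: map_mx (@polyC k) (x ^+ N) *m map_mx (@polyC k) x) a b = 0.
 by rewrite -scalemxAl -map_mxM -[x ^+ N *m x]/(x ^+ N * x) -exprSr xN mxE map_mx0 mxE mulr0.
rewrite addr0;eqbig => i _;rewrite -scalemxAl -map_mxM -[x ^+ i *m x]/(x ^+ i * x) -exprSr.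
rewrite mxE [in RHS]mxE /bump /= add1n derivM.
have -> : (map_mx (@polyC k) (x ^+ i.+1) a b) = ((x ^+ i.+1) a b)%:P by rewrite mxE.
rewrite derivC mulr0 addr0 derivZ derivXn /=;congr (_ * _).
by rewrite -scalerMnr -scaler_nat scalerA factS natrM invfM mulrA mulfV ?mul1r // char0_natf.
Qed.

Definition mx_at (E : 'M[{poly k}]_n) t : 'M[k]_n := map_mx (horner_eval t) E.

Lemma expm_at N x t : mx_at (expm N x) t = \sum_(i < N) ((i`!%:R)^-1 * t ^+ i) *: x ^+ i.
rewrite /mx_at /expm map_mx_sum;eqbig => i _.
by apply/matrixP => a b;rewrite !mxE /= /horner_eval !hornerE.
Qed.

(** All derivatives at t = 0 of p along the curve are values at 1 of iterates of [lx x] on p, hence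
    vanish; in characteristic 0 so do all coefficients. *)
Lemma expm_lie F N x p : x ^+ N = 0 -> (0 < N)%N -> x \in lie F -> ideal_of F p -> peval (expm N x) p = 0.
move=>xN N0 xF;have E0 : mx_at (expm N x) 0 = 1%:M.
 rewrite expm_at -(prednK N0) big_ord_recl expr0 fact0 invr1 mul1r scale1r expr0 big1 ?addr0 //.
 by move=>i _;rewrite /bump /= exprS mul0r mulr0 scale0r.
suff h m : forall p, ideal_of F p -> (peval (expm N x) p)`_m = 0.
 by move=>pF;apply/polyP => m;rewrite coef0 h.
elim: m =>[|m IH] q qF.
 by rewrite -horner_coef0 peval_horner -/(mx_at _ _) E0;apply:qF;apply:carrier1.
have := IH _ (lie_lx xF qF);rewrite -(peval_lx _ (expm_deriv xN)) coef_deriv => /eqP.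
by rewrite -mulr_natr mulf_eq0 (negPf (char0_natf m)) orbF => /eqP.
Qed.

(** If X were split into two closed parts, a product of an equation of one and an equation of the
    other would vanish along each curve through 1; as k[t] is a domain, one factor does. *)
Lemma curve_connected (X : set 'M[k]_n) : (forall u, X u -> exists E : 'M[{poly k}]_n,
  [/\ mx_at E 0 = 1%:M, mx_at E 1 = u & forall t, X (mx_at E t)]) -> zconnected X.
move=>hX;have key Y Y' : zclosed_in X Y -> zclosed_in X Y' -> (forall u, X u -> Y u \/ Y' u) ->
  forall u, Y 1%:M -> ~ Y' 1%:M -> X u -> Y u.
 move=>[S YS] [S' YS'] cov u Y1 Y'1 Xu;have [E [E0 E1 Et]] := hX u Xu.
 have pq p q : S p -> S' q -> peval E p = 0 \/ peval E q = 0.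
  move=>Sp Sq;have : peval E p * peval E q = 0.
   apply:poly_nat_zero =>// m;rewrite hornerM !peval_horner. have [|] := cov _ (Et m%:R).
    by rewrite YS => -[_ /(_ p Sp)];rewrite /mx_at => ->;rewrite mul0r.
   by rewrite YS' => -[_ /(_ q Sq)];rewrite /mx_at => ->;rewrite mulr0.
  by move/eqP;rewrite mulf_eq0 => /orP[/eqP|/eqP];[left|right].
 rewrite YS;split=>// p Sp;rewrite -E1 /mx_at -peval_horner.
 have [-> |p0] := eqVneq (peval E p) 0;first by rewrite horner0.
 case:Y'1;rewrite YS';split=>[|q Sq];first by rewrite -E0.
 rewrite -E0 /mx_at -peval_horner;have [/eqP|->] := pq p q Sp Sq;last by rewrite horner0.
 by rewrite (negPf p0).
move=>Y cY cY';have sub : Y `<=` X by case:cY => S ->;apply:subIset;left.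
have [Y1|Y1] := pselect (Y 1%:M).
 right;apply/seteqP;split=>// u Xu;apply:(key Y (X `\` Y)) =>//;last by case.
 by move=>v Xv;have [|] := pselect (Y v);[left | right].
have [[u Yu]|nY] := pselect (exists u, Y u);last first.
 by left;apply/seteqP;split=>// u Yu;case:nY;exists u.
have Xu := sub u Yu;have X1 : X 1%:M by have [E [<- _ ht]] := hX u Xu;apply:ht.
have cov v : X v -> (X `\` Y) v \/ Y v.
 by move=>Xv;have [|] := pselect (Y v);[right | left].
by have [_ /(_ Yu)] := key _ _ cY' cY cov u (conj X1 Y1) Y1 Xu.
Qed.

Lemma binomial_poly i : exists B : {poly k}, forall m, B.[m%:R] = ('C(m, i))%:R.
exists ((i`!%:R)^-1 *: \prod_(j < i) ('X - (j%:R)%:P)) => m.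
rewrite hornerZ horner_prod;apply:(mulfI (char0_fact i)).
rewrite mulrA mulfV ?char0_fact // mul1r -natrM mulnC bin_ffact ffact_prod.
have [im|mi] := leqP i m.
 rewrite natr_prod;eqbig => j _;rewrite hornerXsubC natrB //. by rewrite (leq_trans _ im) // ltnW.
rewrite -ffact_prod ffact_small //;apply/eqP;rewrite prodf_seq_eq0;apply/hasP.
by exists (Ordinal mi);rewrite ?mem_index_enum //= hornerXsubC subrr.
Qed.

Lemma pow_binomial N z m : z ^+ N = 0 ->
 (1%:M + z) ^+ m = \sum_(i < N) ('C(m, i))%:R *: z ^+ i.
case:N =>[|N] zN.
 have h0 (A : 'M[k]_n) : A = 0 by rewrite -[A]mulmx1 -[1%:M]/(z ^+ 0) zN mulmx0.
 by rewrite big_ord0;apply:h0.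
elim: m =>[|m IH].
 rewrite expr0 big_ord_recl bin0 scale1r expr0 big1 ?addr0 // => i _. by rewrite bin0n scale0r.
rewrite exprSr IH -[X in X = _]/((\sum_(i < N.+1) ('C(m, i))%:R *: z ^+ i) *m (1%:M + z)).
rewrite mulmxDr mulmx1 mulmx_suml [X in _ + X]big_ord_recr /=.
rewrite -scalemxAl -[z ^+ N *m z]/(z ^+ N * z) -exprSr zN scaler0 addr0.
rewrite !big_ord_recl !bin0 -addrA;congr (_ + _);rewrite -big_split;eqbig => i _ /=.
by rewrite /bump /= add1n binS natrD scalerDl -scalemxAl -[z ^+ i *m z]/(z ^+ i * z) -exprSr.
Qed.

Definition flag_nil (S : {vspace 'M[k]_n}) : set 'M[k]_n :=
 [set z | forall i v, v \in flag S i.+1 -> v *m z \in flag S i].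

Lemma flag_nil_pow S z : descends S -> flag_nil S z -> z ^+ n = 0.
move=>dS hz;have h M i v : v \in flag S (i + M) -> v *m z ^+ M \in flag S i.
 elim: M v =>[|M IH] v;first by rewrite addn0 expr0 mulmx1.
 by rewrite addnS exprS => /hz /IH;rewrite mulmxA.
apply/row_matrixP => i;rewrite row0 rowE.
have := h n 0%N (delta_mx 0 i);rewrite add0n flag_full // memvf => /(_ isT).
by rewrite /flag /= memv0 => /eqP.
Qed.

Lemma flag_nil_stable S z i v : flag_nil S z -> v \in flag S i -> v *m z \in flag S i.
move=>hz;case:i =>[|i];first by rewrite /flag /= !memv0 => /eqP ->;rewrite mul0mx.
by move=>/hz;apply:(subvP (flag_sub S (leqnSn i))).
Qed.

Lemma flag_nilM S z z' : flag_nil S z -> flag_nil S z' -> flag_nil S (z *m z').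
by move=>hz hz' i v /hz vz;rewrite mulmxA;apply:flag_nil_stable. Qed.

Lemma flag_nilP S a z z' : flag_nil S z -> flag_nil S z' -> flag_nil S (a *: z + z').
by move=>hz hz' i v vi;rewrite mulmxDr -scalemxAr memvD // ?memvZ ?hz ?hz'.
Qed.

Lemma flag_nil0 S : flag_nil S 0.
by move=>i v _;rewrite mulmx0 mem0v. Qed.

Lemma flag_nil_powS S z i : flag_nil S z -> flag_nil S (z ^+ i.+1).
by move=>hz;elim: i =>// i IH;rewrite exprS;apply:flag_nilM. Qed.

Lemma flag_nil_sum S (I : Type) (s : seq I) (P : pred I) (G : I -> 'M[k]_n) :
 (forall i, P i -> flag_nil S (G i)) -> flag_nil S (\sum_(i <- s | P i) G i).
move=>h;apply:(big_ind (flag_nil S)) =>// [|u v hu hv];first exact:flag_nil0.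
by rewrite -[u]scale1r;apply:flag_nilP.
Qed.

Section Radical.
Variables (F : alg_group k n) (r : {vspace 'M[k]_n}).
Hypothesis r_Ad : forall g x, carrier F g -> x \in r -> Ad g x \in r.
Hypothesis r_desc : descends r.

Lemma flag_carrier g i v : carrier F g -> v \in flag r i -> v *m g \in flag r i.
move=>Fg;elim: i v =>[|i IH] v;first by rewrite /flag /= !memv0 => /eqP ->;rewrite mul0mx.
move=>/annihP vi;apply/annihP => s sr.
have -> : v *m g *m s = v *m Ad g s *m g.
 by rewrite /Ad !mulmxA mulmxKV // (carrier_unit Fg).
by apply:IH;apply:vi;apply:r_Ad.
Qed.

(** The elements of F that are unitriangular for the flag of r: a connected normal unipotent
    subgroup which receives the exponentials of r when r lies in Lie F. *)
Definition radical_carrier : set 'M[k]_n := [set g | carrier F g /\ flag_nil r (g - 1%:M)].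

Lemma radical_unit g : radical_carrier g -> g \in unitmx.
by move=>[/carrier_unit]. Qed.

Lemma radical1 : radical_carrier 1%:M.
by split;[apply:carrier1 | rewrite subrr;apply:flag_nil0]. Qed.

Lemma radicalM g h : radical_carrier g -> radical_carrier h -> radical_carrier (g *m h).
move=>[Fg ng] [Fh nh];split;first exact:carrierM.
have -> : g *m h - 1%:M = 1 *: (g - 1%:M) + (1 *: (h - 1%:M) + (g - 1%:M) *m (h - 1%:M)).
 have -> : (g - 1%:M) *m (h - 1%:M) = g *m h - g - (h - 1%:M).
  by rewrite mulmxBl mulmxBr mul1mx mulmx1.
 by rewrite !scale1r [X in _ = _ + X]addrC subrK [RHS]addrC addrA subrK.
by apply:flag_nilP =>//;apply:flag_nilP =>//;apply:flag_nilM.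
Qed.

Lemma radicalV g : radical_carrier g -> radical_carrier (invmx g).
move=>[Fg ng];have ug := carrier_unit Fg;split;first exact:carrierV.
have st i v : v \in flag r i -> v *m invmx g \in flag r i.
 elim: i v =>[|i IH] v vi;first by move: vi;rewrite /flag /= !memv0 => /eqP ->;rewrite mul0mx.
 have -> : v *m invmx g = v - v *m (g - 1%:M) *m invmx g.
  by rewrite mulmxBr mulmx1 mulmxBl mulmxK // opprB addrCA subrr addr0.
 apply:memvB =>//;apply:(subvP (flag_sub r (leqnSn i)));apply:IH;exact:ng.
move=>i v vi;have -> : v *m (invmx g - 1%:M) = - (v *m (g - 1%:M) *m invmx g).
 by rewrite !mulmxBr mulmx1 mulmxBl mulmxK // opprB.
by rewrite memvN;apply:st;apply:ng.
Qed.

Lemma radical_closed : zclosed_in [set g | g \in unitmx] radical_carrier.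
have [S FS] := carrier_closed F.
have [J JP] := vspace_of_set (@flag_nil0 r) (fun a u v => @flag_nilP r a u v).
(* The strictly triangular matrices form a linear space J, so the condition on g is the system of
   linear equations T g = T 1. *)
pose T z := z - projv J z.
have TP a u v : T (a *: u + v) = a *: T u + T v.
 by rewrite /T linearP scalerBr opprD addrACA.
pose TL : {linear 'M[k]_n -> 'M[k]_n} := HB.pack T (GRing.isLinear.Build _ _ _ _ T TP).
have T0 z : T z = 0 <-> flag_nil r z.
 split=>[/eqP|/JP zJ];last by rewrite /T projv_id // subrr.
 by rewrite subr_eq0 => /eqP ->;apply/JP/memv_proj.
have [c [c1 _]] := lin_sub TL.
exists (S `|` [set p | exists l, p = ('X_l \mPo c) - (mxvec (T 1%:M) 0 l)%:MP]).
apply/seteqP;split=>[g [Fg ng]|g [ug hg]].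
 split=>[|p];first exact:carrier_unit Fg. move=>[Sp|[l ->]];first by move: Fg;rewrite FS => -[_];apply.
 rewrite mx_evalB /mx_eval c1 mevalXU mevalC;apply/eqP;rewrite subr_eq0;apply/eqP.
 congr (mxvec _ _ _);apply/eqP;rewrite -subr_eq0 -scaleN1r addrC -TP scaleN1r addrC. by apply/eqP/T0.
split;first by rewrite FS;split=>// p Sp;apply:hg;left.
apply/T0;have -> : T (g - 1%:M) = T g - T 1%:M.
 by rewrite -[g - _]addrC -scaleN1r TP scaleN1r addrC.
apply/eqP;rewrite subr_eq0;apply/eqP/(can_inj mxvecK)/rowP => l;apply/eqP;rewrite -subr_eq0.
have := hg (('X_l \mPo c) - (mxvec (T 1%:M) 0 l)%:MP);rewrite mx_evalB /mx_eval c1 mevalXU mevalC.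
by move=>h;apply/eqP/h;right;exists l.
Qed.

Definition radical_group : alg_group k n :=
 AlgGroup radical_unit radical1 radicalM radicalV radical_closed.

Lemma radical_normal : normal_in F radical_group.
split=>[g []//|g u Fg [Fu nu]];split.
 by apply:carrierM;[apply:carrierM | apply:carrierV].
have ug := carrier_unit Fg.
have -> : g *m u *m invmx g - 1%:M = g *m (u - 1%:M) *m invmx g.
 by rewrite mulmxBr mulmxBl mulmx1 mulmxV.
move=>i v vi;rewrite !mulmxA;apply:flag_carrier;first exact:carrierV.
by apply:nu;apply:flag_carrier.
Qed.

Lemma radical_unipotent : unipotent radical_group.
by move=>u [_ nu];exists n;apply:flag_nil_pow nu. Qed.

(** The curve t |-> u^t, with binomial coefficients as polynomials in t. It lies in F at every
    natural number, hence for every t, since an equation of F restricts to a polynomial with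
    infinitely many zeros. *)
Lemma radical_connected : zconnected radical_group.
apply:curve_connected => u [Fu nu];pose z := u - 1%:M.
have zn : z ^+ n = 0 by apply:flag_nil_pow nu.
have zn1 : z ^+ n.+1 = 0 by rewrite exprS zn mulr0.
have : forall i : 'I_n.+1, exists B : {poly k}, forall m, B.[m%:R] = ('C(m, i))%:R.
 by move=>i;apply:binomial_poly.
move/fin_all_exists =>[B BE].
pose E : 'M[{poly k}]_n := \sum_(i < n.+1) B i *: map_mx (@polyC k) (z ^+ i).
have Eat t : mx_at E t = \sum_(i < n.+1) (B i).[t] *: z ^+ i.
 rewrite /mx_at /E map_mx_sum;eqbig => i _. by apply/matrixP => a b;rewrite !mxE /= /horner_eval !hornerE.
have Em m : mx_at E m%:R = u ^+ m.
 rewrite Eat -[u](subrK 1%:M) addrC (pow_binomial m zn1);eqbig => i _. by rewrite BE.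
have Fum m : carrier F (u ^+ m).
 by elim: m =>[|m IH];[rewrite expr0;apply:carrier1 | rewrite exprS;apply:carrierM].
exists E;split=>[||t].
- by rewrite -[0]/(0%:R) Em expr0.
- by rewrite -[1]/(1%:R) Em expr1.
have B0 : (B ord0).[t] = 1.
 have : B ord0 - 1%:P = 0 by apply:poly_nat_zero =>// m;rewrite hornerD hornerN hornerC BE bin0 subrr.
 by move/eqP;rewrite subr_eq0 => /eqP ->;rewrite hornerC.
have nE : flag_nil r (mx_at E t - 1%:M).
 rewrite Eat big_ord_recl expr0 B0 scale1r addrAC subrr add0r;apply:flag_nil_sum => i _.
 by rewrite -[_ *: _]addr0;apply:flag_nilP;[apply:flag_nil_powS | apply:flag_nil0].
split=>//;apply:carrier_of_ideal =>[|p pF].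
 by rewrite -[mx_at E t](subrK 1%:M) addrC;apply:unit_nilpotent (flag_nil_pow r_desc nE).
suff : peval E p = 0 by move=>p0;have := peval_horner E p t;rewrite p0 horner0.
by apply:poly_nat_zero =>// m;rewrite peval_horner -/(mx_at E _) Em;apply:pF.
Qed.

End Radical.

(* A nonzero one would exponentiate into the unipotent radical. *)
Lemma nil_lie_trivial F (r : {vspace 'M[k]_n}) : reductive F -> (r <= lie F)%VS ->
 (forall x y, x \in r -> y \in r -> x *m y - y *m x \in r) ->
 (forall g x, carrier F g -> x \in r -> Ad g x \in r) ->
 (forall x, x \in r -> exists N, x ^+ N = 0) -> forall x, x \in r -> x = 0.
move=>redF rF rB rA rN x xr;have rd := engel rB rN.
have U1 : carrier (radical_group F r) = [set 1%:M].
 by apply:redF;[exact:radical_normal | exact:radical_connected | exact:radical_unipotent].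
have nx : flag_nil r x by move=>i v;apply:flagS.
have xn : x ^+ n.+1 = 0 by rewrite exprS (flag_nil_pow rd nx) mulr0.
pose E := expm n.+1 x.
(* The whole exponential curve lies in the unipotent radical, which is trivial; so it is constant,
   and its derivative E x is 0. *)
have E_1 t : mx_at E t = 1%:M.
 suff : radical_carrier F r (mx_at E t) by rewrite -[radical_carrier F r]/(carrier (radical_group F r)) U1.
 have nE : flag_nil r (mx_at E t - 1%:M).
  rewrite expm_at big_ord_recl !expr0 fact0 invr1 mul1r scale1r addrAC subrr add0r;apply:flag_nil_sum => i _.
  by rewrite -[_ *: _]addr0;apply:flag_nilP;[apply:flag_nil_powS | apply:flag_nil0].
 split=>//;apply:carrier_of_ideal =>[|p pF].
  by rewrite -[mx_at E t](subrK 1%:M) addrC;apply:unit_nilpotent (flag_nil_pow rd nE).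
 have := peval_horner E p t;rewrite (expm_lie xn isT _ pF) ?horner0 //. exact:(subvP rF).
have dE a b : (E a b)^`() = 0.
 have -> : E a b = (1%:M a b)%:P;last exact:derivC. apply:subr0_eq;apply/poly_nat_zero =>// m.
 by rewrite hornerD hornerN hornerC -(E_1 m%:R) mxE subrr.
have Ex : E *m map_mx (@polyC k) x = 0.
 by apply/matrixP => a b;rewrite -(expm_deriv xn) dE mxE.
have := congr1 (map_mx (horner_eval 0)) Ex;rewrite map_mxM -/(mx_at E 0) E_1 mul1mx map_mx0.
by rewrite -map_mx_comp => <-;apply/matrixP => a b;rewrite mxE /= /horner_eval hornerC.
Qed.

End Unipotent.

Lemma noetherian_subset (R : comNzRingType) (P : set R) : noetherian R ->
 exists2 s : seq R, (forall f, f \in s -> P f) & forall f, P f -> ideal_gen s f.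
move=>nR;pose J := [set f | exists2 s : seq R, (forall g, g \in s -> P g) & ideal_gen s f].
have iJ : is_ideal J.
 split;first by exists [::] =>//;apply:ideal0;apply:ideal_gen_ideal.
  move=>f g [s sP sf] [t tP tg];exists (s ++ t).
   by move=>h;rewrite mem_cat => /orP[/sP|/tP].
  apply:idealD;first exact:ideal_gen_ideal.
   by apply:ideal_genS sf => h hs;rewrite mem_cat hs.
  by apply:ideal_genS tg => h hs;rewrite mem_cat hs orbT.
 by move=>f g [s sP sg];exists s =>//;apply:idealM =>//;apply:ideal_gen_ideal.
have [s sJ Js] := noetherian_gens nR iJ.
suff [t tP st] : exists2 t : seq R, (forall f, f \in t -> P f) & forall g, g \in s -> ideal_gen t g.
 exists t =>// f Pf;have /Js : J f.
  by exists [:: f];[move=>g;rewrite inE => /eqP -> | apply:mem_ideal_gen;rewrite inE].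
 by apply:ideal_gen_sub =>//;apply:ideal_gen_ideal.
elim: s sJ {Js} =>[|g s IH] sJ;first by exists [::].
have [|t tP st] := IH;first by move=>a h;apply:sJ;rewrite inE h orbT.
have [t' t'P st'] := sJ g (mem_head _ _);exists (t' ++ t).
 by move=>f;rewrite mem_cat => /orP[/t'P|/tP].
move=>a;rewrite inE => /orP[/eqP ->|/st h].
 by apply:ideal_genS st' => f h;rewrite mem_cat h.
by apply:ideal_genS h => f h;rewrite mem_cat h orbT.
Qed.

(** * Tangent spaces at a point and isolated points *)

Section PointIdeal.
Variables (k : fieldType) (m : nat) (a : 'I_m -> k).
Implicit Types p : {mpoly k[m]}.

Definition point_ideal : set {mpoly k[m]} := [set p | p.@[a] = 0].

Lemma point_ideal_ideal : is_ideal point_ideal.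
split=>[|p q|p q];rewrite /point_ideal /=;first exact:meval0.
 by rewrite mevalD => -> ->;rewrite addr0.
by rewrite mevalM => ->;rewrite mulr0.
Qed.

Lemma taylor1 p :
 ipow point_ideal 2 (p - (p.@[a])%:MP - \sum_l ((p^`M(l)).@[a])%:MP * ('X_l - (a l)%:MP)).
have iI := point_ideal_ideal;have iI2 := ipow_ideal 2 iI.
pose d p := \sum_l ((p^`M(l)).@[a])%:MP * ('X_l - (a l)%:MP) : {mpoly k[m]}.
have Id q : point_ideal (d q).
 by apply:ideal_sum =>// l _;apply:idealM =>//;rewrite /point_ideal /= mevalB mevalXU mevalC subrr.
rewrite -/(d p);move: p;apply:mpoly_gen_ind =>[c|l|p q hp hq|p q hp hq].
- rewrite mevalC subrr /d big1 ?subr0;first exact:ideal0.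
 by move=>l _;rewrite mderivC meval0 mpolyC0 mul0r.
- have -> : d 'X_l = 'X_l - (a l)%:MP;last by rewrite mevalXU subrr;apply:ideal0.
 rewrite /d (bigD1 l) //= big1 ?addr0 =>[|j jl];rewrite mderivX mnm1E.
  rewrite eqxx scale1r (_ : 'X_[_] = 1) ?meval1 ?mpolyC1 ?mul1r // -mpolyX0.
  by congr 'X_[_];apply/mnmP => j;rewrite mnmBE subnn mnm0E.
 by rewrite eq_sym (negPf jl) scale0r meval0 mpolyC0 mul0r.
- have -> : d (p + q) = d p + d q.
  by rewrite /d -big_split;eqbig => l _;rewrite mderivD mevalD mpolyCD mulrDl.
 rewrite mevalD mpolyCD. have -> : p + q - ((p.@[a])%:MP + (q.@[a])%:MP) - (d p + d q) =
  (p - (p.@[a])%:MP - d p) + (q - (q.@[a])%:MP - d q) by ring.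
 exact:idealD.
have -> : d (p * q) = (p.@[a])%:MP * d q + (q.@[a])%:MP * d p.
 rewrite /d !mulr_sumr -big_split;eqbig => l _.
 have -> : ((p * q)^`M(l)).@[a] = p.@[a] * (q^`M(l)).@[a] + q.@[a] * (p^`M(l)).@[a].
  by rewrite mderivM mevalD !mevalM;ring.
 by rewrite mpolyCD !mpolyCM mulrDl !mulrA.
rewrite mevalM mpolyCM.
have -> : p * q - (p.@[a])%:MP * (q.@[a])%:MP - ((p.@[a])%:MP * d q + (q.@[a])%:MP * d p) =
  q * (p - (p.@[a])%:MP - d p) + (p.@[a])%:MP * (q - (q.@[a])%:MP - d q) +
  (q - (q.@[a])%:MP) * d p by ring.
apply:idealD =>//;first by apply:idealD =>//;apply:idealM.
apply:ipowMM =>//.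
by rewrite /point_ideal /= mevalB mevalC subrr.
Qed.

(* Double annihilator: covectors that kill the tangent space of I are differentials. *)
Lemma differential_of_ideal (I : set {mpoly k[m]}) (v : 'rV[k]_m) : is_ideal I ->
 (forall w, (forall q, I q -> mdiff q a w = 0) -> \sum_j v 0 j * w j = 0) ->
 exists2 q, I q & forall j, (q^`M(j)).@[a] = v 0 j.
move=>iI tan;pose P : set 'rV[k]_m := [set v | exists2 q, I q & forall j, (q^`M(j)).@[a] = v 0 j].
have P0 : P 0 by exists 0 =>[|j];[apply:ideal0 | rewrite mderiv0 meval0 mxE].
have PL c u w : P u -> P w -> P (c *: u + w).
 move=>[q Iq qu] [q' Iq' qv];exists (c%:MP * q + q').
  by apply:idealD =>//;apply:idealM.
 by move=>j;rewrite mul_mpolyC mderivD mderivZ mevalD mevalZ qu qv !mxE.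
have [U UP] := vspace_of_set P0 PL.
have [A AU] : exists A : 'M[k]_m, forall v : 'rV_m, (v <= A)%MS <-> v \in U.
 exists (\matrix_i projv U (delta_mx 0 i)) => u;split=>[/submxP[w ->]|uU].
  rewrite mulmx_sum_row;apply:memv_suml => i _;rewrite rowK;apply:memvZ;exact:memv_proj.
 apply/submxP;exists u;rewrite mulmx_sum_row -{1}(projv_id uU) {1}[u]row_sum_delta linear_sum /=.
 by eqbig => i _;rewrite linearZ rowK.
apply/UP/AU;rewrite submxE;apply/eqP/rowP => j.
rewrite [RHS]mxE mxE;apply:(tan (fun i => cokermx A i j)) => q Iq;have /AU : \row_i (q^`M(i)).@[a] \in U.
 by apply/UP;exists q =>// i;rewrite mxE.
rewrite submxE => /eqP/rowP/(_ j);rewrite [RHS]mxE mxE => e;rewrite -[RHS]e.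
by eqbig => i _;congr (_ * _);rewrite mxE.
Qed.

(* Nakayama: a point where the ideal I has no tangent vector is isolated in its zero set. *)
Lemma isolated_point (I : set {mpoly k[m]}) : is_ideal I ->
 (forall w, (forall q, I q -> mdiff q a w = 0) -> w = (fun=> 0)) -> I `<=` point_ideal ->
 exists2 t, t.@[a] != 0 & forall l, I (t * ('X_l - (a l)%:MP)).
move=>iI tan IM;have iM := point_ideal_ideal;have nP := mpoly_noetherian (n := m) (@field_noetherian k).
have diffq l : exists2 q, I q & forall j, (q^`M(j)).@[a] = (l == j)%:R.
 have [|q Iq qd] := @differential_of_ideal I (delta_mx 0 l) iI.
  by move=>w /tan ->;rewrite big1 // => j _;rewrite mulr0.
 by exists q =>// j;rewrite qd mxE eqxx eq_sym.
have step T f : ipow point_ideal T.+1 f -> exists2 g, ipow point_ideal T.+2 g & I (f - g).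
 have iT := ipow_ideal T.+2 iM. pose K := [set f | exists2 g, ipow point_ideal T.+2 g & I (f - g)].
 suff sub : ipow point_ideal T.+1 `<=` K by apply:sub. have iK : is_ideal K.
  split.
  - by exists 0;rewrite ?subrr;apply:ideal0.
  - move=>p q [g hg Ig] [g' hg' Ig'];exists (g + g');first exact:(idealD iT).
   by rewrite opprD addrACA;apply:idealD.
  - move=>p q [g hg Ig];exists (p * g);first exact:(idealM _ iT).
   by rewrite -mulrBr;apply:idealM.
 (* Absence of tangent vectors makes every covector the differential of an element of I; with the
    Taylor expansion the point ideal m is contained in m^2 + I. *)
 have MK b : point_ideal b -> exists2 g, ipow point_ideal 2 g & I (b - g).
  have i2 := ipow_ideal 2 iM. have MX l : exists2 g, ipow point_ideal 2 g & I ('X_l - (a l)%:MP - g).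
   have [q Iq qd] := diffq l;have := taylor1 q;rewrite (IM _ Iq) mpolyC0 subr0.
   rewrite (bigD1 l) //= qd eqxx mpolyC1 mul1r big1 ?addr0 =>[h|j /negPf jl];last first.
    by rewrite qd eq_sym jl mpolyC0 mul0r.
   exists ('X_l - (a l)%:MP - q);last by rewrite opprB addrC subrK. by rewrite -opprB;apply:idealN.
  move=>b0;have := taylor1 b;rewrite b0 mpolyC0 subr0 => h.
  have [g [hg Ig]] : exists g, ipow point_ideal 2 g /\ I (\sum_l ((b^`M(l)).@[a])%:MP * ('X_l - (a l)%:MP) - g).
   apply:(big_ind (fun z => exists g, ipow point_ideal 2 g /\ I (z - g))).
   - by exists 0;split;rewrite ?subrr;apply:ideal0.
   - move=>p q [g [hg Ig]] [g' [hg' Ig']];exists (g + g');split;first exact:(idealD i2).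
    by rewrite opprD addrACA;apply:idealD.
   - move=>l _;have [g hg Ig] := MX l;exists (((b^`M(l)).@[a])%:MP * g);split.
     exact:(idealM _ i2).
    by rewrite -mulrBr;apply:idealM.
  exists (b - \sum_l ((b^`M(l)).@[a])%:MP * ('X_l - (a l)%:MP) + g);first exact:(idealD i2).
  by rewrite opprD opprB addrA addrCA subrr addr0.
 apply:ideal_mul_min =>// b c /MK[g hg Ig] hc;exists (g * c).
  by rewrite -[T.+2]/(2 + T)%N;apply:ipowM.
 by rewrite -mulrBl;apply:idealMr.
have iso l : exists2 u, point_ideal u & I ((1 - u) * ('X_l - (a l)%:MP)).
 apply:(krull_intersection nP iM iI);elim=>[|T [g hg Ig]].
  by exists ('X_l - (a l)%:MP);rewrite ?subrr //;apply:ideal0.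
 case:T hg =>[|T] hg.
  exists ('X_l - (a l)%:MP);last by rewrite subrr;apply:ideal0.
  by rewrite ipow1 // /point_ideal /= mevalB mevalXU mevalC subrr.
 have [g' hg' Ig'] := step T g hg;exists g' =>//.
 by rewrite -[_ - g'](subrK g) addrAC;have := idealD iI Ig Ig';rewrite addrA subrK addrAC subrK.
have : forall l, exists u, point_ideal u /\ I ((1 - u) * ('X_l - (a l)%:MP)).
 by move=>l;have [u u0 Iu] := iso l;exists u.
move/fin_all_exists =>[u hu];exists (\prod_l (1 - u l)) =>[|l].
 rewrite rmorph_prod;apply/prodf_neq0 => l _ /=. by rewrite mevalB meval1 (proj1 (hu l)) subr0 oner_eq0.
rewrite (bigD1 l) //= mulrAC;apply:idealMr =>//;by case:(hu l).
Qed.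

End PointIdeal.

(** * Representations on which the Lie algebra acts trivially *)

Section FiniteImage.
Variables (k : closedFieldType) (n w : nat) (char0 : has_pchar0 k).
Variables (F : alg_group k n) (B : 'M[k]_(w, n)) (C : 'M[k]_(n, w)).
Hypotheses (BC : B *m C = 1%:M) (BF : forall g, carrier F g -> B *m g = (B *m g *m C) *m B).

(** Matrices act on row vectors from the right. The rows of B are a basis of an F-stable subspace W,
    C is a right inverse of B, and [rho g] is the matrix of g on W. *)
Let rho g := B *m g *m C.

Lemma restr1 : rho 1%:M = 1%:M.
by rewrite /rho mulmx1. Qed.

Lemma restrM g h : carrier F g -> rho (g *m h) = rho g *m rho h.
by move=>Fg;rewrite /rho mulmxA [in LHS]BF // !mulmxA. Qed.

Hypothesis BL : forall x, x \in lie F -> B *m x = 0.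

(** The field g |-> rho g z is tangent to the image, so at some g it lifts to a tangent vector of F;
    translated to 1 it lies in Lie F and acts on W by 0. Hence rho g z = 0. *)
Lemma restr_tangent (z : 'M[k]_w) :
 (forall q : {mpoly k[w * w]}, (forall g, carrier F g -> mx_eval q (rho g) = 0) ->
   mdiff q (mxvec 1%:M 0) (mxvec z 0) = 0) -> z = 0.
move=>hz;pose V : set ('I_(n * n) -> k) := [set u | carrier F (vec_mx (\row_i u i))].
have uE (u : 'I_(n * n) -> k) i : mxvec (vec_mx (\row_i u i)) 0 i = u i by rewrite vec_mxK mxE.
have VF g : carrier F g -> V (mxvec g 0).
 by move=>Fg;rewrite /V /= (_ : \row_i _ = mxvec g) ?mxvecK //;apply/rowP => i;rewrite mxE.
pose R1 (y : 'M[k]_n) := B *m y *m C;pose R2 (y : 'M[k]_n) := B *m y *m C *m z.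
have R1P a u v : R1 (a *: u + v) = a *: R1 u + R1 v.
 by rewrite /R1 mulmxDr mulmxDl -scalemxAr -scalemxAl.
have R2P a u v : R2 (a *: u + v) = a *: R2 u + R2 v.
 by rewrite /R2 -!/(R1 _) R1P mulmxDl -scalemxAl.
pose R1L : {linear 'M[k]_n -> 'M[k]_w} := HB.pack R1 (GRing.isLinear.Build _ _ _ _ R1 R1P).
pose R2L : {linear 'M[k]_n -> 'M[k]_w} := HB.pack R2 (GRing.isLinear.Build _ _ _ _ R2 R2P).
have [c [c1 c2]] := lin_sub R1L;have [c' [c'1 c'2]] := lin_sub R2L.
have [S FS] := carrier_closed F.
pose sV : {mpoly k[n * n]} := \det (gen_mx k n).
have sVE g : mx_eval sV g = \det g.
 by rewrite /mx_eval /sV -det_map_mx gen_mx_eval.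
have evE (p : {mpoly k[n * n]}) u : p.@[u] = mx_eval p (vec_mx (\row_i u i)).
 by rewrite /mx_eval;apply:meval_eq => i;rewrite uE.
have Vs u : V u -> sV.@[u] != 0.
 by move=>/carrier_unit;rewrite evE sVE unitmxE unitfE.
have Vc u : sV.@[u] != 0 -> (forall f, vanish V f -> f.@[u] = 0) -> V u.
 rewrite evE sVE => du hu;rewrite /V /= FS;split;first by rewrite /= unitmxE unitfE.
 move=>p Sp;rewrite -evE;apply:hu => v;rewrite /V /= FS => -[_ /(_ p Sp)]. by rewrite -evE.
have [|q|u [v [Vu tv cv]]] := @tangent_lift k _ _ V sV c Vs Vc (fun i => 'X_i \mPo c') char0.
- by exists (mxvec 1%:M 0);apply/VF/carrier1.
- move=>hq u Vu;pose g := vec_mx (\row_i u i);have Fg : carrier F g by [].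
 have ug : u =1 mxvec g 0 by move=>i;rewrite uE.
 have -> : (\sum_i (q^`M(i) \mPo c) * ('X_i \mPo c')).@[u] = mdiff q (mxvec (rho g) 0) (mxvec (rho g *m z) 0).
  rewrite rmorph_sum;eqbig => i _ /=. by rewrite mevalM !(meval_eq (v1 := u) _ ug) c1 c'1 mevalXU.
 have [e [e1 e2]] := lin_sub (mulmx (rho g)).
 rewrite -[X in mxvec X 0]mulmx1 -e2;apply:hz => h Fh;rewrite /mx_eval e1.
 by have := hq _ (VF _ (carrierM Fg Fh));rewrite c1 -[R1L _]/(rho (g *m h)) restrM.
pose g := vec_mx (\row_i u i);have Fg : carrier F g by [].
have ug : u =1 mxvec g 0 by move=>i;rewrite uE.
pose y := vec_mx (\row_i v i);have vy : v =1 mxvec y 0 by move=>i;rewrite vec_mxK mxE.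
have gy : invmx g *m y \in lie F.
 apply/lieP => p pF;have [e [e1 e2]] := lin_sub (mulmx (invmx g)).
 rewrite -[1%:M](mulVmx (carrier_unit Fg)) -e2. rewrite -(eq_mdiff _ ug vy);apply:tv => u' Vu'.
 rewrite evE /mx_eval e1;apply:pF;apply:carrierM =>//;exact:carrierV.
have By : B *m y = 0.
 have -> : B *m y = (B *m g *m C) *m (B *m (invmx g *m y)).
  by rewrite [RHS]mulmxA -BF // -mulmxA mulKVmx // (carrier_unit Fg).
 by rewrite (BL gy) mulmx0.
have gz : rho g *m z = 0.
 apply:(can_inj mxvecK);rewrite linear0;apply/rowP => i.
 have := cv i;rewrite (eq_mdiff _ ug vy) (meval_eq (v1 := u) _ ug) c'1 mevalXU => <-.
 have -> : tnth c i = 'X_i \mPo c by rewrite comp_mpolyXU -tnth_nth.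
 by rewrite c2 mdiffX -[R1L y]/(B *m y *m C) By mul0mx linear0.
have FV := carrierV Fg.
by rewrite -[z]mul1mx -restr1 -(mulVmx (carrier_unit Fg)) restrM // -mulmxA gz mulmx0.
Qed.

(** The identity is isolated in the image: there t is nonzero only at 1. At each point of the image
    some translate of t is nonzero, and finitely many translates suffice because they generate the
    ideal of all of them. *)
Lemma finite_image : exists s : seq 'M[k]_w, [/\ uniq s,
 forall y, y \in s -> exists2 g, carrier F g & y = rho g & forall g, carrier F g -> rho g \in s].
pose I := [set q : {mpoly k[w * w]} | forall g, carrier F g -> mx_eval q (rho g) = 0].
have iI : is_ideal I.
 split=>[g _|p q hp hq g Fg|p q hq g Fg];rewrite /mx_eval;first exact:meval0.
  by rewrite mevalD -!/(mx_eval _ _) hp // hq // addr0.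
 by rewrite mevalM -!/(mx_eval _ _) hq // mulr0.
have [|q Iq|t t1 tI] := @isolated_point k _ (mxvec 1%:M 0) I iI.
- move=>v hv;have v0 : vec_mx (\row_i v i) = 0.
  apply:restr_tangent => q Iq;rewrite -[RHS](hv q Iq);apply:eq_mdiff =>// i. by rewrite vec_mxK mxE.
 apply/funext => i;have := congr1 (fun z => mxvec z 0 i) v0. by rewrite vec_mxK linear0 !mxE.
- by have := Iq _ (carrier1 F);rewrite restr1.
have tP g : carrier F g -> mx_eval t (rho g) != 0 -> rho g = 1%:M.
 move=>Fg tg;apply:(can_inj mxvecK);apply/rowP => l;apply/eqP;rewrite -subr_eq0.
 have := tI l g Fg;rewrite /mx_eval mevalM mevalB mevalXU mevalC => /eqP. by rewrite mulf_eq0 (negPf tg).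
pose P := [set q : {mpoly k[w * w]} | exists2 h, carrier F h & forall y, mx_eval q y = mx_eval t (rho (invmx h) *m y)].
have [s sP Ps] := noetherian_subset P (mpoly_noetherian (n := w * w) (@field_noetherian k)).
have : forall q : {mpoly k[w * w]}, exists h, q \in s -> carrier F h /\ forall y, mx_eval q y = mx_eval t (rho (invmx h) *m y).
 move=>q;have [/sP[h Fh qh]|_] := boolP (q \in s);last by exists 1%:M. by exists h.
move/choice =>[h hP].
exists (undup [seq rho (h q) | q <- s]);split=>[|y|g Fg];first exact:undup_uniq.
 by rewrite mem_undup => /mapP[q /hP[Fq _] ->];exists (h q).
have [e [e1 _]] := lin_sub (mulmx (rho (invmx g))).
have : P (t \mPo e) by exists g =>// y;rewrite /mx_eval e1.
move=>/Ps[a ta];have tg : mx_eval (t \mPo e) (rho g) != 0.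
 by rewrite /mx_eval e1 /= -restrM ?mulVmx ?restr1 ?(carrier_unit Fg) //;apply:carrierV.
have [q qs qg] : exists2 q, q \in s & mx_eval q (rho g) != 0.
 apply:contrapT => no;move/eqP: tg;apply;rewrite ta /mx_eval rmorph_sum big1 // => i _ /=.
 rewrite mevalM;suff -> : (s`_i).@[mxvec (rho g) 0] = 0 by rewrite mulr0.
 by apply/eqP/negPn/negP => h0;apply:no;exists s`_i =>//;apply:mem_nth.
have [Fq qE] := hP q qs;rewrite mem_undup;apply/mapP;exists q =>//.
have FV := carrierV Fq.
have := tP (invmx (h q) *m g) (carrierM FV Fg);rewrite restrM // -qE => /(_ qg) e2.
by rewrite -[rho g]mul1mx -restr1 -(mulmxV (carrier_unit Fq)) restrM // -mulmxA e2 mulmx1.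
Qed.

(** The average over the finite image. It differs from v by a mean of the vectors v g - v, and so
    stays in v + E. *)
Lemma average_fixed (v : 'rV[k]_w) : exists a : 'rV[k]_w,
 (forall g, carrier F g -> a *m rho g = a) /\
 forall (E : 'M[k]_n), (forall g, carrier F g -> ((v *m B) *m g - v *m B <= E)%MS) -> (v *m B - a *m B <= E)%MS.
have [s [us sF Fs]] := finite_image.
have s0 : (size s)%:R != 0 :> k.
 have /pcharf0P -> := char0;have := Fs _ (carrier1 F). by case:(s) =>//.
exists ((size s)%:R^-1 *: \sum_(y <- s) v *m y);split=>[g Fg|E hE].
 rewrite -scalemxAl mulmx_suml;congr (_ *: _). have inj : injective (mulmxr (rho g) : 'M_w -> 'M_w).
  have h z : z *m rho g *m rho (invmx g) = z.
   by rewrite -mulmxA -restrM // mulmxV ?(carrier_unit Fg) // restr1 mulmx1.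
  by move=>y y' /= e;rewrite -[y]h e h.
 have pe : perm_eq [seq y *m rho g | y <- s] s.
  have um : uniq [seq y *m rho g | y <- s] by rewrite map_inj_uniq.
  have sub : {subset [seq y *m rho g | y <- s] <= s}.
   move=>_ /mapP[y' /sF[g' Fg' ->] ->];rewrite -restrM //;apply:Fs;exact:carrierM.
  have [|_ e] := uniq_min_size um sub;first by rewrite size_map. exact:uniq_perm.
 rewrite -[RHS](perm_big _ pe) /= big_map;eqbig => y _. by rewrite mulmxA.
have -> : v *m B - ((size s)%:R^-1 *: \sum_(y <- s) v *m y) *m B =
  (size s)%:R^-1 *: \sum_(y <- s) (v *m B - v *m y *m B).
 rewrite sumrB big_const_seq count_predT iter_addr_0 -mulmx_suml scalerBr.
 by rewrite -scaler_nat scalerA mulVf // scale1r -scalemxAl.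
apply:scalemx_sub;rewrite big_seq;apply:summx_sub => y /sF[g Fg ->].
rewrite -(mulmxA v) -BF // mulmxA -opprB -scaleN1r;apply:scalemx_sub;exact:hE.
Qed.

End FiniteImage.

(** * Trace forms and Casimir elements *)

Lemma lie_lin_mx (k : closedFieldType) n (F : alg_group k n) a b (T : 'M[k]_n -> 'M[k]_(a, b)) c0 x :
 (forall c u v, T (c *: u + v) = c *: T u + T v) -> (forall g, carrier F g -> T g = c0) ->
 x \in lie F -> T x = 0.
move=>TL T0 xF;apply/matrixP => i j.
have TijL c u v : (T (c *: u + v) i j : k^o) = c *: (T u i j : k^o) + T v i j by rewrite TL !mxE.
pose Tij : {linear 'M[k]_n -> k^o} := HB.pack (fun u => T u i j : k^o)
 (GRing.isLinear.Build _ _ _ _ (fun u => T u i j : k^o) TijL).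
have h : Tij x = 0 by apply:(@lie_linear k n F Tij (c0 i j) x) =>// g Fg;rewrite /= T0.
by rewrite [RHS]mxE;exact:h.
Qed.

(** The Gram matrix of a basis of V is invertible by nondegeneracy; its inverse gives the dual
    basis. *)
Lemma dual_basis (k : fieldType) n (V : {vspace 'M[k]_n}) (f : 'M[k]_n -> 'M[k]_n -> k) :
 (forall a u v y, f (a *: u + v) y = a * f u y + f v y) ->
 (forall x y, x \in V -> y \in V -> f x y = f y x) ->
 (forall x, x \in V -> (forall y, y \in V -> f x y = 0) -> x = 0) ->
 exists b b' : 'I_(\dim V) -> 'M[k]_n, [/\ forall i, b i \in V, forall i, b' i \in V,
  forall i j, f (b' i) (b j) = (i == j)%:R,
  forall v, v \in V -> v = \sum_i f (b' i) v *: b i &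
  forall v, v \in V -> v = \sum_i f (b i) v *: b' i].
move=>fL fC fN.
have f0 y : f 0 y = 0 by have := fL (-1) 0 0 y;rewrite scaler0 addr0 mulN1r addNr.
have fZ a u y : f (a *: u) y = a * f u y by rewrite -[a *: u]addr0 fL f0 addr0.
have fD u v y : f (u + v) y = f u y + f v y by rewrite -[u]scale1r fL mul1r scale1r.
have fS (I : finType) (G : I -> 'M[k]_n) y : f (\sum_i G i) y = \sum_i f (G i) y.
 by apply:(big_morph (f^~ y));[move=>u v;apply:fD | apply:f0].
pose b (i : 'I_(\dim V)) := (vbasis V)`_i.
have bV i : b i \in V by apply/vbasis_mem/mem_nth;rewrite size_tuple.
have SV (I : finType) (c : I -> k) (G : I -> 'M[k]_n) : (forall i, G i \in V) -> \sum_i c i *: G i \in V.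
 by move=>GV;apply:memv_suml => i _;apply:memvZ.
have ext u v : u \in V -> v \in V -> (forall j, f u (b j) = f v (b j)) -> u = v.
 move=>uV vV e;apply:subr0_eq. have uvV : u - v \in V by apply:memvB.
 have e2 j : f (u - v) (b j) = 0 by rewrite -scaleN1r addrC fL e mulN1r addNr.
 apply:fN =>// y yV;rewrite (coord_vbasis yV) fC //;last by rewrite -(coord_vbasis yV).
 by rewrite fS big1 // => i _;rewrite fZ -/(b i) fC // e2 mulr0.
pose G := \matrix_(i, j) f (b i) (b j).
have GT i j : G i j = G j i by rewrite !mxE fC.
have Gu : G \in unitmx.
 rewrite -row_free_unit -kermx_eq0;apply/eqP/row_matrixP => i;rewrite row0.
 set u := row i _;have /sub_kermxP uG : (u <= kermx G)%MS by apply:row_sub.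
 have s0 : \sum_j u 0 j *: b j = 0.
  apply:(ext _ _ (SV _ _ _ bV) (mem0v _)) => j;rewrite f0 fS.
  transitivity ((u *m G) 0 j);last by rewrite uG mxE.
  by rewrite [RHS]mxE;eqbig => l _;rewrite fZ [G _ _]mxE.
 have /freeP fr : free (vbasis V) by apply:basis_free (vbasisP V).
 by apply/rowP => j;rewrite [RHS]mxE;apply:(fr (fun j => u 0 j)).
pose b' i := \sum_j invmx G i j *: b j.
have b'V i : b' i \in V by apply:SV.
have bb i j : f (b' i) (b j) = (i == j)%:R.
 rewrite /b' fS;have /matrixP/(_ i j) := mulVmx Gu;rewrite [RHS]mxE mxE => <-.
 by eqbig => l _;rewrite fZ [G _ _]mxE.
exists b, b';split=>// v vV;last first.
 apply:ext =>// [|j];first exact:SV.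
 rewrite fS (bigD1 j) //= big1 ?addr0 =>[|i /negPf ij];rewrite fZ bb.
  by rewrite eqxx mulr1 fC.
 by rewrite ij mulr0.
rewrite {1}(coord_vbasis vV);eqbig => i _;congr (_ *: _).
rewrite fC // {2}(coord_vbasis vV) fS (bigD1 i) //= big1 ?addr0 =>[|j /negPf ji];rewrite fZ -/(b _) fC // bb.
 by rewrite eqxx mulr1.
by rewrite eq_sym ji mulr0.
Qed.

Section TraceForm.
Variables (k : closedFieldType) (n w : nat) (char0 : has_pchar0 k).
Variables (F : alg_group k n) (B : 'M[k]_(w, n)) (C : 'M[k]_(n, w)).
Hypotheses (redF : reductive F) (BC : B *m C = 1%:M)
 (BF : forall g, carrier F g -> B *m g = (B *m g *m C) *m B).

Let L := lie F.

Lemma lie_stable x : x \in L -> B *m x = (B *m x *m C) *m B.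
move=>xL;apply:subr0_eq.
apply:(@lie_lin_mx k n F w n (fun z => B *m z - (B *m z *m C) *m B) 0) xL =>[c u v|g /BF <-];last by rewrite subrr.
by rewrite mulmxDr !mulmxDl -!scalemxAr -!scalemxAl scalerBr opprD addrACA.
Qed.

Definition rW (z : 'M[k]_n) := B *m z *m C.
Let stab z := B *m z = rW z *m B.

Lemma rWM z z' : stab z -> rW (z *m z') = rW z *m rW z'.
by move=>sz;rewrite {1}/rW mulmxA sz -!mulmxA /rW !mulmxA. Qed.

Definition trW (x y : 'M[k]_n) := \tr (rW (x *m y)).

Let sL x : x \in L -> stab x.
exact:lie_stable. Qed.

Lemma trWC x y : x \in L -> y \in L -> trW x y = trW y x.
move=>/sL sx /sL sy;have e1 : rW (x *m y) = rW x *m rW y by apply:rWM.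
have e2 : rW (y *m x) = rW y *m rW x by apply:rWM.
by rewrite /trW e1 e2;apply:mxtrace_mulC.
Qed.

Lemma trW_linear a u v y : trW (a *: u + v) y = a * trW u y + trW v y.
by rewrite /trW /rW mulmxDl -scalemxAl mulmxDr mulmxDl -scalemxAr -scalemxAl mxtraceD mxtraceZ.
Qed.

Lemma trW_cycle x y z : x \in L -> y \in L -> z \in L ->
 trW (x *m y - y *m x) z = trW x (y *m z - z *m y).
move=>/sL xL /sL yL /sL zL;have rWB u v : rW (u - v) = rW u - rW v by rewrite /rW mulmxBr mulmxBl.
rewrite /trW mulmxBl mulmxBr !rWB !linearB /= mulmxA;congr (_ - _).
by rewrite -[in LHS]mulmxA !rWM // mxtrace_mulC mulmxA.
Qed.

Lemma trW_Ad g x y : carrier F g -> x \in L -> y \in L -> trW (Ad g x) (Ad g y) = trW x y.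
move=>Fg /sL xL /sL yL;have ug := carrier_unit Fg;rewrite /trW /Ad.
have -> : g *m x *m invmx g *m (g *m y *m invmx g) = g *m (x *m (y *m invmx g)).
 by rewrite !mulmxA mulmxKV.
rewrite !rWM //;last exact:BF.
have e1 : rW (invmx g) *m rW g = 1%:M.
 have sg : stab (invmx g) by apply:BF;apply:carrierV. by rewrite -(rWM _ sg) mulVmx // /rW mulmx1.
by rewrite mxtrace_mulC -(mulmxA (rW x)) -(mulmxA (rW y)) e1 mulmx1.
Qed.

(* A subspace of Lie F closed under replicas has nondegenerate trace form: the
  radical would consist of nilpotents. *)
Lemma trace_nondeg (V : {vspace 'M[k]_n}) : (V <= L)%VS ->
 (forall x y, x \in V -> y \in V -> x *m y - y *m x \in V) ->
 (forall g x, carrier F g -> x \in V -> Ad g x \in V) ->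
 (forall x h, x \in V -> 'X %| h -> mxp x h \in L -> mxp x h \in V) ->
 forall x, x \in V -> (forall y, y \in V -> \tr (x *m y) = 0) -> x = 0.
move=>VL VB VA Vrep x xV x0.
pose P := [set x | x \in V /\ forall y, y \in V -> \tr (x *m y) = 0].
have P0 : P 0 by split=>[|y _];rewrite ?mem0v // mul0mx mxtrace0.
have PL a u v : P u -> P v -> P (a *: u + v).
 move=>[uV u0] [vV v0];split=>[|y yV];first by rewrite memvD ?memvZ.
 by rewrite mulmxDl -scalemxAl mxtraceD mxtraceZ u0 // v0 // mulr0 addr0.
have [U UP] := vspace_of_set P0 PL.
have PUL u : P u -> u \in L by move=>[/(subvP VL)].
apply:(@nil_lie_trivial k n char0 F U) =>//.
- by apply/subvP => u /UP /PUL.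
- move=>u v /UP[uV u0] /UP[vV v0];apply/UP;split=>[|y yV];first exact:VB.
 have -> : (u *m v - v *m u) *m y = u *m (v *m y) - v *m (u *m y) by rewrite mulmxBl !mulmxA.
 rewrite linearB /=.
 have := u0 _ (VB _ _ vV yV);rewrite mulmxBr linearB /= => /eqP;rewrite subr_eq0 => /eqP e.
 by rewrite e mulmxA [X in _ - X]mxtrace_mulC -mulmxA subrr.
- move=>g u Fg /UP[uV u0];apply/UP;split=>[|y yV];first exact:VA.
 have ug := carrier_unit Fg. have := u0 _ (VA _ _ (carrierV Fg) yV);rewrite /Ad invmxK => <-.
 by rewrite -!mulmxA mxtrace_mulC !mulmxA.
- move=>u /UP[uV u0].
 have [|[N]|[h [hX tr hL]]] := @replica k n n u 1%:M 1%:M 1 char0 (mulmx1 _).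
 + by rewrite !mul1mx !mulmx1.
 + rewrite mul1mx => uN;exists N;rewrite -uN;elim: N {uN} =>[|N IH];first by rewrite !expr0 -polyC1 mxpC.
  by rewrite !exprS mxpM mxpX IH.
 move: tr;rewrite mul1mx mulmx1 u0 ?eqxx //;apply:Vrep =>//;apply:hL. by apply:PUL;split.
by apply/UP.
Qed.

Let nP : set 'M[k]_n := [set x | x \in L /\ B *m x = 0].

Lemma kernel_space : exists N : {vspace 'M[k]_n}, forall x, x \in N <-> x \in L /\ B *m x = 0.
apply:(@vspace_of_set _ _ nP) =>[|a u v [uL u0] [vL v0]];first by split;rewrite ?mem0v ?mulmx0.
by split;[rewrite memvD ?memvZ | rewrite mulmxDr -scalemxAr u0 v0 scaler0 addr0].
Qed.

Section Kernel.
Variable N : {vspace 'M[k]_n}.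
Hypothesis NP : forall x, x \in N <-> x \in L /\ B *m x = 0.

Lemma kernel_nondeg x : x \in N -> (forall y, y \in N -> \tr (x *m y) = 0) -> x = 0.
apply:trace_nondeg.
- by apply/subvP => y /NP[].
- move=>y z /NP[yL y0] /NP[zL z0];apply/NP;split;first exact:lie_bracket.
 by rewrite mulmxBr !mulmxA y0 z0 !mul0mx subrr.
- move=>g y Fg /NP[yL y0];apply/NP;split;first exact:Ad_lie.
 by rewrite /Ad !mulmxA BF // -(mulmxA _ B y) y0 mulmx0 mul0mx.
- move=>y h /NP[yL y0] /dvdpP[q ->] hL;apply/NP;split=>//.
 by rewrite mulrC mxpM mxpX mulmxA y0 mul0mx.
Qed.

Lemma kernel_bracket x y : x \in N -> y \in L -> y *m x - x *m y \in N.
move=>/NP[xL x0] yL;apply/NP;split;first exact:lie_bracket.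
by rewrite mulmxBr !mulmxA x0 mul0mx subr0 (sL yL) -mulmxA x0 mulmx0.
Qed.

Lemma kernel_represent x : exists2 z, z \in N & forall y, y \in N -> \tr (x *m y) = \tr (z *m y).
have trL a (u v y : 'M[k]_n) : \tr ((a *: u + v) *m y) = a * \tr (u *m y) + \tr (v *m y).
 by rewrite mulmxDl -scalemxAl mxtraceD mxtraceZ.
have [b [b' [bN b'N bb _ bE]]] := dual_basis (V := N) (f := fun x y => \tr (x *m y)) trL
 (fun x y _ _ => mxtrace_mulC _ _) kernel_nondeg.
exists (\sum_i \tr (x *m b' i) *: b i);first by apply:memv_suml => i _;apply:memvZ.
move=>y yN;rewrite {1}(bE y yN) mulmx_sumr mulmx_suml !raddf_sum;eqbig => i _ /=.
by rewrite -scalemxAr -scalemxAl !mxtraceZ mulrC.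
Qed.

(* The radical of tr_W acts trivially on W. *)
Lemma trW_radical x : x \in L -> (forall y, y \in L -> trW x y = 0) -> x \in N.
pose aP (x : 'M[k]_n) := x \in L /\ forall y, y \in L -> trW x y = 0.
(* The radical of the form of W is cut down further by orthogonality to N for the trace of the
   ambient space; what remains consists of nilpotents and is 0. *)
pose cP : set 'M[k]_n := [set x | aP x /\ forall y, y \in N -> \tr (x *m y) = 0].
have trW0 y : trW 0 y = 0 by rewrite /trW /rW mul0mx mulmx0 mul0mx mxtrace0.
have c0 : cP 0.
 by split=>[|y _];[split=>[|y _];rewrite ?mem0v // trW0 | rewrite mul0mx mxtrace0].
have cL a u v : cP u -> cP v -> cP (a *: u + v).
 move=>[[uL u0] u1] [[vL v0] v1];split=>[|y yN];first split=>[|y yL].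
 - by rewrite memvD ?memvZ.
 - by rewrite trW_linear u0 // v0 // mulr0 addr0.
 - by rewrite mulmxDl -scalemxAl mxtraceD mxtraceZ u1 // v1 // mulr0 addr0.
have [U UP] := vspace_of_set c0 cL.
have U0 u : u \in U -> u = 0.
 apply:(@nil_lie_trivial k n char0 F U) =>//.
 - by apply/subvP => v /UP[[]].
 - move=>u1 v /UP[[uL u0] u1N] /UP[[vL v0] v1];apply/UP;split=>[|y yN];first split=>[|y yL].
  + exact:lie_bracket.
  + by rewrite trW_cycle // u0 //;apply:lie_bracket.
  have -> : (u1 *m v - v *m u1) *m y = u1 *m (v *m y) - v *m (u1 *m y) by rewrite mulmxBl !mulmxA.
  have := u1N _ (kernel_bracket yN vL);rewrite mulmxBr !linearB /= => /eqP;rewrite subr_eq0 => /eqP ->.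
  by rewrite mulmxA [X in _ - X]mxtrace_mulC -mulmxA subrr.
 - move=>g u1 Fg /UP[[uL u0] u1N];have FV := carrierV Fg;have ug := carrier_unit Fg.
  have AK y : Ad g (Ad (invmx g) y) = y.
   by rewrite /Ad invmxK !mulmxA mulmxV // mul1mx mulmxK.
  apply/UP;split=>[|y yN];first split=>[|y yL].
  + exact:Ad_lie.
  + by rewrite -(AK y) trW_Ad ?u0 //;apply:Ad_lie.
  have yN' : Ad (invmx g) y \in N.
   have /NP[yL y0] := yN;apply/NP;split;first exact:Ad_lie.
   by rewrite /Ad !mulmxA (BF FV) -(mulmxA _ B y) y0 mulmx0 mul0mx.
  have := u1N _ yN';rewrite /Ad invmxK => <-. by rewrite -!mulmxA mxtrace_mulC !mulmxA.
 - move=>u1 /UP[[uL u0] u1N].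
  (* A first replica shows that u1 is nilpotent on W. In a second one h is divisible by X^M, so the
     replica kills W and lies in N, and orthogonality to N makes u1 nilpotent on the ambient
     space. *)
  have [[M uM]|[h [_ /eqP tr hL]]] := @replica k n w u1 B C 1 char0 BC (sL uL);last first.
   by case:tr;exact:(u0 _ (hL _ uL)).
  have [|[M']|[h [hX tr hL]]] := @replica k n n u1 1%:M 1%:M M char0 (mulmx1 _).
  + by rewrite !mul1mx !mulmx1.
  + rewrite mul1mx => uN;exists M';rewrite -uN;elim: M' {uN} =>[|M' IH];first by rewrite !expr0 -polyC1 mxpC.
   by rewrite !exprS mxpM mxpX IH.
  move: tr;rewrite mul1mx mulmx1 u1N ?eqxx //;apply/NP;split;first exact:hL.
  by case/dvdpP: hX => q ->;rewrite mulrC mxpM mulmxA uM mul0mx.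
move=>xL x0;have [z zN xz] := kernel_represent x.
suff : x - z \in U by move/U0/eqP;rewrite subr_eq0 => /eqP ->.
have /NP[zL Bz] := zN;apply/UP;split=>[|y yN];first split=>[|y yL].
- by rewrite memvB.
- rewrite -scaleN1r addrC trW_linear x0 // addr0 /trW /rW mulmxA Bz !mul0mx mxtrace0.
 by rewrite mulr0.
- by rewrite mulmxBl linearB /= xz // subrr.
Qed.

(* Either Lie F kills W, or the Casimir element of the trace form of W acts
  on W with nonzero trace and commutes with F. *)
Lemma casimir : (forall x, x \in L -> B *m x = 0) \/
 exists d (b b' : 'I_d -> 'M[k]_n), [/\ forall i, b i \in L, forall i, b' i \in L,
  \tr (rW (\sum_i b i *m b' i)) != 0 &
  forall g, carrier F g -> g *m (\sum_i b i *m b' i) = (\sum_i b i *m b' i) *m g].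
(* V is the orthogonal of N in Lie F for the ambient trace; Lie F = N + V, and the form of W is
   nondegenerate on V. *)
pose bP : set 'M[k]_n := [set x | x \in L /\ forall y, y \in N -> \tr (x *m y) = 0].
have b0 : bP 0 by split=>[|y _];rewrite ?mem0v // mul0mx mxtrace0.
have bL a u v : bP u -> bP v -> bP (a *: u + v).
 move=>[uL u1] [vL v1];split=>[|y yN];first by rewrite memvD ?memvZ.
 by rewrite mulmxDl -scalemxAl mxtraceD mxtraceZ u1 // v1 // mulr0 addr0.
have [V VP] := vspace_of_set b0 bL.
have dec x : x \in L -> exists2 z, z \in N & x - z \in V.
 move=>xL;have [z zN xz] := kernel_represent x;exists z =>//;apply/VP.
 split=>[|y yN];first by rewrite memvB //;case/NP: zN. by rewrite mulmxBl linearB /= xz // subrr.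
have VL x : x \in V -> x \in L by move/VP =>[].
have Vnd x : x \in V -> (forall y, y \in V -> trW x y = 0) -> x = 0.
 move=>xV x0;have /VP[xL x1] := xV;apply:kernel_nondeg =>//.
 apply:trW_radical =>// y yL;have [z zN yz] := dec y yL;have /NP[zL z0] := zN.
 rewrite trWC // -[y](subrK z) -[y - z]scale1r trW_linear trWC ?VL // x0 // mulr0 add0r.
 by rewrite /trW /rW mulmxA z0 !mul0mx mxtrace0.
have VA g x : carrier F g -> x \in V -> Ad g x \in V.
 move=>Fg /VP[xL x0];apply/VP;split=>[|y yN];first exact:Ad_lie.
 have FV := carrierV Fg;have yN' : Ad (invmx g) y \in N.
  have /NP[yL y0] := yN;apply/NP;split;first exact:Ad_lie.
  by rewrite /Ad !mulmxA (BF FV) -(mulmxA _ B y) y0 mulmx0 mul0mx.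
 have := x0 _ yN';rewrite /Ad invmxK => <-. by rewrite -!mulmxA mxtrace_mulC !mulmxA.
have [b [b' [bV b'V bb bE b'E]]] := dual_basis (V := V) (f := trW) trW_linear
 (fun x y xV yV => trWC (VL x xV) (VL y yV)) Vnd.
have [dV|dV] := posnP (\dim V).
 left=> x /dec[z /NP[_ Bz] xz];move/eqP: dV;rewrite dimv_eq0 => /eqP V0.
 by move: xz;rewrite V0 memv0 subr_eq0 => /eqP ->.
right;exists (\dim V), b, b';split=>[i|i||g Fg];rewrite ?VL //.
 have -> : \tr (rW (\sum_i b i *m b' i)) = \sum_i trW (b i) (b' i).
  by rewrite /rW mulmx_sumr mulmx_suml raddf_sum.
 rewrite (eq_bigr (fun=> 1)) =>[|i _];last by rewrite trWC ?VL // bb eqxx.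
 by rewrite sumr_const card_ord;have /pcharf0P -> := char0;rewrite -lt0n.
have ug := carrier_unit Fg;have FV := carrierV Fg.
have AK y : Ad g (Ad (invmx g) y) = y.
 by rewrite /Ad invmxK !mulmxA mulmxV // mul1mx mulmxK.
(* Ad g carries dual bases to dual bases, and the Casimir element does not depend on the pair of
   dual bases. *)
pose c i := Ad g (b i);pose c' i := Ad g (b' i).
have AdS (I : finType) (G : I -> 'M[k]_n) : Ad g (\sum_i G i) = \sum_i Ad g (G i).
 by rewrite /Ad mulmx_sumr mulmx_suml.
have AdZ a y : Ad g (a *: y) = a *: Ad g y by rewrite /Ad -scalemxAr -scalemxAl.
have cE v : v \in V -> v = \sum_i trW (c i) v *: c' i.
 move=>vV;have v'V := VA _ _ FV vV;rewrite -{1}(AK v) {1}(b'E _ v'V) AdS.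
 eqbig => i _;rewrite AdZ;congr (_ *: _). by rewrite -(trW_Ad Fg (VL _ (bV i)) (VL _ v'V)) AK.
have e : \sum_i c i *m c' i = \sum_i b i *m b' i.
 have cV i : c i \in V by apply:VA. under eq_bigr => i _ do rewrite {1}(bE _ (cV i)) mulmx_suml.
 rewrite exchange_big /=;eqbig => j _. rewrite [in RHS](cE _ (b'V j)) mulmx_sumr;eqbig => i _.
 by rewrite -scalemxAl -scalemxAr trWC ?VL.
have -> : g *m (\sum_i b i *m b' i) = (\sum_i c i *m c' i) *m g;last by rewrite e.
rewrite mulmx_sumr mulmx_suml;eqbig => i _.
by rewrite /c /c' /Ad !mulmxA mulmxKV // mulmxKV.
Qed.

End Kernel.

End TraceForm.

(** * Complete reducibility for matrix groups *)

Section FixedVector.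
Variables (k : closedFieldType) (n : nat) (char0 : has_pchar0 k).
Variables (F : alg_group k n).
Hypothesis redF : reductive F.

(** The cocycle v g - v with values in E is a coboundary. On W = E + <v>, either Lie F acts
    trivially and a finite average works, or the Casimir element Om maps W into E without being
    nilpotent on W; its Fitting decomposition removes a nonzero part of E, and the induction is on
    the rank of E. *)
Lemma fixed_vector m (E : 'M[k]_n) (v : 'rV[k]_n) : (\rank E <= m)%N ->
 (forall g, carrier F g -> (E *m g <= E)%MS) ->
 (forall g, carrier F g -> (v *m g - v <= E)%MS) ->
 exists2 y : 'rV[k]_n, (y <= E)%MS & forall g, carrier F g -> (v - y) *m g = v - y.
elim: m E v =>[|m IH] E v rE EF vF.
 move: rE;rewrite leqn0 mxrank_eq0 => /eqP E0;exists 0;first exact:sub0mx.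
 move=>g Fg;have := vF g Fg;rewrite E0 submx0 subr_eq0 subr0 => /eqP //.
pose W := (E + v)%MS;pose B := row_base W;pose C := pinvmx B.
have BC : B *m C = 1%:M by apply/mulmxVp/row_base_free.
have BW : (B :=: W)%MS by apply:eq_row_base.
have vW : (v <= B)%MS by rewrite BW addsmxSr.
have EW : (E <= B)%MS by rewrite BW addsmxSl.
have WF g : carrier F g -> (B *m g <= B)%MS.
 move=>Fg;have -> : (B *m g <= B)%MS = (W *m g <= W)%MS.
  by rewrite BW;apply/idP/idP;apply:submx_trans;rewrite submxMr ?BW.
 rewrite addsmxMr addsmx_sub (submx_trans (EF g Fg)) ?addsmxSl //=.
 by rewrite -[v *m g](subrK v) addmx_sub_adds // vF.
have BF g : carrier F g -> B *m g = (B *m g *m C) *m B by move=>/WF h;rewrite mulmxKpV.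
have EL x : x \in lie F -> (E *m x <= E)%MS.
 move=>xL;rewrite submxE;apply/eqP.
 apply:(@lie_lin_mx k n F _ _ (fun z => E *m z *m cokermx E) 0) xL =>[c u z|g /EF].
  by rewrite mulmxDr mulmxDl -scalemxAr -scalemxAl.
 by rewrite submxE => /eqP.
have vL x : x \in lie F -> (v *m x <= E)%MS.
 move=>xL;rewrite submxE;apply/eqP.
 apply:(@lie_lin_mx k n F _ _ (fun z => v *m z *m cokermx E) (v *m cokermx E)) xL =>[c u z|g /vF].
  by rewrite mulmxDr mulmxDl -scalemxAr -scalemxAl.
 by rewrite submxE mulmxBl subr_eq0 => /eqP.
have [N NP] := @kernel_space k n _ F B.
have [BL|[d [b [b' [bL b'L tr com]]]]] := casimir char0 redF BC BF NP.
 have [a [aF aE]] := average_fixed char0 BC BF BL (v *m C). have vCB : v *m C *m B = v by rewrite mulmxKpV.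
 exists (v - a *m B);first by have := aE E;rewrite vCB;apply.
 by move=>g Fg;rewrite opprB addrCA subrr addr0 -mulmxA BF // mulmxA aF.
set Om := \sum_i _ in tr com;pose T := B *m Om *m C.
have EO : (E *m Om <= E)%MS.
 rewrite mulmx_sumr;apply:summx_sub => i _;rewrite mulmxA.
 by apply:submx_trans (EL _ (b'L i));rewrite submxMr ?EL.
have vO : (v *m Om <= E)%MS.
 rewrite mulmx_sumr;apply:summx_sub => i _;rewrite mulmxA.
 by apply:submx_trans (EL _ (b'L i));rewrite submxMr ?vL.
have BOE : (B *m Om <= E)%MS.
 have -> : (B *m Om <= E)%MS = (W *m Om <= E)%MS.
  by apply/idP/idP;apply:submx_trans;rewrite submxMr ?BW.
 by rewrite addsmxMr addsmx_sub EO.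
have BO : B *m Om = T *m B by rewrite mulmxKpV // (submx_trans BOE).
have Eh h : (E *m mxp Om h <= E)%MS.
 elim/poly_ind: h =>[|h c IHh];first by rewrite /mxp opoly0 mulmx0 sub0mx.
 rewrite mxpD mxpM mxpC mxpX mulmxDr mulmxA addmx_sub //;last by rewrite mul_mx_scalar scalemx_sub.
 by apply:submx_trans EO;rewrite submxMr.
have [P P0 PT] := mxp_annih T.
(* P = Q X^m0 with Q prime to X. The Bezout relation splits v into y0, which lies in E, and v1 in
   the image of Q(Om). *)
have [m0 [Q]] := multiplicity_XsubC P 0;rewrite P0 /= subr0 => Q0 PE.
have cop : coprimep Q ('X^(m0.+1)).
 by apply:coprimep_expr;have := coprimep_XsubC Q 0;rewrite subr0 => ->.
have /Bezout_eq1_coprimepP[[c c'] /= cc] := cop.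
pose y0 := v *m mxp Om (c' * 'X^(m0.+1));pose v1 := v *m mxp Om (c * Q).
have vE : v = v1 + y0 by rewrite /v1 /y0 -mulmxDr -mxpD cc -polyC1 mxpC mulmx1.
have y0E : (y0 <= E)%MS.
 rewrite /y0 exprSr mulrA [_ * 'X]mulrC mxpM mxpX mulmxA.
 by apply:submx_trans (Eh (c' * 'X^m0));rewrite submxMr.
pose A := mxp Om Q.
have gmx g h : carrier F g -> mxp Om h *m g = g *m mxp Om h.
 by move=>Fg;rewrite (@mxp_restrict k n n Om g Om h) // com.
have [|||y' y'E y'F] := IH (E *m A) v1.
(* The rows of [R], the image of W under Om^(m0+1), lie in E and are killed by A = Q(Om). They are
   not all 0, since Om would otherwise be nilpotent on W, with trace 0. So E A has smaller rank than
   E. *)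
- rewrite -ltnS;apply:leq_trans rE.
 rewrite -(mxrank_mul_ker E A) -addn1 leq_add2l lt0n mxrank_eq0. pose R := B *m mxp Om ('X^(m0.+1)).
 have RE : (R <= E :&: kermx A)%MS.
  rewrite sub_capmx;apply/andP;split.
   rewrite /R exprS mxpM mxpX mulmxA;apply:submx_trans (Eh ('X^m0)). by rewrite submxMr.
  apply/sub_kermxP;rewrite /R -mulmxA -mxpM (mxp_restrict _ BO).
  have -> : 'X^(m0.+1) * Q = 'X * P by rewrite PE exprS;ring. by rewrite mxpM PT mulmx0 mul0mx.
 apply:contraNneq tr => K0;have /eqP R0 : R == 0 by rewrite -submx0 -K0.
 have TX : mxp T ('X^(m0.+1)) = T ^+ m0.+1.
  by elim: m0.+1 =>[|M IHM];rewrite ?expr0 -?polyC1 ?mxpC // !exprS mxpM mxpX IHM.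
 apply/eqP/(@nilpotent_trace _ _ T m0.+1);rewrite -TX.
 by rewrite -[mxp T _]mulmx1 -BC mulmxA -(mxp_restrict _ BO) -/R R0 mul0mx.
- move=>g Fg;rewrite -mulmxA gmx // mulmxA;apply:submxMr;exact:EF.
- move=>g Fg;have -> : v1 *m g - v1 = (v *m g - v) *m mxp Om c *m A.
  rewrite /v1 mxpM mulmxA -(mulmxA _ (mxp Om Q) g) gmx // (mulmxA _ g) -(mulmxA _ (mxp Om c) g) gmx //.
  by rewrite (mulmxA v) !mulmxBl.
 by apply:submxMr;apply:submx_trans (Eh c);apply:submxMr;apply:vF.
exists (y0 + y');first by rewrite addmx_sub // (submx_trans y'E) // /A Eh.
have -> : v - (y0 + y') = v1 - y' by rewrite {1}vE opprD addrA addrK.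
exact:y'F.
Qed.

End FixedVector.

(** * Regular functions and vector fields on the general linear group *)

Section RegularFunctions.
Variables (k : closedFieldType) (n : nat).
Implicit Types (g a b : 'M[k]_n) (p q : {mpoly k[n * n + 1]}).

(** The point of affine space with coordinates the entries of g and 1/det g. At a singular g the
    last coordinate is 0, the inverse of 0 by convention, and multiplicativity of 1/det persists. *)
Definition rvec g : 'I_(n * n + 1) -> k := row_mx (mxvec g) (const_mx (\det g)^-1) 0.

Definition reg p g : k := p.@[rvec g].

Lemma rvecl g l : rvec g (lshift 1 l) = mxvec g 0 l.
by rewrite /rvec row_mxEl. Qed.

Lemma rvecr g j : rvec g (rshift (n * n) j) = (\det g)^-1.
by rewrite /rvec row_mxEr mxE. Qed.

End RegularFunctions.

Section RegularCalculus.
Variables (k : closedFieldType) (n : nat).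
Implicit Types (p q : {mpoly k[n * n + 1]}) (a b g h : 'M[k]_n).

Lemma regD p q g : reg (p + q) g = reg p g + reg q g.
exact:mevalD. Qed.
Lemma regM p q g : reg (p * q) g = reg p g * reg q g.
exact:mevalM. Qed.
Lemma regB p q g : reg (p - q) g = reg p g - reg q g.
exact:mevalB. Qed.
Lemma regC c g : reg c%:MP g = c.
exact:mevalC. Qed.
Lemma regZ c p g : reg (c *: p) g = c * reg p g.
exact:mevalZ. Qed.
Lemma reg_sum (I : Type) (r : seq I) (P : pred I) (G : I -> {mpoly k[n * n + 1]}) g :
 reg (\sum_(i <- r | P i) G i) g = \sum_(i <- r | P i) reg (G i) g.
exact:(raddf_sum (meval _)). Qed.
Definition coord i j : {mpoly k[n * n + 1]} := 'X_(lshift 1 (mxvec_index i j)).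
Definition inv_det : {mpoly k[n * n + 1]} := 'X_(rshift (n * n) ord0).

Lemma reg_coord i j g : reg (coord i j) g = g i j.
by rewrite /reg mevalXU rvecl mxvecE. Qed.

Lemma reg_inv_det g : reg inv_det g = (\det g)^-1.
by rewrite /reg mevalXU rvecr. Qed.

Lemma reg_ind (P : {mpoly k[n * n + 1]} -> Prop) : (forall c, P c%:MP) ->
 (forall i j, P (coord i j)) -> P inv_det -> (forall p q, P p -> P q -> P (p + q)) ->
 (forall p q, P p -> P q -> P (p * q)) -> forall p, P p.
move=>PC Pc Pd PD PM;apply:mpoly_gen_ind =>// l;case:(split_ordP l) =>[l' ->|j ->].
 by case/mxvec_indexP: l' => i j;apply:Pc.
by rewrite ord1.
Qed.

Definition det_poly : {mpoly k[n * n + 1]} := \det (\matrix_(i, j) coord i j).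

Lemma reg_det g : reg det_poly g = \det g.
rewrite /reg /det_poly -det_map_mx;congr (\det _);apply/matrixP => i j.
by rewrite !mxE -[RHS]reg_coord.
Qed.

Lemma reg_inverse p : exists q, forall g, g \in unitmx -> reg q g = reg p (invmx g).
move: p;apply:reg_ind =>[c|i j||p q [p' hp] [q' hq]|p q [p' hp] [q' hq]].
- by exists c%:MP => g _;rewrite !regC.
- exists (inv_det * (\adj (\matrix_(i, j) coord i j)) i j) => g ug.
 rewrite regM reg_inv_det reg_coord /invmx ug [RHS]mxE;congr (_ * _).
 have -> : reg ((\adj (\matrix_(i, j) coord i j)) i j) g = (\adj (map_mx (meval (rvec g)) (\matrix_(i, j) coord i j))) i j.
  by rewrite -map_mx_adj [RHS]mxE.
 by congr ((\adj _) _ _);apply/matrixP => a b;rewrite !mxE -[LHS]/(reg _ _) reg_coord.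
- by exists det_poly => g ug;rewrite reg_det reg_inv_det det_inv invrK.
- by exists (p' + q') => g ug;rewrite !regD hp ?hq.
- by exists (p' * q') => g ug;rewrite !regM hp ?hq.
Qed.

(** The comultiplication of k[GL_n]; it makes the translates of p span a space of finite
    dimension. *)
Lemma reg_comult p : exists N (q x : 'I_N -> {mpoly k[n * n + 1]}),
 forall a b, reg p (a *m b) = \sum_i reg (q i) a * reg (x i) b.
have one (q x : {mpoly k[n * n + 1]}) (f : 'M[k]_n -> 'M[k]_n -> k) : (forall a b, f a b = reg q a * reg x b) ->
  exists N (q x : 'I_N -> {mpoly k[n * n + 1]}), forall a b, f a b = \sum_i reg (q i) a * reg (x i) b.
 by move=>h;exists 1%N, (fun=> q), (fun=> x) => a b;rewrite big_ord1.
move: p;apply:reg_ind =>[c|i j||p q [N [f [x hp]]] [N' [f' [x' hq]]]|p q [N [f [x hp]]] [N' [f' [x' hq]]]].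
- by apply:(one c%:MP 1%:MP) => a b;rewrite !regC mulr1.
- exists n, (fun l => coord i l), (fun l => coord l j) => a b;rewrite reg_coord mxE.
 by eqbig => l _;rewrite !reg_coord.
- by apply:(one inv_det inv_det) => a b;rewrite !reg_inv_det det_mulmx invfM.
- exists (N + N')%N, (fun i => match fintype.split i with inl l => f l | inr l => f' l end),
  (fun i => match fintype.split i with inl l => x l | inr l => x' l end) => a b.
 rewrite regD hp hq big_split_ord /=;congr (_ + _);eqbig => i _.
  by rewrite -[lshift N' i]/(unsplit (inl i)) unsplitK.
 by rewrite -[rshift N i]/(unsplit (inr i)) unsplitK.
exists #|{: 'I_N * 'I_N'}|, (fun i => f (enum_val i).1 * f' (enum_val i).2),
 (fun i => x (enum_val i).1 * x' (enum_val i).2) => a b.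
rewrite regM hp hq big_distrlr /= pair_big /=.
rewrite [LHS](reindex (enum_val (A := predT))) /=;last first.
 by apply:onW_bij;exists enum_rank;[exact:enum_valK | exact:enum_rankK].
by eqbig => i _;rewrite !regM;ring.
Qed.

End RegularCalculus.

Lemma der_const_comp (k : comNzRingType) m l (D : {mpoly k[l]} -> {mpoly k[l]}) (c : m.-tuple {mpoly k[l]}) p :
 derivation D -> (forall c, D c%:MP = 0) ->
 D (p \mPo c) = \sum_i (p^`M(i) \mPo c) * D (tnth c i).
move=>[DD DM] DC;pose D' q := \sum_i (q^`M(i) \mPo c) * D (tnth c i).
rewrite -/(D' p);move: p;apply:mpoly_gen_ind =>[a|i|p q ep eq|p q ep eq].
- rewrite comp_mpolyC DC /D' big1 // => i _;by rewrite mderivC comp_mpoly0 mul0r.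
- rewrite comp_mpolyXU -tnth_nth /D' (bigD1 i) //= comp_mpoly_deriv eqxx mul1r big1 ?addr0 // => j ji.
 by rewrite comp_mpoly_deriv (negPf ji) mul0r.
- rewrite comp_mpolyD DD ep eq /D' -big_split;eqbig => i _ /=.
 by rewrite mderivD comp_mpolyD mulrDl.
rewrite rmorphM /= DM ep eq /D' !mulr_sumr -big_split;eqbig => i _ /=.
by rewrite mderivM comp_mpolyD !rmorphM /=;ring.
Qed.

Lemma mxvec_index_ex m n (l : 'I_(m * n)) : exists i j, l = mxvec_index i j.
by case/mxvec_indexP: l => i j;exists i, j. Qed.

Section Fields.
Variables (k : closedFieldType) (n : nat).
Local Notation PA := {mpoly k[n * n + 1]}.
Implicit Types (p q : PA) (a b g h x y : 'M[k]_n) (T : 'M[PA]_n).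

Definition coord_mx : 'M[PA]_n := \matrix_(i, j) coord k i j.
Definition emb : (n * n).-tuple PA := [tuple 'X_(lshift 1 l) | l < n * n].
Definition cmx x : 'M[PA]_n := map_mx (@mpolyC _ _) x.
Definition evmx T g : 'M[k]_n := map_mx (fun p => reg p g) T.

Lemma cmxM x y : cmx (x *m y) = cmx x *m cmx y.
exact:map_mxM. Qed.

Lemma evmx_mul T T' g : evmx (T *m T') g = evmx T g *m evmx T' g.
exact:(map_mxM (meval (rvec g))). Qed.

Lemma evmxB T T' g : evmx (T - T') g = evmx T g - evmx T' g.
exact:(map_mxB (meval (rvec g))). Qed.

Lemma evmx_coord g : evmx coord_mx g = g.
by apply/matrixP => i j;rewrite !mxE reg_coord. Qed.

Lemma evmx_cmx x g : evmx (cmx x) g = x.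
by apply/matrixP => i j;rewrite !mxE regC. Qed.

Lemma emb_coord i j : tnth emb (mxvec_index i j) = coord k i j.
by rewrite tnthE. Qed.

Lemma det_poly_emb : det_poly k n = (\det (gen_mx k n)) \mPo emb.
rewrite -(det_map_mx (comp_mpoly emb));congr (\det _).
by apply/matrixP => i j;rewrite [LHS]mxE [RHS]mxE gen_mxE /=;rewrite comp_mpolyXU -tnth_nth emb_coord.
Qed.

(** An auxiliary field that leaves 1/det fixed. It computes the derivative of det, from which [vf]
    takes its value on 1/det. *)
Definition vf0 T (i : 'I_(n * n + 1)) : PA := if fintype.split i is inl l then mxvec T 0 l else 0.
Definition vf T (i : 'I_(n * n + 1)) : PA := match fintype.split i with inl l => mxvec T 0 l
 | inr _ => - inv_det k n ^+ 2 * vfield (vf0 T) (det_poly k n) end.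

(* The derivation of k[GL_n] that sends the matrix X of coordinates to T. *)
Definition V T := vfield (vf T).

Lemma VD T p q : V T (p + q) = V T p + V T q.
exact:vfieldD. Qed.
Lemma VM T p q : V T (p * q) = p * V T q + q * V T p.
exact:vfieldM. Qed.
Lemma VC T c : V T c%:MP = 0.
exact:vfieldC. Qed.
Lemma V_der T : derivation (V T).
exact:vfield_der. Qed.
Lemma VZ T c p : V T (c *: p) = c *: V T p.
by rewrite -!mul_mpolyC VM VC mulr0 addr0. Qed.
Lemma V_zero T : V T 0 = 0.
by rewrite -mpolyC0 VC. Qed.
Lemma VN T p : V T (- p) = - V T p.
by rewrite -!scaleN1r VZ. Qed.
Lemma VB T p q : V T (p - q) = V T p - V T q.
by rewrite VD VN. Qed.
Lemma V_sum T (I : Type) (r : seq I) (P : pred I) (G : I -> PA) :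
 V T (\sum_(i <- r | P i) G i) = \sum_(i <- r | P i) V T (G i).
exact:(big_morph (V T) (VD T) (V_zero T)). Qed.

Lemma V_coord T i j : V T (coord k i j) = T i j.
by rewrite /V vfieldX /vf -[lshift 1 _]/(unsplit (inl _)) unsplitK mxvecE. Qed.

Lemma derivation_det (D D' : PA -> PA) : derivation D -> derivation D' -> (forall c, D c%:MP = 0) ->
 (forall c, D' c%:MP = 0) -> (forall i j, D (coord k i j) = D' (coord k i j)) -> D (det_poly k n) = D' (det_poly k n).
move=>dD dD' DC DC' e;rewrite det_poly_emb !der_const_comp //;eqbig => l _;congr (_ * _).
by case/mxvec_indexP: l => i j;rewrite emb_coord.
Qed.

Lemma V_inv T : V T (inv_det k n) = - inv_det k n ^+ 2 * V T (det_poly k n).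
rewrite {1}/V vfieldX /vf -[rshift _ _]/(unsplit (inr _)) unsplitK;congr (_ * _).
apply:derivation_det;[exact:vfield_der | exact:V_der | exact:vfieldC | exact:VC | move=>i j].
by rewrite V_coord vfieldX /vf0 -[lshift 1 _]/(unsplit (inl _)) unsplitK mxvecE.
Qed.

Lemma V_ext T (D : PA -> PA) : derivation D -> (forall c, D c%:MP = 0) ->
 (forall i j, D (coord k i j) = T i j) -> D (inv_det k n) = - inv_det k n ^+ 2 * D (det_poly k n) -> D =1 V T.
move=>dD DC Dc Di;apply:(derivation_ext dD (V_der T)) =>[c|l];first by rewrite DC VC.
case:(split_ordP l) =>[l' ->|j ->];first by case/mxvec_indexP: l' => i j;rewrite Dc V_coord.
rewrite ord1 -[X in D X]/(inv_det k n) Di -[X in _ = V T X]/(inv_det k n) V_inv;congr (_ * _).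
apply:derivation_det =>//;[exact:V_der | exact:VC | by move=>i' j';rewrite Dc V_coord].
Qed.

Lemma V_sub T T' p : V (T - T') p = V T p - V T' p.
apply/esym/(V_ext (D := fun p => V T p - V T' p)) =>[|c|i j|].
- by split=> q r;rewrite ?VD ?VM;ring.
- by rewrite !VC subrr.
- by rewrite !V_coord !mxE.
by rewrite !V_inv mulrBr.
Qed.

Lemma V_scale f T p : V (f *: T) p = f * V T p.
apply/esym/(V_ext (D := fun p => f * V T p)) =>[|c|i j|].
- by split=> q r;rewrite ?VD ?VM;ring.
- by rewrite !VC mulr0.
- by rewrite !V_coord !mxE.
by rewrite !V_inv;ring.
Qed.

Lemma V_add T T' p : V (T + T') p = V T p + V T' p.
have -> : T + T' = T - (- 1 *: T') by rewrite scaleN1r opprK.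
by rewrite V_sub V_scale mulN1r opprK.
Qed.

Lemma V_emb_eval T (q : {mpoly k[n * n]}) g : reg (V T (q \mPo emb)) g = mdiff q (mxvec g 0) (mxvec (evmx T g) 0).
rewrite der_const_comp ?VC //;[|exact:V_der | exact:VC].
rewrite reg_sum;eqbig => l _;rewrite regM /evmx;congr (_ * _).
 rewrite /reg comp_mpoly_meval;apply:meval_eq => l'. by rewrite tnthE mevalXU rvecl.
by case/mxvec_indexP: l => i j;rewrite emb_coord V_coord mxvecE mxE.
Qed.

Lemma V_eval0 T g p : evmx T g = 0 -> reg (V T p) g = 0.
move=>T0.
have md (q : {mpoly k[n * n]}) : reg (V T (q \mPo emb)) g = 0.
 rewrite V_emb_eval T0 /mdiff big1 // => i _;by rewrite linear0 mxE mulr0.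
move: p;apply:reg_ind =>[c|i j||p q hp hq|p q hp hq].
- by rewrite VC /reg meval0.
- by rewrite V_coord;move/matrixP: T0 => /(_ i j);rewrite !mxE.
- by rewrite V_inv regM det_poly_emb md mulr0.
- by rewrite VD regD hp hq addr0.
by rewrite VM regD !regM hp hq !mulr0 addr0.
Qed.

Lemma V_eval_eq T T' g p : evmx T g = evmx T' g -> reg (V T p) g = reg (V T' p) g.
move=>e;apply/eqP;rewrite -subr_eq0 -regB -V_sub;apply/eqP/V_eval0.
by rewrite evmxB e subrr.
Qed.

Definition det_rel : PA := det_poly k n * inv_det k n - 1.

Lemma det_rel_eval g : g \in unitmx -> reg det_rel g = 0.
rewrite unitmxE unitfE => dg.
by rewrite /det_rel regB regM reg_det reg_inv_det mulfV // /reg meval1 subrr.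
Qed.

Lemma V_det_rel T : V T det_rel = - V T (det_poly k n) * inv_det k n * det_rel.
by rewrite /det_rel VB VM V_inv -mpolyC1 VC mpolyC1;ring. Qed.

(** A power of det removes the variable 1/det, up to multiples of det * (1/det) - 1. *)
Lemma det_poly_clear p : exists N (q : {mpoly k[n * n]}) r,
 det_poly k n ^+ N * p = (q \mPo emb) + r * det_rel.
have dX N : det_poly k n ^+ N = (\det (gen_mx k n) ^+ N) \mPo emb by rewrite rmorphXn /= -det_poly_emb.
move: p;apply:reg_ind =>[c|i j||p q [N [p' [r hp]]] [N' [q' [r' hq]]]|p q [N [p' [r hp]]] [N' [q' [r' hq]]]].
- by exists 0%N, c%:MP, 0;rewrite comp_mpolyC mul0r addr0 expr0 mul1r.
- exists 0%N, 'X_(mxvec_index i j), 0.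
 by rewrite comp_mpolyXU -tnth_nth emb_coord mul0r addr0 expr0 mul1r.
- by exists 1%N, 1, 1;rewrite comp_mpoly1 /det_rel expr1;ring.
- exists (N + N')%N, (\det (gen_mx k n) ^+ N' * p' + \det (gen_mx k n) ^+ N * q'), (det_poly k n ^+ N' * r + det_poly k n ^+ N * r').
 rewrite comp_mpolyD !rmorphM /= -!dX.
 have -> : det_poly k n ^+ (N + N') * (p + q) = det_poly k n ^+ N' * (det_poly k n ^+ N * p) + det_poly k n ^+ N * (det_poly k n ^+ N' * q).
  by rewrite exprD;ring.
 by rewrite hp hq;ring.
exists (N + N')%N, (p' * q'), (r * (q' \mPo emb) + (p' \mPo emb) * r' + r * r' * det_rel).
have -> : det_poly k n ^+ (N + N') * (p * q) = (det_poly k n ^+ N * p) * (det_poly k n ^+ N' * q) by rewrite exprD;ring.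
by rewrite hp hq rmorphM /=;ring.
Qed.

Definition reg_ideal (G : set 'M[k]_n) : set PA := [set p | forall g, G g -> reg p g = 0].

Lemma reg_ideal_ideal G : is_ideal (reg_ideal G).
split=>[g _|p q hp hq g Gg|p q hq g Gg];first by rewrite /reg meval0.
 by rewrite regD hp // hq // addr0.
by rewrite regM hq // mulr0.
Qed.

(** A field tangent to G preserves its ideal. For polynomials in the matrix entries this is [lie_lx]
    at each point; a power of det reduces the general case to this one. *)
Lemma V_ideal (G : alg_group k n) T p :
 (forall g, carrier G g -> exists2 x, x \in lie G & evmx T g = g *m x) ->
 reg_ideal G p -> reg_ideal G (V T p).
move=>GT Ip;have [N [q [r e]]] := det_poly_clear p.
have iq : ideal_of G q.
 move=>g Gg;have := congr1 (fun p => reg p g) e;rewrite regM regD regM Ip // det_rel_eval ?(carrier_unit Gg) //.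
 rewrite !mulr0 addr0 /reg comp_mpoly_meval => h;rewrite -[RHS]/(0 : k) h;apply:meval_eq => l.
 by rewrite tnthE mevalXU rvecl.
move=>g Gg;have ug := carrier_unit Gg;have [x xG Tx] := GT g Gg.
have := congr1 (fun p => reg (V T p) g) e;rewrite /= VM VD VM V_det_rel !regD !regM Ip // det_rel_eval // V_emb_eval Tx.
rewrite -lx_eval (lie_lx xG iq) // !mul0r !mulr0 !addr0.
have -> : reg (det_poly k n ^+ N) g = \det g ^+ N by rewrite -reg_det;exact:rmorphXn.
move/eqP;rewrite mulf_eq0 expf_eq0;move: ug;rewrite unitmxE unitfE => /negPf ->.
by rewrite andbF => /eqP.
Qed.

(** [L x] is the left-invariant field with value g x at g; [Rt y] is the right-invariant field with
    value y g. *)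
Definition L x := V (coord_mx *m cmx x).
Definition Rt y := V (cmx y *m coord_mx).

Lemma evL x g : evmx (coord_mx *m cmx x) g = g *m x.
by rewrite evmx_mul evmx_coord evmx_cmx. Qed.

Lemma evR x g : evmx (cmx x *m coord_mx) g = x *m g.
by rewrite evmx_mul evmx_coord evmx_cmx. Qed.

Lemma L_ideal (G : alg_group k n) x p : x \in lie G -> reg_ideal G p -> reg_ideal G (L x p).
by move=>xG;apply:V_ideal => g Gg;exists x =>//;rewrite evL. Qed.

Lemma Rt_ideal (G : alg_group k n) x p : x \in lie G -> reg_ideal G p -> reg_ideal G (Rt x p).
move=>xG;apply:V_ideal => g Gg;exists (Ad (invmx g) x).
 by apply:Ad_lie =>//;apply:carrierV.
by rewrite evR /Ad invmxK !mulmxA mulmxV ?mul1mx // (carrier_unit Gg).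
Qed.

Lemma LB1 x y p : L (x - y) p = L x p - L y p.
by rewrite /L -V_sub -mulmxBr /cmx map_mxB. Qed.

Definition trans a b : (n * n + 1).-tuple PA :=
 [tuple match fintype.split i with inl l => mxvec (cmx a *m coord_mx *m cmx b) 0 l
  | inr _ => (\det a * \det b)^-1 *: inv_det k n end | i < n * n + 1].

Lemma trans_coord a b i j : coord k i j \mPo trans a b = (cmx a *m coord_mx *m cmx b) i j.
by rewrite comp_mpolyXU -tnth_nth tnthE -[lshift 1 _]/(unsplit (inl _)) unsplitK mxvecE.
Qed.

Lemma trans_inv a b : inv_det k n \mPo trans a b = (\det a * \det b)^-1 *: inv_det k n.
by rewrite comp_mpolyXU -tnth_nth tnthE -[rshift _ _]/(unsplit (inr _)) unsplitK. Qed.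

Lemma map_trans a b : map_mx (comp_mpoly (trans a b)) coord_mx = cmx a *m coord_mx *m cmx b.
by apply/matrixP => i j;rewrite [LHS]mxE [coord_mx _ _]mxE trans_coord. Qed.

Lemma trans_det a b : det_poly k n \mPo trans a b = (\det a * \det b) *: det_poly k n.
rewrite -[LHS]det_map_mx map_trans.
by rewrite !det_mulmx !det_map_mx -mul_mpolyC mpolyCM;rewrite -/(det_poly k n);ring.
Qed.

Lemma reg_trans a b p g : reg (p \mPo trans a b) g = reg p (a *m g *m b).
move: p;apply:reg_ind =>[c|i j||p q hp hq|p q hp hq].
- by rewrite comp_mpolyC !regC.
- rewrite trans_coord reg_coord;have -> (M : 'M[PA]_n) : reg (M i j) g = evmx M g i j by rewrite mxE.
 by rewrite !evmx_mul !evmx_cmx evmx_coord.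
- by rewrite trans_inv regZ !reg_inv_det !det_mulmx -!invfM;congr (_^-1);ring.
- by rewrite comp_mpolyD !regD hp hq.
by rewrite rmorphM /= !regM hp hq.
Qed.

Lemma V_mx T a b : map_mx (V T) (cmx a *m coord_mx *m cmx b) = cmx a *m T *m cmx b.
apply/matrixP => i j;rewrite 2!mxE V_sum [RHS]mxE;eqbig => l _.
have -> : cmx b l j = (b l j)%:MP by rewrite mxE.
rewrite VM VC mulr0 add0r mulrC;congr (_ * _);rewrite 2!mxE V_sum;eqbig => l' _.
have -> : cmx a i l' = (a i l')%:MP by rewrite mxE.
by rewrite VM VC mulr0 addr0 [coord_mx _ _]mxE V_coord.
Qed.

Lemma L_trans x a b p : a \in unitmx -> b \in unitmx ->
 L x (p \mPo trans a b) = L (invmx b *m x *m b) p \mPo trans a b.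
move=>ua ub;set z := invmx b *m x *m b;move: p.
have cE i j : L x (coord k i j \mPo trans a b) = L z (coord k i j) \mPo trans a b.
 rewrite trans_coord /L V_coord;have -> (M : 'M[PA]_n) : V (coord_mx *m cmx x) (M i j) = map_mx (V (coord_mx *m cmx x)) M i j.
  by rewrite mxE.
 have -> (M : 'M[PA]_n) : M i j \mPo trans a b = map_mx (comp_mpoly (trans a b)) M i j by rewrite mxE.
 rewrite V_mx map_mxM map_trans.
 have -> : map_mx (comp_mpoly (trans a b)) (cmx z) = cmx z by apply/matrixP => u v;rewrite !mxE comp_mpolyC.
 have e : cmx x *m cmx b = cmx b *m cmx z.
  by rewrite -!cmxM /z !mulmxA mulmxV // mul1mx.
 by rewrite -!mulmxA e.
have lE l : L x (tnth emb l \mPo trans a b) = L z (tnth emb l) \mPo trans a b.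
 by have [i [j ->]] := mxvec_index_ex l;rewrite emb_coord.
have PD p q : L x (p \mPo trans a b) = L z p \mPo trans a b -> L x (q \mPo trans a b) = L z q \mPo trans a b ->
  L x ((p + q) \mPo trans a b) = L z (p + q) \mPo trans a b.
 by move=>hp hq;rewrite /L comp_mpolyD !VD -!/(L _ _) hp hq comp_mpolyD.
have PM p q : L x (p \mPo trans a b) = L z p \mPo trans a b -> L x (q \mPo trans a b) = L z q \mPo trans a b ->
  L x ((p * q) \mPo trans a b) = L z (p * q) \mPo trans a b.
 by move=>hp hq;rewrite /L rmorphM /= !VM -!/(L _ _) hp hq comp_mpolyD !rmorphM.
have PC c : L x (c%:MP \mPo trans a b) = L z c%:MP \mPo trans a b.
 by rewrite /L comp_mpolyC !VC comp_mpoly0.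
have detE : L x (det_poly k n \mPo trans a b) = L z (det_poly k n) \mPo trans a b.
 rewrite det_poly_emb;move: (\det _);apply:mpoly_gen_ind =>[c|l|p' q hp hq|p' q hp hq].
 - by rewrite comp_mpolyC.
 - by rewrite comp_mpolyXU -tnth_nth.
 - by rewrite [(p' + q) \mPo emb]comp_mpolyD;apply:PD.
 have -> : (p' * q) \mPo emb = (p' \mPo emb) * (q \mPo emb) by exact:rmorphM. exact:PM.
apply:reg_ind =>// .
have u0 : \det a * \det b != 0 by move: ua ub;rewrite !unitmxE !unitfE => ? ?;apply:mulf_neq0.
rewrite trans_inv /L VZ !V_inv rmorphM /= rmorphN rmorphXn /= trans_inv -/(L z _) -detE trans_det /L VZ.
rewrite -!mul_mpolyC;set s := \det a * \det b;set a1 := s^-1%:MP;set a2 := s%:MP.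
have e : a1 * a2 = 1 by rewrite -mpolyCM mulVf.
by ring: e.
Qed.

Lemma clear_denominator p : exists N (q : {mpoly k[n * n]}), forall g, g \in unitmx ->
 mx_eval q g = \det g ^+ N * reg p g.
have [N [q [r E]]] := det_poly_clear p;exists N, q => g ug;have := congr1 (fun p => reg p g) E.
rewrite regD !regM det_rel_eval // mulr0 addr0 -reg_det [reg (_ ^+ N) g](rmorphXn (meval (rvec g))) => ->.
by rewrite /reg comp_mpoly_meval;apply:meval_eq => l;rewrite tnthE mevalXU rvecl.
Qed.

End Fields.

(** * Representations as subrepresentations of a graph group *)

Section GraphGroup.
Variables (k : closedFieldType) (n m : nat) (F : alg_group k n).
Variables (R : 'M[k]_n -> 'M[k]_m) (Q : 'I_m -> 'I_m -> {mpoly k[n * n + 1]}).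
Hypotheses (RQ : forall g, carrier F g -> forall i j, R g i j = reg (Q i j) g)
 (R1 : R 1%:M = 1%:M) (RM : forall g h, carrier F g -> carrier F h -> R (g *m h) = R g *m R h).

(** [fixed_vector] concerns the defining representation of a matrix group. The graph of R realises F
    by larger matrices whose defining representation contains R. *)
Definition graph g : 'M[k]_(n + m) := block_mx g 0 0 (R g).

Definition graph_carrier : set 'M[k]_(n + m) := [set z | exists2 g, carrier F g & z = graph g].

Lemma graphM g h : carrier F g -> carrier F h -> graph g *m graph h = graph (g *m h).
by move=>Fg Fh;rewrite /graph mulmx_block !mulmx0 !mul0mx !addr0 !add0r RM.
Qed.

Lemma graph1 : graph 1%:M = 1%:M.
by rewrite /graph R1 -scalar_mx_block. Qed.

Lemma graphV g : carrier F g -> graph (invmx g) *m graph g = 1%:M.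
by move=>Fg;rewrite graphM // ?mulVmx ?graph1 ?(carrier_unit Fg) //;apply:carrierV. Qed.

Lemma graph_unit z : graph_carrier z -> z \in unitmx.
by move=>[g Fg ->];have /mulmx1_unit[] := graphV Fg. Qed.

Lemma graph_invmx g : carrier F g -> invmx (graph g) = graph (invmx g).
move=>Fg;have u := graph_unit (ex_intro2 _ _ g Fg erefl).
by rewrite -[RHS]mulmx1 -(mulmxV u) mulmxA graphV // mul1mx.
Qed.

Lemma graph_carrier1 : graph_carrier 1%:M.
by exists 1%:M;[apply:carrier1 | rewrite graph1]. Qed.

Lemma graph_carrierM z z' : graph_carrier z -> graph_carrier z' -> graph_carrier (z *m z').
by move=>[g Fg ->] [h Fh ->];exists (g *m h);[apply:carrierM | rewrite graphM]. Qed.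

Lemma graph_carrierV z : graph_carrier z -> graph_carrier (invmx z).
by move=>[g Fg ->];exists (invmx g);[apply:carrierV | rewrite graph_invmx]. Qed.

Lemma sub_linear n1 m1 n2 m2 (f : 'M[k]_(n1, m1) -> 'M[k]_(n2, m2)) :
 (forall c u v, f (c *: u + v) = c *: f u + f v) -> exists L : {linear 'M[k]_(n1, m1) -> 'M[k]_(n2, m2)}, L =1 f.
move=>fL;pose L : {linear 'M[k]_(n1, m1) -> 'M[k]_(n2, m2)} := HB.pack f (GRing.isLinear.Build _ _ _ _ f fL).
by exists L.
Qed.

Lemma ulsubmx_sub : exists L : {linear 'M[k]_(n + m) -> 'M[k]_n}, forall z, L z = ulsubmx z.
have fL c (u v : 'M[k]_(n + m)) : (ulsubmx (c *: u + v) : 'M[k]_n) = c *: ulsubmx u + ulsubmx v.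
 by apply/matrixP => i j;rewrite !mxE.
by have [L LE] := sub_linear fL;exists L.
Qed.

Lemma graph_closed : zclosed_in [set z | z \in unitmx] graph_carrier.
have [S FS] := carrier_closed F.
have [ul ulE] := ulsubmx_sub.
have [c [c1 _]] := lin_sub ul.
have : forall ij, exists t : nat * {mpoly k[n * n]}, forall g, g \in unitmx ->
  mx_eval t.2 g = \det g ^+ t.1 * reg (Q ij.1 ij.2) g.
 by move=>ij;have [N [q h]] := clear_denominator (Q ij.1 ij.2);exists (N, q).
move/choice =>[t tE].
pose D : {mpoly k[n * n]} := \det (gen_mx k n).
have DE g : mx_eval D g = \det g by rewrite /mx_eval /D -det_map_mx gen_mx_eval.
have DXE N g : mx_eval (D ^+ N) g = \det g ^+ N by rewrite /mx_eval rmorphXn /= -/(mx_eval _ _) DE.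
pose x a b : {mpoly k[(n + m) * (n + m)]} := 'X_(mxvec_index a b).
have xE a b z : mx_eval (x a b) z = z a b by rewrite /mx_eval mevalXU mxvecE.
(* The equations of F on the upper block, the vanishing of the mixed blocks, and the entries of R in
   the lower block with the powers of det cleared. *)
pose P := [set p | exists2 p0, S p0 & p = p0 \mPo c] `|`
 [set p | exists i j, p = x (lshift m i) (rshift n j) \/ p = x (rshift n j) (lshift m i)] `|`
 [set p | exists i j, p = (D ^+ (t (i, j)).1 \mPo c) * x (rshift n i) (rshift n j) - ((t (i, j)).2 \mPo c)].
exists P;apply/seteqP;split=>[_ [g Fg ->]|z [uz hz]].
 split;first by apply:graph_unit;exists g. have ulg : ulsubmx (graph g) = g by rewrite block_mxKul.
 move=>p [[[p0 Sp ->]|[i [j [->|->]]]]|[i [j ->]]].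
 - rewrite /mx_eval c1 ulE ulg;by move: Fg;rewrite FS => -[_];apply.
 - by rewrite xE block_mxEur mxE.
 - by rewrite xE block_mxEdl mxE.
 rewrite mx_evalB {1}/mx_eval mevalM -!/(mx_eval _ _) xE /mx_eval !c1 ulE ulg -!/(mx_eval _ _).
 rewrite tE ?(carrier_unit Fg) // block_mxEdr RQ // /mx_eval rmorphXn /= -/(mx_eval _ _) DE. by rewrite subrr.
have ur0 : ursubmx z = 0.
 apply/matrixP => i j;have := hz (x (lshift m i) (rshift n j));rewrite xE !mxE;apply.
 by left;right;exists i, j;left.
have dl0 : dlsubmx z = 0.
 apply/matrixP => j i;have := hz (x (rshift n j) (lshift m i));rewrite xE !mxE;apply.
 by left;right;exists i, j;right.
pose g := ulsubmx z.
have zE : z = block_mx g 0 0 (drsubmx z) by rewrite -[LHS]submxK ur0 dl0.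
have ug : g \in unitmx.
 by move: uz;rewrite /= zE !unitmxE det_ublock unitrM => /andP[].
have Fg : carrier F g.
 rewrite FS;split=>// p Sp;have := hz (p \mPo c);rewrite /mx_eval c1 ulE;apply. by left;left;exists p.
exists g =>//;rewrite zE /graph;congr block_mx;apply/matrixP => i j;rewrite RQ //.
have := hz ((D ^+ (t (i, j)).1 \mPo c) * x (rshift n i) (rshift n j) - ((t (i, j)).2 \mPo c)).
rewrite mx_evalB {1}/mx_eval mevalM -!/(mx_eval _ _) xE /mx_eval !c1 ulE -/g -!/(mx_eval _ _).
rewrite tE // DXE -mulrBr => h.
have /eqP := h (or_intror (ex_intro _ i (ex_intro _ j erefl))).
move: ug;rewrite unitmxE unitfE => dg.
by rewrite mulf_eq0 expf_eq0 (negPf dg) andbF /= subr_eq0 => /eqP <-;rewrite 2!mxE.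
Qed.

Definition graph_group : alg_group k (n + m) :=
 AlgGroup graph_unit graph_carrier1 graph_carrierM graph_carrierV graph_closed.

(** A connected normal unipotent closed subgroup of the graph is pulled back to one of F: closed
    sets correspond under g |-> graph g, and the upper block of a unipotent matrix is unipotent. *)
Lemma graph_reductive : reductive F -> reductive graph_group.
move=>redF U [UF UN] Uc Uu.
pose V : set 'M[k]_n := [set g | carrier F g /\ carrier U (graph g)].
have Vu g : V g -> g \in unitmx by move=>[/carrier_unit].
have V1 : V 1%:M by split;[apply:carrier1 | rewrite graph1;apply:carrier1].
have VM g h : V g -> V h -> V (g *m h).
 by move=>[Fg Ug] [Fh Uh];split;[apply:carrierM | rewrite -graphM //;apply:carrierM].
have VV g : V g -> V (invmx g).
 by move=>[Fg Ug];split;[apply:carrierV | rewrite -graph_invmx //;apply:carrierV].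
pose e : ((n + m) * (n + m)).-tuple {mpoly k[n * n + 1]} := [tuple
 mxvec (block_mx (\matrix_(i, j) 'X_(lshift 1 (mxvec_index i j))) 0 0 (\matrix_(i, j) Q i j)) 0 l | l < (n + m) * (n + m)].
have eE p g : carrier F g -> reg (p \mPo e) g = mx_eval p (graph g).
 move=>Fg;rewrite /reg comp_mpoly_meval /mx_eval;apply:meval_eq => l;rewrite tnthE.
 have -> : (mxvec (block_mx (\matrix_(i, j) 'X_(lshift 1 (mxvec_index i j))) 0 0 (\matrix_(i, j) Q i j)) 0 l).@[rvec g]
   = map_mx (meval (rvec g)) (mxvec (block_mx (\matrix_(i, j) 'X_(lshift 1 (mxvec_index i j))) 0 0 (\matrix_(i, j) Q i j))) 0 l.
  by rewrite [RHS]mxE.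
 rewrite map_mxvec map_block_mx !map_mx0;congr (mxvec (block_mx _ _ _ _) _ _).
  by apply/matrixP => i j;rewrite !mxE mevalXU rvecl mxvecE.
 by apply/matrixP => i j;rewrite !mxE RQ.
have Vc : zclosed_in [set g | g \in unitmx] V.
 have [S FS] := carrier_closed F;have [S' US] := carrier_closed U.
 have : forall p : {mpoly k[(n + m) * (n + m)]}, exists t : nat * {mpoly k[n * n]}, forall g, g \in unitmx ->
   mx_eval t.2 g = \det g ^+ t.1 * reg (p \mPo e) g.
  by move=>p;have [N [q h]] := clear_denominator (p \mPo e);exists (N, q).
 move/choice =>[t tE].
 exists (S `|` [set p | exists2 p', S' p' & p = (t p').2]);apply/seteqP;split=>[g [Fg Ug]|g [ug hg]].
  split=>[|p [Sp|[p' Sp' ->]]];first exact:carrier_unit Fg.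
   by move: Fg;rewrite FS => -[_];apply.
  rewrite tE ?(carrier_unit Fg) // eE //;move: Ug;rewrite US => -[_ ->] //. by rewrite mulr0.
 have Fg : carrier F g by rewrite FS;split=>// p Sp;apply:hg;left.
 split=>//;rewrite US;split=>[|p Sp];first by apply:graph_unit;exists g.
 have /eqP := hg (t p).2 (or_intror (ex_intro2 _ _ p Sp erefl));rewrite tE // eE //.
 by move: ug;rewrite /= unitmxE unitfE mulf_eq0 expf_eq0 => /negPf ->;rewrite andbF => /eqP.
pose UV : alg_group k n := AlgGroup Vu V1 VM VV Vc.
have [ul ulE] := ulsubmx_sub.
have [c [c1 _]] := lin_sub ul.
have ulg g : ulsubmx (graph g) = g by rewrite block_mxKul.
have V_1 : carrier UV = [set 1%:M].
 apply:redF.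
 - split=>[g []//|g u Fg [Fu Uu']];split.
   by apply:carrierM;[apply:carrierM | apply:carrierV].
  have Gg : carrier graph_group (graph g) by exists g.
  have := UN _ _ Gg Uu';rewrite graph_invmx // graphM // graphM //;first exact:carrierM. exact:carrierV.
 - move=>Y [S YS] [S' YS'];pose Y' : set 'M[k]_(n + m) := [set z | carrier U z /\ Y (ulsubmx z)].
  have UE z : carrier U z -> V (ulsubmx z) /\ z = graph (ulsubmx z).
   by move=>Uz;have [g Fg zg] := UF _ Uz;rewrite {1 2 3}zg ulg;split=>//;split=>//;rewrite -zg.
  have YV : Y `<=` V by rewrite YS => g []. have [||Y0|Y1] := Uc Y'.
  + exists [set p | exists2 p0, S p0 & p = p0 \mPo c];apply/seteqP;split=> z [Uz h].
    split=>// _ [p Sp ->];rewrite /mx_eval c1 ulE. by move: h;rewrite YS => -[_];apply.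
   split=>//;rewrite YS;split=>[|p Sp];first by case:(UE z Uz).
   by have := h (p \mPo c);rewrite /mx_eval c1 ulE;apply;exists p.
  + exists [set p | exists2 p0, S' p0 & p = p0 \mPo c];apply/seteqP;split=> z [Uz h].
    split=>// _ [p Sp ->];rewrite /mx_eval c1 ulE. have : (V `\` Y) (ulsubmx z).
     by split;[case:(UE z Uz) | move=>hY;apply:h;split].
    by rewrite [V `\` Y]YS' => -[_];apply.
   split=>// -[_ hY];have : (V `\` Y) (ulsubmx z).
    rewrite [V `\` Y]YS';split=>[|p Sp];first by case:(UE z Uz).
    by have := h (p \mPo c);rewrite /mx_eval c1 ulE;apply;exists p.
   by case.
  + left;apply/seteqP;split=>// g Yg;have [Fg Ug] := YV g Yg.
   have : Y' (graph g) by split=>//;rewrite ulg. by rewrite Y0.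
  right;apply/seteqP;split=>// g [Fg Ug]. by have : Y' (graph g) by [rewrite Y1];case;rewrite ulg.
 - move=>u [Fu /Uu[N uN]];exists N.
  have h M : exists A, (graph u - 1%:M) ^+ M = block_mx ((u - 1%:M) ^+ M) 0 0 A.
   elim: M =>[|M [A IH]];first by exists 1%:M;rewrite !expr0 -scalar_mx_block.
   exists ((R u - 1%:M) *m A);rewrite !exprS IH.
   rewrite -[X in X = _]/((graph u - 1%:M) *m block_mx ((u - 1%:M) ^+ M) 0 0 A).
   rewrite scalar_mx_block /graph opp_block_mx add_block_mx oppr0 !addr0 mulmx_block.
   by rewrite !mulmx0 !mul0mx !oppr0 !(addr0, add0r) !mul0mx.
  have [A hA] := h N;move: uN;rewrite hA => /matrixP h0;apply/matrixP => i j.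
  by have := h0 (lshift m i) (lshift m j);rewrite block_mxEul => ->;rewrite !mxE.
apply/seteqP;split=>[z Uz|_ ->];last exact:carrier1.
have [g Fg zg] := UF _ Uz;have : V g by split=>//;rewrite -zg.
by rewrite -[V]/(carrier UV) V_1 => g1;rewrite zg /= g1 graph1.
Qed.

Lemma representation_fixed (E : 'M[k]_m) (v : 'rV[k]_m) : has_pchar0 k -> reductive F ->
 (forall g, carrier F g -> (E *m R g <= E)%MS) ->
 (forall g, carrier F g -> (v *m R g - v <= E)%MS) ->
 exists2 y : 'rV[k]_m, (y <= E)%MS & forall g, carrier F g -> (v - y) *m R g = v - y.
move=>char0 redF EF vF;pose E' : 'M[k]_(n + m) := block_mx 0 0 0 E.
have rgr w (X : 'M[k]_(w, m)) g : row_mx 0 X *m graph g = row_mx 0 (X *m R g).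
 by rewrite /graph mul_row_block !mulmx0 !mul0mx !addr0 !add0r.
have sub w (X : 'M[k]_(w, m)) : (X <= E)%MS -> (row_mx 0 X <= E')%MS.
 move=>/submxP[D ->];apply/submxP;exists (row_mx 0 D). by rewrite /E' mul_row_block !mulmx0 !addr0 add0r.
have h1 z : carrier graph_group z -> (E' *m z <= E')%MS.
 move=>[g Fg ->];rewrite /E' /graph mulmx_block !mulmx0 !mul0mx !addr0 !add0r.
 have -> : block_mx 0 0 0 (E *m R g) = col_mx (0 : 'M_(n, n + m)) (row_mx 0 (E *m R g)).
  by rewrite /block_mx row_mx0.
 by rewrite col_mx_sub sub0mx /=;apply:sub;apply:EF.
have h2 z : carrier graph_group z -> (row_mx 0 v *m z - row_mx 0 v <= E')%MS.
 by move=>[g Fg ->];rewrite rgr opp_row_mx add_row_mx subr0;apply:sub;apply:vF.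
have [y yE yF] := fixed_vector char0 (graph_reductive redF) (rank_leq_row E') h1 h2.
have [D yD] : exists D, y = D *m E' by apply/submxP.
have yE2 : y = row_mx 0 (rsubmx D *m E).
 by rewrite yD -{1}[D]hsubmxK /E' mul_row_block !mulmx0 !addr0 add0r.
exists (rsubmx D *m E);first exact:submxMl.
move=>g Fg;have := yF (graph g) (ex_intro2 _ _ g Fg erefl).
by rewrite yE2 opp_row_mx add_row_mx subr0 rgr => /eq_row_mx[].
Qed.

End GraphGroup.

(** * Linear reductivity for rational actions on arbitrary spaces *)

Lemma row_basis_of_set (k : fieldType) p (S : set 'rV[k]_p) : exists m (f : 'I_m -> 'rV[k]_p),
 [/\ forall i, S (f i), row_free (\matrix_i f i) & forall s, S s -> (s <= \matrix_i f i)%MS].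
suff ext l m (f : 'I_m -> 'rV[k]_p) : (p - m <= l)%N -> (forall i, S (f i)) -> row_free (\matrix_i f i) ->
  exists m (f : 'I_m -> 'rV[k]_p), [/\ forall i, S (f i), row_free (\matrix_i f i) & forall s, S s -> (s <= \matrix_i f i)%MS].
 apply:(ext p 0%N (fun=> 0)) =>[|[]//|];first by rewrite subn0.
 by rewrite /row_free -leqn0;apply:rank_leq_row.
elim: l m f =>[|l IH] m f lm fS ff.
 exists m, f;split=>// s _;apply:submx_full.
 rewrite /row_full eqn_leq rank_leq_col /=;move/eqP: ff => ->. by rewrite -subn_eq0 -leqn0.
have [h|/existsNP[s /not_implyP[Ss /negP ns]]] := pselect (forall s, S s -> (s <= \matrix_i f i)%MS).
 by exists m, f.
pose f' (i : 'I_(m + 1)) := if fintype.split i is inl j then f j else s.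
have E : \matrix_i f' i = col_mx (\matrix_i f i) s.
 apply/row_matrixP => i;rewrite rowK /f';case:split_ordP => j ->.
  by rewrite rowKu rowK.
 by rewrite rowKd;apply/rowP => l';rewrite mxE ord1.
have rk : \rank (col_mx (\matrix_i f i) s) = (m + 1)%N.
 have /eqP fr := ff. have le1 := rank_leq_row (col_mx (\matrix_i f i) s).
 suff lt : (m < \rank (col_mx (\matrix_i f i) s))%N by move: le1 lt;clear;lia. rewrite ltnNge.
 apply:contra ns => le;have sub : (\matrix_i f i <= col_mx (\matrix_i f i) s)%MS by rewrite -addsmxE addsmxSl.
 have /eqmxP eq : (\matrix_i f i == col_mx (\matrix_i f i) s)%MS.
  by rewrite -(mxrank_leqif_eq sub) eqn_leq mxrankS //= fr.
 by rewrite eq -addsmxE addsmxSr.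
apply:(IH (m + 1)%N f') =>[|i|];[|by rewrite /f';case:split_ordP|by rewrite E /row_free rk].
have : (m + 1 <= p)%N by rewrite -rk;apply:rank_leq_col.
lia.
Qed.

Section LinearReductivity.
Variables (k : closedFieldType) (n : nat) (char0 : has_pchar0 k) (F : alg_group k n).
Variables (X : lmodType k) (act : 'M[k]_n -> X -> X).

(** A right action, in accordance with row vectors. Finiteness is asked of the orbit of u0 alone, as
    functions on G form an infinite-dimensional space. *)
Definition rational_act u0 := [/\ forall g c u v, act g (c *: u + v) = c *: act g u + act g v,
 forall u, act 1%:M u = u,
 forall g h u, carrier F g -> carrier F h -> act (g *m h) u = act h (act g u) &
 exists p (q : 'I_p -> {mpoly k[n * n + 1]}) (x : 'I_p -> X),
  forall g, carrier F g -> act g u0 = \sum_i reg (q i) g *: x i].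

(* Complete reducibility: a vector that is fixed modulo a stable subspace can be
  corrected to a fixed vector. *)
Theorem linear_reductivity u (Y : set X) : reductive F -> rational_act u ->
 Y 0 -> (forall c v w, Y v -> Y w -> Y (c *: v + w)) ->
 (forall g v, carrier F g -> Y v -> Y (act g v)) ->
 (forall g, carrier F g -> Y (act g u - u)) ->
 exists2 y, Y y & forall g, carrier F g -> act g (u - y) = u - y.
move=>redF [actL act1 actM [p [q [x ux]]]] Y0 YL YF uY.
pose lc (c : 'rV[k]_p) := \sum_i c 0 i *: x i.
have lcL a c d : lc (a *: c + d) = a *: lc c + lc d.
 rewrite /lc scaler_sumr -big_split;eqbig => i _ /=. by rewrite !mxE scalerDl scalerA.
have lc0 : lc 0 = 0 by rewrite /lc big1 // => i _;rewrite mxE scale0r.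
pose KP : set 'rV[k]_p := [set c | lc c = 0].
have [K KE] : exists K : {vspace 'rV[k]_p}, forall v, v \in K <-> KP v.
 apply:vspace_of_set =>[|a c d];rewrite /KP /=;first exact:lc0.
 by move=>hc hd;rewrite lcL hc hd scaler0 addr0.
pose KM : 'M[k]_p := \matrix_i projv K (delta_mx 0 i).
have KME (c : 'rV_p) : (c <= KM)%MS <-> lc c = 0.
 split=>[/submxP[d ->]|/KE cK].
  by apply/KE;rewrite mulmx_sum_row;apply:memv_suml => i _;rewrite rowK;apply/memvZ/memv_proj.
 apply/submxP;exists c;rewrite mulmx_sum_row -{1}(projv_id cK) {1}[c]row_sum_delta linear_sum /=.
 by eqbig => i _;rewrite linearZ rowK.
(* The x i may be dependent; multiplication by A divides out their relations. *)
pose A := cokermx KM.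
have AE (c : 'rV_p) : c *m A = 0 <-> lc c = 0 by rewrite -KME submxE;split=>[->//|/eqP].
pose Qv g : 'rV[k]_p := \row_i reg (q i) g.
have uQ g : carrier F g -> act g u = lc (Qv g).
 by move=>Fg;rewrite ux //;eqbig => i _;rewrite mxE.
(* A basis of the span of the orbit of u is chosen among the points of the orbit. The coordinates of
   act (gj j *m g) u in it are regular functions of g, so [Rm] is a matrix representation with
   regular entries. *)
have [m [f [fS ff fs]]] := row_basis_of_set [set r | exists2 g, carrier F g & r = Qv g *m A].
have : forall j, exists g, carrier F g /\ f j = Qv g *m A by move=>j;have [g Fg e] := fS j;exists g.
move/fin_all_exists =>[gj gjE];pose e j := act (gj j) u.
set G := \matrix_i f i in ff fs.
have GC : G *m pinvmx G = 1%:M by apply:mulmxVp.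
pose co g : 'rV[k]_m := Qv g *m A *m pinvmx G.
have coG g : carrier F g -> co g *m G = Qv g *m A.
 by move=>Fg;rewrite /co mulmxKpV //;apply:fs;exists g.
pose le (c : 'rV[k]_m) := \sum_j c 0 j *: e j.
have leL a c d : le (a *: c + d) = a *: le c + le d.
 rewrite /le scaler_sumr -big_split;eqbig => i _ /=. by rewrite !mxE scalerDl scalerA.
have leB (c d : 'rV_m) : le (c - d) = le c - le d.
 have -> : c - d = (-1) *: d + c by rewrite scaleN1r addrC. by rewrite leL scaleN1r addrC.
have lcS (I : finType) (c : I -> k) (d : I -> 'rV_p) : lc (\sum_i c i *: d i) = \sum_i c i *: lc (d i).
 apply:(big_rec2 (fun a b => lc a = b)) =>// i a b _ <-;exact:lcL.
have leE (c : 'rV_m) : le c = lc (\sum_j c 0 j *: Qv (gj j)).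
 by rewrite lcS;eqbig => j _;rewrite /e uQ //;case:(gjE j).
have GE (c : 'rV_m) : (\sum_j c 0 j *: Qv (gj j)) *m A = c *m G.
 rewrite mulmx_suml [RHS]mulmx_sum_row;eqbig => j _. by rewrite rowK -scalemxAl;case:(gjE j) => _ ->.
have le_inj c d : le c = le d -> c = d.
 move=>ecd;apply:(row_free_inj ff);rewrite -!GE;apply/eqP;rewrite -subr_eq0 -mulmxBl;apply/eqP/AE.
 by rewrite -scaleN1r addrC lcL -!leE ecd scaleN1r addNr.
have co_le g : carrier F g -> le (co g) = act g u.
 move=>Fg;rewrite leE uQ //;apply/eqP;rewrite -subr_eq0 -scaleN1r addrC -lcL;apply/eqP/AE.
 by rewrite mulmxDl -scalemxAl GE coG // scaleN1r addNr.
pose Rm g : 'M[k]_m := \matrix_j co (gj j *m g).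
have Fgj j : carrier F (gj j) by case:(gjE j).
have actS (I : finType) g (c : I -> k) (d : I -> X) : act g (\sum_i c i *: d i) = \sum_i c i *: act g (d i).
 have act0 : act g 0 = 0 by have := actL g (-1) 0 0;rewrite scaler0 addr0 scaleN1r addNr.
 apply:(big_rec2 (fun a b => act g a = b)) =>// i a b _ <-;exact:actL.
have leR g c : carrier F g -> le (c *m Rm g) = act g (le c).
 move=>Fg;rewrite /le actS mulmx_sum_row.
 have -> : \sum_j (\sum_i c 0 i *: row i (Rm g)) 0 j *: e j = le (\sum_i c 0 i *: row i (Rm g)) by [].
 have leS (I : finType) (a : I -> k) (d : I -> 'rV_m) : le (\sum_i a i *: d i) = \sum_i a i *: le (d i).
  have le0 : le 0 = 0 by rewrite /le big1 // => i _;rewrite mxE scale0r.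
  apply:(big_rec2 (fun a b => le a = b)) =>// i a' b _ <-;exact:leL.
 rewrite leS;eqbig => j _;congr (_ *: _);rewrite rowK co_le;last exact:carrierM. exact:actM.
have RmM g h : carrier F g -> carrier F h -> Rm (g *m h) = Rm g *m Rm h.
 move=>Fg Fh;apply/row_matrixP => j;rewrite row_mul;apply:le_inj.
 rewrite leR // !rowK !co_le ?mulmxA ?actM //;do ?apply:carrierM =>//;exact:carrierM.
have Rm1 : Rm 1%:M = 1%:M.
 apply/row_matrixP => j;apply:le_inj;rewrite rowK co_le ?mulmx1 // rowE mulmx1.
 rewrite /le (bigD1 j) //= !mxE !eqxx scale1r big1 ?addr0 // => i /negPf ij. by rewrite mxE ij andbF scale0r.
have : forall i j, exists Q : {mpoly k[n * n + 1]}, forall g, carrier F g -> Rm g i j = reg Q g.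
 move=>i j;pose c := trans (gj i) 1%:M;have cE := reg_trans (gj i) 1%:M.
 exists (\sum_l (A *m pinvmx G) l j *: (q l \mPo c)) => g Fg.
 rewrite mxE /co -mulmxA mxE /reg rmorph_sum;eqbig => l _ /=.
 by rewrite mevalZ -/(reg _ _) cE mulmx1 mulrC [Qv _ _ _]mxE.
move=>hQ;have {}hQ i : exists Q : 'I_m -> {mpoly k[n * n + 1]}, forall j g, carrier F g -> Rm g i j = reg (Q j) g.
 exact:(fin_all_exists (hQ i)).
have [Q QE] := fin_all_exists hQ.
have [E EE] : exists E : 'M[k]_m, forall c : 'rV_m, (c <= E)%MS <-> Y (le c).
 have le0 : le 0 = 0 by rewrite /le big1 // => i _;rewrite mxE scale0r.
 have [U UE] : exists U : {vspace 'rV[k]_m}, forall v, v \in U <-> [set c | Y (le c)] v.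
  apply:vspace_of_set =>[|a c d];rewrite /= ?le0 // leL;exact:YL.
 exists (\matrix_i projv U (delta_mx 0 i)) => c;split=>[/submxP[d ->]|/UE cU].
  by apply/UE;rewrite mulmx_sum_row;apply:memv_suml => i _;rewrite rowK;apply/memvZ/memv_proj.
 apply/submxP;exists c;rewrite mulmx_sum_row -{1}(projv_id cU) {1}[c]row_sum_delta linear_sum /=.
 by eqbig => i _;rewrite linearZ rowK.
have [||y yE yF] := @representation_fixed k n m F Rm Q (fun g Fg i j => QE i j g Fg) Rm1 RmM E (co 1%:M) char0 redF.
- move=>g Fg;apply/row_subP => i;rewrite row_mul;apply/EE;rewrite leR //;apply:YF =>//.
 by apply/EE;apply:row_sub.
- move=>g Fg;apply/EE;rewrite leB leR // co_le ?act1;last exact:carrier1.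
 exact:uY.
exists (le y);first exact/EE.
have u1 : le (co 1%:M) = u by rewrite co_le ?act1 //;apply:carrier1.
by move=>g Fg;rewrite -{1}u1 -leB -leR // yF // leB u1.
Qed.

End LinearReductivity.

Lemma rational_index (k : closedFieldType) n (F : alg_group k n) (X : lmodType k) (act : 'M[k]_n -> X -> X) u
  (T : finType) (q : T -> {mpoly k[n * n + 1]}) (x : T -> X) :
 (forall g, carrier F g -> act g u = \sum_t reg (q t) g *: x t) ->
 exists p (q : 'I_p -> {mpoly k[n * n + 1]}) (x : 'I_p -> X),
  forall g, carrier F g -> act g u = \sum_i reg (q i) g *: x i.
move=>h;exists #|{: T}|, (q \o enum_val), (x \o enum_val) => g Fg;rewrite h //.
by rewrite (reindex (enum_val (A := T))) //;apply:onW_bij;exists enum_rank;[exact:enum_valK | exact:enum_rankK].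
Qed.

Section InvariantCorrection.
Variables (k : closedFieldType) (n s : nat) (char0 : has_pchar0 k).
Variables (F H : alg_group k n) (tau : 'M[k]_n -> 'M[k]_s).
Hypotheses (redF : reductive F) (redH : reductive H).
Hypotheses (tau1 : tau 1%:M = 1%:M)
 (tauM : forall g h, carrier H g -> carrier H h -> tau (g *m h) = tau g *m tau h)
 (tauQ : forall i j, exists q : {mpoly k[n * n + 1]}, forall h, carrier H h -> tau h i j = reg q h).

Let X := 'M[k]_n -> 'rV[k]_s.

(** Two commuting right actions on maps from matrices to row vectors; a common fixed point is a map
    m with m(a g h^-1) tau(h) = m(g). *)
Definition actF a (m : X) : X := fun g => m (a *m g).
Definition actH h (m : X) : X := fun g => m (g *m invmx h) *m tau h.
Definition regular_map : set X := [set m | exists P : 'I_s -> {mpoly k[n * n + 1]},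
 forall g, m g = \row_j reg (P j) g].

Lemma regular_mapP c m m' : regular_map m -> regular_map m' -> regular_map (c *: m + m').
move=>[P hP] [P' hP'];exists (fun j => c *: P j + P' j) => g.
rewrite -[LHS]/(c *: m g + m' g) hP hP';apply/rowP => j.
by rewrite !mxE regD regZ.
Qed.

Lemma rational_actF m : regular_map m -> rational_act F actF m.
move=>[P hP];split;[by move=>g c u v;apply/funext | by move=>u;apply/funext => g;rewrite /actF mul1mx
 | by move=>g h u _ _;apply/funext => g';rewrite /actF mulmxA |].
have : forall j, exists t : {N & (('I_N -> {mpoly k[n * n + 1]}) * ('I_N -> {mpoly k[n * n + 1]}))%type},
  forall a b, reg (P j) (a *m b) = \sum_i reg ((projT2 t).1 i) a * reg ((projT2 t).2 i) b.
 by move=>j;have [N [q [x h]]] := reg_comult (P j);exists (existT _ N (q, x)).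
move/fin_all_exists =>[t tE].
pose T := {j : 'I_s & 'I_(projT1 (t j))}.
apply:(rational_index (T := T) (q := fun i => (projT2 (t (tag i))).1 (tagged i))
 (x := fun i => fun g => reg ((projT2 (t (tag i))).2 (tagged i)) g *: delta_mx 0 (tag i))) => a _.
apply/funext => g;rewrite /actF hP;apply/rowP => j;rewrite mxE tE fct_sumE summxE.
rewrite -(sig_big_dep (fun j' => true) (fun j' _ => true) (fun j' (l : 'I_(projT1 (t j'))) =>
 (reg ((projT2 (t j')).1 l) a *: (reg ((projT2 (t j')).2 l) g *: (delta_mx 0 j' : 'rV[k]_s))) 0 j)) /=.
rewrite (bigD1 j) //= [X in _ = _ + X]big1 ?addr0 =>[|j' /negPf jj'].
 by eqbig => l _;rewrite !mxE !eqxx mulr1.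
by rewrite big1 // => l _;rewrite !mxE eq_sym jj' andbF !mulr0.
Qed.

Lemma rational_actH m : regular_map m -> rational_act H actH m.
move=>[P hP];split.
- by move=>g c u v;apply/funext => g';rewrite /actH -[(c *: u + v) _]/(c *: u _ + v _) mulmxDl -scalemxAl.
- by move=>u;apply/funext => g;rewrite /actH invmx1 mulmx1 tau1 mulmx1.
- move=>g h u Hg Hh;apply/funext => g';rewrite /actH tauM // !mulmxA;congr (u _ *m _ *m _).
 rewrite -mulmxA;congr (_ *m _). have [ug uh] := (carrier_unit Hg, carrier_unit Hh).
 have ugh : g *m h \in unitmx by rewrite unitmx_mul ug.
 by rewrite -[RHS]mulmx1 -(mulmxV ugh) !mulmxA mulmxKV // mulVmx // mul1mx.
have : forall j, exists t : {N & (('I_N -> {mpoly k[n * n + 1]}) * ('I_N -> {mpoly k[n * n + 1]}))%type},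
  forall a b, b \in unitmx -> reg (P j) (a *m invmx b) = \sum_i reg ((projT2 t).1 i) a * reg ((projT2 t).2 i) b.
 move=>j;have [N [q [x h]]] := reg_comult (P j). have /fin_all_exists[x' x'E] := fun i => reg_inverse (x i).
 by exists (existT _ N (q, x')) => a b ub;rewrite h;eqbig => i _ /=;rewrite x'E.
move/fin_all_exists =>[t tE].
have /fin_all_exists[Q QE] : forall i, exists Q : 'I_s -> {mpoly k[n * n + 1]}, forall j h, carrier H h -> tau h i j = reg (Q j) h.
 by move=>i;apply:(fin_all_exists (tauQ i)).
pose T := ('I_s * {j : 'I_s & 'I_(projT1 (t j))})%type.
apply:(rational_index (T := T) (q := fun i => (projT2 (t (tag i.2))).2 (tagged i.2) * Q (tag i.2) i.1)
 (x := fun i => fun g => reg ((projT2 (t (tag i.2))).1 (tagged i.2)) g *: delta_mx 0 i.1)) => h Hh.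
apply/funext => g;rewrite /actH hP;apply/rowP => j;rewrite mxE fct_sumE summxE.
rewrite -(pair_bigA _ (fun i1 i2 => (reg ((projT2 (t (tag i2))).2 (tagged i2) * Q (tag i2) i1) h *:
 (reg ((projT2 (t (tag i2))).1 (tagged i2)) g *: (delta_mx 0 i1 : 'rV[k]_s))) 0 j)) /=.
rewrite [RHS](bigD1 j) //= [X in _ = _ + X]big1 ?addr0 =>[|j' /negPf jj'].
 rewrite -(sig_big_dep (fun j' => true) (fun j' _ => true) (fun j' (l : 'I_(projT1 (t j'))) =>
  (reg ((projT2 (t j')).2 l * Q j' j) h *: (reg ((projT2 (t j')).1 l) g *: (delta_mx 0 j : 'rV[k]_s))) 0 j)) /=.
 eqbig => j' _;rewrite mxE tE ?(carrier_unit Hh) // QE // mulr_suml.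
 by eqbig => l _;rewrite !mxE !eqxx regM mulr1;ring.
by rewrite big1 // => l _;rewrite !mxE eq_sym jj' andbF !mulr0.
Qed.

(** The correction is made first for F in Y, then for H within the F-fixed elements of Y, which H
    preserves because the actions commute. *)
Theorem invariant_correction u (Y : set X) : regular_map u -> Y `<=` regular_map ->
 Y 0 -> (forall c v w, Y v -> Y w -> Y (c *: v + w)) ->
 (forall a v, carrier F a -> Y v -> Y (actF a v)) ->
 (forall h v, carrier H h -> Y v -> Y (actH h v)) ->
 (forall a, carrier F a -> Y (actF a u - u)) -> (forall h, carrier H h -> Y (actH h u - u)) ->
 exists2 y, Y y & forall a h g, carrier F a -> carrier H h ->
  (u - y) (a *m g *m invmx h) *m tau h = (u - y) g.
move=>ru Yr Y0 YL YF YH uF uH.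
have [y1 Yy1 y1F] := linear_reductivity char0 redF (rational_actF ru) Y0 YL YF uF.
have YB v w : Y v -> Y w -> Y (v - w).
 by move=>Yv Yw;rewrite -scaleN1r addrC;apply:YL.
have subE v w : v - w = (-1) *: w + v by rewrite scaleN1r addrC.
have r1 : regular_map (u - y1) by rewrite subE;apply:regular_mapP =>//;apply:Yr.
have [_ _ _ _] := rational_actH r1;have [HL _ _ _] := rational_actH r1;have [FL _ _ _] := rational_actF r1.
have HB h v w : actH h (v - w) = actH h v - actH h w by rewrite subE HL -subE.
have FB h v w : actF h (v - w) = actF h v - actF h w by rewrite subE FL -subE.
have comm a h v : actF a (actH h v) = actH h (actF a v).
 by apply/funext => g;rewrite /actF /actH mulmxA.
pose Y' := [set y | Y y /\ forall a, carrier F a -> actF a y = y].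
have [y2 [Yy2 y2F] y2H] : exists2 y, Y' y & forall h, carrier H h -> actH h (u - y1 - y) = u - y1 - y.
 apply:linear_reductivity (rational_actH r1) _ _ _ _ =>//.
 - move=>c v w [Yv vF] [Yw wF];split;first exact:YL.
  by move=>a Fa;rewrite FL vF // wF.
 - move=>h v Hh [Yv vF];split;first exact:YH.
  by move=>a Fa;rewrite comm vF.
 move=>h Hh;split.
  have -> : actH h (u - y1) - (u - y1) = (actH h u - u) - (actH h y1 - y1).
   by rewrite HB !opprB addrACA [RHS]addrACA [- u - _]addrC.
  by apply:(YB) =>//;[exact:uH | apply:(YB) =>//;exact:YH].
 by move=>a Fa;rewrite FB comm y1F.
exists (y1 + y2).
 by have := YL 1 y1 y2 Yy1 Yy2;rewrite scale1r.
move=>a h g Fa Hh;rewrite opprD addrA.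
have e1 : actF a (u - y1 - y2) = u - y1 - y2 by rewrite FB y1F // y2F.
by have e2 := y2H h Hh;rewrite -[in RHS]e2 /actH -[in RHS]e1 /actF mulmxA.
Qed.

End InvariantCorrection.

(** * The filtration by order at the identity and its graded ring *)

Lemma der_pow (R : comNzRingType) (D : R -> R) (I : set R) d j a : derivation D -> is_ideal I ->
 (forall a, I a -> ipow I d (D a)) -> ipow I j.+1 a -> ipow I (j + d) (D a).
move=>[DD DM] iI ID;have D0 : D 0 = 0 by apply:(addrI (D 0));rewrite -DD !addr0.
elim: j a =>[|j IH] a;first by rewrite ipow1 //;apply:ID.
move=>[s hs ->];rewrite (big_morph D DD D0) big_seq;apply:ideal_sum =>[|p /hs[h1 h2]];first exact:ipow_ideal.
rewrite DM;apply:(idealD (ipow_ideal _ iI));first by apply:mem_ideal_mul =>//;apply:IH.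
exact:(@ipowM _ I j.+1 d _ _ iI h2 (ID _ h1)).
Qed.

Section Symbols.
Variables (k : fieldType) (R : comNzRingType) (A : nat -> set R).
Hypotheses (iA : forall j, is_ideal (A j)) (A0 : forall a, A 0 a)
 (AM : forall i j a b, A i a -> A j b -> A (i + j)%N (a * b)).

(** Equality of symbols in degree j. *)
Definition sim j a b := [/\ A j a, A j b & A j.+1 (a - b)].

Lemma simM i j a b a' b' : sim i a b -> sim j a' b' -> sim (i + j) (a * a') (b * b').
move=>[h1 h2 h3] [h1' h2' h3'];split;[exact:AM | exact:AM |].
have -> : a * a' - b * b' = a * (a' - b') + (a - b) * b' by ring.
apply:(idealD (iA _));first by rewrite -addnS;apply:AM.
by rewrite -addSn;apply:AM.
Qed.

Lemma sim1 : sim 0 1 1.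
by split=>//;rewrite subrr;apply:ideal0. Qed.

Lemma simX d (u v : 'I_d -> R) (m : 'X_{1..d}) : (forall l, sim 1 (u l) (v l)) ->
 sim (mdeg m) (\prod_l u l ^+ m l) (\prod_l v l ^+ m l).
move=>uv;rewrite mdegE;apply:(big_rec3 (fun i a b => sim i a b)) =>[|l i a b _ h];first exact:sim1.
apply:simM h;elim: (m l) =>[|e IH];first by rewrite !expr0;apply:sim1.
by rewrite !exprS -add1n;apply:simM.
Qed.
End Symbols.

Section PolySymbols.
Variables (k : fieldType) (w : nat) (A : nat -> set {mpoly k[w]}).
Hypotheses (iA : forall j, is_ideal (A j)) (A0 : forall a, A 0 a)
 (AM : forall i j a b, A i a -> A j b -> A (i + j)%N (a * b)).

Lemma sim_comp d (u v : d.-tuple {mpoly k[w]}) (q : {mpoly k[d]}) j : q \is j.-homog ->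
 (forall l, sim A 1 (tnth u l) (tnth v l)) -> sim A j (q \mPo u) (q \mPo v).
move=>/dhomogP hq uv;rewrite !comp_mpolyEX !big_seq.
apply:(big_rec2 (fun a b => sim A j a b)) =>[|m a b mq [h1 h2 h3]].
 by split;rewrite ?subrr;apply:ideal0.
have [h1' h2' h3'] := simX iA A0 AM m uv;move: h1' h2' h3';rewrite (hq m mq) => h1' h2' h3'.
rewrite !comp_mpolyX -!mul_mpolyC;split.
- by apply:(idealD (iA _)) =>//;apply:idealM.
- by apply:(idealD (iA _)) =>//;apply:idealM.
by rewrite opprD addrACA -mulrBr;apply:(idealD (iA _)) =>//;apply:idealM.
Qed.

Lemma homog_filtered d (u : d.-tuple {mpoly k[w]}) (q : {mpoly k[d]}) j : q \is j.-homog ->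
 (forall l, A 1 (tnth u l)) -> A j (q \mPo u).
move=>hq hu;have [//] : sim A j (q \mPo u) (q \mPo u).
by apply:sim_comp =>// l;split=>//;rewrite subrr;apply:ideal0.
Qed.
End PolySymbols.

Lemma dhomog_deriv (k : fieldType) d (q : {mpoly k[d]}) j l : q \is j.+1.-homog -> q^`M(l) \is j.-homog.
move=>/dhomogP hq;apply/dhomogP => m;rewrite mcoeff_msupp mcoeff_deriv => nz.
have mq : (m + U_(l))%MM \in msupp q.
 by rewrite mcoeff_msupp;apply:contraNneq nz => ->;rewrite mul0rn.
by have := hq _ mq;rewrite /= mdegD mdeg1 addn1 => -[].
Qed.

Lemma dhomog0_const (k : fieldType) d (q : {mpoly k[d]}) : q \is 0.-homog -> exists c, q = c%:MP.
move=>/dhomogP hq;exists (q@_0%MM);apply/mpolyP => m;rewrite mcoeffC;case:(eqVneq m 0%MM) =>[->|m0];first by rewrite mulr1.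
by rewrite mulr0;apply:memN_msupp_eq0;apply:contra m0 => /hq/eqP;rewrite mdeg_eq0.
Qed.

Lemma dhomog_const (k : fieldType) d (c : k) : (c%:MP : {mpoly k[d]}) \is 0.-homog.
by apply/dhomogP => m;rewrite msuppC;case:ifP =>// _;rewrite inE => /eqP ->;rewrite /= mdeg0. Qed.

Lemma natr_neq0 (k : fieldType) : has_pchar0 k -> forall j, (j.+1)%:R != 0 :> k.
by move=>c0 j;rewrite ((pcharf0P k).1 c0). Qed.

Lemma deriv_zero (k : fieldType) d (q : {mpoly k[d]}) j : has_pchar0 k ->
 q \is j.+1.-homog -> (forall l, q^`M(l) = 0) -> q = 0.
move=>c0 /dhomogP hq dq;apply/mpolyP => m;rewrite mcoeff0;apply/eqP/negPn/negP => nz.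
have mq : m \in msupp q by rewrite mcoeff_msupp.
have [l ml] : exists l, (0 < m l)%N.
 apply:contrapT => no;have := hq m mq;rewrite /= mdegE big1 // => l _.
 by apply/eqP;rewrite eqn0Ngt;apply/negP => h;apply:no;exists l.
have := congr1 (mcoeff (m - U_(l))%MM) (dq l);rewrite mcoeff_deriv mcoeff0 submK;last first.
 by apply/mnm_lepP => i;rewrite mnm1E;case:eqP =>[<-|].
by move/eqP;rewrite -mulr_natr mulf_eq0 (negPf nz) (negPf (natr_neq0 c0 _)).
Qed.

Section LinearPolys.
Variables (k : closedFieldType) (n : nat).
Local Notation PA := {mpoly k[n * n + 1]}.

Definition linpoly (f : {linear 'M[k]_n -> k^o}) : PA := \sum_i \sum_j (f (delta_mx i j) : k) *: coord k i j.

Lemma linpolyE f (T : 'M[PA]_n) g : reg (V T (linpoly f)) g = f (evmx T g).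
rewrite [evmx T g]matrix_sum_delta /linpoly V_sum reg_sum linear_sum;eqbig => i _.
rewrite V_sum reg_sum linear_sum;eqbig => j _.
by rewrite VZ regZ V_coord linearZ /= [evmx _ _ _ _]mxE mulrC.
Qed.

Lemma reg_linpoly f g : reg (linpoly f) g = f g.
rewrite [g in RHS]matrix_sum_delta /linpoly reg_sum linear_sum;eqbig => i _.
rewrite reg_sum linear_sum;eqbig => j _.
by rewrite regZ reg_coord linearZ /= mulrC.
Qed.

End LinearPolys.

Section Filtration.
Variables (k : closedFieldType) (n : nat) (char0 : has_pchar0 k) (G : alg_group k n).
Local Notation PA := {mpoly k[n * n + 1]}.
Local Notation e := (1%:M : 'M[k]_n).

Definition point_one : set PA := [set p | reg p e = 0].

(** Vanishing of order j at the identity for the restriction to G; adding the ideal of G avoids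
    passing to the quotient ring k[G]. *)
Definition Aj j : set PA := ideal_add (ipow point_one j) (reg_ideal (carrier G)).

Lemma point_one_ideal : is_ideal point_one.
exact:point_ideal_ideal. Qed.

Lemma reg_ideal_one : reg_ideal (carrier G) `<=` point_one.
by move=>p;apply;apply:carrier1. Qed.

Let iI := reg_ideal_ideal (carrier G).
Let im := point_one_ideal.
Let ip j := ipow_ideal j im.

Lemma Aj_ideal j : is_ideal (Aj j).
exact:ideal_add_ideal. Qed.

Lemma Aj_reg j p : reg_ideal (carrier G) p -> Aj j p.
exact:ideal_addr. Qed.
Lemma Aj_pow j p : ipow point_one j p -> Aj j p.
exact:ideal_addl. Qed.

Lemma Aj0 p : Aj 0 p.
exact:Aj_pow. Qed.

Lemma AjM i j p q : Aj i p -> Aj j q -> Aj (i + j) (p * q).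
move=>[a [b [ha hb ->]]] [a' [b' [ha' hb' ->]]];rewrite mulrDl mulrDr -addrA.
exists (a * a'), (a * b' + b * (a' + b'));split=>//;first exact:ipowM.
by apply:(idealD iI);[apply:(idealM _ iI) | apply:(idealMr _ iI)].
Qed.

Lemma Aj_le i j : (i <= j)%N -> Aj j `<=` Aj i.
by move=>ij p [a [b [ha hb ->]]];exists a, b;split=>//;apply:ipow_le ha. Qed.

Lemma Aj1 p : Aj 1 p <-> reg p e = 0.
split=>[[a [b [ha hb ->]]]|h];last by apply:Aj_pow;rewrite ipow1.
by move: ha;rewrite ipow1 // regD => ->;rewrite (reg_ideal_one hb) addr0.
Qed.

Definition preserves (D : PA -> PA) := forall p, reg_ideal (carrier G) p -> reg_ideal (carrier G) (D p).

Lemma V_Aj T j p : preserves (V T) -> Aj j.+1 p -> Aj j (V T p).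
move=>h [a [b [ha hb ->]]];rewrite VD;apply:(idealD (Aj_ideal j)).
 by apply:Aj_pow;rewrite -[j]addn0;apply:der_pow ha =>//;apply:V_der.
by apply:Aj_reg;apply:h.
Qed.

Lemma V_Aj_stable T j p : preserves (V T) -> evmx T e = 0 -> Aj j p -> Aj j (V T p).
move=>h T0 [a [b [ha hb ->]]];rewrite VD;apply:(idealD (Aj_ideal j)).
 case:j ha =>[_|j ha];first exact:Aj0.
 (* A field that vanishes at the identity maps the point ideal into itself and loses no order; a
    general field, with d = 0, loses one. *)
 apply:Aj_pow;have := der_pow (d := 1) (V_der T) im _ ha;rewrite [(j + 1)%N]addn1;apply=> q _.
 by rewrite ipow1 //;apply:V_eval0.
by apply:Aj_reg;apply:h.
Qed.

Lemma L_preserves x : x \in lie G -> preserves (L x).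
by move=>xG p;apply:L_ideal. Qed.

Lemma L_Aj x j p : x \in lie G -> Aj j.+1 p -> Aj j (L x p).
by move=>/L_preserves;apply:V_Aj. Qed.

Lemma LR_Aj x j p : x \in lie G -> Aj j p -> Aj j (L x p - Rt x p).
move=>xG hp;rewrite /L /Rt -V_sub;apply:V_Aj_stable hp;last first.
 by rewrite evmxB evL evR mul1mx mulmx1 subrr.
move=>q hq;rewrite V_sub;apply:(idealB iI);first exact:L_ideal.
exact:Rt_ideal.
Qed.

(** A tangent vector of G in affine space is determined by its matrix part: the relation det *
    (1/det) = 1 fixes the remaining coordinate. *)
Lemma tangent_one w : (forall q, reg_ideal (carrier G) q -> mdiff q (rvec e) w = 0) ->
 exists2 x, x \in lie G & forall p, mdiff p (rvec e) w = reg (L x p) e.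
move=>tan;pose x : 'M[k]_n := vec_mx (\row_l w (lshift 1 l)).
have embE (q : {mpoly k[n * n]}) : mdiff (q \mPo emb k n) (rvec e) w = mdiff q (mxvec e 0) (mxvec x 0).
 rewrite mdiff_comp;apply:eq_mdiff => l;rewrite tnthE;first by rewrite mevalXU rvecl.
 by rewrite mdiffX vec_mxK mxE.
have xG : x \in lie G.
 apply/lieP => q hq;rewrite -embE;apply:tan => g Gg;rewrite -[RHS](hq g Gg) /reg comp_mpoly_meval.
 by apply:meval_eq => l;rewrite tnthE mevalXU rvecl.
have LE p : reg (L x p) e = mdiff p (rvec e) (fun i => reg (vf (coord_mx k n *m cmx x) i) e).
 exact:vfield_eval.
have LembE (q : {mpoly k[n * n]}) : reg (L x (q \mPo emb k n)) e = mdiff q (mxvec e 0) (mxvec x 0).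
 by rewrite /L V_emb_eval evL mul1mx.
exists x =>// p;rewrite LE;apply:eq_mdiff =>// i;case:(split_ordP i) =>[l ->|j ->].
 case/mxvec_indexP: l => a b;rewrite /vf -[lshift 1 _]/(unsplit (inl _)) unsplitK mxvecE.
 have -> : reg ((coord_mx k n *m cmx x) a b) e = evmx (coord_mx k n *m cmx x) e a b by rewrite [RHS]mxE.
 by rewrite evL mul1mx /x mxE mxE.
have du : mdiff (det_rel k n) (rvec e) w = reg (L x (det_rel k n)) e.
 have h : reg_ideal (carrier G) (det_rel k n) by move=>g Gg;apply:det_rel_eval;apply:carrier_unit Gg.
 by rewrite tan //;apply/esym/(L_ideal xG h)/carrier1.
have LdE : mdiff (det_poly k n) (rvec e) (fun i => reg (vf (coord_mx k n *m cmx x) i) e) = mdiff (det_poly k n) (rvec e) w.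
 by rewrite -LE det_poly_emb LembE embE.
move: du;rewrite ord1 LE /det_rel !mdiffD !mdiffM LdE !mdiffX => /eqP.
have m1 v : mdiff (- 1 : PA) (rvec e) v = 0 by rewrite -scaleN1r mdiffZ mdiff1 mulr0.
rewrite !m1 !addr0 (inj_eq (addIr _)) => /eqP.
have -> : (det_poly k n).@[rvec e] = 1 by rewrite -[LHS]/(reg _ _) reg_det det1.
by rewrite !mul1r.
Qed.

Section Coordinates.
Variables (s : nat) (x : 'I_s -> 'M[k]_n) (xi : 'I_s -> {linear 'M[k]_n -> k^o}).
Hypotheses (xG : forall i, x i \in lie G) (xi_x : forall i l, xi i (x l) = (i == l)%:R)
 (x_span : forall z, z \in lie G -> z = \sum_i (xi i z : k) *: x i).

(** The function xi i (g - 1); together they are local parameters of G at the identity. *)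
Definition tpoly i : PA := linpoly (xi i) - (xi i e : k)%:MP.
Definition tt_ : s.-tuple PA := [tuple tpoly i | i < s].

Lemma V_tpoly T i g : reg (V T (tpoly i)) g = xi i (evmx T g).
by rewrite /tpoly VB VC subr0 linpolyE. Qed.

Lemma L_tpoly z i : reg (L z (tpoly i)) e = xi i z.
by rewrite /L V_tpoly evL mul1mx. Qed.

Lemma tpoly1 i : Aj 1 (tpoly i).
by apply/Aj1;rewrite /tpoly regB regC reg_linpoly subrr. Qed.

Lemma tt_Aj1 l : Aj 1 (tnth tt_ l).
by rewrite tnthE;apply:tpoly1. Qed.

Lemma tt_Aj j (q : {mpoly k[s]}) : q \is j.-homog -> Aj j (q \mPo tt_).
by move=>hq;apply:(homog_filtered Aj_ideal Aj0 AjM hq) => l;apply:tt_Aj1. Qed.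

(** On symbols the field of x i is the i-th partial derivative, since its values on the parameters
    at the identity are Kronecker symbols. *)
Lemma L_symbol j (q : {mpoly k[s]}) i : q \is j.+1.-homog ->
 Aj j.+1 (L (x i) (q \mPo tt_) - (q^`M(i) \mPo tt_)).
move=>hq;rewrite /L (der_const_comp _ _ (V_der _) (VC _)) -/(L _ _) (bigD1 i) //= addrAC.
have h l : Aj j.+1 ((q^`M(l) \mPo tt_) * (V (coord_mx k n *m cmx (x i)) (tnth tt_ l) - (l == i)%:R%:MP)).
 rewrite -addn1;apply:AjM;first by apply:tt_Aj;apply:dhomog_deriv.
 by apply/Aj1;rewrite regB regC tnthE L_tpoly xi_x subrr.
apply:(idealD (Aj_ideal _));first by have := h i;rewrite eqxx mpolyC1 mulrBr mulr1.
apply:ideal_sum =>[|l /negPf li];first exact:Aj_ideal.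
by have := h l;rewrite li mpolyC0 subr0.
Qed.

(** Derivatives lower degree and order together, and in characteristic 0 a form of positive degree
    with zero partial derivatives is 0. This is the smoothness of G at the identity. *)
Lemma symbol_unique j (q : {mpoly k[s]}) : q \is j.-homog -> Aj j.+1 (q \mPo tt_) -> q = 0.
elim: j q =>[|j IH] q hq hA.
 have [c qc] := dhomog0_const hq. by move: hA;rewrite qc comp_mpolyC => /Aj1;rewrite regC => ->.
apply:(deriv_zero char0 hq) => l;apply:IH;first exact:dhomog_deriv.
have h1 := L_symbol l hq;have h2 := L_Aj (xG l) hA.
by have := idealB (Aj_ideal _) h2 h1;rewrite opprB addrC subrK.
Qed.

Lemma L_sum (c : 'I_s -> k) p : L (\sum_i c i *: x i) p = \sum_i c i *: L (x i) p.
apply:(big_rec2 (fun a b => L a p = b)) =>[|i y1 y2 _ <-].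
 by rewrite -(subrr (0 : 'M_n)) LB1 subrr.
rewrite /L /cmx map_mxD mulmxDr V_add;congr (_ + _).
by rewrite map_mxZ -scalemxAr V_scale mul_mpolyC.
Qed.

Lemma L_sub_tpoly z p (c : 'I_s -> k) :
 reg (L z (p - \sum_i c i *: tpoly i)) e = reg (L z p) e - \sum_i c i * (xi i z : k).
rewrite {1}/L VB regB V_sum;congr (_ - _);rewrite reg_sum;eqbig => i _.
by rewrite VZ regZ;congr (_ * _);apply:L_tpoly.
Qed.

(** After subtraction of the linear part, the differential kills Lie G, so it is the differential of
    an element of the ideal of G; Taylor's formula does the rest. *)
Lemma taylor_one p : Aj 1 p -> Aj 2 (p - \sum_i reg (L (x i) p) e *: tpoly i).
move=>p1;set p' := p - _.
have Lp' z : z \in lie G -> reg (L z p') e = 0.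
 move=>zG;rewrite L_sub_tpoly {1}(x_span zG) L_sum reg_sum -sumrB big1 // => i _.
 by rewrite regZ mulrC subrr.
have [|q hq qd] := @differential_of_ideal k _ (rvec e) (reg_ideal (carrier G)) (\row_j (p'^`M(j)).@[rvec e]) iI.
 move=>w /tangent_one[z zG zE];rewrite -[RHS](Lp' z zG) -zE. by eqbig => j _;rewrite mxE.
have -> : p' = (p' - q) + q by rewrite subrK.
apply:(idealD (Aj_ideal _));last exact:Aj_reg.
apply:Aj_pow;have := taylor1 (rvec e) (p' - q).
have -> : (p' - q).@[rvec e] = 0.
 rewrite -[LHS]/(reg _ _) regB [reg q _](reg_ideal_one hq) subr0;apply/Aj1.
 apply:(idealB (Aj_ideal _)) =>//;apply:ideal_sum =>[|i _];first exact:Aj_ideal.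
 by rewrite -mul_mpolyC;apply:(idealM _ (Aj_ideal _));apply:tpoly1.
rewrite mpolyC0 subr0 big1 ?subr0 // => l _.
by rewrite mderivB mevalB qd mxE subrr mpolyC0 mul0r.
Qed.

(** The graded ring is generated in degree 1, and in degree 1 [taylor_one] gives the symbol. *)
Lemma symbol_exists j p : Aj j p -> exists2 q : {mpoly k[s]}, q \is j.-homog & Aj j.+1 (p - (q \mPo tt_)).
move=>[a [b [ha hb ->]]].
suff [q hq qa] : exists2 q : {mpoly k[s]}, q \is j.-homog & Aj j.+1 (a - (q \mPo tt_)).
 exists q =>//;rewrite addrAC;apply:(idealD (Aj_ideal _)) =>//;exact:Aj_reg.
elim: j a ha =>[|j IH] a.
 move=>_;exists (reg a e)%:MP;last by rewrite comp_mpolyC;apply/Aj1;rewrite regB regC subrr.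
 exact:dhomog_const.
pose K : set PA := [set p | exists2 q : {mpoly k[s]}, q \is j.+1.-homog & Aj j.+2 (p - (q \mPo tt_))].
suff : ipow point_one j.+1 `<=` K by apply.
apply:ideal_mul_min =>[|u v um vm].
 split.
 - by exists 0;[exact:rpred0 | rewrite comp_mpoly0 subrr;apply:ideal0 (Aj_ideal _)].
 - move=>p1 p2 [q1 h1 a1] [q2 h2 a2];exists (q1 + q2);first exact:rpredD.
  by rewrite comp_mpolyD opprD addrACA;apply:(idealD (Aj_ideal _)).
 move=>f p1 [q hq hA];exists (reg f e *: q);first exact:rpredZ. have pA : Aj j.+1 p1.
  rewrite -[p1](subrK (q \mPo tt_));apply:(idealD (Aj_ideal _));last exact:tt_Aj. exact:Aj_le hA.
 have -> : f * p1 - ((reg f e *: q) \mPo tt_) = (f - (reg f e)%:MP) * p1 + (reg f e)%:MP * (p1 - (q \mPo tt_)).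
  by rewrite comp_mpolyZ -mul_mpolyC;ring.
 apply:(idealD (Aj_ideal _));last exact:(idealM _ (Aj_ideal _)).
 by rewrite -add1n;apply:AjM =>//;apply/Aj1;rewrite regB regC subrr.
have [q hq hv] := IH v vm.
have u1 : Aj 1 u by apply/Aj1.
have [hu hA1] : (\sum_i reg (L (x i) u) e *: 'X_i : {mpoly k[s]}) \is 1.-homog /\
  (\sum_i reg (L (x i) u) e *: 'X_i : {mpoly k[s]}) \mPo tt_ = \sum_i reg (L (x i) u) e *: tpoly i.
 split;last first.
  rewrite rmorph_sum;eqbig => i _ /=. by rewrite comp_mpolyZ comp_mpolyXU -tnth_nth tnthE.
 by apply:rpred_sum => i _;apply:rpredZ;rewrite dhomogX /= mdeg1.
exists ((\sum_i reg (L (x i) u) e *: 'X_i) * q);first by rewrite -add1n;apply:dhomogM.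
have [hc1 hc2 hc3] : sim Aj (1 + j) (u * v) (((\sum_i reg (L (x i) u) e *: 'X_i) \mPo tt_) * (q \mPo tt_)).
 apply:(simM Aj_ideal AjM).
  split=>//;first exact:tt_Aj. by rewrite hA1;apply:taylor_one.
 by split=>//;[exact:Aj_pow | exact:tt_Aj].
by rewrite rmorphM /=.
Qed.

End Coordinates.
End Filtration.

Lemma dhomog_var_free (k : fieldType) d r (q : {mpoly k[d]}) (P : pred 'I_d) (u : 'I_d -> {mpoly k[r]}) (l : r.-tuple {mpoly k[d]}) :
 has_pchar0 k -> (forall j, P j -> u j \mPo l = 'X_j) -> (forall j, ~~ P j -> q^`M(j) = 0) ->
 (q \mPo [tuple u j | j < d]) \mPo l = q.
move=>c0 li dq;rewrite comp_mpolyA [RHS]mpolyE comp_mpolyEX;apply:eq_big_seq => m mq;congr (_ *: _).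
rewrite comp_mpolyX [RHS]mpolyXE_id;eqbig => j _;rewrite !tnthE.
have [Pj|Pj] := boolP (P j);first by rewrite li.
suff -> : m j = 0%N by rewrite !expr0.
apply/eqP;rewrite eqn0Ngt;apply/negP => mj.
have := congr1 (mcoeff (m - U_(j))%MM) (dq j Pj);rewrite mcoeff_deriv mcoeff0 submK;last first.
 by apply/mnm_lepP => i';rewrite mnm1E;case:eqP =>[<-|].
move: mq;rewrite mcoeff_msupp => mq /eqP.
by rewrite -mulr_natr mulf_eq0 (negPf mq) (negPf (natr_neq0 c0 _)).
Qed.

Lemma comp_homog1 (k : fieldType) d r (u : d.-tuple {mpoly k[r]}) j c :
 (forall l, tnth u l \is (1%N).-homog) -> c \is j.-homog -> c \mPo u \is j.-homog.
move=>hu /dhomogP hc;rewrite comp_mpolyEX big_seq;apply:rpred_sum => m /hc mj;apply:rpredZ.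
have := dhomog_monomial (mf := mdeg) (e := fun=> 1%N) hu m;rewrite /wt.
by under eq_bigr do rewrite muln1;rewrite -mdegE mj.
Qed.

Lemma pihomog_comp1 (k : fieldType) d r (u : d.-tuple {mpoly k[r]}) j c :
 (forall l, tnth u l \is (1%N).-homog) -> pihomog mdeg j c \mPo u = pihomog mdeg j (c \mPo u).
move=>hu;rewrite (pihomog_comp (e := fun=> 1%N) hu);congr (_ \mPo _).
apply/mpolyP => m;rewrite !mcoeff_pihomog;congr (if _ == j then _ else _).
by rewrite /= /wt mdegE;eqbig => l _;rewrite muln1.
Qed.

Lemma lin_form_homog (k : fieldType) r (c : 'I_r -> k) : \sum_i c i *: 'X_i \is (1%N).-homog.
by apply:rpred_sum => i _;apply:rpredZ;rewrite dhomogX /= mdeg1. Qed.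

(** * Linear substitutions and regular functions on F x H *)

Section LinearSubstitution.
Variables (k : fieldType) (r : nat).
Implicit Types (M : 'M[k]_r) (c : {mpoly k[r]}).

Definition lin M : r.-tuple {mpoly k[r]} := [tuple \sum_l M i l *: 'X_l | i < r].

Lemma lin_homog M j c : c \is j.-homog -> c \mPo lin M \is j.-homog.
by apply:comp_homog1 => l;rewrite tnthE;apply:lin_form_homog. Qed.

Lemma lin_comp c M M' : (c \mPo lin M) \mPo lin M' = c \mPo lin (M *m M').
rewrite comp_mpolyA;congr (_ \mPo _);apply:eq_from_tnth => i;rewrite !tnthE rmorph_sum /=.
under eq_bigr => l _ do rewrite comp_mpolyZ comp_mpolyXU -tnth_nth tnthE scaler_sumr.
rewrite exchange_big;eqbig => t _ /=;rewrite mxE scaler_suml;eqbig => l _.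
by rewrite scalerA.
Qed.

Lemma lin_scale j c a M : c \is j.-homog -> c \mPo lin (a *: M) = a ^+ j *: (c \mPo lin M).
move=>/dhomogP hc;rewrite !comp_mpolyEX scaler_sumr;apply:eq_big_seq => m mc.
rewrite scalerA mulrC -scalerA;congr (_ *: _);rewrite !comp_mpolyX -(hc m mc) /= mdegE.
apply:(big_rec3 (fun d p q => p = a ^+ d *: q)) =>[|i d p q _ ->];first by rewrite expr0 scale1r.
have -> : tnth (lin (a *: M)) i = a *: tnth (lin M) i.
 by rewrite !tnthE scaler_sumr;eqbig => l _;rewrite mxE scalerA.
by rewrite exprZn exprD -scalerAl -scalerAr scalerA.
Qed.

Lemma lin_1 c : c \mPo lin 1%:M = c.
rewrite -[RHS]comp_mpoly_id;congr (_ \mPo _);apply:eq_from_tnth => i;rewrite !tnthE.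
rewrite (bigD1 i) //= mxE eqxx scale1r big1 ?addr0 // => l /negPf li.
by rewrite mxE eq_sym li scale0r.
Qed.
End LinearSubstitution.

Section RegularPairs.
Variables (k : closedFieldType) (n : nat) (F H : alg_group k n).
Local Notation N1 := (n * n + 1)%N.
Local Notation PA := {mpoly k[N1]}.
Local Notation PK := {mpoly k[N1 + N1]}.
Implicit Types (f : 'M[k]_n -> 'M[k]_n -> k).

Definition kpt (a h : 'M[k]_n) (i : 'I_(N1 + N1)) : k :=
 match fintype.split i with inl l => rvec a l | inr l => rvec h l end.

(** Regular functions on F x H as set-theoretic functions; the closure rules below spare writing the
    polynomials of determinants, adjugates and coefficients. *)
Definition regK f := exists Q : PK, forall a h, carrier F a -> carrier H h -> f a h = Q.@[kpt a h].

Lemma regKC c : regK (fun _ _ => c).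
by exists c%:MP => a h _ _;rewrite mevalC. Qed.

Lemma regKD f f' : regK f -> regK f' -> regK (fun a h => f a h + f' a h).
by move=>[Q h] [Q' h'];exists (Q + Q') => a b Fa Hb;rewrite mevalD -h // -h'. Qed.

Lemma regKM f f' : regK f -> regK f' -> regK (fun a h => f a h * f' a h).
by move=>[Q h] [Q' h'];exists (Q * Q') => a b Fa Hb;rewrite mevalM -h // -h'. Qed.

Lemma regK_eq f f' : (forall a h, carrier F a -> carrier H h -> f a h = f' a h) -> regK f' -> regK f.
by move=>e [Q h];exists Q => a b Fa Hb;rewrite e // h. Qed.

Lemma regK_sum (I : Type) (s : seq I) (P : pred I) (f : I -> 'M[k]_n -> 'M[k]_n -> k) :
 (forall i, regK (f i)) -> regK (fun a h => \sum_(i <- s | P i) f i a h).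
move=>hf;elim: s =>[|i s IH];first by apply:(regK_eq _ (regKC 0)) => a h _ _;rewrite big_nil.
apply:(regK_eq (f' := fun a h => (if P i then f i a h else 0) + \sum_(i <- s | P i) f i a h)).
 by move=>a h _ _;rewrite big_cons;case:ifP;rewrite ?add0r.
by apply:regKD IH;case:(P i);[apply:hf | apply:regKC].
Qed.

Lemma regK_prod (I : Type) (s : seq I) (f : I -> 'M[k]_n -> 'M[k]_n -> k) :
 (forall i, regK (f i)) -> regK (fun a h => \prod_(i <- s) f i a h).
move=>hf;elim: s =>[|i s IH];first by apply:(regK_eq _ (regKC 1)) => a h _ _;rewrite big_nil.
apply:(regK_eq (f' := fun a h => f i a h * \prod_(i <- s) f i a h));last exact:regKM.
by move=>a h _ _;rewrite big_cons.
Qed.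

Lemma regK_l p : regK (fun a _ => reg p a).
exists (p \mPo [tuple 'X_(lshift N1 l) | l < N1]) => a h _ _;rewrite comp_mpoly_meval;apply:meval_eq => l.
by rewrite tnthE mevalXU /kpt -[lshift N1 l]/(unsplit (inl l)) unsplitK.
Qed.

Lemma regK_r p : regK (fun _ h => reg p h).
exists (p \mPo [tuple 'X_(rshift N1 l) | l < N1]) => a h _ _;rewrite comp_mpoly_meval;apply:meval_eq => l.
by rewrite tnthE mevalXU /kpt -[rshift N1 l]/(unsplit (inr l)) unsplitK.
Qed.

Lemma regK_mul p : regK (fun a h => reg p (a *m h)).
have [N [q [x e]]] := reg_comult p;apply:(regK_eq (fun a h _ _ => e a h)).
by apply:regK_sum => i;apply:regKM;[apply:regK_l | apply:regK_r].
Qed.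

Lemma regK_det d (T : 'M[k]_n -> 'M[k]_n -> 'M[k]_d) :
 (forall i j, regK (fun a h => T a h i j)) -> regK (fun a h => \det (T a h)).
move=>hT;apply:regK_sum => s;apply:regKM;first exact:regKC.
by apply:regK_prod => i.
Qed.

Lemma regK_adj d (T : 'M[k]_n -> 'M[k]_n -> 'M[k]_d) i j :
 (forall i j, regK (fun a h => T a h i j)) -> regK (fun a h => (\adj (T a h)) i j).
move=>hT;apply:(regK_eq (f' := fun a h => (-1) ^+ (j + i) * \det (row' j (col' i (T a h))))).
 by move=>a h _ _;rewrite mxE.
apply:regKM;first exact:regKC.
apply:regK_det => u v;apply:(regK_eq _ (hT (lift j u) (lift i v))) => a h _ _.
by rewrite !mxE.
Qed.

Lemma regK_coef r (T : 'M[k]_n -> 'M[k]_n -> 'M[k]_r) (c : {mpoly k[r]}) m :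
 (forall i j, regK (fun a h => T a h i j)) -> regK (fun a h => (c \mPo lin (T a h))@_m).
move=>hT;move: c m;apply:(mpoly_gen_ind (P := fun c => forall m, regK (fun a h => (c \mPo lin (T a h))@_m)))
 =>[c m|i m|p q hp hq m|p q hp hq m].
- by apply:(regK_eq _ (regKC (c%:MP@_m))) => a h _ _;rewrite comp_mpolyC.
- apply:(regK_eq (f' := fun a h => \sum_l T a h i l * (('X_l : {mpoly k[r]})@_m))).
  move=>a h _ _;rewrite comp_mpolyXU -tnth_nth tnthE raddf_sum /=;eqbig => l _. by rewrite mcoeffZ.
 by apply:regK_sum => l;apply:regKM =>//;apply:regKC.
- by apply:(regK_eq _ (regKD (hp m) (hq m))) => a h _ _;rewrite comp_mpolyD mcoeffD.
apply:(regK_eq (f' := fun a h => \sum_(u : 'X_{1..r < (mdeg m).+1, (mdeg m).+1} | m == (u.1 + u.2)%MM)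
  (p \mPo lin (T a h))@_u.1 * (q \mPo lin (T a h))@_u.2)).
 by move=>a h _ _;rewrite rmorphM /= mcoeffM.
by apply:regK_sum => u;apply:regKM.
Qed.

Lemma regK_conj (l : {linear 'M[k]_n -> k^o}) x : regK (fun _ h => (l (invmx h *m x *m h) : k)) /\
 regK (fun _ h => (l (h *m x *m invmx h) : k)).
have inv i j : regK (fun _ h => invmx h i j).
 have [q qE] := reg_inverse (coord k i j);apply:(regK_eq _ (regK_r q)) => a h _ Hh.
 by rewrite qE ?(carrier_unit Hh) // reg_coord.
have id_ i j : regK (fun _ h => h i j).
 by apply:(regK_eq _ (regK_r (coord k i j))) => a h _ _;rewrite reg_coord.
have lE (z : 'M[k]_n) : (l z : k) = (\sum_i \sum_j ((l (delta_mx i j) : k) * z i j)%R : k).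
 rewrite {1}[z]matrix_sum_delta linear_sum;eqbig => i _;rewrite linear_sum;eqbig => j _.
 by rewrite linearZ /= mulrC.
have mul (u v : 'M[k]_n -> 'M[k]_n) : (forall i j, regK (fun _ h => u h i j)) -> (forall i j, regK (fun _ h => v h i j)) ->
  regK (fun _ h => (l (u h *m x *m v h) : k)).
 move=>hu hv;apply:(regK_eq (fun a h _ _ => lE _));apply:regK_sum => i;apply:regK_sum => j.
 apply:regKM;first exact:regKC.
 apply:(regK_eq (f' := fun a h => \sum_b (\sum_c u h i c * x c b) * v h b j)).
  by move=>a h _ _;rewrite mxE;eqbig => b _;rewrite mxE.
 apply:regK_sum => b;apply:regKM =>//;apply:regK_sum => c;apply:regKM =>//;exact:regKC.
by split;apply:mul.
Qed.

End RegularPairs.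

(** * The tangent space of the double coset at the identity *)

Section OrbitTangent.
Variables (k : closedFieldType) (n : nat) (char0 : has_pchar0 k) (F H : alg_group k n).
Local Notation N := (n * n)%N.
Local Notation PM := {mpoly k[N + N]}.

Let pt (a h : 'M[k]_n) : 'I_(N + N) -> k := fun i => row_mx (mxvec a) (mxvec h) 0 i.
Let ptl a h l : pt a h (lshift N l) = mxvec a 0 l.
by rewrite /pt row_mxEl. Qed.
Let ptr a h l : pt a h (rshift N l) = mxvec h 0 l.
by rewrite /pt row_mxEr. Qed.
Let XA : 'M[PM]_n := \matrix_(i, j) 'X_(lshift N (mxvec_index i j)).
Let XB : 'M[PM]_n := \matrix_(i, j) 'X_(rshift N (mxvec_index i j)).
Let eA a h : map_mx (meval (pt a h)) XA = a.
by apply/matrixP => i j;rewrite !mxE mevalXU ptl mxvecE. Qed.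
Let eB a h : map_mx (meval (pt a h)) XB = h.
by apply/matrixP => i j;rewrite !mxE mevalXU ptr mxvecE. Qed.
Let embL : N.-tuple PM := [tuple 'X_(lshift N l) | l < N].
Let embR : N.-tuple PM := [tuple 'X_(rshift N l) | l < N].
Let embLE (p : {mpoly k[N]}) a h : (p \mPo embL).@[pt a h] = mx_eval p a.
by rewrite comp_mpoly_meval;apply:meval_eq => l;rewrite tnthE mevalXU ptl. Qed.
Let embRE (p : {mpoly k[N]}) a h : (p \mPo embR).@[pt a h] = mx_eval p h.
by rewrite comp_mpoly_meval;apply:meval_eq => l;rewrite tnthE mevalXU ptr. Qed.
Let V : set ('I_(N + N) -> k) := [set x | exists a h, [/\ carrier F a, carrier H h & x = pt a h]].

Lemma translate_tangent (E : alg_group k n) (b w : 'M[k]_n) (T : {linear 'M[k]_n -> 'M[k]_n}) :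
 T b = 1%:M -> (forall g, carrier E g -> carrier E (T g)) ->
 (forall q : {mpoly k[N]}, (forall g, carrier E g -> mx_eval q g = 0) -> mdiff q (mxvec b 0) (mxvec w 0) = 0) ->
 T w \in lie E.
move=>Tb TE h;apply/lieP => p hp;have [c [c1 c2]] := lin_sub T.
rewrite -Tb -c2;apply:h => g Eg;rewrite /mx_eval c1.
exact/hp/TE.
Qed.

(** The field a z h is tangent to F H along the multiplication map, hence lifts at some (a, h) to
    tangent vectors wa of F and wh of H. From wa h + a wh = a z h one reads off z = a^-1 wa + wh
    h^-1. *)
Lemma orbit_tangent (z : 'M[k]_n) :
 (forall q : {mpoly k[N]}, (forall a h, carrier F a -> carrier H h -> mx_eval q (a *m h) = 0) ->
   mdiff q (mxvec 1%:M 0) (mxvec z 0) = 0) -> z \in (lie F + lie H)%VS.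
move=>hz;pose zm : 'M[PM]_n := map_mx (@mpolyC _ _) z.
pose c : N.-tuple PM := [tuple mxvec (XA *m XB) 0 l | l < N].
pose D l : PM := mxvec (XA *m zm *m XB) 0 l.
have ezm a h : map_mx (meval (pt a h)) zm = z by apply/matrixP => i j;rewrite !mxE mevalC.
have evm (T : 'M[PM]_n) a h l : (mxvec T 0 l).@[pt a h] = mxvec (map_mx (meval (pt a h)) T) 0 l.
 by rewrite -map_mxvec [RHS]mxE.
have cE a h l : (tnth c l).@[pt a h] = mxvec (a *m h) 0 l by rewrite tnthE evm map_mxM eA eB.
have DE a h l : (D l).@[pt a h] = mxvec (a *m z *m h) 0 l by rewrite /D evm !map_mxM eA eB ezm.
pose sV : PM := \det XA * \det XB.
have sVE a h : sV.@[pt a h] = \det a * \det h by rewrite mevalM -!det_map_mx eA eB.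
have [|x sx hx||q hq|y [w [[a [h [Fa Hh ->]]] tw dw]]] := @tangent_lift k _ N V sV c _ _ D char0 _ _.
- move=>_ [a [h [Fa Hh ->]]];rewrite sVE;apply:mulf_neq0;rewrite -unitfE -unitmxE;
  [exact:carrier_unit Fa | exact:carrier_unit Hh].
- pose a : 'M[k]_n := vec_mx (\row_l x (lshift N l));pose h : 'M[k]_n := vec_mx (\row_l x (rshift N l)).
 have xE : x = pt a h.
  by apply/funext => i;case:(split_ordP i) => l ->;rewrite ?ptl ?ptr vec_mxK mxE.
 move: sx;rewrite xE sVE mulf_eq0 negb_or => /andP[da dh];exists a, h;split=>//.
  have [S FS] := carrier_closed F;rewrite FS;split=>[|p Sp];first by rewrite /= unitmxE unitfE.
  have := hx (p \mPo embL);rewrite xE embLE;apply=> _ [a' [h' [Fa' _ ->]]];rewrite embLE.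
  by move: Fa';rewrite FS => -[_];apply.
 have [S HS] := carrier_closed H;rewrite HS;split=>[|p Sp];first by rewrite /= unitmxE unitfE.
 have := hx (p \mPo embR);rewrite xE embRE;apply=> _ [a' [h' [_ Hh' ->]]];rewrite embRE.
 by move: Hh';rewrite HS => -[_];apply.
- by exists (pt 1%:M 1%:M), 1%:M, 1%:M;split=>//;apply:carrier1.
- move=>_ [a [h [Fa Hh ->]]].
 have TL d u v : a *m (d *: u + v) *m h = d *: (a *m u *m h) + a *m v *m h.
  by rewrite mulmxDr mulmxDl -scalemxAr -scalemxAl.
 have [T TE] := sub_linear TL;have [c' [c1 c2]] := lin_sub T.
 have q0 : mdiff (q \mPo c') (mxvec 1%:M 0) (mxvec z 0) = 0.
  apply:hz => a' h' Fa' Hh';rewrite /mx_eval c1 TE.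
  have := hq (pt (a *m a') (h' *m h));rewrite comp_mpoly_meval => <-;last first.
   by exists (a *m a'), (h' *m h);split=>//;apply:carrierM.
  by apply:meval_eq => l;rewrite cE !mulmxA.
 move: q0;rewrite c2 !TE mulmx1 => q0;rewrite -[RHS]q0 rmorph_sum;eqbig => l _.
 by rewrite /= mevalM DE comp_mpoly_meval;congr (_ * _);apply:meval_eq => l';rewrite cE.
pose wa : 'M[k]_n := vec_mx (\row_l w (lshift N l));pose wh : 'M[k]_n := vec_mx (\row_l w (rshift N l)).
have ua := carrier_unit Fa;have uh := carrier_unit Hh.
have faw : invmx a *m wa \in lie F.
 apply:(@translate_tangent F a wa (mulmx (invmx a)));first exact:mulVmx.
  by move=>g Fg;apply:carrierM =>//;apply:carrierV.
 move=>q hq;have := tw (q \mPo embL);rewrite mdiff_comp => <- //.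
  by apply:eq_mdiff => l;rewrite tnthE ?mevalXU ?ptl ?mdiffX // vec_mxK mxE.
 by move=>_ [a' [h' [Fa' _ ->]]];rewrite embLE;apply:hq.
have fwh : wh *m invmx h \in lie H.
 apply:(@translate_tangent H h wh (mulmxr (invmx h)));first exact:mulmxV.
  by move=>g Hg;apply:carrierM =>//;apply:carrierV.
 move=>q hq;have := tw (q \mPo embR);rewrite mdiff_comp => <- //.
  by apply:eq_mdiff => l;rewrite tnthE ?mevalXU ?ptr ?mdiffX // vec_mxK mxE.
 by move=>_ [a' [h' [_ Hh' ->]]];rewrite embRE;apply:hq.
have e1 : wa *m h + a *m wh = a *m z *m h.
 apply:(can_inj mxvecK);apply/rowP => l;rewrite -DE -dw tnthE.
 case/mxvec_indexP: l => i j;rewrite !mxvecE [(XA *m XB) i j]mxE (big_morph (fun q : PM => mdiff q (pt a h) w)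
  (fun q r => mdiffD q r _ _) (mdiff0 _ _)) [LHS]mxE [(wa *m h) i j]mxE [(a *m wh) i j]mxE -big_split;eqbig => u _ /=.
 rewrite mdiffM ![XA _ _]mxE ![XB _ _]mxE !mdiffX !mevalXU ptl ptr !mxvecE ![vec_mx _ _ _]mxE ![(\row__ _) _ _]mxE.
 by ring.
have -> : z = invmx a *m wa + wh *m invmx h.
 have -> : z = invmx a *m (a *m z *m h) *m invmx h by rewrite !mulmxA mulVmx // mul1mx mulmxK.
 by rewrite -e1 mulmxDr mulmxDl !mulmxA mulmxK // mulVmx // mul1mx.
exact:memv_add.
Qed.
End OrbitTangent.

(** * The slice: symbols of biinvariant functions and their lifts *)

Lemma adj_mul_right (k : fieldType) r (P R P1 : 'M[k]_r) : P1 = P *m R -> P \in unitmx ->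
 R *m \adj P1 = \det R *: \adj P.
move=>-> uP;apply:(can_inj (mulKmx uP));rewrite mulmxA mul_mx_adj -scalemxAr mul_mx_adj det_mulmx.
by rewrite scale_scalar_mx mulrC.
Qed.

Lemma cross_ratio (R : comNzRingType) (w w' d d' : R) j : w' * d ^+ j = w * d' ^+ j ->
 (w * d) * d' ^+ j.+1 = (w' * d') * d ^+ j.+1.
by move=>E;rewrite !exprS;ring: E. Qed.

Lemma cross_shift (R : comNzRingType) (a p q q' w v : R) : q * w = q' * v -> a * p * q' * v = a * (q * p) * w.
by move=>E;ring: E. Qed.

Lemma comp_comp_sum (k : comNzRingType) a b d (u : a.-tuple {mpoly k[b]}) (v : b.-tuple {mpoly k[d]})
  (T : finType) (P : pred T) (c : T -> k) (q : T -> {mpoly k[a]}) :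
 ((\sum_(m | P m) c m *: q m) \mPo u) \mPo v = \sum_(m | P m) c m *: ((q m \mPo u) \mPo v).
rewrite (raddf_sum (comp_mpoly u)) (raddf_sum (comp_mpoly v));eqbig => m _ /=.
by rewrite !comp_mpolyZ.
Qed.

Lemma euler_identity (k : fieldType) r (c : {mpoly k[r]}) j : c \is j.-homog ->
 \sum_l c^`M(l) * 'X_l = j%:R *: c.
move=>/dhomogP hc;have h l : c^`M(l) * 'X_l = \sum_(m <- msupp c) c@_m *: ((m l)%:R *: 'X_[m]).
 rewrite {1}[c]mpolyE (raddf_sum (mderiv l)) mulr_suml;eqbig => m _ /=.
 rewrite mderivZ mderivX -!scalerAl -mpolyXD;congr (_ *: _);have [->|ml] := posnP (m l);first by rewrite !scale0r.
 by rewrite submK //;apply/mnm_lepP => i;rewrite mnm1E;case:eqP =>[<-|].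
rewrite (eq_bigr _ (fun l _ => h l)) exchange_big [c in RHS]mpolyE scaler_sumr;apply:eq_big_seq => m mc /=.
rewrite -scaler_sumr scalerA mulrC -scalerA;congr (_ *: _).
by rewrite -(hc m mc) /= mdegE natr_sum scaler_suml.
Qed.

(** X adj(P X) P is the scalar det(P X) if P X is invertible; the extra factor d makes the identity
    hold in the singular case too. *)
Lemma adj_sandwich (k : fieldType) r (P X : 'M[k]_r) (d : k) : d = \det (P *m X) ->
 d *: (X *m \adj (P *m X) *m P) = (d * d)%:M.
move=>dE;have [->|d0] := eqVneq d 0;first by rewrite scale0r mul0r raddf0.
have uX : X \in unitmx by move: d0;rewrite dE det_mulmx mulf_eq0 negb_or unitmxE unitfE => /andP[].
apply:(can_inj (mulmxK uX));rewrite -scalemxAl -[X *m _ *m P *m X]mulmxA -[X *m _ *m (P *m X)]mulmxA mul_adj_mx -dE.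
by rewrite mul_mx_scalar mul_scalar_mx scalerA.
Qed.

Section Slice.
Variables (k : closedFieldType) (n : nat) (char0 : has_pchar0 k) (F G H : alg_group k n).
Hypotheses (FG : F `<=` G) (HG : H `<=` G).
Local Notation PA := {mpoly k[n * n + 1]}.
Local Notation e := (1%:M : 'M[k]_n).
Local Notation A := (Aj G).
(** A basis of Lie G whose first r members represent the normal space N and whose last r' lie in Lie
    F + Lie H. *)
Variables (r r' : nat) (x : 'I_(r + r') -> 'M[k]_n) (xi : 'I_(r + r') -> {linear 'M[k]_n -> k^o}).
Hypotheses (xG : forall i, x i \in lie G) (xi_x : forall i l, xi i (x l) = (i == l)%:R)
 (x_span : forall z, z \in lie G -> z = \sum_i (xi i z : k) *: x i)
 (x_orbit : forall j, x (rshift r j) \in (lie F + lie H)%VS)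
 (xi_orbit : forall j z, z \in (lie F + lie H)%VS -> xi (lshift r' j) z = 0).

Let iA := Aj_ideal G.
Let uniq := symbol_unique char0 xG xi_x.
Let ex := symbol_exists x_span.

(** The local parameters transversal to the orbit; substituting them into a form c gives a function
    with symbol c. *)
Definition tau : r.-tuple PA := [tuple tpoly xi (lshift r' i) | i < r].
Definition slice_emb : r.-tuple {mpoly k[r + r']} := [tuple 'X_(lshift r' i) | i < r].

Lemma tau_emb c : c \mPo tau = (c \mPo slice_emb) \mPo tt_ xi.
rewrite comp_mpolyA;congr (_ \mPo _);apply:eq_from_tnth => i.
by rewrite !tnthE comp_mpolyXU -tnth_nth tnthE.
Qed.

Lemma tau_Aj1 l : A 1 (tnth tau l).
by rewrite tnthE;apply:tpoly1. Qed.

Lemma slice_emb_inj c : c \mPo slice_emb = 0 -> c = 0.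
move=>c0;have := congr1 (comp_mpoly [tuple if fintype.split i is inl j then 'X_j else 0 | i < r + r'] : {mpoly k[r + r']} -> {mpoly k[r]}) c0.
rewrite comp_mpoly0 comp_mpolyA => <-;rewrite -[LHS]comp_mpoly_id;congr (_ \mPo _).
apply:eq_from_tnth => i;rewrite !tnthE comp_mpolyXU -tnth_nth tnthE.
by rewrite -[lshift r' i]/(unsplit (inl i)) unsplitK.
Qed.

Lemma slice_emb_homog j c : c \is j.-homog -> c \mPo slice_emb \is j.-homog.
by apply:comp_homog1 => l;rewrite tnthE dhomogX /= mdeg1. Qed.

Lemma tau_Aj j c : c \is j.-homog -> A j (c \mPo tau).
by move=>hc;rewrite tau_emb;apply:tt_Aj;apply:slice_emb_homog. Qed.

Lemma tau_unique j c : c \is j.-homog -> A j.+1 (c \mPo tau) -> c = 0.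
move=>hc;rewrite tau_emb => /(uniq (slice_emb_homog hc)).
exact:slice_emb_inj.
Qed.

Lemma A_trans a b j p : carrier G a -> carrier G b -> a *m b = 1%:M -> A j p -> A j (p \mPo trans a b).
move=>Ga Gb ab [p1 [p2 [h1 h2 ->]]];rewrite comp_mpolyD.
have hm : forall q, point_one q -> point_one (q \mPo trans a b).
 by move=>q;rewrite /point_one /= reg_trans mulmx1 ab.
exists (p1 \mPo trans a b), (p2 \mPo trans a b);split=>//;last first.
 by move=>g Gg;rewrite reg_trans h2 //;do ?apply:carrierM.
have iP := point_one_ideal k n.
elim: j p1 h1 =>[//|j IH] p1 [s hs ->];rewrite rmorph_sum big_seq /=.
apply:ideal_sum =>[|q /hs[q1 q2]];first exact:(ipow_ideal j.+1).
by rewrite rmorphM /=;apply:mem_ideal_mul;[apply:hm | apply:IH].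
Qed.

(** The action of Ad a on N as a substitution in the coordinates of N. *)
Definition rho a : r.-tuple {mpoly k[r]} :=
 [tuple \sum_i (xi (lshift r' l) (Ad a (x (lshift r' i))) : k) *: 'X_i | l < r].

Definition slice_inv : set {mpoly k[r]} :=
 [set c | forall a, carrier F a -> carrier H a -> c \mPo rho a = c].

Lemma Ad_orbit a z : carrier F a -> carrier H a -> z \in (lie F + lie H)%VS -> Ad a z \in (lie F + lie H)%VS.
move=>Fa Ha /memv_addP[u uF [v vH ->]].
have -> : Ad a (u + v) = Ad a u + Ad a v by rewrite /Ad mulmxDr mulmxDl.
by apply:memv_add;apply:Ad_lie.
Qed.

Lemma rho_homog a j c : c \is j.-homog -> c \mPo rho a \is j.-homog.
by apply:comp_homog1 => l;rewrite tnthE;apply:lin_form_homog. Qed.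

Lemma tau_conj a l : carrier F a -> carrier H a ->
 A 2 ((tnth tau l \mPo trans a (invmx a)) - (tnth (rho a) l \mPo tau)).
move=>Fa Ha;have Ga := FG Fa;have ua := carrier_unit Ga.
have h1 : A 1 (tnth tau l \mPo trans a (invmx a)).
 apply:A_trans (tau_Aj1 l) =>//;[exact:carrierV | exact:mulmxV].
have := taylor_one x_span h1;rewrite big_split_ord /= [X in _ - (_ + X)]big1 ?addr0.
 move=>h;suff -> : tnth (rho a) l \mPo tau = \sum_i reg (L (x (lshift r' i)) (tnth tau l \mPo trans a (invmx a))) e *: tpoly xi (lshift r' i) by [].
 rewrite tnthE rmorph_sum;eqbig => i _ /=. rewrite comp_mpolyZ comp_mpolyXU -tnth_nth !tnthE;congr (_ *: _).
 rewrite L_trans ?unitmx_inv // reg_trans mulmx1 mulmxV // invmxK. by rewrite L_tpoly.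
move=>j _;rewrite L_trans ?unitmx_inv // reg_trans mulmx1 mulmxV // invmxK tnthE L_tpoly.
by rewrite xi_orbit ?scale0r //;apply:Ad_orbit.
Qed.

Lemma tau_rho a j c : carrier F a -> carrier H a -> c \is j.-homog ->
 A j.+1 (((c \mPo tau) \mPo trans a (invmx a)) - ((c \mPo rho a) \mPo tau)).
move=>Fa Ha hc;rewrite !comp_mpolyA.
have [] // := @sim_comp k _ A iA (@Aj0 _ _ G) (@AjM _ _ G) r
 [tuple tnth tau l \mPo trans a (invmx a) | l < r] [tuple tnth (rho a) l \mPo tau | l < r] c j hc.
move=>l;rewrite !tnthE;split;last by have := tau_conj l Fa Ha;rewrite !tnthE.
 have Ga := FG Fa;apply:A_trans;rewrite ?mulmxV ?(carrier_unit Ga) //;first exact:carrierV.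
 exact:tpoly1.
apply:tau_Aj;apply:rpred_sum => i _;apply:rpredZ.
by rewrite dhomogX /= mdeg1.
Qed.

Definition biinv (p : PA) := forall a h g, carrier F a -> carrier H h -> carrier G g ->
 reg p (a *m g *m invmx h) = reg p g.

Lemma biinv_LH p z : biinv p -> z \in lie H -> reg_ideal G (L z p).
move=>Ip zH g Gg;have ug := carrier_unit Gg.
have h : reg_ideal H ((p \mPo trans g e) - (reg p g)%:MP).
 move=>h Hh;have Hh' := carrierV Hh;rewrite regB regC reg_trans mulmx1.
 have := Ip e (invmx h) g (carrier1 F) Hh' Gg;rewrite invmxK mul1mx => ->. by rewrite subrr.
have := L_ideal zH h (carrier1 H);rewrite {1}/L VB VC subr0 -/(L z _) L_trans ?unitmx1 //.
by rewrite reg_trans !mulmx1 invmx1 mul1mx.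
Qed.

Lemma biinv_RF p y : biinv p -> y \in lie F -> reg_ideal G (Rt y p).
move=>Ip yF g Gg;have ug := carrier_unit Gg.
have h : reg_ideal F ((p \mPo trans e g) - (reg p g)%:MP).
 move=>a Fa;rewrite regB regC reg_trans mul1mx.
 by have := Ip a e g Fa (carrier1 H) Gg;rewrite invmx1 mulmx1 => ->;rewrite subrr.
have := L_ideal yF h (carrier1 F);rewrite {1}/L VB VC subr0 -/(L y _) L_trans ?unitmx1 //.
rewrite reg_trans !mul1mx => <-;apply:V_eval_eq;rewrite evR evL.
by rewrite !mulmxA mulmxV // mul1mx.
Qed.

(** For z = y + w in Lie F + Lie H the field of w kills p, and the left field of y agrees, up to
    terms of the same order, with the right field of y, which kills p. So the symbol has no
    derivative along Lie F + Lie H. Conjugation by F and H together fixes p, whence the invariance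
    of c. *)
Lemma biinv_symbol j p : biinv p -> A j p ->
 exists c, [/\ c \is j.-homog, slice_inv c & A j.+1 (p - (c \mPo tau))].
move=>Ip pA;have [q hq qA] := ex pA.
have Lorb z : z \in (lie F + lie H)%VS -> A j (L z p).
 move=>/memv_addP[y yF [w wH ->]]. have -> : y + w = y - (- w) by rewrite opprK.
 rewrite LB1;apply:(idealB (iA _)).
  rewrite -[L y p](subrK (Rt y p));apply:(idealD (iA _)).
   by apply:LR_Aj pA;apply:(subvP (lieS FG)).
  by apply:Aj_reg;apply:biinv_RF.
 by apply:Aj_reg;apply:biinv_LH =>//;rewrite memvN.
have [c qc] : exists c, q = c \mPo slice_emb.
 case:j hq qA pA Lorb =>[|j] hq qA pA Lorb.
  by have [a ->] := dhomog0_const hq;exists a%:MP;rewrite comp_mpolyC.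
 pose u (i : 'I_(r + r')) : {mpoly k[r]} := if fintype.split i is inl i' then 'X_i' else 0.
 exists (q \mPo [tuple u i | i < r + r']);apply/esym.
 apply:(dhomog_var_free (P := fun i => if fintype.split i is inl _ then true else false)) =>// i;rewrite /u.
  by case:split_ordP =>// i' -> _;rewrite comp_mpolyXU -tnth_nth tnthE.
 case:split_ordP =>// i' -> _;set i0 := rshift r i';apply:(uniq (dhomog_deriv _ hq)).
 have -> : q^`M(i0) \mPo tt_ xi = (L (x i0) p) - (L (x i0) (p - (q \mPo tt_ xi))) - (L (x i0) (q \mPo tt_ xi) - (q^`M(i0) \mPo tt_ xi)).
  by rewrite {2}/L VB -!/(L _ _);ring.
 apply:(idealB (iA _));last exact:L_symbol. apply:(idealB (iA _));last by apply:L_Aj.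
 exact:Lorb (x_orbit i').
have hc : c \is j.-homog.
 have [N hN] := homog_sum mdeg c. suff -> : c = pihomog mdeg j c by exact:pihomogP.
 apply:subr0_eq;apply/slice_emb_inj.
 have h l : tnth slice_emb l \is (1%N).-homog by rewrite tnthE dhomogX /= mdeg1.
 by rewrite comp_mpolyB (pihomog_comp1 j c h) -qc pihomog_dE // subrr.
exists c;split=>//;last by rewrite tau_emb -qc.
move=>a Fa Ha;have Ga := FG Fa;apply:subr0_eq.
apply:(@tau_unique j);first by apply:rpredB =>//;apply:rho_homog.
have pc : A j.+1 (p - (c \mPo tau)) by rewrite tau_emb -qc.
have pc' : A j.+1 ((p - (c \mPo tau)) \mPo trans a (invmx a)).
 apply:A_trans pc =>//;[exact:carrierV | exact:mulmxV (carrier_unit Ga)].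
have pI : A j.+1 ((p \mPo trans a (invmx a)) - p).
 by apply:Aj_reg => g Gg;rewrite regB reg_trans Ip // subrr.
have h := tau_rho Fa Ha hc.
have -> : (c \mPo rho a - c) \mPo tau = (p - (c \mPo tau)) - ((p - (c \mPo tau)) \mPo trans a (invmx a)) + ((p \mPo trans a (invmx a)) - p)
  - (((c \mPo tau) \mPo trans a (invmx a)) - ((c \mPo rho a) \mPo tau)).
 by rewrite !comp_mpolyB;ring.
by do 2?[apply:(idealB (iA _)) =>// | apply:(idealD (iA _)) =>//];apply:(idealB (iA _)).
Qed.

Hypothesis Ocl : zclosed_in G (double_coset F H).
Local Notation O := (double_coset F H).

Definition K_stable (J : set PA) := forall a h p, carrier F a -> carrier H h -> J p -> J (p \mPo trans a h).

Lemma orbitG g : O g -> carrier G g.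
by move=>[a Fa [h Hh <-]];apply:carrierM;[apply:FG | apply:HG]. Qed.

Lemma reg_eq_point (y : 'I_(n * n + 1) -> k) : (det_rel k n).@[y] = 0 ->
 exists2 g, g \in unitmx & y = rvec g.
pose g : 'M[k]_n := vec_mx (\row_l y (lshift 1 l)).
have dE : (det_poly k n).@[y] = \det g.
 rewrite det_poly_emb comp_mpoly_meval -[RHS](congr1 _ (gen_mx_eval g)) det_map_mx;apply:meval_eq => l.
 by rewrite tnthE mevalXU vec_mxK mxE.
rewrite /det_rel mevalB mevalM dE meval1 mevalXU => /eqP;rewrite subr_eq0 => /eqP dx.
have dg : \det g != 0 by apply:contra_eq_neq dx => ->;rewrite mul0r eq_sym oner_eq0.
exists g;first by rewrite unitmxE unitfE.
apply/funext => i;case:(split_ordP i) =>[l ->|j ->];first by rewrite rvecl vec_mxK mxE.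
by rewrite rvecr ord1;apply:(mulfI dg);rewrite dx mulfV.
Qed.

(* The orbit is a closed subset of affine space on which K acts transitively. *)
Lemma orbit_nullstellensatz (J : set PA) q : is_ideal J -> reg_ideal O `<=` J -> K_stable J ->
 J q -> reg q e != 0 -> J 1.
move=>iJ OJ KJ Jq qe;apply:nullstellensatz =>// y.
have [dx|/eqP dx] := pselect ((det_rel k n).@[y] = 0);last first.
 exists (det_rel k n) =>//;apply:OJ => g /orbitG Gg;apply:det_rel_eval;exact:carrier_unit Gg.
have [g ug ->] := reg_eq_point dx.
have [[a Fa [h Hh ah]]|nO] := pselect (O g).
 have ua := carrier_unit Fa;have uh := carrier_unit Hh.
 exists (q \mPo trans (invmx a) (invmx h));first by apply:KJ =>//;apply:carrierV.
 by rewrite -[X in X != 0]/(reg _ g) reg_trans -ah mulmxA mulVmx // mul1mx mulmxV.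
have [S OS] := Ocl;have [S' GS] := carrier_closed G.
apply:contrapT => no;apply:nO.
have h (p : {mpoly k[n * n]}) : (forall g, O g -> mx_eval p g = 0) -> mx_eval p g = 0.
 move=>hp;apply/eqP/negPn/negP => nz;apply:no;exists (p \mPo emb k n).
  apply:OJ => g' /hp <-;rewrite /reg comp_mpoly_meval;apply:meval_eq => l. by rewrite tnthE mevalXU rvecl.
 rewrite comp_mpoly_meval (meval_eq (v2 := mxvec g 0)) // => l. by rewrite tnthE mevalXU rvecl.
rewrite OS;split=>[|p Sp].
 by rewrite GS;split=>// p Sp;apply:h => g' /orbitG;rewrite GS => -[_];apply.
by apply:h => g';rewrite OS => -[_];apply.
Qed.

Lemma reg_ideal_orbit : K_stable (reg_ideal O).
move=>a h p Fa Hh Op _ [a' Fa' [h' Hh' <-]];rewrite reg_trans;apply:Op.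
exists (a *m a');first exact:carrierM.
by exists (h' *m h);[exact:carrierM | rewrite !mulmxA].
Qed.

Lemma orbit_group p : reg_ideal O p -> reg_ideal F p /\ reg_ideal H p.
move=>Op;split=> g Eg;apply:Op.
 by exists g =>//;exists e;[apply:carrier1 | rewrite mulmx1].
by exists e;[apply:carrier1 | exists g =>//;rewrite mul1mx].
Qed.

Lemma orbit_L p z : reg_ideal O p -> z \in (lie F + lie H)%VS -> reg (L z p) e = 0.
move=>/orbit_group[pF pH] /memv_addP[u uF [v vH ->]].
have nvH : - v \in lie H by rewrite memvN.
have h1 := L_ideal uF pF (carrier1 F);have h2 := L_ideal nvH pH (carrier1 H).
have -> : u + v = u - (- v) by rewrite opprK.
have -> : L (u - - v) p = L u p - L (- v) p by exact:LB1.
by apply:(etrans (regB _ _ _));apply/eqP;rewrite subr_eq0;apply/eqP;exact:(etrans h1 (esym h2)).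
Qed.

Local Notation xs l := (x (lshift r' l)).

(** The covector of a transversal parameter kills the tangent space of the orbit, so it is the
    differential of a function vanishing on the orbit. *)
Lemma slice_functions : exists f : 'I_r -> PA, forall i,
 reg_ideal O (f i) /\ A 2 (f i - tpoly xi (lshift r' i)).
apply:(fin_all_exists (P := fun i p => reg_ideal O p /\ A 2 (p - tpoly xi (lshift r' i)))) => i.
have iO := reg_ideal_ideal O;set t := tpoly xi _.
have GO : reg_ideal G `<=` reg_ideal O by move=>p hp g /orbitG;apply:hp.
have [|q hq qd] := @differential_of_ideal k _ (rvec e) (reg_ideal O) (\row_j (t^`M(j)).@[rvec e]) iO.
 move=>w tw;have [z zG zE] := tangent_one (fun q hq => tw q (GO q hq)). have zO : z \in (lie F + lie H)%VS.
  apply:(orbit_tangent char0) => q hq;have := tw (q \mPo emb k n).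
  rewrite zE /L V_emb_eval evL mul1mx;apply=> _ [a Fa [h Hh <-]].
  rewrite -[RHS](hq a h Fa Hh) /reg comp_mpoly_meval;apply:meval_eq => l. by rewrite tnthE mevalXU rvecl.
 rewrite -[RHS](xi_orbit i zO) -(L_tpoly xi z (lshift r' i)) -zE. by eqbig => j _;rewrite mxE.
exists q;split=>//;apply:Aj_pow;have := taylor1 (rvec e) (q - t).
have -> : (q - t).@[rvec e] = 0.
 rewrite -[LHS]/(reg _ _) regB (_ : reg q e = 0) ?sub0r;last first.
  by apply:hq;exists e;[apply:carrier1 | exists e;[apply:carrier1 | rewrite mul1mx]].
 by have /Aj1 -> := tpoly1 G xi (lshift r' i);rewrite oppr0.
rewrite mpolyC0 subr0 big1 ?subr0 // => l _.
by rewrite mderivB mevalB qd mxE subrr mpolyC0 mul0r.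
Qed.

Lemma orbit_taylor p : reg_ideal O p ->
 A 2 (p - \sum_l reg (L (xs l) p) e *: tpoly xi (lshift r' l)).
move=>Op;have p1 : A 1 p.
 by apply/Aj1;apply:Op;exists e;[apply:carrier1 | exists e;[apply:carrier1 | rewrite mul1mx]].
have := taylor_one x_span p1;rewrite big_split_ord /= [X in _ - (_ + X)]big1 ?addr0 // => j _.
by rewrite orbit_L // scale0r.
Qed.

Lemma A_eq_fun j p q : (forall g, carrier G g -> reg p g = reg q g) -> A j q -> A j p.
move=>pq qA;rewrite -(subrK q p);apply:(idealD (iA _)) =>//;apply:Aj_reg => g Gg.
by rewrite regB pq // subrr.
Qed.

Lemma trans_trans j p a h a' h' : A j (p \mPo trans (a *m a') (h' *m h)) -> A j ((p \mPo trans a h) \mPo trans a' h').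
by apply:A_eq_fun => g _;rewrite !reg_trans !mulmxA. Qed.

Lemma subC_A1 (p : PA) : A 1 (p - (reg p e)%:MP).
by apply/Aj1;rewrite regB regC subrr. Qed.

(** [invariant_correction] with trivial twist, for tuples of polynomials: P is a stable linear space
    of tuples modulo which u is invariant. *)
Lemma invariant_polys d (u : 'I_d -> PA) (P : ('I_d -> PA) -> Prop) : reductive F -> reductive H ->
 P (fun=> 0) -> (forall c p q, P p -> P q -> P (fun i => c *: p i + q i)) ->
 (forall a h p, carrier F a -> carrier H h -> P p -> P (fun i => p i \mPo trans a h)) ->
 (forall a h, carrier F a -> carrier H h -> P (fun i => (u i \mPo trans a h) - u i)) ->
 exists2 p, P p & forall i, biinv (u i - p i).
move=>redF redH P0 PL PK uP.
pose m (p : 'I_d -> PA) (g : 'M[k]_n) : 'rV[k]_d := \row_i reg (p i) g.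
pose tau1 (_ : 'M[k]_n) := 1%:M : 'M[k]_d.
pose Y : set ('M[k]_n -> 'rV[k]_d) := [set y | exists2 p, y = m p & P p].
have actFm a p : actF a (m p) = m (fun i => p i \mPo trans a e).
 by apply/funext => g;apply/rowP => i;rewrite !mxE reg_trans mulmx1.
have actHm h p : actH tau1 h (m p) = m (fun i => p i \mPo trans e (invmx h)).
 by apply/funext => g;rewrite /actH mulmx1;apply/rowP => i;rewrite !mxE reg_trans mul1mx.
have mL c p q : c *: m p + m q = m (fun i => c *: p i + q i).
 by apply/funext => g;apply/rowP => i;rewrite !mxE regD regZ.
have mB p q : m p - m q = m (fun i => p i - q i) by apply/funext => g;apply/rowP => i;rewrite !mxE regB.
have uY a h : carrier F a -> carrier H h -> Y (m (fun i => u i \mPo trans a h) - m u).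
 by move=>Fa Hh;rewrite mB;exists (fun i => (u i \mPo trans a h) - u i) =>//;apply:uP.
have [y [p yp pA] inv] : exists2 y, Y y & forall a h g, carrier F a -> carrier H h ->
  (m u - y) (a *m g *m invmx h) *m tau1 h = (m u - y) g.
 apply:(@invariant_correction k n d char0 F H tau1 redF redH) =>//.
 - by move=>g h _ _;rewrite mulmx1.
 - by move=>i i';exists ((1%:M : 'M[k]_d) i i')%:MP => h _;rewrite regC.
 - by exists u.
 - by move=>_ [p -> _];exists p.
 - by exists (fun=> 0) =>//;apply/funext => g;apply/rowP => i;rewrite !mxE /reg meval0.
 - by move=>c _ _ [p -> hp] [q -> hq];rewrite mL;exists (fun i => c *: p i + q i) =>//;apply:PL.
 - move=>a _ Fa [p -> hp];rewrite actFm;exists (fun i => p i \mPo trans a e) =>//.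
  by apply:PK =>//;apply:carrier1.
 - move=>h _ Hh [p -> hp];rewrite actHm;exists (fun i => p i \mPo trans e (invmx h)) =>//.
  by apply:PK =>//;[apply:carrier1 | apply:carrierV].
 - by move=>a Fa;rewrite actFm;apply:uY =>//;apply:carrier1.
 by move=>h Hh;rewrite actHm;apply:uY;[apply:carrier1 | apply:carrierV].
exists p =>// i a h g Fa Hh _;have := congr1 (fun z : 'rV[k]_d => z 0 i) (inv a h g Fa Hh).
by rewrite mulmx1 yp mB !mxE.
Qed.

Section Jets.
Variables (j : nat) (c0 : PA).
Hypothesis c0A : A j c0.

(* The functions q such that q c0 extends along the orbit. *)
Definition jets : set PA := [set q | exists u : PA, forall a h, carrier F a -> carrier H h ->
 A j.+1 ((u \mPo trans a h) - (reg q (a *m h))%:MP * c0)].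

Lemma jets_ideal : is_ideal jets.
split.
- by exists 0 => a h _ _;rewrite comp_mpoly0 /reg meval0 mpolyC0 mul0r subrr;apply:ideal0 (iA _).
- move=>q q' [u hu] [u' hu'];exists (u + u') => a h Fa Hh.
 by rewrite comp_mpolyD regD mpolyCD mulrDl opprD addrACA;apply:(idealD (iA _));[apply:hu | apply:hu'].
move=>p q [u hu];exists (p * u) => a h Fa Hh;rewrite rmorphM /= regM mpolyCM.
have -> : (p \mPo trans a h) * (u \mPo trans a h) - (reg p (a *m h))%:MP * (reg q (a *m h))%:MP * c0 =
 (p \mPo trans a h) * ((u \mPo trans a h) - (reg q (a *m h))%:MP * c0) +
 (reg q (a *m h))%:MP * (((p \mPo trans a h) - (reg p (a *m h))%:MP) * c0) by ring.
apply:(idealD (iA _));first by apply:(idealM _ (iA _));apply:hu.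
apply:(idealM _ (iA _));rewrite -add1n;apply:AjM =>//;have := subC_A1 (p \mPo trans a h).
by rewrite reg_trans mulmx1.
Qed.

Lemma jets_orbit : reg_ideal O `<=` jets.
move=>q hq;exists 0 => a h Fa Hh;rewrite comp_mpoly0 hq;last by exists a =>//;exists h.
by rewrite mpolyC0 mul0r subrr;apply:ideal0 (iA _).
Qed.

Lemma jets_stable : K_stable jets.
move=>a h q Fa Hh [u hu];exists (u \mPo trans a h) => a' h' Fa' Hh'.
have h1 := hu _ _ (carrierM Fa Fa') (carrierM Hh' Hh).
have h2 : A j.+1 (((u \mPo trans a h) \mPo trans a' h') - (u \mPo trans (a *m a') (h' *m h))).
 by apply:Aj_reg => g _;rewrite regB !reg_trans !mulmxA subrr.
have -> : reg (q \mPo trans a h) (a' *m h') = reg q ((a *m a') *m (h' *m h)) by rewrite reg_trans !mulmxA.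
by have := idealD (iA _) h2 h1;rewrite addrA subrK.
Qed.

Hypotheses (redF : reductive F) (redH : reductive H).

(** F x H moves u only by functions that vanish to order j + 1 along the orbit, and correcting u by
    such a function leaves the symbol c0. *)
Lemma jets_invariant : jets 1 -> exists2 p, biinv p & A j.+1 (p - c0).
move=>[u hu];have {}hu a h : carrier F a -> carrier H h -> A j.+1 ((u \mPo trans a h) - c0).
 by move=>Fa Hh;have := hu a h Fa Hh;rewrite /reg meval1 mpolyC1 mul1r.
pose P (p : 'I_1 -> PA) := forall a h, carrier F a -> carrier H h -> A j.+1 (p 0 \mPo trans a h).
have [|c p q hp hq a h Fa Hh|a0 h0 p Fa0 Hh0 hp a h Fa Hh|a0 h0 Fa0 Hh0 a h Fa Hh|p hp inv] :=
 invariant_polys redF redH (P := P) (u := fun=> u).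
- by move=>a h _ _;rewrite comp_mpoly0;apply:ideal0 (iA _).
- rewrite comp_mpolyD comp_mpolyZ -mul_mpolyC;apply:(idealD (iA _));last exact:hq.
 by apply:(idealM _ (iA _));apply:hp.
- by apply:trans_trans;apply:hp;apply:carrierM.
- rewrite comp_mpolyB;have h1 := hu _ _ (carrierM Fa0 Fa) (carrierM Hh Hh0);have h2 := hu _ _ Fa Hh.
 have h3 : A j.+1 (((u \mPo trans a0 h0) \mPo trans a h) - (u \mPo trans (a0 *m a) (h *m h0))).
  by apply:Aj_reg => g _;rewrite regB !reg_trans !mulmxA subrr.
 by have := idealD (iA _) h3 (idealB (iA _) h1 h2);rewrite opprB !addrA !subrK.
exists (u - p 0);first exact:inv.
have tr1 q : A j.+1 (q \mPo trans e e) -> A j.+1 q.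
 by apply:A_eq_fun => g _;rewrite reg_trans mul1mx mulmx1.
rewrite addrAC;apply:(idealB (iA _));last exact/tr1/(hp _ _ (carrier1 F) (carrier1 H)).
apply:tr1;rewrite comp_mpolyB;have := hu _ _ (carrier1 F) (carrier1 H).
have h3 : A j.+1 (c0 - (c0 \mPo trans e e)) by apply:Aj_reg => g _;rewrite regB reg_trans mul1mx mulmx1 subrr.
by move=>h4;have := idealD (iA _) h4 h3;rewrite addrA subrK.
Qed.
End Jets.

Variable (f : 'I_r -> PA).
Hypothesis fO : forall i, reg_ideal O (f i) /\ A 2 (f i - tpoly xi (lshift r' i)).

(** The normal Jacobian of f at a h, in the frame of N carried from the identity by (a, h). [Nmx]
    uses the left-invariant frame and depends on the product only; [xi_mx] compares the two
    frames. *)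
Definition Phi (a h : 'M[k]_n) : 'M[k]_r := \matrix_(i, l) reg (L (xs l) (f i \mPo trans a h)) e.
Definition Nmx (g : 'M[k]_n) : 'M[k]_r := \matrix_(i, l) reg (L (xs l) (f i)) g.
Definition xi_mx (y z : 'M[k]_n) : 'M[k]_r := \matrix_(i, l) (xi (lshift r' i) (y *m xs l *m z) : k).

Lemma L_eq_fun z p q : z \in lie G -> (forall g, carrier G g -> reg p g = reg q g) -> reg (L z p) e = reg (L z q) e.
move=>zG pq;apply/eqP;rewrite -subr_eq0 -regB -VB;apply/eqP.
have h : reg_ideal G (p - q) by move=>g Gg;rewrite regB pq ?subrr.
exact:(L_ideal zG h (carrier1 G)).
Qed.

Lemma Phi_step a h z i : carrier F a -> carrier H h -> z \in lie G ->
 reg (L z (f i \mPo trans a h)) e = \sum_l Phi a h i l * (xi (lshift r' l) z : k).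
move=>Fa Hh zG;have h1 : forall j, reg (L (x (rshift r j)) (f i \mPo trans a h)) e = 0.
 by move=>j;apply:(orbit_L (reg_ideal_orbit Fa Hh (fO i).1)).
rewrite {1}(x_span zG) (L_sum x) reg_sum big_split_ord /= [X in _ + X]big1 ?addr0.
 by eqbig => l _;rewrite regZ mxE mulrC.
by move=>j _;rewrite regZ h1 mulr0.
Qed.

Lemma Nmx_Phi a h : carrier F a -> carrier H h -> Nmx (a *m h) = Phi a h *m xi_mx h (invmx h).
move=>Fa Hh;have uh := carrier_unit Hh;apply/matrixP => i l;rewrite mxE [RHS]mxE.
have zG : h *m xs l *m invmx h \in lie G by apply:Ad_lie =>//;apply:HG.
under eq_bigr => t _ do rewrite [xi_mx _ _ _ _]mxE.
rewrite -Phi_step // L_trans ?(carrier_unit Fa) // reg_trans mulmx1.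
by have -> : invmx h *m (h *m xs l *m invmx h) *m h = xs l by rewrite !mulmxA mulVmx // mul1mx mulmxKV.
Qed.

(** The pairs (a s, s^-1 h) with s in F and H run through the fibre of multiplication; the frame
    changes by Ad s. *)
Lemma Phi_conj a h s t : carrier F a -> carrier H h -> carrier F s -> carrier H s -> s *m t = 1%:M -> t *m s = 1%:M ->
 Phi (a *m s) (t *m h) = Phi a h *m xi_mx s t.
move=>Fa Hh Fs Hs st ts;have us := carrier_unit Fs;have tE : t = invmx s.
 by rewrite -[LHS]mulmx1 -(mulmxV us) mulmxA ts mul1mx.
apply/matrixP => i l;rewrite mxE [RHS]mxE.
have zG : s *m xs l *m t \in lie G by rewrite tE;apply:Ad_lie =>//;apply:FG.
transitivity (reg (L (s *m xs l *m t) (f i \mPo trans a h)) e);last first.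
 by rewrite Phi_step //;eqbig => u _;rewrite [xi_mx _ _ _ _]mxE.
transitivity (reg (L (xs l) ((f i \mPo trans a h) \mPo trans s t)) e).
 have h2 g : carrier G g -> reg (f i \mPo trans (a *m s) (t *m h)) g = reg ((f i \mPo trans a h) \mPo trans s t) g.
  by move=>_;rewrite 3!reg_trans !mulmxA.
 exact:(L_eq_fun (xG (lshift r' l)) h2).
have ut : t \in unitmx by rewrite tE unitmx_inv.
have -> : s *m xs l *m t = invmx t *m xs l *m t by rewrite tE invmxK.
by rewrite (L_trans _ _ us ut) reg_trans mulmx1 st.
Qed.

Lemma Nmx1 : Nmx e = 1%:M.
apply/matrixP => i l;rewrite !mxE;have [_ h] := fO i;have := L_Aj (xG (lshift r' l)) h.
move/Aj1;rewrite /L VB regB -!/(L _ _) L_tpoly xi_x => /eqP;rewrite subr_eq0 => /eqP ->.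
by rewrite (inj_eq (@lshift_inj _ _)) eq_sym.
Qed.

Lemma Phi_taylor a h i : carrier F a -> carrier H h ->
 sim A 1 (f i \mPo trans a h) (\sum_l Phi a h i l *: tpoly xi (lshift r' l)).
move=>Fa Hh;have Op := reg_ideal_orbit Fa Hh (fO i).1;split.
- apply/Aj1;apply:Op;exists e;[exact:carrier1 | exists e;[exact:carrier1 | by rewrite mul1mx]].
- apply:ideal_sum =>[|l _];first exact:iA.
 by rewrite -mul_mpolyC;apply:(idealM _ (iA _));apply:tpoly1.
have := orbit_taylor Op;congr (A 2 (_ - _)).
by eqbig => l _;rewrite mxE.
Qed.

Local Notation N1 := (n * n + 1)%N.
Local Notation PK := {mpoly k[N1 + N1]}.
Hypotheses (redF : reductive F) (redH : reductive H).

Definition Npoly : PA := \det (\matrix_(i, l) L (xs l) (f i)).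

Lemma NpolyE g : reg Npoly g = \det (Nmx g).
by rewrite /reg /Npoly -det_map_mx;congr (\det _);apply/matrixP => i l;rewrite !mxE. Qed.

Lemma regK_Phi i l : regK F H (fun a h => Phi a h i l).
apply:(regK_eq (f' := fun a h => \sum_t (xi t (invmx h *m xs l *m h) : k) * reg (L (x t) (f i)) (a *m h))).
 move=>a h Fa Hh;have zG : invmx h *m xs l *m h \in lie G.
  have := Ad_lie (carrierV (HG Hh)) (xG (lshift r' l)). by rewrite /Ad invmxK.
 rewrite mxE L_trans ?(carrier_unit Fa) ?(carrier_unit Hh) // reg_trans mulmx1.
 by rewrite {1}(x_span zG) (L_sum x) reg_sum;eqbig => t _;rewrite regZ.
apply:regK_sum => t;apply:regKM;last exact:regK_mul.
by have [] := regK_conj F H (xi t) (xs l).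
Qed.

Lemma regK_xi i l : regK F H (fun _ h => xi_mx h (invmx h) i l).
by have [_ h] := regK_conj F H (xi (lshift r' i)) (xs l);apply:(regK_eq _ h) => a y _ _;rewrite mxE. Qed.

Let V : set ('I_(N1 + N1) -> k) := [set y | exists a h, [/\ carrier F a, carrier H h & y = kpt a h]].

Lemma kptl (a h : 'M[k]_n) l : kpt a h (lshift N1 l) = rvec a l.
by rewrite /kpt -[lshift N1 l]/(unsplit (inl l)) unsplitK. Qed.
Lemma kptr (a h : 'M[k]_n) l : kpt a h (rshift N1 l) = rvec h l.
by rewrite /kpt -[rshift N1 l]/(unsplit (inr l)) unsplitK. Qed.

Lemma group_closed (E : alg_group k n) (y : 'I_N1 -> k) :
 (forall p, reg_ideal E p -> p.@[y] = 0) -> exists2 g, carrier E g & y = rvec g.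
move=>hy;have [|g ug yg] := @reg_eq_point y.
 by apply:hy => g Eg;apply:det_rel_eval;apply:carrier_unit Eg.
exists g =>//;have [S ES] := carrier_closed E;rewrite ES;split=>// p Sp.
have := hy (p \mPo emb k n);rewrite yg comp_mpoly_meval (meval_eq (v2 := mxvec g 0)) =>[|l];last first.
 by rewrite tnthE mevalXU rvecl.
apply=> g' Eg';rewrite /reg comp_mpoly_meval (meval_eq (v2 := mxvec g' 0)) =>[|l];last first.
 by rewrite tnthE mevalXU rvecl.
by move: Eg';rewrite ES => -[_];apply.
Qed.

Lemma V_closed y : (1 : PK).@[y] != 0 -> (forall p, vanish V p -> p.@[y] = 0) -> V y.
move=>_ hy;pose eL : N1.-tuple PK := [tuple 'X_(lshift N1 l) | l < N1];pose eR : N1.-tuple PK := [tuple 'X_(rshift N1 l) | l < N1].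
have [|a Fa ya] := @group_closed F (fun l => y (lshift N1 l)).
 move=>p hp;have := hy (p \mPo eL);rewrite comp_mpoly_meval (meval_eq (v2 := fun l => y (lshift N1 l))) =>[|l];last first.
  by rewrite tnthE mevalXU.
 apply=> _ [a [h [Fa Hh ->]]];rewrite comp_mpoly_meval -[RHS](hp a Fa);apply:meval_eq => l.
 by rewrite tnthE mevalXU kptl.
have [|h Hh yh] := @group_closed H (fun l => y (rshift N1 l)).
 move=>p hp;have := hy (p \mPo eR);rewrite comp_mpoly_meval (meval_eq (v2 := fun l => y (rshift N1 l))) =>[|l];last first.
  by rewrite tnthE mevalXU.
 apply=> _ [a' [h [Fa' Hh ->]]];rewrite comp_mpoly_meval -[RHS](hp h Hh);apply:meval_eq => l.
 by rewrite tnthE mevalXU kptr.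
exists a, h;split=>//;apply/funext => i;case:(split_ordP i) => l ->;rewrite ?kptl ?kptr.
 by rewrite -ya.
by rewrite -yh.
Qed.

Section Lift.
Variables (j : nat) (c : {mpoly k[r]}).
Hypotheses (hc : c \is j.-homog) (cinv : slice_inv c).

(** Near a h the functions f have linear part Phi tau, so c(tau) is approximated by c(Phi^-1 f). The
    adjugate replaces the inverse, at the cost of a factor det^j. *)
Let D a h : {mpoly k[r]} := c \mPo lin (\adj (Phi a h)).
Let Dh a h : D a h \is j.-homog.
exact:lin_homog. Qed.

(** D / det^j depends on the product a h only: along a fibre Phi is multiplied by the matrix of Ad
    s, which c does not see. *)
Lemma coef_fibre a h a' h' m : carrier F a -> carrier H h -> carrier F a' -> carrier H h' ->
 a *m h = a' *m h' -> \det (Phi a h) != 0 -> (D a' h')@_m * \det (Phi a h) ^+ j = (D a h)@_m * \det (Phi a' h') ^+ j.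
move=>Fa Hh Fa' Hh' ah d0;have ua := carrier_unit Fa;have uh := carrier_unit Hh;have uh' := carrier_unit Hh'.
pose s := invmx a *m a';pose t := h' *m invmx h.
have Fs : carrier F s by apply:carrierM =>//;apply:carrierV.
have us := carrier_unit Fs.
have sE : s *m h' = h by rewrite /s -mulmxA -ah mulmxA mulVmx // mul1mx.
have st : s *m t = 1%:M by rewrite /t mulmxA sE mulmxV.
have ts : t *m s = 1%:M by apply:mulmx1C.
have sV : s = invmx t.
 have ut : t \in unitmx by have [] := mulmx1_unit st. by rewrite -[LHS]mulmx1 -(mulmxV ut) mulmxA st mul1mx.
have tV : t = invmx s by rewrite -[LHS]mulmx1 -(mulmxV us) mulmxA ts mul1mx.
have Hs : carrier H s by rewrite sV;apply:carrierV;apply:carrierM =>//;apply:carrierV.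
have -> : a' = a *m s by rewrite /s mulmxA mulmxV // mul1mx.
have -> : h' = t *m h by rewrite /t mulmxKV.
have P' := Phi_conj Fa Hh Fs Hs st ts.
set R := xi_mx s t in P';set P := Phi a h;set P1 := Phi (a *m s) (t *m h) in P' *.
have RP : R *m \adj P1 = \det R *: \adj P.
 by apply:adj_mul_right P' _;rewrite unitmxE unitfE.
have cR : c \mPo lin R = c.
 have := cinv Fs Hs;congr (_ \mPo _ = _);apply:eq_from_tnth => i;rewrite !tnthE.
 by eqbig => l _;rewrite mxE /Ad tV.
have -> : D (a *m s) (t *m h) = \det R ^+ j *: D a h.
 transitivity ((c \mPo lin R) \mPo lin (\adj P1));first by rewrite cR.
 by rewrite lin_comp RP;apply:lin_scale.
by rewrite mcoeffZ P' det_mulmx exprMn;ring.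
Qed.

Lemma D_taylor a h : carrier F a -> carrier H h ->
 A j.+1 ((D a h \mPo [tuple f i | i < r]) \mPo trans a h - (\det (Phi a h) ^+ j)%:MP * (c \mPo tau)).
move=>Fa Hh;have [_ _] : sim A j (D a h \mPo [tuple f i \mPo trans a h | i < r])
  (D a h \mPo [tuple \sum_l Phi a h i l *: tpoly xi (lshift r' l) | i < r]).
 apply:(sim_comp iA (@Aj0 _ _ G) (@AjM _ _ G) (Dh a h)) => i;rewrite !tnthE. exact:Phi_taylor.
congr (A _ (_ - _)).
 by rewrite [RHS]comp_mpolyA;congr (_ \mPo _);apply:eq_from_tnth => i;rewrite !tnthE.
have -> : [tuple \sum_l Phi a h i l *: tpoly xi (lshift r' l) | i < r] = [tuple tnth (lin (Phi a h)) l \mPo tau | l < r].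
 apply:eq_from_tnth => i;rewrite !tnthE rmorph_sum;eqbig => l _ /=.
 by rewrite comp_mpolyZ comp_mpolyXU -tnth_nth tnthE.
rewrite -comp_mpolyA /D lin_comp mul_adj_mx -scalemx1 (lin_scale _ _ hc) lin_1 comp_mpolyZ.
by rewrite mul_mpolyC.
Qed.

(** The coefficients of c(Phi^-1 X) descend generically to quotients of functions on the orbit. With
    the denominators cleared, c(tau) times Npoly * B extends along the orbit; this multiplier is
    nonzero at some point of the orbit, so the stable ideal [jets] contains 1. *)
Lemma jets_lift : jets j (c \mPo tau) 1.
have cA : A j (c \mPo tau) by apply:tau_Aj.
have [C CE] : exists C : 'I_N1 -> PK, forall i a h, carrier F a -> carrier H h -> rvec (a *m h) i = (C i).@[kpt a h].
 apply:(fin_all_exists (P := fun i (q : PK) => forall a h, carrier F a -> carrier H h -> rvec (a *m h) i = q.@[kpt a h])) => i.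
 have [Q hQ] := regK_mul F H ('X_i : PA);exists Q => a h Fa Hh;rewrite -hQ //. by rewrite /reg mevalXU.
pose cc : N1.-tuple PK := [tuple C i | i < N1].
have cptE a h : carrier F a -> carrier H h -> cpt cc (kpt a h) = rvec (a *m h).
 by move=>Fa Hh;apply/funext => i;rewrite /cpt tnthE CE.
have V1 : V (kpt e e) by exists e, e;split=>//;apply:carrier1.
have [P gP nP] : exists2 P, generic V cc P & ~ P (Npoly \mPo cc).
 apply:exists_generic V1 _;rewrite cptE;[|exact:carrier1|exact:carrier1].
 by rewrite -/(reg _ _) mul1mx NpolyE (Nmx1) det1 oner_eq0.
have [pP VP _ _] := gP;have [[_ _ PM] _ Pp] := pP.
have [Qd QdE] := regK_det regK_Phi;have [Qx QxE] := regK_det regK_xi.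
have NE a h : carrier F a -> carrier H h -> reg Npoly (a *m h) = \det (Phi a h) * \det (xi_mx h (invmx h)).
 by move=>Fa Hh;rewrite NpolyE (Nmx_Phi) // det_mulmx.
have nPd : ~ P Qd.
 move=>PQ;apply:nP;have PQ' : P (Qx * Qd) by apply:PM. have : P (Npoly \mPo cc - Qx * Qd).
  apply:VP => _ [a [h [Fa Hh ->]]];rewrite mevalB mevalM -QdE // -QxE // comp_mpoly_meval.
  rewrite (meval_eq (v2 := cpt cc (kpt a h))) // cptE // -/(reg _ _) NE //. by rewrite mulrC subrr.
 have iP : is_ideal P by case:pP. by move=>h;apply:(ideal_subl iP h).
have nPv : ~ P (Qd ^+ j.+1) by move=>/(is_primeX pP).
pose T := 'X_{1..r < j.+1}.
have [ab abP] : exists ab : T -> PA * PA, forall m : T, ~ P ((ab m).2 \mPo cc) /\ forall a h, carrier F a -> carrier H h ->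
  \det (Phi a h) != 0 -> reg (ab m).2 (a *m h) * (D a h)@_m = reg (ab m).1 (a *m h) * \det (Phi a h) ^+ j.
 apply:(fin_all_exists (P := fun (m : T) (ab : PA * PA) => ~ P (ab.2 \mPo cc) /\ forall a h, carrier F a -> carrier H h ->
  \det (Phi a h) != 0 -> reg ab.2 (a *m h) * (D a h)@_m = reg ab.1 (a *m h) * \det (Phi a h) ^+ j)) => m.
 have [w wE] := regK_coef c m (fun i l => regK_adj i l regK_Phi).
 have QjE a h : carrier F a -> carrier H h -> (Qd ^+ j.+1).@[kpt a h] = \det (Phi a h) ^+ j.+1.
  by move=>Fa Hh;rewrite rmorphXn /= -QdE.
 have wQE a h : carrier F a -> carrier H h -> (w * Qd).@[kpt a h] = (D a h)@_m * \det (Phi a h).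
  by move=>Fa Hh;rewrite mevalM -wE // -QdE.
 (* The quotient w / Qd^j is written with one more factor Qd, so that a nonzero denominator forces
    det Phi to be nonzero even for j = 0. *)
 have [||a [b [nb bE]]] := @descent k _ _ V 1 cc _ V_closed P (w * Qd) (Qd ^+ j.+1) char0 gP nPv.
 - by move=>y _;rewrite meval1 oner_eq0.
 - move=>_ _ [a [h [Fa Hh ->]]] [a' [h' [Fa' Hh' ->]]];rewrite !cptE // => erv.
  rewrite (QjE _ _ Fa Hh) (QjE _ _ Fa' Hh') (wQE _ _ Fa Hh) (wQE _ _ Fa' Hh') => d0 _;have ah : a *m h = a' *m h'.
   by apply:(can_inj mxvecK);apply/rowP => l;rewrite -!rvecl erv.
  have d1 : \det (Phi a h) != 0 by apply:contra_neq d0 => ->;rewrite exprS mul0r.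
  have E := coef_fibre m Fa Hh Fa' Hh' ah d1;exact:(cross_ratio E).
 exists (a, b);split=>// a' h' Fa' Hh' d0.
 have := bE (kpt a' h');rewrite cptE // wQE // QjE // => E;apply:(mulIf d0).
 by rewrite -mulrA E;[rewrite exprSr mulrA | exists a', h' | rewrite expf_neq0].
(* B is a common denominator of the coefficients; the factor Npoly in [gm] makes both sides vanish
   where Phi is singular. *)
pose B := \prod_(m : T) (ab m).2.
pose gm (m : T) : PA := Npoly * (\prod_(m' : T | m' != m) (ab m').2) * (ab m).1.
pose fa (m : T) : PA := 'X_[m] \mPo [tuple f i | i < r].
pose u : PA := \sum_(m : T | mdeg m == j) gm m * fa m.
have Jq : jets j (c \mPo tau) (Npoly * B).
 exists u => a h Fa Hh;pose d := \det (Phi a h).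
 have h1 : A j.+1 ((u \mPo trans a h) - \sum_(m : T | mdeg m == j) (reg (gm m) (a *m h))%:MP * (fa m \mPo trans a h)).
  rewrite rmorph_sum -sumrB;apply:ideal_sum =>[|m /eqP mj];first exact:iA.
  rewrite rmorphM /= -mulrBl -add1n;apply:AjM.
   by have := subC_A1 (gm m \mPo trans a h);rewrite reg_trans mulmx1.
  rewrite /fa comp_mpolyA;apply:(homog_filtered iA (@Aj0 _ _ G) (@AjM _ _ G));first by rewrite dhomogX /= mj.
  by move=>l;rewrite !tnthE;have [] := Phi_taylor l Fa Hh.
 have [d0|dn0] := eqVneq d 0.
  have N0 : reg Npoly (a *m h) = 0 by rewrite NE // -/d d0 mul0r.
  have g0 m : reg (gm m) (a *m h) = 0 by rewrite /gm !regM N0 !mul0r.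
  move: h1;rewrite big1 =>[|m _];last by rewrite g0 mpolyC0 mul0r. by rewrite regM N0 mul0r mpolyC0 mul0r.
 have dj : d ^+ j != 0 by rewrite expf_neq0. have h2 := D_taylor Fa Hh.
 have gE m : reg (gm m) (a *m h) * d ^+ j = reg (Npoly * B) (a *m h) * (D a h)@_m.
  have [_ /(_ a h Fa Hh dn0) E] := abP m.
  have BE : B = (ab m).2 * \prod_(m' : T | m' != m) (ab m').2 by rewrite /B (bigD1 m).
  rewrite BE /gm (regM _ (ab m).1) (regM Npoly) (regM Npoly) (regM (ab m).2);exact:cross_shift E.
 have h3 : \sum_(m : T | mdeg m == j) (reg (gm m) (a *m h))%:MP * (fa m \mPo trans a h) =
   (reg (Npoly * B) (a *m h) / d ^+ j)%:MP * ((D a h \mPo [tuple f i | i < r]) \mPo trans a h).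
  have -> : D a h = \sum_(m : T | mdeg m == j) (D a h)@_m *: 'X_[m].
   have ms : (msize (D a h) <= j.+1)%N by rewrite msizeE;apply/bigmax_leqP_seq => m mD _;move/dhomogP: (Dh a h) => /(_ m mD) /= ->.
   rewrite {1}(mpolywE ms) [RHS]big_mkcond;eqbig => m _;case:ifP =>// /negbT mj.
   rewrite (_ : _@_m = 0) ?scale0r //;apply:memN_msupp_eq0;apply:contra mj => mD.
   by move/dhomogP: (Dh a h) => /(_ m mD) /= ->.
  rewrite comp_comp_sum mulr_sumr;eqbig => m _;rewrite -mul_mpolyC mulrA -mpolyCM.
  by congr (_%:MP * _);apply:(mulIf dj);rewrite gE mulrAC divfK.
 rewrite h3 in h1;have := idealD (iA _) h1 (idealM (reg (Npoly * B) (a *m h) / d ^+ j)%:MP (iA _) h2).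
 by rewrite mulrBr addrA subrK mulrA -mpolyCM divfK.
have [y Vy qy] : exists2 y, V y & (Npoly * B).@[cpt cc y] != 0.
 apply:contrapT => no;have : vanish V ((Npoly * B) \mPo cc).
  move=>y Vy;rewrite comp_mpoly_meval;apply/eqP/negPn/negP => h;apply:no;exists y =>//.
 move=>/VP;rewrite rmorphM /= => /Pp[//|];rewrite rmorph_prod.
 apply:(big_ind (fun q => ~ P q)) =>[|p q hp hq /Pp[]//|m _];first by case:pP. by case:(abP m).
(* Translation by (a, h) moves the point where the multiplier is nonzero to the identity. *)
have [a [h [Fa Hh yE]]] := Vy;rewrite yE cptE // in qy.
apply:(orbit_nullstellensatz (q := (Npoly * B) \mPo trans a h)) =>//.
- exact:jets_ideal.
- exact:jets_orbit.
- exact:jets_stable.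
- exact:jets_stable.
by rewrite reg_trans mulmx1.
Qed.

Lemma symbol_lift : exists2 p, biinv p & A j.+1 (p - (c \mPo tau)).
exact:(jets_invariant redF redH jets_lift). Qed.

End Lift.
Definition dM (M : 'M[PA]_n) y g : 'M[k]_n := evmx (map_mx (L y) M) g.

Definition conjM a h (M : 'M[PA]_n) := cmx h *m map_mx (comp_mpoly (trans a h)) M *m cmx (invmx h).

(* X M is a vector field on G that vanishes on the orbit, where its linear part
  on the normal space is multiplication by q. *)
Definition euler_field (M : 'M[PA]_n) (q : PA) := [/\ forall g, carrier G g -> evmx M g \in lie G,
 forall g, O g -> evmx M g = 0 &
 forall a h t l, carrier F a -> carrier H h ->
  xi (lshift r' l) (h *m dM M (invmx h *m x t *m h) (a *m h) *m invmx h) = (reg q (a *m h) * (lshift r' l == t)%:R : k)].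

Lemma evmxD (M M' : 'M[PA]_n) g : evmx (M + M') g = evmx M g + evmx M' g.
by apply/matrixP => i j;rewrite !mxE regD. Qed.

Lemma evmxZ (p : PA) (M : 'M[PA]_n) g : evmx (p *: M) g = reg p g *: evmx M g.
by apply/matrixP => i j;rewrite !mxE regM. Qed.

Lemma dM_D M M' y g : dM (M + M') y g = dM M y g + dM M' y g.
by apply/matrixP => i j;rewrite !mxE /L VD regD. Qed.

Lemma dM_Z p M y g : evmx M g = 0 -> dM (p *: M) y g = reg p g *: dM M y g.
move=>/matrixP M0;apply/matrixP => i j;have := M0 i j;rewrite !mxE /L VM regD !regM => ->.
by rewrite mul0r addr0.
Qed.

Lemma dM_mul a M b y g : dM (cmx a *m M *m cmx b) y g = a *m dM M y g *m b.
apply/matrixP => i j;rewrite 2!mxE [RHS]mxE [(_ *m cmx b) i j]mxE /L V_sum reg_sum;eqbig => l _.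
have -> : cmx b l j = (b l j)%:MP by rewrite mxE.
rewrite VM VC mulr0 add0r regM regC mulrC;congr (_ * _);rewrite !mxE V_sum reg_sum;eqbig => l' _.
have -> : cmx a i l' = (a i l')%:MP by rewrite mxE.
by rewrite VM VC mulr0 addr0 regM regC !mxE.
Qed.

Lemma conjM_ev a h M g : evmx (conjM a h M) g = h *m evmx M (a *m g *m h) *m invmx h.
rewrite /conjM !evmx_mul !evmx_cmx;congr (_ *m _ *m _).
by apply/matrixP => i j;rewrite !mxE reg_trans.
Qed.

Lemma euler_field_lin c M M' q q' : euler_field M q -> euler_field M' q' -> euler_field (c%:MP *: M + M') (c *: q + q').
move=>[h1 h2 h3] [h1' h2' h3'];split=>[g Gg|g Og|a h t l Fa Hh].
- by rewrite evmxD evmxZ regC;apply:memvD;[apply:memvZ;apply:h1 | apply:h1'].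
- by rewrite evmxD evmxZ h2 // h2' // scaler0 addr0.
have Oah : O (a *m h) by exists a =>//;exists h.
rewrite dM_D dM_Z ?h2 // regC mulmxDr mulmxDl -scalemxAr -scalemxAl linearP h3 // h3' // regD regZ mulrDl.
by rewrite -mulrA.
Qed.

Lemma euler_fieldZ p M q : euler_field M q -> euler_field (p *: M) (p * q).
move=>[h1 h2 h3];split=>[g Gg|g Og|a h t l Fa Hh].
- by rewrite evmxZ;apply:memvZ;apply:h1.
- by rewrite evmxZ h2 // scaler0.
have Oah : O (a *m h) by exists a =>//;exists h.
by rewrite dM_Z ?h2 // -scalemxAr -scalemxAl linearZ h3 // regM -mulrA.
Qed.

Lemma euler_field_conj a h M q : carrier F a -> carrier H h -> euler_field M q -> euler_field (conjM a h M) (q \mPo trans a h).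
move=>Fa Hh [h1 h2 h3];have uh := carrier_unit Hh;have ua := carrier_unit Fa;split=>[g Gg|g [a' Fa' [h' Hh' <-]]|a' h' t l Fa' Hh'].
- rewrite conjM_ev;apply:Ad_lie;first exact:HG.
 by apply:h1;apply:carrierM;[apply:carrierM =>//;apply:FG | apply:HG].
- rewrite conjM_ev h2 ?mulmx0 ?mul0mx //;exists (a *m a');first exact:carrierM.
 by exists (h' *m h);[apply:carrierM | rewrite !mulmxA].
have uh' := carrier_unit Hh';have uhh : h' *m h \in unitmx by rewrite unitmx_mul uh'.
have inv : invmx (h' *m h) = invmx h *m invmx h'.
 by rewrite -[RHS]mulmx1 -(mulmxV uhh) !mulmxA mulmxKV // mulVmx // mul1mx.
have := h3 (a *m a') (h' *m h) t l (carrierM Fa Fa') (carrierM Hh' Hh).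
rewrite reg_trans !mulmxA => <-;congr (xi _ _);rewrite inv /conjM dM_mul.
have -> : dM (map_mx (comp_mpoly (trans a h)) M) (invmx h' *m x t *m h') (a' *m h') =
  dM M (invmx h *m (invmx h' *m x t *m h') *m h) (a *m (a' *m h') *m h).
 by apply/matrixP => i j;rewrite !mxE (L_trans _ _ ua uh) reg_trans.
by rewrite !mulmxA.
Qed.

Lemma euler_field0 q : reg_ideal O q -> euler_field 0 q.
move=>hq;have e0 g : evmx (0 : 'M[PA]_n) g = 0 by apply/matrixP => i j;rewrite !mxE /reg meval0.
split=>[g _|g _|a h t l Fa Hh];rewrite ?e0 ?mem0v //.
rewrite hq;last by exists a =>//;exists h.
have -> : dM 0 (invmx h *m x t *m h) (a *m h) = 0.
 by apply/matrixP => i j;rewrite !mxE /L V_zero /reg meval0.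
by rewrite mulmx0 !mul0mx linear0 mul0r.
Qed.

Let b := Npoly.
Let bE g : reg b g = \det (Nmx g).
exact:NpolyE. Qed.

(** The field with normal components N^-1 f vanishes on the orbit with identity linear part.
    Clearing the denominator by the adjugate costs one factor b, and [adj_sandwich] asks for
    another. *)
Lemma euler_field_local : exists M, euler_field M (b * b).
pose Np : 'M[PA]_r := \matrix_(i, l) L (xs l) (f i).
pose m l : PA := b * \sum_i (\adj Np) l i * f i.
pose M : 'M[PA]_n := \sum_l m l *: cmx (xs l).
have evM g : evmx M g = \sum_l reg (m l) g *: xs l.
 apply/matrixP => i j;rewrite mxE [RHS]summxE /M summxE reg_sum;eqbig => l _. by rewrite !mxE regM regC.
have m0 l g : O g -> reg (m l) g = 0.
 move=>Og;rewrite regM [X in _ * X](_ : _ = 0) ?mulr0 // reg_sum big1 // => i _.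
 by rewrite regM (fO i).1 // mulr0.
have adjE g l i : reg ((\adj Np) l i) g = (\adj (Nmx g)) l i.
 transitivity (map_mx (meval (rvec g)) (\adj Np) l i);first by rewrite [RHS]mxE.
 by rewrite map_mx_adj;congr ((\adj _) _ _);apply/matrixP => u v;rewrite !mxE.
exists M;split=>[g Gg|g Og|a h t l Fa Hh].
- by rewrite evM;apply:memv_suml => l _;apply:memvZ.
- by rewrite evM big1 // => l _;rewrite m0 // scale0r.
have Oah : O (a *m h) by exists a =>//;exists h.
have uh := carrier_unit Hh;have ua := carrier_unit Fa;set y := invmx h *m x t *m h.
have dm u : reg (L y (m u)) (a *m h) = reg b (a *m h) * \sum_i (\adj (Nmx (a *m h))) u i * (\sum_v Phi a h i v * (xi (lshift r' v) (x t) : k)).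
 rewrite /m /L VM regD !regM [X in _ + X * _]reg_sum [X in _ + X * _]big1 ?mul0r ?addr0;last first.
  by move=>i _;rewrite regM (fO i).1 // mulr0.
 congr (_ * _);rewrite V_sum reg_sum;eqbig => i _;rewrite VM regD !regM (fO i).1 // mul0r addr0 adjE.
 congr (_ * _);rewrite -(Phi_step i Fa Hh (xG t)) (L_trans _ _ ua uh) reg_trans mulmx1 //.
have -> : dM M y (a *m h) = \sum_u reg (L y (m u)) (a *m h) *: xs u.
 apply/matrixP => i j;rewrite !mxE [RHS]summxE /M summxE /L V_sum reg_sum;eqbig => u _.
 by rewrite !mxE VM VC mulr0 add0r regM regC mulrC.
rewrite mulmx_sumr mulmx_suml linear_sum regM.
have N1 := Nmx_Phi Fa Hh.
have := adj_sandwich (P := Phi a h) (X := xi_mx h (invmx h)) (congr1 (fun Z => \det Z) N1).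
rewrite -N1 -bE => /matrixP E.
have E' (v : 'cV[k]_r) : reg b (a *m h) *: (xi_mx h (invmx h) *m (\adj (Nmx (a *m h)) *m (Phi a h *m v))) = (reg b (a *m h) * reg b (a *m h)) *: v.
 rewrite !mulmxA scalemxAl;move/matrixP: E => ->;exact:mul_scalar_mx.
have := congr1 (fun w : 'cV[k]_r => w l 0) (E' (\col_v (xi (lshift r' v) (x t) : k))).
rewrite !mxE xi_x => <-;rewrite mulr_sumr;eqbig => u _.
rewrite -scalemxAr -scalemxAl linearZ dm /= -[LHS]mulrA;congr (_ * _);rewrite mulrC !mxE;congr (_ * _).
by eqbig => i _;rewrite !mxE;congr (_ * _);eqbig => v _;rewrite !mxE.
Qed.

(** The multipliers q that admit a field form an ideal stable under F x H; it contains the ideal of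
    the orbit and b^2, which is 1 at the identity. *)
Lemma euler_field_one : exists M, euler_field M 1.
pose J : set PA := [set q | exists M, euler_field M q].
apply:(@orbit_nullstellensatz J (b * b)) =>//.
- split;first by exists 0;apply:euler_field0;exact:ideal0 (reg_ideal_ideal O).
  by move=>p q [M hM] [M' hM'];exists (1%:MP *: M + M');rewrite -[p]scale1r;apply:euler_field_lin.
 by move=>p q [M hM];exists (p *: M);apply:euler_fieldZ.
- by move=>q hq;exists 0;apply:euler_field0.
- by move=>a h q Fa Hh [M hM];exists (conjM a h M);apply:euler_field_conj.
- exact:euler_field_local.
by rewrite regM bE (Nmx1) det1 mulr1 oner_eq0.
Qed.

(** Translates of a solution differ from it by fields of multiplier 0, a stable linear space; [tau]
    is conjugation by h^-1, as X M is read in the left-invariant frame. *)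
Theorem invariant_euler_field : exists2 M, euler_field M 1 &
 forall a h g, carrier F a -> carrier H h -> evmx M (a *m g *m invmx h) = h *m evmx M g *m invmx h.
have [M0 hM0] := euler_field_one.
pose m (M : 'M[PA]_n) (g : 'M[k]_n) : 'rV[k]_(n * n) := mxvec (evmx M g).
pose tau (h : 'M[k]_n) : 'M[k]_(n * n) := lin_mulmx (invmx h) *m lin_mulmxr h.
have tauE h z : mxvec z *m tau h = mxvec (invmx h *m z *m h) by rewrite mulmxA !mul_vec_lin.
have eq_tau (B C : 'M[k]_(n * n)) : (forall z : 'M[k]_n, mxvec z *m B = mxvec z *m C) -> B = C.
 by move=>E;apply/row_matrixP => i;rewrite !rowE -[delta_mx 0 i]vec_mxK.
have mL c M M' : c *: m M + m M' = m (c%:MP *: M + M').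
 by apply/funext => g;rewrite /m evmxD evmxZ regC linearP.
have mB M M' : m M - m M' = m ((-1)%:MP *: M' + M) by rewrite -mL scaleN1r addrC.
have actFm a M : actF a (m M) = m (conjM a e M).
 by apply/funext => g;rewrite /actF /m conjM_ev invmx1 mul1mx !mulmx1.
have actHm h M : carrier H h -> actH tau h (m M) = m (conjM e (invmx h) M).
 by move=>Hh;apply/funext => g;rewrite /actH /m tauE conjM_ev invmxK mul1mx.
pose Y : set ('M[k]_n -> 'rV[k]_(n * n)) := [set y | exists2 M, y = m M & euler_field M 0].
have mreg M : regular_map (m M).
 have /fin_all_exists[P hP] : forall l, exists p, forall g, mxvec (evmx M g) 0 l = reg p g.
  by move=>l;case/mxvec_indexP: l => i j;exists (M i j) => g;rewrite mxvecE mxE.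
 by exists P => g;apply/rowP => l;rewrite mxE -hP.
have uY a h : carrier F a -> carrier H h -> Y (m (conjM a h M0) - m M0).
 move=>Fa Hh;rewrite mB;exists ((-1)%:MP *: M0 + conjM a h M0) =>//.
 have := euler_field_lin (-1) hM0 (euler_field_conj Fa Hh hM0). by rewrite comp_mpoly1 scaleN1r addNr.
have YK a h M : carrier F a -> carrier H h -> euler_field M 0 -> euler_field (conjM a h M) 0.
 by move=>Fa Hh hM;have := euler_field_conj Fa Hh hM;rewrite comp_mpoly0.
have [y [M yM hM] inv] : exists2 y, Y y & forall a h g, carrier F a -> carrier H h ->
  (m M0 - y) (a *m g *m invmx h) *m tau h = (m M0 - y) g.
 apply:(@invariant_correction k n _ char0 F H tau redF redH) =>//.
 - by apply:eq_tau => z;rewrite tauE invmx1 mul1mx !mulmx1.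
 - move=>g h Hg Hh;apply:eq_tau => z;have [ug uh] := (carrier_unit Hg, carrier_unit Hh).
  have ugh : g *m h \in unitmx by rewrite unitmx_mul ug. have inv : invmx (g *m h) = invmx h *m invmx g.
   by rewrite -[RHS]mulmx1 -(mulmxV ugh) !mulmxA mulmxKV // mulVmx // mul1mx.
  by rewrite mulmxA !tauE inv !mulmxA.
 - move=>i j;have [q qE] := reg_inverse (1 : PA).
  case/mxvec_indexP: i => u v;case/mxvec_indexP: j => u' v'.
  have [q1 q1E] := reg_inverse (coord k u' u);exists (q1 * coord k v v') => h Hh.
  have -> : tau h (mxvec_index u v) (mxvec_index u' v') = (mxvec (delta_mx u v) *m tau h) 0 (mxvec_index u' v').
   by rewrite mxvec_delta -rowE [RHS]mxE.
  rewrite tauE mxvecE regM q1E ?(carrier_unit Hh) // !reg_coord mxE (bigD1 v) //= big1 ?addr0 =>[|w wv];last first.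
   by rewrite mxE big1 ?mul0r // => t _;rewrite mxE (negPf wv) andbF mulr0.
  congr (_ * _);rewrite mxE (bigD1 u) //= big1 ?addr0 =>[|w wu];last by rewrite mxE (negPf wu) mulr0.
  by rewrite mxE !eqxx mulr1.
 - by move=>_ [M -> _];apply:mreg.
 - exists 0;last by apply:euler_field0;exact:ideal0 (reg_ideal_ideal O).
  by apply/funext => g;apply:(can_inj vec_mxK);apply/matrixP => i j;rewrite mxvecK !mxE /reg meval0.
 - move=>c _ _ [M -> hM] [M' -> hM'];rewrite mL;exists (c%:MP *: M + M') =>//.
  by have := euler_field_lin c hM hM';rewrite scaler0 addr0.
 - by move=>a _ Fa [M -> hM];rewrite actFm;exists (conjM a e M) =>//;exact:(YK a e M Fa (carrier1 H) hM).
 - move=>h _ Hh [M -> hM];rewrite actHm //;exists (conjM e (invmx h) M) =>//.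
  exact:(YK e (invmx h) M (carrier1 F) (carrierV Hh) hM).
 - by move=>a Fa;rewrite actFm;apply:uY =>//;apply:carrier1.
 by move=>h Hh;rewrite actHm //;apply:uY;[apply:carrier1 | apply:carrierV].
exists ((-1)%:MP *: M + M0).
 by have := euler_field_lin (-1) hM hM0;rewrite scaler0 add0r.
move=>a h g Fa Hh;have uh := carrier_unit Hh;have := inv a h g Fa Hh;rewrite yM mB /m tauE => /(can_inj mxvecK) <-.
by rewrite !mulmxA mulmxV // mul1mx mulmxK.
Qed.

End Slice.

(** * The ring of biinvariant functions *)

Section InvariantRing.
Variables (k : closedFieldType) (n : nat) (F G H : alg_group k n).
Local Notation PA := {mpoly k[n * n + 1]}.
Local Notation B := (dc_alg F G H).

Fact dc_nonzero : 1 != 0 :> B.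
apply/eqP => e;have := congr1 (fun f : B => dc_fun f (group_id G)) e.
by move/eqP;rewrite oner_eq0.
Qed.
HB.instance Definition _ := GRing.PzSemiRing_isNonZero.Build B dc_nonzero.

Fact dc_const_mem (a : k) : (fun=> a : k^o) \in @dc_pred k n F G H.
by apply/asboolP;split=>//;exists a%:MP => g;rewrite mevalC. Qed.
Definition dc_const (a : k) : B := DcAlg (dc_const_mem a).
Fact dc_const_zmod : zmod_morphism dc_const.
by move=>a b;apply:val_inj. Qed.
Fact dc_const_monoid : monoid_morphism dc_const.
by split=>[|a b];apply:val_inj. Qed.
HB.instance Definition _ := GRing.isZmodMorphism.Build k B dc_const dc_const_zmod.
HB.instance Definition _ := GRing.isMonoidMorphism.Build k B dc_const dc_const_monoid.

Hypotheses (FG : F `<=` G) (HG : H `<=` G).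

Lemma dc_ext (f f' : B) : (forall g : G, f g = f' g) -> f = f'.
by move=>e;apply:val_inj;apply/funext. Qed.

Lemma dc_rep_ex (f : B) : exists p : PA, biinv F G H p /\ forall g : G, f g = reg p (val g).
have /asboolP[[p fp] If] := dc_funP f;exists p;split=>// a h g Fa Hh Gg.
have Gg' : carrier G (a *m g *m invmx h).
 by do 2?[apply:carrierM =>//];[apply:FG | apply:carrierV;apply:HG].
have := If a h (SigSub (mem_set Gg)) (SigSub (mem_set Gg')) Fa Hh erefl.
by rewrite !fp.
Qed.

(** A representative is unique only on G; identities between representatives are therefore stated at
    points of G. *)
Definition rep (f : B) : PA := projT1 (cid (dc_rep_ex f)).
Lemma rep_biinv (f : B) : biinv F G H (rep f).
by have [] := projT2 (cid (dc_rep_ex f)). Qed.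
Lemma repE (f : B) (g : G) : f g = reg (rep f) (val g).
by have [_ ->] := projT2 (cid (dc_rep_ex f)). Qed.

Lemma rep_fun (f : B) p : (forall g : G, f g = reg p (val g)) -> forall g, carrier G g -> reg (rep f) g = reg p g.
by move=>e g Gg;have := e (SigSub (mem_set Gg));rewrite repE. Qed.

Lemma repD (f f' : B) g : carrier G g -> reg (rep (f + f')) g = reg (rep f + rep f') g.
by move: g;apply:rep_fun => g;rewrite regD -!repE. Qed.
Lemma repM (f f' : B) g : carrier G g -> reg (rep (f * f')) g = reg (rep f * rep f') g.
by move: g;apply:rep_fun => g;rewrite regM -!repE. Qed.
Lemma repC a g : carrier G g -> reg (rep (dc_const a)) g = a.
by move=>Gg;rewrite (rep_fun (p := a%:MP)) ?regC // => g';rewrite regC. Qed.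
Lemma rep_sum d (f : 'I_d -> B) g : carrier G g -> reg (rep (\sum_i f i)) g = \sum_i reg (rep (f i)) g.
move=>Gg;apply:(big_rec2 (fun a b => reg (rep a) g = b)) =>[|i a b _ <-];last by rewrite repD // regD.
by rewrite -(rmorph0 dc_const) repC.
Qed.

Lemma dc_of (p : PA) : biinv F G H p -> exists f : B, forall g : G, f g = reg p (val g).
move=>Ip;have h : (fun g : G => reg p (val g) : k^o) \in @dc_pred k n F G H.
 apply/asboolP;split;first by exists p.
 by move=>a b g g' Fa Hb ->;apply:Ip =>//;exact:set_mem (valP g).
by exists (DcAlg h).
Qed.

Definition ofp (p : PA) : B := if pselect (biinv F G H p) is left Ip then projT1 (cid (dc_of Ip)) else 0.
Lemma ofpE p g : biinv F G H p -> carrier G g -> reg (rep (ofp p)) g = reg p g.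
move=>Ip;move: g;apply:rep_fun => g;rewrite /ofp;case:pselect =>// Ip'.
exact:(projT2 (cid (dc_of Ip'))).
Qed.

Lemma rep_inj (f f' : B) : (forall g, carrier G g -> reg (rep f) g = reg (rep f') g) -> f = f'.
by move=>e;apply:dc_ext => g;rewrite !repE;apply:e;apply:set_mem (valP g). Qed.

Hypotheses (char0 : has_pchar0 k) (redF : reductive F) (redH : reductive H).
Hypothesis Ocl : zclosed_in G (double_coset F H).

Lemma GK a h g : carrier F a -> carrier H h -> carrier G g -> carrier G (a *m g *m h).
by move=>Fa Hh Gg;apply:carrierM;[apply:carrierM =>//;apply:FG | apply:HG]. Qed.

Lemma repK (b : B) a h g : carrier F a -> carrier H h -> carrier G g -> reg (rep b) (a *m g *m h) = reg (rep b) g.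
by move=>Fa Hh Gg;have := rep_biinv b Fa (carrierV Hh) Gg;rewrite invmxK. Qed.

(* By complete reducibility, an ideal of invariants is the contraction of the
  ideal that it generates. *)
Lemma invariant_combination (f : B) (s : seq B) (c : 'I_(size s) -> PA) :
 (forall g, carrier G g -> reg (rep f) g = \sum_i reg (c i) g * reg (rep s`_i) g) -> ideal_gen s f.
move=>fc;pose P (p : 'I_(size s) -> PA) := forall g, carrier G g -> \sum_i reg (p i) g * reg (rep s`_i) g = 0.
have [||a h p Fa Hh Pp g Gg|a h Fa Hh g Gg|p Pp cp] := invariant_polys char0 G redF redH (P := P) (u := c).
- by move=>g _;rewrite big1 // => i _;rewrite /reg meval0 mul0r.
- move=>a p q Pp Pq g Gg.
 have -> : \sum_i reg (a *: p i + q i) g * reg (rep s`_i) g =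
   a * (\sum_i reg (p i) g * reg (rep s`_i) g) + \sum_i reg (q i) g * reg (rep s`_i) g.
  by rewrite mulr_sumr -big_split;eqbig => i _;rewrite regD regZ mulrDl mulrA.
 by rewrite Pp // Pq // mulr0 addr0.
- rewrite -[RHS](Pp (a *m g *m h));last exact:GK.
 by eqbig => i _;rewrite reg_trans repK.
- rewrite -[RHS](subrr (reg (rep f) (a *m g *m h))) {2}repK // fc;last exact:GK.
 rewrite fc // -sumrB;eqbig => i _;rewrite regB reg_trans repK //. by rewrite mulrBl.
exists (fun i => ofp (c i - p i));apply:rep_inj => g Gg;rewrite rep_sum // fc //.
rewrite -[LHS]subr0 -[X in _ - X](Pp g Gg) -sumrB;eqbig => i _.
by rewrite repM // regM ofpE // regB mulrBl.
Qed.

(** Hilbert's argument: finitely many invariants generate the extension of I to polynomials, and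
    they generate I itself by [invariant_combination]. *)
Lemma dc_noetherian : noetherian B.
apply:gens_noetherian => I iI;have nP := mpoly_noetherian (n := n * n + 1) (@field_noetherian k).
have [s sI gen] := noetherian_subset [set p | exists2 f, I f & p = rep f] nP.
have : forall p, exists f, p \in s -> I f /\ p = rep f.
 by move=>p;have [/sI[f If ->]|_] := boolP (p \in s);[exists f | exists 0].
move/choice =>[b bP];exists (map b s) =>[f /mapP[p ps ->]|f If];first by case:(bP p ps).
have [|c fc] := gen (rep f);first by exists f.
apply:(invariant_combination (c := fun i => c (cast_ord (size_map b s) i))) => g _.
rewrite fc reg_sum (reindex (cast_ord (size_map b s))) /=;last first.
 by apply:onW_bij;exists (cast_ord (esym (size_map b s)));[exact:cast_ordK | exact:cast_ordKV].
eqbig => i _;rewrite regM (nth_map 0) -?(size_map b s) //.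
have hi : s`_(cast_ord (size_map b s) i) \in s by apply:mem_nth.
by congr (_ * reg _ _);case:(bP _ hi).
Qed.

Let M : set B := prime_ideal (dc_proj F H (group_id G)).
Let iM : is_ideal M.
by case:(prime_idealP (dc_proj F H (group_id G))). Qed.
Local Notation e := (1%:M : 'M[k]_n).

Lemma dc_maxE (f : B) : M f <-> reg (rep f) e = 0.
by rewrite /M /= repE. Qed.

Lemma dc_res (f : B) : exists a, M (f - dc_const a).
exists (f (group_id G));rewrite /M /=;exact:subrr.
Qed.

Lemma spans_pow T : exists s, spans dc_const (ipow M T) s.
elim: T =>[|T [s hs]];first by exists [::] => f;exists (fun=> 0).
have iT := ipow_ideal T iM;have iT1 := ipow_ideal T.+1 iM.
have [t tI tgen] := noetherian_gens dc_noetherian iT;exists (s ++ t) => f;have [c hc] := hs f.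
have [d dE] := tgen _ hc.
have /choice[a aE] : forall j, exists a, forall lt : (j < size t)%N, M (d (Ordinal lt) - dc_const a).
 move=>j;have [lt|ge] := pselect (j < size t)%N;last by exists 0 => lt;case:ge.
 by have [a ha] := dc_res (d (Ordinal lt));exists a => lt';rewrite (bool_irrelevance lt' lt).
exists (fun j => if (j < size s)%N then c j else a (j - size s)%N);rewrite comb_cat.
have -> : comb dc_const (fun j => if (j < size s)%N then c j else a (j - size s)%N) s = comb dc_const c s.
 by apply:eq_big_nat => j /andP[_ ->].
have -> : comb dc_const (fun j => if (j + size s < size s)%N then c (j + size s)%N else a (j + size s - size s)%N) t = comb dc_const a t.
 by apply:eq_big_nat => j _;rewrite addnK ltnNge leq_addl.
rewrite opprD addrA dE /comb big_mkord -sumrB;apply:ideal_sum =>// i _;rewrite -mulrBl.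
apply:mem_ideal_mul;last by apply:tI;apply:mem_nth.
by have := aE i (ltn_ord i);congr (M (d _ - _));apply:val_inj.
Qed.

Local Notation A := (Aj G).

(** M^T is closed for the order of vanishing at the identity. Krull's theorem puts (1 - u) f into
    the extension of M^T, with u zero at the identity. The multipliers of f into it form a stable
    ideal Q, so some c in Q is 1 on the orbit; made invariant, c becomes d in B with d f in M^T and
    1 - d in M, and expanding 1 - (1 - d)^T gives the claim for f. *)
Lemma krull_invariants T (f : B) : (forall J, exists2 f', ipow M T f' & A J (rep f - rep f')) -> ipow M T f.
move=>hf;have iT := ipow_ideal T iM;have [s sT gen] := noetherian_gens dc_noetherian iT.
pose N : set PA := [set p | exists c : 'I_(size s) -> PA, forall g, carrier G g -> reg p g = \sum_i reg (c i) g * reg (rep s`_i) g].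
have iN : is_ideal N.
 split=>[|p q [c hc] [d hd]|p q [c hc]].
 - by exists (fun=> 0) => g _;rewrite big1 =>[|i _];rewrite /reg meval0 ?mul0r.
 - exists (fun i => c i + d i) => g Gg;rewrite regD hc // hd // -big_split;eqbig => i _.
  by rewrite regD mulrDl.
 by exists (fun i => p * c i) => g Gg;rewrite regM hc // mulr_sumr;eqbig => i _;rewrite regM mulrA.
have NI p : reg_ideal G p -> N p.
 by move=>hp;exists (fun=> 0) => g Gg;rewrite hp // big1 // => i _;rewrite /reg meval0 mul0r.
have NT f' : ipow M T f' -> N (rep f').
 move=>/gen[c ->];exists (fun i => rep (c i)) => g Gg;rewrite rep_sum //.
 by eqbig => i _;rewrite repM // regM.
have NB f' : N (rep f') -> ipow M T f'.
 move=>[c hc];apply:(ideal_gen_sub iT sT);exact:invariant_combination hc.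
pose Q : set PA := [set h | N (h * rep f)].
have iQ : is_ideal Q.
 split=>[|p q hp hq|p q hq];rewrite /Q /= ?mul0r ?mulrDl -?mulrA;first exact:ideal0.
  exact:(idealD iN).
 exact:(idealM _ iN).
have QK : K_stable F H Q.
 move=>a h p Fa Hh [c hc];exists (fun i => c i \mPo trans a h) => g Gg.
 rewrite regM reg_trans -(repK f Fa Hh Gg) -regM hc;last exact:GK. by eqbig => i _;rewrite reg_trans repK.
have [u um Nu] : exists2 u, point_one u & N ((1 - u) * rep f).
 have nP := mpoly_noetherian (n := n * n + 1) (@field_noetherian k).
 apply:(krull_intersection nP (point_one_ideal k n) iN) => J.
 have [f' hf' [a [b [ha hb ab]]]] := hf J;exists a =>//.
 have -> : rep f - a = rep f' + b by rewrite -[rep f](subrK (rep f')) ab;ring.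
 by apply:(idealD iN);[apply:NT | apply:NI].
have OI := reg_ideal_ideal (double_coset F H).
have [c [o [Qc Oo co]]] : ideal_add Q (reg_ideal (double_coset F H)) 1.
 apply:(orbit_nullstellensatz FG HG Ocl (q := 1 - u)).
 - exact:ideal_add_ideal.
 - by move=>p;apply:ideal_addr.
 - move=>a h p Fa Hh [c [o [Qc Oo ->]]];rewrite comp_mpolyD;exists (c \mPo trans a h), (o \mPo trans a h).
  by split=>//;[apply:QK | apply:reg_ideal_orbit].
 - exact:ideal_addl.
 by rewrite regB um subr0 /reg meval1 oner_eq0.
have cO g : double_coset F H g -> reg c g = 1.
 by move=>Og;have := congr1 (fun p => reg p g) co;rewrite regD Oo // addr0 => <-;rewrite /reg meval1.
pose P (p : 'I_1 -> PA) := Q (p 0) /\ reg_ideal (double_coset F H) (p 0).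
have [||a h p Fa Hh [Qp Op]|a h Fa Hh|p [Qp Op] inv] := invariant_polys char0 G redF redH (P := P) (u := fun=> c).
- by split;[apply:ideal0 iQ | apply:ideal0 OI].
- move=>a p q [Qp Op] [Qq Oq];rewrite /P -mul_mpolyC;split.
  by apply:(idealD iQ) =>//;apply:(idealM _ iQ).
 by apply:(idealD OI) =>//;apply:(idealM _ OI).
- by split;[apply:QK | apply:reg_ideal_orbit].
- split;first by apply:(idealB iQ) =>//;apply:QK.
 move=>g [a' Fa' [h' Hh' <-]];rewrite regB reg_trans !cO ?subrr //.
  by exists a' =>//;exists h'.
 by exists (a *m a');[apply:carrierM | exists (h' *m h);[apply:carrierM | rewrite !mulmxA]].
have Oe : double_coset F H e by exists e;[apply:carrier1 | exists e;[apply:carrier1 | rewrite mul1mx]].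
pose d := ofp (c - p 0);have dE g : carrier G g -> reg (rep d) g = reg (c - p 0) g by apply:ofpE.
have dT : ipow M T (d * f).
 apply:NB;have [q hq] : Q (c - p 0) by apply:(idealB iQ).
 by exists q => g Gg;rewrite repM // -hq // !regM dE.
have d1 : M (1 - d).
 have de : d (group_id G) = 1.
  by rewrite repE dE ?regB ?Op ?cO ?subr0 //;apply:carrier1.
 by rewrite /M /= -[LHS]/(1 - d (group_id G)) de subrr.
have powT t : ipow M t ((1 - d) ^+ t).
 by elim: t =>[|t IH] //;rewrite exprS;apply:mem_ideal_mul.
have -> : f = (1 - d) ^+ T * f + (1 - (1 - d) ^+ T) * f by ring.
apply:(idealD iT);first exact:(idealMr _ iT).
rewrite -{1}(expr1n B T) subrXX subKr -mulrA mulrCA;exact:(idealM _ iT).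
Qed.

(** Chevalley's argument: the images of the invariants of order J in the finite-dimensional B / M^T
    decrease and become stationary. An element of the stable image is represented in every order,
    hence lies in M^T by [krull_invariants]. *)
Lemma invariants_cofinal T : exists J, forall f : B, A J (rep f) -> ipow M T f.
have iT := ipow_ideal T iM;have [s hs] := spans_pow T.
pose W J : set 'rV[k]_(size s) := [set w | exists2 f, A J (rep f) &
 ipow M T (f - comb dc_const (fun j => if insub j is Some i then w 0 i else 0) s)].
have iA := Aj_ideal G.
have AD J (f f' : B) : A J (rep f) -> A J (rep f') -> A J (rep (f + f')).
 by move=>hf hf';apply:(A_eq_fun (q := rep f + rep f')) =>[g|];[exact:repD | exact:(idealD (iA _))].
have AZ J a (f : B) : A J (rep f) -> A J (rep (dc_const a * f)).
 move=>hf;apply:(A_eq_fun (q := a%:MP * rep f)) =>[g Gg|];last exact:(idealM _ (iA _)).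
 by rewrite repM // !regM repC // regC.
have A0 J : A J (rep 0) by apply:Aj_reg => g Gg;rewrite -(rmorph0 dc_const) repC.
have W0 J : W J 0.
 exists 0 =>//;rewrite comb_eq0 ?subrr;first exact:ideal0.
 by move=>j _;case:insubP =>// i _ _;rewrite mxE.
have WL J c u v : W J u -> W J v -> W J (c *: u + v).
 move=>[f hf hu] [f' hf' hv];exists (dc_const c * f + f');first by apply:AD =>//;apply:AZ.
 set cu := fun j => _ in hu;set cv := fun j => _ in hv;set cw := fun j => _.
 have -> : comb dc_const cw s = dc_const c * comb dc_const cu s + comb dc_const cv s.
  rewrite -combZ -combD;eqbig => j _;congr (dc_const _ * _);rewrite /cw /cu /cv.
  by case:insubP =>[i _ _|_];rewrite ?mxE // mulr0 addr0.
 by rewrite opprD addrACA -mulrBr;apply:(idealD iT) =>//;apply:(idealM _ iT).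
have /choice[U UE] : forall J, exists U : {vspace 'rV[k]_(size s)}, forall v, v \in U <-> W J v.
 by move=>J;apply:vspace_of_set;[apply:W0 | apply:WL].
have [J0 J0min] : exists J0, forall J, (\dim (U J0) <= \dim (U J))%N.
 suff h d J : (\dim (U J) <= d)%N -> exists J0, forall J, (\dim (U J0) <= \dim (U J))%N by apply:(h _ 0%N (leqnn _)).
 elim: d J =>[|d IH] J le;first by exists J => J';apply:leq_trans le _.
 have [h|/existsNP[J' /negP]] := pselect (forall J', (\dim (U J) <= \dim (U J'))%N);first by exists J.
 by rewrite -ltnNge => lt;apply:(IH J');rewrite -ltnS (leq_trans lt).
have Wle J : (J0 <= J)%N -> W J0 `<=` W J.
 move=>le w /UE wU;apply/UE;suff /eqP -> : U J == U J0 by [].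
 rewrite eqEdim J0min andbT;apply/subvP => v /UE[f hf hv];apply/UE;exists f =>//. exact:Aj_le hf.
exists J0 => f hf;apply:krull_invariants => J.
have [c hc] := hs f;pose w : 'rV[k]_(size s) := \row_i c i.
have wc : comb dc_const (fun j => if insub j is Some i then w 0 i else 0) s = comb dc_const c s.
 by apply:eq_big_nat => j /andP[_ js];rewrite insubT mxE.
have [f' hf' hw'] : W (maxn J0 J) w by apply:Wle;[exact:leq_maxl | exists f =>//;rewrite wc].
exists (f - f').
 rewrite wc in hw';have := idealB iT hc hw';congr (ipow M T _);ring.
have hJ : A J (rep f') by apply:Aj_le hf';apply:leq_maxr.
apply:(A_eq_fun (q := rep f')) hJ => g Gg;rewrite regB;apply/eqP;rewrite subr_eq -regD -repD //.
by rewrite addrC subrK.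
Qed.

End InvariantRing.

(** * Coordinates on the slice representation and the comparison of the two quotients *)

Lemma L_V_linpoly (k : closedFieldType) n (l : {linear 'M[k]_n -> k^o}) y T g :
 reg (L y (V T (linpoly l))) g = l (evmx (map_mx (L y) T) g).
have -> : V T (linpoly l) = \sum_i \sum_j (l (delta_mx i j) : k) *: T i j.
 rewrite /linpoly V_sum;eqbig => i _;rewrite V_sum;eqbig => j _. by rewrite VZ V_coord.
rewrite /L V_sum reg_sum [evmx _ _]matrix_sum_delta linear_sum;eqbig => i _.
rewrite V_sum reg_sum linear_sum;eqbig => j _.
by rewrite VZ regZ linearZ /= mulrC;congr (_ * _);rewrite !mxE.
Qed.

Section SliceCoordinates.
Variables (k : closedFieldType) (n : nat) (F G H : alg_group k n).
Hypotheses (FG : F `<=` G) (HG : H `<=` G).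
Local Notation S := (slice_alg F G H).
Local Notation W := (lie F + lie H)%VS.
Variables (r r' : nat) (x : 'I_(r + r') -> 'M[k]_n) (xi : 'I_(r + r') -> {linear 'M[k]_n -> k^o}).
Hypotheses (xG : forall i, x i \in lie G) (xi_x : forall i l, xi i (x l) = (i == l)%:R)
 (x_span : forall z, z \in lie G -> z = \sum_i (xi i z : k) *: x i)
 (x_orbit : forall j, x (rshift r j) \in W)
 (xi_orbit : forall j z, z \in W -> xi (lshift r' j) z = 0).

Definition nu (v : slice_rep F G H) (i : 'I_r) : k := xi (lshift r' i) (vsval (repr v)).

Lemma nu_proj (y : subvs_of (lie G)) i : nu (quotv_proj W y) i = xi (lshift r' i) (vsval y).
apply/eqP;rewrite -subr_eq0 /nu;set z := repr _.
have h : z - y \in quotv_pred (U := lie G) W by rewrite Quotient.idealrBE reprK.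
have -> : (xi (lshift r' i) (vsval z) : k) - xi (lshift r' i) (vsval y) = xi (lshift r' i) (vsval z - vsval y) by rewrite linearB.
by apply/eqP;rewrite -linearB;apply:xi_orbit.
Qed.

Lemma quotv_projP (v : slice_rep F G H) : exists y, v = quotv_proj W y.
by exists (repr v);rewrite /quotv_proj reprK. Qed.

Lemma nu_linear i : exists l : {linear slice_rep F G H -> k^o}, forall v, l v = nu v i.
have lin_ : linear (fun v => nu v i : k^o).
 move=>c u v;have [y ->] := quotv_projP u;have [z ->] := quotv_projP v.
 have -> : c *: quotv_proj W y + quotv_proj W z = quotv_proj W (c *: y + z)
  by rewrite -[c *: quotv_proj W y]/(quotv_scale c (quotv_proj W y)) /quotv_proj !piE.
 rewrite !nu_proj;have -> : vsval (c *: y + z) = c *: vsval y + vsval z by []. exact:linearP.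
pose l : {linear slice_rep F G H -> k^o} := HB.pack (fun v => nu v i : k^o) (GRing.isLinear.Build k _ _ _ _ lin_).
by exists l.
Qed.

Definition vec (z : 'I_r -> k) : slice_rep F G H := quotv_proj W (vsproj (lie G) (\sum_i z i *: x (lshift r' i))).

Lemma nu_vec z : nu (vec z) = z.
apply/funext => i;rewrite nu_proj vsprojK;last by apply:memv_suml => l _;apply:memvZ.
rewrite linear_sum (bigD1 i) //= linearZ /= xi_x eqxx big1 ?addr0;first exact:mulr1.
move=>l li;rewrite linearZ /= xi_x (inj_eq (@lshift_inj _ _)) eq_sym (negPf li);exact:mulr0.
Qed.

Lemma vec_nu v : vec (nu v) = v.
have [y ->] := quotv_projP v;apply/eqmodP;rewrite /= /Quotient.equiv unfold_in /quotv_pred linearB /= vsprojK;last first.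
 by apply:memv_suml => l _;apply:memvZ.
rewrite {1}(x_span (subvsP y)) big_split_ord opprD addrA.
under [X in X - _ - _]eq_bigr => i _ do rewrite nu_proj.
by rewrite subrr sub0r memvN;apply:memv_suml => l _;apply:memvZ.
Qed.

Lemma nu_act a v : carrier F a -> carrier H a -> nu (slice_act a v) =1 fun i => (tnth (rho x xi a) i).@[nu v].
move=>Fa Ha i;have [y ->] := quotv_projP v.
have yG := subvsP y;have AyG : Ad a (vsval y) \in lie G by apply:Ad_lie =>//;apply:FG.
rewrite (slice_act_proj (y := vsproj (lie G) (Ad a (vsval y)))) ?vsprojK // nu_proj vsprojK //.
rewrite {1}(x_span yG).
have AdL (c : 'I_(r + r') -> k) : Ad a (\sum_l c l *: x l) = \sum_l c l *: Ad a (x l).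
 rewrite /Ad mulmx_sumr mulmx_suml;eqbig => l _;by rewrite -scalemxAr -scalemxAl.
rewrite AdL linear_sum big_split_ord /= [X in _ + X]big1 ?addr0 =>[|l _];last first.
 by rewrite linearZ /= xi_orbit ?scaler0 //;apply:Ad_orbit.
rewrite tnthE rmorph_sum;eqbig => l _ /=.
rewrite linearZ mevalZ mevalXU nu_proj;exact:mulrC.
Qed.

Lemma mpoly_eq0 (c : {mpoly k[r]}) : (forall z, c.@[z] = 0) -> c = 0.
move=>h;apply:contrapT => nc;have [|z [_ /eqP]] := @prime_point k r [set 0] c _ nc;last by [].
split=>[|/eqP|a b /eqP];rewrite ?oner_eq0 ?mulf_eq0 //.
 by split=>// a b;[move=>-> ->;rewrite addr0 | move=>->;rewrite mulr0].
by case/orP => /eqP;[left | right].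
Qed.

Lemma polynomial_fun_nu (f : slice_rep F G H -> k^o) : polynomial_fun f <-> exists c : {mpoly k[r]}, forall v, f v = c.@[nu v].
split=>[|[c fc]].
 elim=>[l|a|f1 f2 _ [c hc] _ [d hd]|f1 f2 _ [c hc] _ [d hd]].
 - exists (\sum_i (l (vec (fun j => (j == i)%:R)) : k) *: 'X_i) => v.
  rewrite rmorph_sum -{1}(vec_nu v). have -> : vec (nu v) = \sum_i nu v i *: vec (fun j => (j == i)%:R).
   rewrite -[RHS]vec_nu;congr vec;apply/funext => i;have [l' l'E] := nu_linear i.
   rewrite -[RHS]l'E linear_sum (bigD1 i) //= linearZ /= l'E nu_vec eqxx big1 ?addr0;first exact/esym/mulr1.
   by move=>j ji;rewrite linearZ /= l'E nu_vec eq_sym (negPf ji);exact:mulr0.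
  by rewrite linear_sum;eqbig => i _;rewrite linearZ /= mevalZ mevalXU;exact:mulrC.
 - by exists a%:MP => v;rewrite mevalC.
 - by exists (c + d) => v;rewrite mevalD -hc -hd.
 by exists (c * d) => v;rewrite mevalM -hc -hd.
have -> : f = (fun v => c.@[nu v]) by apply/funext.
move: c {fc};apply:mpoly_gen_ind =>[a|i|p q hp hq|p q hp hq].
- have -> : (fun v => a%:MP.@[nu v]) = cst a :> (slice_rep F G H -> k^o) by apply/funext => v;rewrite mevalC.
 exact:PolyCst.
- have [l lE] := nu_linear i;have -> : (fun v => ('X_i).@[nu v]) = l :> (slice_rep F G H -> k^o).
  by apply/funext => v;rewrite mevalXU lE.
 exact:PolyLin.
- have -> : (fun v => (p + q).@[nu v]) = (fun v => p.@[nu v] : k^o) + (fun v => q.@[nu v] : k^o) :> (slice_rep F G H -> k^o).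
  by apply/funext => v;rewrite mevalD.
 exact:PolyAdd.
have -> : (fun v => (p * q).@[nu v]) = (fun v => p.@[nu v] : k^o) * (fun v => q.@[nu v] : k^o) :> (slice_rep F G H -> k^o).
 by apply/funext => v;rewrite mevalM.
exact:PolyMul.
Qed.

Lemma slice_mem (c : {mpoly k[r]}) : slice_inv F H x xi c <-> (fun v => c.@[nu v] : k^o) \in @slice_pred k n F G H.
have act v a : carrier F a -> carrier H a -> c.@[nu (slice_act a v)] = (c \mPo rho x xi a).@[nu v].
 by move=>Fa Ha;rewrite comp_mpoly_meval;apply:meval_eq => i;apply:nu_act.
split=>[hc|/asboolP[_ hc] a Fa Ha].
 apply/asboolP;split;first by apply/polynomial_fun_nu;exists c. by move=>a v [Fa Ha];rewrite act // hc.
apply:subr0_eq;apply/mpoly_eq0 => z;rewrite mevalB -(nu_vec z) -act //.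
by rewrite (hc a (vec z)) // subrr.
Qed.

Lemma slice_poly (f : S) : exists c, slice_inv F H x xi c /\ forall v, f v = c.@[nu v].
have := slice_funP f => /[dup] fS /asboolP[/polynomial_fun_nu[c fc] _];exists c;split=>//.
by apply/slice_mem;have <- : slice_fun f = (fun v => c.@[nu v]) by apply/funext.
Qed.

Section Presentation.
Variables (d : nat) (t : d.-tuple {mpoly k[r]}).
Hypothesis tC : forall l, slice_inv F H x xi (tnth t l).

Lemma slice_inv_comp q : slice_inv F H x xi (q \mPo t).
move=>a Fa Ha;rewrite comp_mpolyA;congr (_ \mPo _);apply:eq_from_tnth => l.
by rewrite tnthE tC.
Qed.

Definition slice_eval q : S := SliceAlg ((slice_mem _).1 (slice_inv_comp q)).

Fact slice_eval_linear : linear slice_eval.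
by move=>a p q;apply:val_inj;apply/funext => v /=;rewrite comp_mpolyD comp_mpolyZ mevalD mevalZ. Qed.
Fact slice_eval_monoid : monoid_morphism slice_eval.
split=>[|p q];apply:val_inj;apply/funext => v /=;first by rewrite comp_mpoly1 meval1.
by rewrite rmorphM /= mevalM.
Qed.

Definition slice_hom : {lrmorphism {mpoly k[d]} -> S} :=
 HB.pack slice_eval (GRing.isLinear.Build _ _ _ _ _ slice_eval_linear) (GRing.isMonoidMorphism.Build _ _ _ slice_eval_monoid).
End Presentation.

(** The coordinates [nu] identify the algebra of the slice quotient with the subring [slice_inv] of
    polynomials; being affine space means having algebraically independent generators. *)
Lemma affine_space_gens : is_affine_space S <-> exists d (t : d.-tuple {mpoly k[r]}),
 [/\ forall l, slice_inv F H x xi (tnth t l), forall c, slice_inv F H x xi c -> exists q : {mpoly k[d]}, c = q \mPo t &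
  forall q : {mpoly k[d]}, q \mPo t = 0 -> q = 0].
have eq_nu (c c' : {mpoly k[r]}) : (forall v, c.@[nu v] = c'.@[nu v]) -> c = c'.
 by move=>e;apply:subr0_eq;apply/mpoly_eq0 => z;rewrite mevalB -(nu_vec z) e subrr.
split=>[[d [phi [psi phiK psiK]]]|[d [t [tC gen inj]]]].
 have /fin_all_exists[u uE] := fun l => slice_poly (phi 'X_l). pose t := [tuple u l | l < d];exists d, t.
 have ev q v : (phi q : S) v = (q \mPo t).@[nu v].
  move: q;apply:mpoly_gen_ind =>[a|l|p q hp hq|p q hp hq].
  - by rewrite -[a%:MP]mulr1 mul_mpolyC linearZ rmorph1 comp_mpolyZ comp_mpoly1 mevalZ meval1.
  - by rewrite comp_mpolyXU -tnth_nth tnthE;case:(uE l).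
  - by rewrite raddfD comp_mpolyD mevalD -hp -hq.
  by rewrite !rmorphM /= -hp -hq.
 split=>[l|c hc|q q0].
 - by rewrite tnthE;case:(uE l).
 - pose f : S := SliceAlg ((slice_mem c).1 hc);exists (psi f);apply:eq_nu => v.
  by rewrite -ev psiK.
 rewrite -(phiK q) -(phiK 0) rmorph0;congr psi;apply:val_inj;apply/funext => v /=.
 by rewrite [LHS]ev q0 meval0.
exists d, (slice_hom tC);have i : injective (slice_eval tC).
 move=>p q e;apply:subr0_eq;apply/inj;rewrite comp_mpolyB;apply/eqP;rewrite subr_eq0;apply/eqP.
 by apply:eq_nu => v;have := congr1 (fun f : S => slice_fun f v) e.
have s f : exists q, slice_eval tC q = f.
 have [c [hc fc]] := slice_poly f;have [q qE] := gen c hc;exists q;apply:val_inj;apply/funext => v /=.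
 by rewrite -qE -fc.
have /choice[g gE] := s;exists g =>[q|f];last exact:gE.
by apply:i;rewrite gE.
Qed.

Hypotheses (char0 : has_pchar0 k) (redF : reductive F) (redH : reductive H).
Hypothesis Ocl : zclosed_in G (double_coset F H).
Local Notation PA := {mpoly k[n * n + 1]}.
Local Notation B := (dc_alg F G H).
Local Notation A := (Aj G).
Local Notation e := (1%:M : 'M[k]_n).
Let iA := Aj_ideal G.
Variable (f : 'I_r -> PA).
Hypothesis fO : forall i, reg_ideal (double_coset F H) (f i) /\ A 2 (f i - tpoly xi (lshift r' i)).
Local Notation rp := (rep FG HG).
Local Notation taus := (tau xi).

(** The invariant b vanishes to order j at the identity, with leading form c in the transversal
    parameters. *)
Definition dc_lead j (b : B) (c : {mpoly k[r]}) :=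
 [/\ slice_inv F H x xi c, c \is j.-homog & A j.+1 (rp b - (c \mPo taus))].

Lemma dc_lead_sim j b c : dc_lead j b c -> sim A j (rp b) (c \mPo taus).
move=>[_ hc hA];have cA : A j (c \mPo taus) by apply:tau_Aj.
split=>//;rewrite -[rp b](subrK (c \mPo taus));apply:(idealD (iA _)) =>//.
exact:Aj_le hA.
Qed.

(** The existence of lifts is [symbol_lift]; an invariant with zero symbol in degree j has one in
    degree j + 1 by [biinv_symbol]; cofinality with the powers of the maximal ideal is
    [invariants_cofinal]. *)
Lemma dc_filtered : filtered (dc_const F G H : {rmorphism k -> B}) (dc_proj F H (group_id G)) (slice_inv F H x xi) dc_lead.
have invC a : slice_inv F H x xi a%:MP by move=>? _ _;rewrite comp_mpolyC.
have invD c c' : slice_inv F H x xi c -> slice_inv F H x xi c' -> slice_inv F H x xi (c + c').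
 by move=>hc hc' a Fa Ha;rewrite comp_mpolyD hc // hc'.
have invM c c' : slice_inv F H x xi c -> slice_inv F H x xi c' -> slice_inv F H x xi (c * c').
 by move=>hc hc' a Fa Ha;rewrite rmorphM /= hc // hc'.
have rho1 a l : tnth (rho x xi a) l \is (1%N).-homog by rewrite tnthE;apply:lin_form_homog.
have inv0 : slice_inv F H x xi 0 by rewrite -mpolyC0.
split=>//.
- by move=>j c hc a Fa Ha;rewrite (pihomog_comp1 j c (rho1 a)) hc.
- by move=>j b c [].
- move=>j c hc cC;have [p Ip pA] := symbol_lift char0 FG HG xG xi_x x_span x_orbit Ocl fO redF redH hc cC.
 by exists (ofp F G H p);split=>//;apply:A_eq_fun pA => g Gg;rewrite !regB ofpE.
- move=>j b c c' [_ hc hA] [_ hc' hA'];apply:subr0_eq.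
 apply:(tau_unique char0 xG xi_x (j := j));first exact:rpredB.
 by have := idealB (iA _) hA' hA;congr (A _ _);rewrite comp_mpolyB;ring.
- move=>j b b' c c' [cC hc hA] [cC' hc' hA'];split;[exact:invD | exact:rpredD |].
 apply:A_eq_fun (idealD (iA _) hA hA') => g Gg.
 by rewrite regB repD // -regB comp_mpolyD;congr (reg _ g);ring.
- move=>j a b c [cC hc hA];split;[exact:invM | by rewrite mul_mpolyC;apply:rpredZ |].
 apply:A_eq_fun (idealM a%:MP (iA _) hA) => g Gg.
 by rewrite regB repM // !regM repC // rmorphM /= comp_mpolyC regM regB !regC mulrBr.
- move=>j j' b b' c c' hb hb';have [cC hc _] := hb;have [cC' hc' _] := hb'.
 split;[exact:invM | exact:dhomogM |].
 have [_ _ h] := simM iA (@AjM _ _ G) (dc_lead_sim hb) (dc_lead_sim hb').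
 by apply:A_eq_fun h => g Gg;rewrite !regB repM // rmorphM.
- move=>j b;split=>[[_ _]|[c hb]].
  rewrite comp_mpoly0 subr0 => hA.
  have [c [hc cC cA]] := biinv_symbol char0 FG xG xi_x x_span x_orbit xi_orbit (rep_biinv FG HG b) hA.
  by exists c.
 split=>//;first exact:rpred0. by rewrite comp_mpoly0 subr0;have [] := dc_lead_sim hb.
- move=>b;exists (reg (rp b) e);split;[exact:invC | exact:dhomog_const |].
 by rewrite comp_mpolyC;apply:subC_A1.
- move=>b;rewrite (dc_maxE FG HG);split=>[b0|[_ _]].
  by split=>//;[exact:rpred0 | rewrite comp_mpoly0 subr0;apply/Aj1].
 by rewrite comp_mpoly0 subr0 => /Aj1.
move=>T;have [J hJ] := invariants_cofinal FG HG char0 redF redH Ocl T;exists J => b c hb.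
by apply:hJ;have [] := dc_lead_sim hb.
Qed.

(** The derivation required by [regular_filtered] comes from the invariant Euler field: it preserves
    biinvariance, and Euler's identity makes it act on symbols of degree j as multiplication by
    j. *)
Lemma regular_slice : regular_point (dc_proj F H (group_id G)) <-> is_affine_space (slice_alg F G H).
have [M [MG MO Meuler] Meq] := invariant_euler_field char0 FG HG xG xi_x x_span x_orbit Ocl fO redF redH.
pose T := coord_mx k n *m M.
have evT g : evmx T g = g *m evmx M g by rewrite evmx_mul evmx_coord.
have TI p : reg_ideal G p -> reg_ideal G (V T p).
 by apply:V_ideal => g Gg;exists (evmx M g);[apply:MG | rewrite evT].
have Oe : double_coset F H e by exists e;[apply:carrier1 | exists e;[apply:carrier1 | rewrite mul1mx]].
have T1 : evmx T e = 0 by rewrite evT MO // mulmx0.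
have VL p g : reg (V T p) g = reg (L (evmx M g) p) g by apply:V_eval_eq;rewrite evT evL.
have VBi p : biinv F G H p -> biinv F G H (V T p).
 move=>Ip a h g Fa Hh Gg;have Gh := HG Hh;have uh := carrier_unit Hh;have ua := carrier_unit Fa.
 have uh' : invmx h \in unitmx by rewrite unitmx_inv. have hI : reg_ideal G ((p \mPo trans a (invmx h)) - p).
  by move=>g' Gg';rewrite regB reg_trans Ip // subrr.
 rewrite !VL Meq //;have := L_ideal (MG g Gg) hI Gg;rewrite /L VB regB -/(L _ _) (L_trans _ _ ua uh') invmxK reg_trans.
 by move/eqP;rewrite subr_eq0 => /eqP.
have eqV p q : (forall g, carrier G g -> reg p g = reg q g) -> forall g, carrier G g -> reg (V T p) g = reg (V T q) g.
 move=>pq g Gg;apply/eqP;rewrite -subr_eq0 -regB -VB;apply/eqP/TI =>// g' Gg'.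
 by rewrite regB pq // subrr.
pose D (b : B) := ofp F G H (V T (rp b)).
have DE b g : carrier G g -> reg (rp (D b)) g = reg (V T (rp b)) g by apply:ofpE;apply:VBi;apply:rep_biinv.
(* The third clause of [euler_field] at a = h = e says that the linear part of the field is the
   identity in the transversal directions. *)
have tauV l : A 2 (V T (tnth taus l) - tnth taus l).
 rewrite tnthE;set t := tpoly _ _;set d := _ - _.
 have d1 : A 1 d by apply:(idealB (iA _));[apply:V_Aj_stable =>//;apply:tpoly1 | apply:tpoly1].
 have := taylor_one x_span d1;rewrite big1 ?subr0 // => i _;rewrite [X in X *: _](_ : _ = 0) ?scale0r //.
 have -> : reg (L (x i) d) e = reg (L (x i) (V T t)) e - reg (L (x i) t) e by rewrite -regB -VB.
 rewrite L_tpoly xi_x;apply/eqP;rewrite subr_eq0;apply/eqP.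
 have := Meuler e e i l (carrier1 F) (carrier1 H);rewrite invmx1 !mul1mx !mulmx1 /reg meval1 mul1r => <-.
 rewrite -[LHS]/(reg _ _) /t /tpoly VB VC subr0 L_V_linpoly;congr (xi _ _).
 apply/matrixP => a b;rewrite [LHS]mxE [RHS]mxE ![map_mx _ _ _ _]mxE [T a b]mxE /L V_sum reg_sum.
 rewrite (bigD1 a) //= big1 ?addr0 =>[|u ua].
  rewrite VM regD !regM [coord_mx _ _ _ _]mxE reg_coord mxE eqxx mul1r.
  by have /matrixP/(_ a b) := MO e Oe;rewrite !mxE => ->;rewrite mul0r addr0.
 rewrite VM regD !regM [coord_mx _ _ _ _]mxE reg_coord mxE eq_sym (negPf ua) mul0r add0r.
 by have /matrixP/(_ u b) := MO e Oe;rewrite !mxE => ->;rewrite mul0r.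
rewrite affine_space_gens.
apply:(regular_filtered (D := D) char0 (dc_noetherian FG HG char0 redF redH) dc_filtered).
- move=>b b';apply:(rep_inj (FG := FG) (HG := HG)) => g Gg;rewrite DE // repD // regD !DE // -regD -VD.
 by apply:eqV =>// g' Gg';apply:repD.
- move=>a b;apply:(rep_inj (FG := FG) (HG := HG)) => g Gg;rewrite DE // repM // regM repC // DE //.
 have -> : a * reg (V T (rp b)) g = reg (V T (a *: rp b)) g by rewrite VZ regZ.
 by apply:eqV =>// g' Gg';rewrite repM // regM repC // regZ.
- move=>b b';apply:(rep_inj (FG := FG) (HG := HG)) => g Gg;rewrite DE // repD // regD.
 have e1 c c' : reg (rp (c * D c')) g = reg (rp c * V T (rp c')) g by rewrite repM // !regM DE.
 by rewrite !e1 -regD -VM;apply:eqV =>// g' Gg';apply:repM.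
move=>j b c [cC hc cA];split;[|by rewrite mul_mpolyC;apply:rpredZ|].
 by move=>a Fa Ha;rewrite mul_mpolyC comp_mpolyZ cC.
apply:(A_eq_fun (q := V T (rp b - (c \mPo taus)) + (V T (c \mPo taus) - (((j%:R)%:MP * c) \mPo taus)))) =>[g Gg|].
 by rewrite regB DE // -regB VB;congr (reg _ g);ring.
apply:(idealD (iA _));first exact:V_Aj_stable.
rewrite mul_mpolyC -(euler_identity hc) (der_const_comp _ _ (V_der T) (VC T)) rmorph_sum -sumrB.
apply:ideal_sum =>[|l _];first exact:iA.
rewrite rmorphM /= comp_mpolyXU -tnth_nth -mulrBr.
(* In degree 0 no partial derivative of degree j - 1 is available, and the factor of order 2 alone
   is enough. *)
case:j hc {cC cA} =>[|j] hc;first by apply:(Aj_le (j := 0 + 2)) =>//;apply:AjM =>//;apply:Aj0.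
rewrite -[j.+2]addn2;apply:AjM =>//;apply:tau_Aj;exact:dhomog_deriv.
Qed.

End SliceCoordinates.

Theorem proposition1 (k : closedFieldType) (char0 : [pchar k] =i pred0)
    (n : nat) (G F H : alg_group k n)
    (G_connected : zconnected G) (G_reductive : reductive G)
    (FG : F `<=` G) (HG : H `<=` G)
    (F_reductive : reductive F) (H_reductive : reductive H)
    (FH_closed : zclosed_in G (double_coset F H)) :
  regular_point (dc_proj F H (group_id G)) <->
  is_affine_space (slice_alg F G H).
Proof.
pose W := (lie F + lie H)%VS;have WG : (W <= lie G)%VS by rewrite subv_add !lieS.
(* A basis of Lie G adapted to W: a complement of W comes first, so that the leading coordinates are
   coordinates on the slice representation. *)
pose X := cat_tuple (vbasis (lie G :\: W)%VS) (vbasis W).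
have bX : basis_of (lie G) X.
 have eG : ((lie G :\: W) + W)%VS = lie G by rewrite addv_diff;apply/addv_idPl.
 have : basis_of ((lie G :\: W) + W)%VS X.
  by apply:cat_basis;rewrite ?vbasisP //;apply/directv_addP;exact:capv_diff.
 by rewrite [X in basis_of X]eG.
pose xi i : {linear 'M[k]_n -> k^o} := vector.coord X i.
have xi_x i l : xi i (tnth X l) = (i == l)%:R.
 rewrite (tnth_nth 0) -[LHS]/(vector.coord X i X`_l) coord_free ?(basis_free bX) // eq_sym. by [].
have x_orbit j : tnth X (rshift _ j) \in W by rewrite tnth_rshift;apply/vbasis_mem/mem_tnth.
have xi_orbit j z : z \in W -> xi (lshift _ j) z = 0.
 move=>/coord_vbasis->;rewrite linear_sum big1 // => i _;rewrite linearZ /= -tnth_nth.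
 have -> : tnth (vbasis W) i = tnth X (rshift _ i) by rewrite tnth_rshift.
 by rewrite xi_x eq_lrshift;exact:mulr0.
have x_span z : z \in lie G -> z = \sum_i (xi i z : k) *: tnth X i.
 by move=>/(coord_basis bX) {1}->;eqbig => i _;rewrite -tnth_nth.
have xG i : tnth X i \in lie G by apply:(basis_mem bX);apply:mem_tnth.
have [f fO] := slice_functions char0 FG HG xi_orbit.
exact:(regular_slice FG HG xG xi_x x_span x_orbit xi_orbit char0 F_reductive H_reductive FH_closed fO).
Qed.
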